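(* Let $f$ be a smooth positive function on $S^{2n+1}$, let $u_0\in C^\infty(S^{2n+1})$ be positive with $\int u_0^{2+\frac2n}dV_{\theta_0}=\int dV_{\theta_0}$, and let $\theta(t)=u(t)^{\frac2n}\theta_0$, $t\ge0$, be the solution of the Webster scalar curvature flow with initial data $u_0$. Then $$G_2(t)=\int_{S^{2n+1}}|\nabla_\theta(R_\theta-\alpha f)|^2_\theta\,dV_\theta\to0\quad\text{as }t\to\infty.$$
   Context: Let $n\ge1$, $S^{2n+1}=\{x\in\mathbb C^{n+1}:|x|=1\}$ with its standard CR structure and contact form $\theta_0=\sqrt{-1}\sum_{j=1}^{n+1}(x_jd\bar x_j-\bar x_jdx_j)$. For a contact form $\theta$, $dV_\theta=\theta\wedge d\theta^n$. The sub-gradient $\nabla_{\theta_0}$, Levi form $\langle\cdot,\cdot\rangle_{\theta_0}$ and sub-Laplacian, $\int(\Delta_{\theta_0}\phi)\psi\,dV_{\theta_0}=-\int\langle\nabla_{\theta_0}\phi,\nabla_{\theta_0}\psi\rangle_{\theta_0}dV_{\theta_0}$, are normalized so that $-\Delta_{\theta_0}x_j=\frac n2x_j$ (equivalently, $\langle\nabla_{\theta_0}\phi,\nabla_{\theta_0}\psi\rangle_{\theta_0}$ is one quarter of the round inner product of the projections to $\ker\theta_0$ of the round gradients). For smooth $u>0$ and $\theta=u^{\frac2n}\theta_0$: $dV_\theta=u^{2+\frac2n}dV_{\theta_0}$, $|\nabla_\theta\phi|^2_\theta=u^{-\frac2n}|\nabla_{\theta_0}\phi|^2_{\theta_0}$,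 and the Webster scalar curvature is $R_\theta=u^{-(1+\frac2n)}\left(-(2+\frac2n)\Delta_{\theta_0}u+R_{\theta_0}u\right)$, $R_{\theta_0}=\frac{n(n+1)}2$. The Webster scalar curvature flow with initial data $u_0$ is $\partial_tu=\frac n2(\alpha f-R_\theta)u$, $u|_{t=0}=u_0$, with $\theta=u^{\frac2n}\theta_0$ and $\alpha(t)$ determined by $\alpha\int f\,dV_\theta=\int R_\theta\,dV_\theta$; it has a smooth positive solution for all $t\ge0$. *)

(* Defs.v *)
From mathcomp Require Import all_boot all_order all_algebra.
From mathcomp Require Import all_classical all_reals all_analysis.
Import Order.TTheory GRing.Theory Num.Theory.
Import numFieldNormedType.Exports.

Set Implicit Arguments.
Unset Strict Implicit.
Unset Printing Implicit Defensive.

Local Open Scope classical_set_scope.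
Local Open Scope ring_scope.

(* C^oo on the open set U: every iterated directional derivative, along any
   finite list of constant vectors, is Frechet differentiable (in particular
   continuous) at every point of U. *)
Definition smooth_on (R : realType) (V : normedModType R) (U : set V)
    (F : V -> R^o) : Prop :=
  forall (vs : seq V) (x : V), U x ->
    differentiable (foldr (fun v (G : V -> R^o) => 'D_v G) F vs) x.

(* Iterated Lebesgue integral; equal to the integral against Lebesgue measure
   on R^m for the bounded, compactly supported Borel functions used below. *)
Fixpoint integral_rV (R : realType) (m : nat) : ('rV[R]_m -> R) -> R :=
  match m with
  | 0 => fun F => F 0
  | m'.+1 => fun F =>
      \int[@lebesgue_measure R]_s
        integral_rV (fun y : 'rV[R]_m' => F (row_mx (s%:M : 'rV[R]_1) y))
  end.

Section Sphere.
Variables (R : realType) (n : nat).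

(* C^(n+1) as R^(2n+2): the point x_j = a_j + i b_j is the row vector
   (a_1, ..., a_(n+1), b_1, ..., b_(n+1)). *)
Definition ambient := 'rV[R]_(n.+1 + n.+1).

(* The library norm of a row vector is the sup norm, hence these. *)
Definition edot (x y : ambient) : R := \sum_j x 0 j * y 0 j.
Definition enorm (x : ambient) : R := Num.sqrt (edot x x).

Definition sphere : set ambient := [set x | enorm x = 1].

(* Multiplication by the imaginary unit. *)
Definition Jmul (x : ambient) : ambient := row_mx (- rsubmx x) (lsubmx x).

(* A function on S^(2n+1) is represented by a function on the ambient space of
   which only the values on the sphere matter: differentiation, integration and
   smoothness all go through its extension to C^(n+1) \ {0} that is homogeneous
   of degree 0. *)
Definition hext (phi : ambient -> R) : ambient -> R :=
  fun y => phi ((enorm y)^-1 *: y).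

Definition smooth_sphere (phi : ambient -> R) : Prop :=
  smooth_on [set y : ambient | y != 0] (hext phi : ambient -> R^o).

(* Smoothness on R x S^(2n+1). *)
Definition smooth_time_sphere (u : R -> ambient -> R) : Prop :=
  smooth_on [set p : (R^o * ambient)%type | p.2 != 0]
    (fun p : (R^o * ambient)%type => hext (u p.1) p.2 : R^o).

(* theta_0 = i \sum_j (x_j d\bar x_j - \bar x_j dx_j)
           = 2 \sum_j (a_j db_j - b_j da_j), evaluated at x on the vector v. *)
Definition theta0 (x v : ambient) : R :=
  2 * \sum_(j < n.+1) (lsubmx x 0 j * rsubmx v 0 j - rsubmx x 0 j * lsubmx v 0 j).

(* The gradient at a point of the sphere of the degree 0 extension is tangent
   to the sphere: it is the round gradient. *)
Definition round_grad (phi : ambient -> R) (x : ambient) : ambient :=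
  \row_j 'D_(delta_mx 0 j : ambient) (hext phi : ambient -> R^o) x.

(* Orthogonal projection of a tangent vector onto ker theta_0: on the sphere
   Jmul x is a unit tangent vector and theta0 x v = 2 <Jmul x, v>. *)
Definition proj_ker_theta0 (x v : ambient) : ambient :=
  v - (theta0 x v / 2) *: Jmul x.

(* < nabla_theta0 phi, nabla_theta0 psi >_theta0 *)
Definition levi_grad (phi psi : ambient -> R) (x : ambient) : R :=
  4^-1 * edot (proj_ker_theta0 x (round_grad phi x))
              (proj_ker_theta0 x (round_grad psi x)).

(* Round surface integral, in polar coordinates:
   \int_S phi dsigma = (2n+2) \int_{|y| <= 1} phi(y/|y|) dy. *)
Definition round_integral (phi : ambient -> R) : R :=
  (n.+1 + n.+1)%:R *
  integral_rV (fun y : ambient => if enorm y <= 1 then hext phi y else 0).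

(* \int phi dV_theta0. As theta_0 = 2 <Jmul x, .> and
   d theta_0 = 4 \sum_j da_j /\ db_j, evaluating theta_0 /\ (d theta_0)^n on
   Jmul x and a unitary frame of ker theta_0 gives 2 * 4^n * n!, so that
   dV_theta0 = 2 * 4^n * n! dsigma. *)
Definition integral_dV0 (phi : ambient -> R) : R :=
  (2 * 4 ^+ n * n`!%:R) * round_integral phi.

(* The sub-Laplacian of theta_0, defined by duality. For smooth phi such a w
   exists and is unique on the sphere; 0 is a default value. *)
Definition is_sublaplacian (phi w : ambient -> R) : Prop :=
  smooth_sphere w /\
  forall psi, smooth_sphere psi ->
    integral_dV0 (fun x => w x * psi x) = - integral_dV0 (levi_grad phi psi).

Definition sublaplacian (phi : ambient -> R) : ambient -> R :=
  xget (fun=> 0) [set w : ambient -> R | is_sublaplacian phi w].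

(* In the next definitions theta = u^(2/n) theta_0. *)

(* \int phi dV_theta *)
Definition integral_dV (u phi : ambient -> R) : R :=
  integral_dV0 (fun x => phi x * u x `^ (2 + 2 / n%:R)).

(* |nabla_theta phi|^2_theta *)
Definition grad_sq (u phi : ambient -> R) (x : ambient) : R :=
  u x `^ (- (2 / n%:R)) * levi_grad phi phi x.

(* R_theta, with R_theta0 = n(n+1)/2 *)
Definition webster (u : ambient -> R) (x : ambient) : R :=
  u x `^ (- (1 + 2 / n%:R)) *
  (- (2 + 2 / n%:R) * sublaplacian u x + (n * n.+1)%:R / 2 * u x).

(* u is a smooth positive solution on [0, +oo[ with coefficient alpha.
   Smoothness on the manifold with boundary [0, +oo[ x S^(2n+1) means having a
   smooth extension across t = 0; u t for t < 0 is such an extension, and is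
   subject to no other condition. *)
Record webster_flow (f u0 : ambient -> R) (alpha : R -> R)
    (u : R -> ambient -> R) : Prop := WebsterFlow {
  flow_smooth : smooth_time_sphere u;
  flow_pos : forall t x, 0 <= t -> sphere x -> 0 < u t x;
  flow_init : forall x, sphere x -> u 0 x = u0 x;
  flow_alpha : forall t, 0 <= t ->
    alpha t * integral_dV (u t) f = integral_dV (u t) (webster (u t));
  flow_eq : forall t x, 0 <= t -> sphere x ->
    derive1 (fun s => u s x : R^o) t
      = n%:R / 2 * (alpha t * f x - webster (u t) x) * u t x
}.

Definition G2 (f : ambient -> R) (alpha : R -> R) (u : R -> ambient -> R)
    (t : R) : R :=
  integral_dV (u t)
    (grad_sq (u t) (fun x => webster (u t) x - alpha t * f x)).

End Sphere.

(* Main.v *)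
Require Import Defs.
From HB Require Import structures.
From mathcomp Require Import all_boot all_order all_algebra.
From mathcomp Require Import all_classical all_reals all_analysis.
From mathcomp Require Import measurable_realfun ring lra.
Import Order.TTheory GRing.Theory Num.Theory.
Import numFieldNormedType.Exports.

Set Implicit Arguments.
Unset Strict Implicit.
Unset Printing Implicit Defensive.

Local Open Scope classical_set_scope.
Local Open Scope ring_scope.

(** Write theta = u^(2/n) theta_0, g = R_theta - alpha f and D = Delta_theta g.
   Along the flow dV_theta changes at the rate -(n+1) g, and differentiating
   R_theta = alpha f + g gives g_t = - alpha' f + g (g + alpha f) + (n+1) D. With
   integrals against dV_theta, put m = int f, q = int f g, F2 = int g^2,
   Z = int g^3, G = int |grad g|^2 = G2 and H = int g |grad g|^2. Since g has mean 0,
   m' = -(n+1) q and alpha' m = - n F2 + alpha q, and integration by parts yields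
   the derivatives of F2, Z and G (lemmas F2_derive, Z_derive, G_derive).

   The quantity alpha m^(1/(n+1)) is nonnegative, and its derivative is - n F2 times
   a power of m, which is bounded from above and below; hence F2 is integrable in
   time and alpha is bounded (integrable_F2, alpha_le). The rest rests on the
   following principle (integrable_vanishing): a nonnegative quantity x that is
   integrable in time, and grows at most at the rate z (1 + x)^2 with z integrable,
   tends to 0. It gives F2 -> 0. The equation for F2' then bounds the time integral
   of G, and it remains to bound the growth of G. In
   G' = (4 - n) H - 2 (n+1) int D^2 + lower order terms
   the indefinite term is (4 - n) H.

   If n >= 2, the maximum principle bounds g from below by a constant -gamma
   (g_lower_bound). Then H >= - gamma G, and the equation for F2', in which Z has
   the coefficient 1 - n < 0, bounds the time integral of Z + gamma F2 as well. For
   n >= 4 this suffices; for n = 2 and n = 3 the principle is applied to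
   G + k (Z + gamma F2), with k such that H cancels (G_vanishing_high).

   If n = 1, Z disappears from the equation for F2'. Now H = - (1/2) int g^2 D is
   bounded by int D^2 and int g^4. The Folland-Stein inequality on the
   three-sphere, applied to u g, and the conformal invariance of the quadratic form
   of the Yamabe problem bound int g^4 by the square of
   4 G + Z + alpha int f g^2, where Z is absorbed because F2 -> 0. Thus
   G' <= C (F2 + G^2), which is of the required form (G_vanishing_one).

   The Folland-Stein inequality (folland_stein) is proved on the unit quaternions.
   Horizontal linear fields generate rotations, and three of them compose to the
   translation by a quaternion in a box of the size r, r, r^2; hence the L^2
   distance between v and its translate is at most a multiple of r times the norm
   of the horizontal gradient. Comparing v with its averages over such boxes gives
   a weak-type inequality (weak_type), which dyadic truncation upgrades to the
   strong one.

   All calculus uses extensions that are homogeneous of degree 0. The horizontal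
   gradient and the sub-Laplacian are expressed by linear vector fields given by
   skew matrices (levi_gradE, sublaplacianE); these are divergence free and tangent
   to all spheres, so that integration by parts on the sphere follows from the one
   on the ambient space (integral_dV0_Xf). *)

(** * Iterated Lebesgue integrals *)

Section IteratedIntegral.
Context {R : realType}.
Notation mu := (@lebesgue_measure R).

Definition cons_rv m (s : R) (y : 'rV[R]_m) : 'rV[R]_m.+1 :=
  row_mx (s%:M : 'rV[R]_1) y.

Lemma cons_rv0 m (s : R) (y : 'rV[R]_m) : cons_rv s y 0 ord0 = s.
Proof.
rewrite /cons_rv; have -> : ord0 = lshift m (0 : 'I_1) by apply/val_inj.
by rewrite (row_mxEl (s%:M : 'rV[R]_1) y) mxE.
Qed.

Lemma cons_rvS m (s : R) (y : 'rV[R]_m) j : cons_rv s y 0 (lift ord0 j) = y 0 j.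
Proof.
rewrite /cons_rv; have -> : lift ord0 j = rshift 1 j by apply/val_inj.
by rewrite (row_mxEr (s%:M : 'rV[R]_1) y).
Qed.

Definition vslice m (F : 'rV[R]_m.+1 -> R) (s : R) : 'rV[R]_m -> R :=
  fun y => F (cons_rv s y).

(** Measurability of the functions of one real variable that the iterated
   integral integrates, one at each stage. *)
Fixpoint iter_measurable (m : nat) : ('rV[R]_m -> R) -> Prop :=
  match m with
  | 0 => fun _ => True
  | m'.+1 => fun F => (forall s, iter_measurable (vslice F s)) /\
      measurable_fun setT (fun s => integral_rV (vslice F s))
  end.

Definition bounded_supp (V : normedZmodType R) (K M : R) (F : V -> R) :=
  forall y, `|F y| <= M /\ (K < `|y| -> F y = 0).

Lemma coord_le_norm m (y : 'rV[R]_m) i : `|y 0 i| <= `|y|.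
Proof.
rewrite [leRHS]/Num.norm/= mx_normrE; apply/bigmax_geP; right => /=.
by exists (0, i).
Qed.

Lemma norm_le_coord m (y : 'rV[R]_m) c :
  0 <= c -> (forall i, `|y 0 i| <= c) -> `|y| <= c.
Proof.
move=> c0 h; rewrite [leLHS]/Num.norm/= mx_normrE; apply/bigmax_leP; split=> //.
by move=> [i j] _ /=; rewrite ord1.
Qed.

Lemma norm_cons_rv_ge m (s : R) (y : 'rV[R]_m) :
  `|s| <= `|cons_rv s y| /\ `|y| <= `|cons_rv s y|.
Proof.
split; first by have := coord_le_norm (cons_rv s y) ord0; rewrite cons_rv0.
apply: norm_le_coord => // i.
by have := coord_le_norm (cons_rv s y) (lift ord0 i); rewrite cons_rvS.
Qed.

Lemma bounded_supp_vslice m K M (F : 'rV[R]_m.+1 -> R) s :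
  bounded_supp K M F -> bounded_supp K M (vslice F s).
Proof.
move=> bF y; have [h1 h2] := bF (cons_rv s y); split => // Ky.
by apply: h2; apply: lt_le_trans Ky (norm_cons_rv_ge s y).2.
Qed.

Lemma bounded_supp_vslice0 m K M (F : 'rV[R]_m.+1 -> R) s :
  bounded_supp K M F -> K < `|s| -> vslice F s = fun=> 0.
Proof.
move=> bF Ks; apply/funext => y; apply: (bF _).2.
exact: lt_le_trans Ks (norm_cons_rv_ge s y).1.
Qed.

Lemma mu_segment (K : R) : mu `[- K, K]%classic = (Num.max 0 (2 * K))%:E.
Proof.
have -> := lebesgue_measure_itv `[- K, K]; rewrite /= lte_fin.
by case: ifP => h; rewrite -?EFinD; congr EFin; rewrite /Num.max; case: ifP; lra.
Qed.

Lemma bounded_supp_restrict (K M : R) (h : R -> R) :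
  bounded_supp K M h -> h = h \_ (`[-K, K]%classic).
Proof.
move=> bh; apply/funext => s; rewrite patchE; case: ifPn => // /negP sK.
apply: (bh s).2; rewrite ltNge; apply/negP => Ks; apply: sK.
by rewrite inE/= in_itv/= -ler_norml.
Qed.

Lemma integrable_cst_segment (K M : R) :
  mu.-integrable `[- K, K] (EFin \o cst M).
Proof.
apply: measurable_bounded_integrable => //.
  by apply: (@le_lt_trans _ _ (mu `[- K, K]%classic)) => //; rewrite mu_segment ltry.
by exists `|M|; split; [exact: num_real|move=> x Mx y _ /=; rewrite ltW].
Qed.

Lemma integrable_bounded_supp (K M : R) (h : R -> R) :
  measurable_fun setT h -> bounded_supp K M h ->
  mu.-integrable setT (EFin \o h).
Proof.
move=> mh bh; rewrite (bounded_supp_restrict bh).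
rewrite -restrict_EFin; apply/integrable_restrict => //; rewrite setTI.
apply: measurable_bounded_integrable => //.
- by apply: (@le_lt_trans _ _ (mu `[- K, K]%classic)) => //; rewrite mu_segment ltry.
- exact: measurable_funS mh.
exists M; split; first exact: num_real.
by move=> x Mx y _; apply: le_trans (bh y).1 (ltW Mx).
Qed.

Lemma Rintegral_le_bound (K M : R) (h : R -> R) :
  0 <= K -> measurable_fun setT h -> bounded_supp K M h ->
  `|\int[mu]_s h s| <= M * (2 * K).
Proof.
move=> K0 mh bh.
have ih := integrable_bounded_supp mh bh.
rewrite (bounded_supp_restrict bh) -Rintegral_mkcond.
have ihK : mu.-integrable `[-K, K] (EFin \o h) by exact: integrableS ih.
apply: le_trans (le_normr_Rintegral _ _) _ => //.
have -> : M * (2 * K) = \int[mu]_(x in `[-K, K]) M.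
  rewrite Rintegral_cst//; congr (_ * _).
  by have /= -> := mu_segment K; apply/esym/max_idPr; lra.
apply: le_Rintegral => //; [|exact: integrable_cst_segment|by move=> x _; exact: (bh x).1].
by have /integrable_norm := ihK; apply: eq_integrable.
Qed.

Lemma bounded_supp_cvg (V : normedZmodType R) (K M : R) (h_ : nat -> V -> R) (h : V -> R) :
  (forall k, bounded_supp K M (h_ k)) ->
  (forall s, h_ k s @[k --> \oo] --> h s) -> bounded_supp K M h.
Proof.
move=> bh_ hcv y; split.
  have hn : `|h_ k y| @[k --> \oo] --> `|h y| by exact: cvg_norm (hcv y).
  rewrite -(cvg_lim _ hn)//; apply: limr_le; first by apply/cvg_ex; eexists; exact: hn.
  by apply: nearW => k; exact: (bh_ k y).1.
move=> Ky; have h0 : h_ k y @[k --> \oo] --> (0:R).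
  rewrite (_ : (fun k => _) = cst 0); first exact: cvg_cst.
  by apply/funext => k; apply: (bh_ k y).2.
by have := cvg_unique _ (hcv y) h0; apply.
Qed.

Lemma dominated_bounded_supp (K M : R) (h_ : nat -> R -> R) (h : R -> R) :
  (forall k, measurable_fun setT (h_ k)) ->
  (forall k, bounded_supp K M (h_ k)) ->
  (forall s, h_ k s @[k --> \oo] --> h s) ->
  measurable_fun setT h /\ \int[mu]_s h_ k s @[k --> \oo] --> \int[mu]_s h s.
Proof.
move=> mh_ bh_ hcv.
have mh : measurable_fun setT h.
  by apply: (@measurable_realfun.measurable_fun_cvg _ _ _ _ h_) => // x _; exact: hcv.
split=> //.
have bh := bounded_supp_cvg bh_ hcv.
have ih := integrable_bounded_supp mh bh.
pose g : R -> R := (cst M) \_ (`[-K, K]%classic).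
have ig : mu.-integrable setT (EFin \o g).
  rewrite /g -restrict_EFin; apply/integrable_restrict => //; rewrite setTI.
  exact: integrable_cst_segment.
have := @dominated_convergence _ _ _ mu setT measurableT
  (fun k => EFin \o h_ k) (EFin \o h) (EFin \o g).
move=> dc; have {dc}[//|||//||_ _ dc] := dc.
- by move=> k; have /measurable_EFinP := mh_ k; exact.
- by have /measurable_EFinP := mh; exact.
- by apply: aeW => x _; apply: cvg_EFin; [exact: nearW|exact: hcv].
- apply: aeW => x k _ /=; rewrite lee_fin /g patchE; case: ifPn => xK.
    exact: (bh_ k x).1.
  rewrite (bh_ k x).2 ?normr0// ltNge; apply/negP => h0; move/negP: xK; apply.
  by rewrite inE/= in_itv/= -ler_norml.
rewrite /Rintegral; apply: fine_cvg.
rewrite fineK; first exact: dc.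
exact: integrable_fin_num.
Qed.

(* Class of functions to which the iterated integral applies well. *)
Definition nice m (K M : R) (F : 'rV[R]_m -> R) :=
  iter_measurable F /\ bounded_supp K M F.

Lemma nice_vslice m K M (F : 'rV[R]_m.+1 -> R) s : nice K M F -> nice K M (vslice F s).
Proof. by case=> -[mF _] bF; split; [exact: mF|exact: bounded_supp_vslice]. Qed.

Lemma integral_rV0 m : integral_rV (fun _ : 'rV[R]_m => 0) = 0.
Proof.
elim: m => // m IH /=; under eq_Rintegral do rewrite IH.
by rewrite Rintegral_cst// mul0r.
Qed.

Lemma integral_rVE m (F : 'rV[R]_m.+1 -> R) :
  integral_rV F = \int[mu]_s integral_rV (vslice F s).
Proof. by []. Qed.

Lemma integral_rV_bound m (K M : R) (F : 'rV[R]_m -> R) : 0 <= K ->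
  nice K M F -> `|integral_rV F| <= M * (2 * K) ^+ m.
Proof.
move=> K0; elim: m F => [|m IH] F.
  by move=> -[_ bF]; rewrite expr0 mulr1; exact: (bF _).1.
move=> nF; have [[mF m1] bF] := nF.
rewrite integral_rVE exprSr [leRHS]mulrA.
apply: (@Rintegral_le_bound K (M * (2 * K) ^+ m) (fun s => integral_rV (vslice F s))) => // s; split.
  exact/IH/nice_vslice.
by move=> Ks; rewrite (bounded_supp_vslice0 bF Ks) integral_rV0.
Qed.

Lemma bounded_supp_integral m (K M : R) (F : 'rV[R]_m.+1 -> R) : 0 <= K ->
  nice K M F -> bounded_supp K (M * (2 * K) ^+ m) (fun s => integral_rV (vslice F s)).
Proof.
move=> K0 nF s; split; first exact/integral_rV_bound/nice_vslice.
by move=> Ks; rewrite (bounded_supp_vslice0 nF.2 Ks) integral_rV0.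
Qed.

(** Bounds and supports are uniform at every stage of the iteration, so that
   the one-dimensional dominated convergence theorem applies at each stage. *)
Lemma integral_rV_cvg m (K M : R) (F_ : nat -> 'rV[R]_m -> R) (F : 'rV[R]_m -> R) :
  0 <= K -> (forall k, nice K M (F_ k)) ->
  (forall y, F_ k y @[k --> \oo] --> F y) ->
  nice K M F /\ integral_rV (F_ k) @[k --> \oo] --> integral_rV F.
Proof.
move=> K0; elim: m F_ F => [|m IH] F_ F nF Fcv.
  split; last exact: Fcv.
  by split=> //; apply: bounded_supp_cvg Fcv => k; exact: (nF k).2.
have h s : nice K M (vslice F s) /\
    integral_rV (vslice (F_ k) s) @[k --> \oo] --> integral_rV (vslice F s).
  by apply: IH => [k|y]; [exact: nice_vslice|exact: Fcv].
have [mI cI] := dominated_bounded_supp (fun k => (nF k).1.2)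
  (fun k => bounded_supp_integral K0 (nF k)) (fun s => (h s).2).
split=> //; split; first by split=> // s; exact: (h s).1.1.
by apply: bounded_supp_cvg Fcv => k; exact: (nF k).2.
Qed.

Lemma bounded_supp_lin (V : normedZmodType R) K M M' a (F G : V -> R) :
  bounded_supp K M F -> bounded_supp K M' G ->
  bounded_supp K (`|a| * M + M') (fun y => a * F y + G y).
Proof.
move=> bF bG y; split.
  apply: le_trans (ler_normD _ _) _; rewrite normrM lerD ?(bG y).1//.
  by rewrite ler_wpM2l ?(bF y).1.
by move=> Ky; rewrite (bF y).2// (bG y).2// mulr0 addr0.
Qed.

Lemma integral_rV_lin m (K M M' a : R) (F G : 'rV[R]_m -> R) : 0 <= K ->
  nice K M F -> nice K M' G ->
  nice K (`|a| * M + M') (fun y => a * F y + G y) /\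
  integral_rV (fun y => a * F y + G y) = a * integral_rV F + integral_rV G.
Proof.
move=> K0; elim: m F G => [|m IH] F G nF nG.
  by split=> //; split=> //; apply: bounded_supp_lin; [exact: nF.2|exact: nG.2].
have h s := IH _ _ (nice_vslice s nF) (nice_vslice s nG).
have mF := nF.1.2; have mG := nG.1.2.
have E : (fun s => integral_rV (vslice (fun y => a * F y + G y) s)) =
   (fun s => a * integral_rV (vslice F s) + integral_rV (vslice G s)).
  by apply/funext => s; rewrite -(h s).2.
split; last first.
  rewrite !integral_rVE E RintegralD//.
  - rewrite RintegralZl//.
    exact: integrable_bounded_supp (bounded_supp_integral K0 nF).
  - have := integrable_bounded_supp mF (bounded_supp_integral K0 nF).
    by move=> /(integrableZl measurableT a); apply: eq_integrable.
  - exact: integrable_bounded_supp (bounded_supp_integral K0 nG).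
split; last by apply: bounded_supp_lin; [exact: nF.2|exact: nG.2].
split; first by move=> s; exact: (h s).1.1.
rewrite E; apply: measurable_funD => //; exact: measurable_funM.
Qed.

Lemma integral_rV_ge0 m (F : 'rV[R]_m -> R) :
  (forall y, 0 <= F y) -> 0 <= integral_rV F.
Proof.
elim: m F => [|m IH] F F0; first exact: F0.
by rewrite integral_rVE; apply: Rintegral_ge0 => s _; apply: IH => y; exact: F0.
Qed.

(** Gives strict positivity of the integral of a function that is positive
   near one point, and lower bounds for the mass of bumps. *)
Lemma integral_rV_box m (K M c : R) (F : 'rV[R]_m -> R) (l h : 'I_m -> R) : 0 <= K ->
  nice K M F -> (forall y, 0 <= F y) -> 0 <= c -> (forall i, l i <= h i) ->
  (forall y : 'rV[R]_m, (forall i, l i <= y 0 i <= h i) -> c <= F y) ->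
  c * \prod_i (h i - l i) <= integral_rV F.
Proof.
move=> K0; elim: m c F l h => [|m IH] c F l h nF F0 c0 lh hF.
  by rewrite big_ord0 mulr1; apply: hF => -[].
rewrite big_ord_recl integral_rVE.
set p := \prod_i _.
have p0 : 0 <= p by apply: prodr_ge0 => i _; rewrite subr_ge0.
pose G := fun s => integral_rV (vslice F s).
have bG := bounded_supp_integral K0 nF.
have iG := integrable_bounded_supp nF.1.2 bG.
have -> : c * ((h ord0 - l ord0) * p) = \int[mu]_(s in `[l ord0, h ord0]) (c * p).
  rewrite Rintegral_cst// mulrCA [in RHS]mulrC; congr (_ * _).
  have /= -> := lebesgue_measure_itv `[l ord0, h ord0]; rewrite lte_fin.
  by case: ltrP => //=; move: (lh ord0); lra.
rewrite Rintegral_mkcond; apply: le_Rintegral => //.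
  rewrite -restrict_EFin; apply/integrable_restrict => //; rewrite setTI.
  apply: measurable_bounded_integrable => //.
    have := lebesgue_measure_itv `[l ord0, h ord0]; rewrite /= lte_fin => ->.
    by case: ifP => // _; rewrite -EFinD ltry.
  by exists `|c * p|; split; [exact: num_real|move=> x Mx y _ /=; rewrite ltW].
move=> s _; rewrite patchE; case: ifPn; last first.
  by move=> _; apply: integral_rV_ge0 => y; exact: F0.
rewrite inE/= in_itv/= => sl.
apply: (IH c (vslice F s) (fun i => l (lift ord0 i)) (fun i => h (lift ord0 i))) => //.
- exact: nice_vslice.
- by move=> y; exact: F0.
move=> y hy; apply: hF => i.
have [->|[j ->]] : i = ord0 \/ exists j, i = lift ord0 j.
  by case: (unliftP ord0 i) => [j ->|->]; [right; exists j|left].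
  by rewrite (cons_rv0 s y).
by rewrite (cons_rvS s y).
Qed.

End IteratedIntegral.

(** * Iterated integrals of continuous functions *)

Section Sequential.
Context {R : realType}.

Lemma seq_continuous_at (V : normedModType R) (f : V -> R) (x : V) :
  (forall u : nat -> V, u k @[k --> \oo] --> x -> f (u k) @[k --> \oo] --> f x) ->
  {for x, continuous f}.
Proof.
move=> h; apply: contrapT => nf.
have [e e0 he] : exists2 e : R, 0 < e & forall k : nat, exists y : V,
    `|x - y| < k.+1%:R^-1 /\ e <= `|f x - f y|.
  apply: contrapT => H; apply: nf; apply/cvgrPdist_lt => e e0.
  have [k hk] : exists k : nat, forall y : V, `|x - y| < k.+1%:R^-1 -> `|f x - f y| < e.
    apply: contrapT => H'; apply: H; exists e => // k; apply: contrapT => H2.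
    apply: H'; exists k => y hy; rewrite ltNge; apply/negP => h2.
    by apply: H2; exists y.
  apply/nbhs_ballP; exists k.+1%:R^-1 => /=; first by rewrite invr_gt0.
  by move=> y; rewrite -ball_normE => hy; exact: hk.
have [u hu] := choice he.
have ux : u k @[k --> \oo] --> x.
  apply/cvgrPdist_lt => d d0.
  have [N _ hN] := near_infty_natSinv_lt (PosNum d0).
  by exists N => // k /= Nk; apply: lt_trans (hu k).1 (hN _ _).
have /cvgrPdist_lt /(_ _ e0) [N _ hN] := h u ux.
by have := hN N (leqnn N); rewrite ltNge (hu N).2.
Qed.

Lemma is_derive_seq (f : R -> R) (x l : R) :
  (forall u : nat -> R, (forall k, u k != 0) -> u k @[k --> \oo] --> (0 : R) ->
    (u k)^-1 * (f (u k + x) - f x) @[k --> \oo] --> l) ->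
  is_derive x (1 : R) (f : R -> R^o) l.
Proof.
move=> h.
pose q (d : R) := if d == 0 then l else d^-1 * (f (d + x) - f x).
have qc : {for (0 : R^o), continuous (q : R^o -> R)}.
  apply: (@seq_continuous_at R^o) => u u0.
  have -> : q 0 = l by rewrite /q eqxx.
  pose u' k := if u k == 0 then k.+1%:R^-1 else u k.
  have u'0 k : u' k != 0.
    by rewrite /u'; case: ifPn => // _; rewrite invr_neq0// pnatr_eq0.
  have u'cv : u' k @[k --> \oo] --> (0 : R).
    apply/cvgrPdist_lt => d d0; have /cvgrPdist_lt /(_ _ d0) [N1 _ h1] := u0.
    have [N2 _ h2] := near_infty_natSinv_lt (PosNum d0).
    exists (maxn N1 N2) => // k /=; rewrite geq_max => /andP[k1 k2].
    rewrite /u'; case: ifPn => _; last exact: h1.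
    rewrite sub0r normrN ger0_norm ?invr_ge0//; exact: h2.
  have /cvgrPdist_lt H := h u' u'0 u'cv.
  apply/cvgrPdist_lt => e e0; have [N _ hN] := H e e0; exists N => // k /= Nk.
  have := hN k Nk; rewrite /q /=; case: ifPn => uk; first by rewrite subrr normr0.
  by rewrite /u' (negPf uk).
have qd : (d^-1 *: (f (d *: (1:R) + x) - f x)) @[d --> (0:R)^'] --> l.
  have {}qc : q d @[d --> (0:R)^'] --> l.
    have -> : l = q 0 by rewrite /q eqxx.
    by apply: cvg_trans qc; apply: cvg_app; exact: cvg_within.
  apply: cvg_trans qc; apply: near_eq_cvg.
  near=> d; rewrite /q ifF; first by rewrite [d *: _]mulr1.
  by apply/negbTE; near: d; exact: nbhs_dnbhs_neq.
apply: DeriveDef; first by apply/cvg_ex; exists l; exact: qd.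
by apply/cvg_lim => //; exact: qd.
Unshelve. all: by end_near. Qed.

Lemma is_derive_quotient (f : R -> R) (x l : R) :
  is_derive x (1 : R) (f : R -> R^o) l ->
  forall u : nat -> R, (forall k, u k != 0) -> u k @[k --> \oo] --> (0 : R) ->
    (u k)^-1 * (f (u k + x) - f x) @[k --> \oo] --> l.
Proof.
move=> [df <-] u u0 ucv.
have h : (d^-1 *: (f (d *: (1:R) + x) - f x)) @[d --> (0:R)^'] --> 'D_1 (f : R -> R^o) x.
  exact: df.
have ud : u k @[k --> \oo] --> (0:R)^'.
  move=> A [e e0 hA]; have /cvgrPdist_lt /(_ _ e0) [N _ hN] := ucv.
  by exists N => // k /= Nk; apply: hA => //=; exact: hN.
have := cvg_comp _ _ ud h; apply: cvg_trans; apply: near_eq_cvg.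
by near=> k; rewrite /= [u k *: _]mulr1.
Unshelve. all: by end_near. Qed.

(** Covers both orders of the endpoints, for difference quotients with steps of
   either sign. *)
Lemma is_derive_lipschitz (f df : R -> R) (M a b : R) :
  (forall x, Num.min a b <= x <= Num.max a b -> is_derive x (1 : R) (f : R -> R^o) (df x)) ->
  (forall x, Num.min a b <= x <= Num.max a b -> `|df x| <= M) ->
  `|f b - f a| <= M * `|b - a|.
Proof.
move=> hd hM; wlog ab : a b hd hM / a <= b.
  move=> H; have [|ba] := leP a b; first exact: H.
  by rewrite distrC [`|b - a|]distrC; apply: H (ltW ba) => x;
    rewrite minC maxC; [exact: hd|exact: hM].
move: hd hM; rewrite (min_idPl ab) (max_idPr ab) => hd hM.
have [||c cab ->] := @MVT_segment R f df a b ab.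
- by move=> x xab; apply: hd; rewrite !ltW ?(itvP xab).
- apply: derivable_within_continuous => x xab.
  have [] // := hd x; by rewrite !(itvP xab).
by rewrite normrM ler_wpM2r// hM// !(itvP cab).
Qed.

Lemma continuous_seq (V : normedModType R) (f : V -> R) (x : V) (u : nat -> V) :
  {for x, continuous f} -> u k @[k --> \oo] --> x ->
  f (u k) @[k --> \oo] --> f x.
Proof. by move=> cf ux; exact: (cvg_comp _ _ ux cf). Qed.

Lemma norm_cons_rv_le m (s : R) (y : 'rV[R]_m) : `|cons_rv s y| <= `|s| + `|y|.
Proof.
apply: norm_le_coord => [|i]; first by rewrite addr_ge0.
case: (unliftP ord0 i) => [j ->|->].
  by rewrite cons_rvS ler_wpDl// coord_le_norm.
by rewrite cons_rv0 ler_wpDr.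
Qed.

Lemma rv_ext m (y z : 'rV[R]_m) : (forall i, y 0 i = z 0 i) -> y = z.
Proof. by move=> h; apply/matrixP => i j; rewrite ord1. Qed.

Lemma cons_rvB m (s t : R) (y z : 'rV[R]_m) :
  cons_rv s y - cons_rv t z = cons_rv (s - t) (y - z).
Proof.
have E k (a b : 'rV[R]_k) i : (a - b) 0 i = a 0 i - b 0 i by rewrite !mxE.
apply: rv_ext => i; rewrite E; case: (unliftP ord0 i) => [j ->|->].
  by rewrite !cons_rvS E.
by rewrite !cons_rv0.
Qed.

Lemma cons_rv_cvg m (s_ : nat -> R) s (y_ : nat -> 'rV[R]_m) y :
  s_ k @[k --> \oo] --> s -> y_ k @[k --> \oo] --> y ->
  cons_rv (s_ k) (y_ k) @[k --> \oo] --> cons_rv s y.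
Proof.
move=> /cvgrPdist_lt hs /cvgrPdist_lt hy; apply/cvgrPdist_lt => e e0.
have e2 : 0 < e / 2 by rewrite divr_gt0.
have [N1 _ h1] := hs _ e2; have [N2 _ h2] := hy _ e2.
exists (maxn N1 N2) => // k /=; rewrite geq_max => /andP[k1 k2].
rewrite cons_rvB; apply: le_lt_trans (norm_cons_rv_le _ _) _.
by have := h1 k k1; have := h2 k k2; lra.
Qed.

(** By induction on the dimension: dominated convergence makes the partial
   integrals continuous, hence measurable. *)
Lemma continuous_nice m (K M : R) (F : 'rV[R]_m -> R) : 0 <= K ->
  continuous F -> bounded_supp K M F -> nice K M F.
Proof.
move=> K0; elim: m F => [|m IH] F cF bF; first by split.
have nF s : nice K M (vslice F s).
  apply: IH; last exact: bounded_supp_vslice.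
  move=> y; apply: seq_continuous_at => u uy; apply: (continuous_seq (cF _)).
  by apply: cons_rv_cvg uy; exact: cvg_cst.
split=> //; split; first by move=> s; exact: (nF s).1.
apply: continuous_measurable_fun => s.
apply: (@seq_continuous_at R^o) => u us.
have [] // := @integral_rV_cvg _ m K M (fun k => vslice F (u k)) (vslice F s).
by move=> y; apply: (continuous_seq (cF _)); apply: cons_rv_cvg us _; exact: cvg_cst.
Qed.

Lemma integral_compact_derive (K M M' : R) (H dH : R -> R) : 0 <= K ->
  (forall s, is_derive s (1 : R) (H : R -> R^o) (dH s)) -> continuous dH ->
  bounded_supp K M H -> bounded_supp K M' dH ->
  \int[@lebesgue_measure R]_s dH s = 0.
Proof.
move=> K0 hd cd bH bd.
pose L := K + 1.
have cH : continuous H.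
  by move=> s; have [h _] := hd s; apply: differentiable_continuous; exact/derivable1_diffP.
have LL : - L < L by rewrite /L; lra.
have bd' : bounded_supp L M' dH.
  by move=> s; split; [exact: (bd s).1|move=> Ls; apply: (bd s).2; move: Ls; rewrite /L; lra].
rewrite (bounded_supp_restrict bd') -Rintegral_mkcond.
have := @continuous_FTC2 R dH H (- L) L LL.
rewrite /Rintegral => -> //.
- have L0 : 0 <= L by rewrite /L; lra.
  have KL : K < `|L| by rewrite ger0_norm// /L; lra.
  by rewrite (bH L).2// (bH (- L)).2 ?normrN// -EFinB /= subrr.
- exact: continuous_subspaceT.
- split.
  + by move=> x _; have [] := hd x.
  + by apply: cvg_at_right_filter; exact: cH.
  + by apply: cvg_at_left_filter; exact: cH.
- by move=> x _; rewrite derive1E derive_val.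
Qed.

(** In the direction of the outer variable, this is the fundamental theorem of
   calculus after differentiation under the inner integral; in the other
   directions the inner integral already vanishes. *)
Lemma integral_rV_derive m (K M M' : R) (G dG : 'rV[R]_m -> R) (k : 'I_m) :
  0 <= K -> continuous G -> continuous dG ->
  bounded_supp K M G -> bounded_supp K M' dG ->
  (forall y, is_derive (0 : R) (1 : R)
    ((fun s => G (y + s *: delta_mx 0 k)) : R -> R^o) (dG y)) ->
  integral_rV dG = 0.
Proof.
move=> K0; elim: m G dG k => [|m IH] G dG k cG cdG bG bdG hd; first by case: k hd.
have cS (F : 'rV[R]_m.+1 -> R) s : continuous F -> continuous (vslice F s).
  move=> cF y; apply: seq_continuous_at => u uy; apply: (continuous_seq (cF _)).
  by apply: cons_rv_cvg uy; exact: cvg_cst.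
case: (unliftP ord0 k) hd => [j ->|->] hd; rewrite integral_rVE.
  have E0 s : integral_rV (vslice dG s) = 0.
    apply: (IH (vslice G s) (vslice dG s) j); [exact: cS|exact: cS|
      exact: bounded_supp_vslice|exact: bounded_supp_vslice|].
    move=> y; have := hd (cons_rv s y); rewrite /vslice.
    rewrite (_ : (fun s0 => G (cons_rv s y + _)) = (fun s0 => G (cons_rv s (y + s0 *: delta_mx 0 j))))//.
    apply/funext => s0; congr G; apply: rv_ext => i.
    case: (unliftP ord0 i) => [i' ->|->].
      by rewrite mxE !cons_rvS !mxE !eqxx.
    by rewrite mxE !cons_rv0 !mxE /= mulr0 addr0.
  under eq_Rintegral do rewrite E0.
  by rewrite Rintegral_cst// mul0r.
pose H s := integral_rV (vslice G s).
have M'0 : 0 <= M' by apply: le_trans (bdG 0).1.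
have shift s y (t : R) : is_derive s (1 : R) ((fun s => G (cons_rv s y)) : R -> R^o) (dG (cons_rv s y)).
  have h := hd (cons_rv s y).
  apply: is_derive_seq => u u0 ucv; have := is_derive_quotient h u0 ucv.
  apply: cvg_trans; apply: near_eq_cvg; near=> k0; congr (_ * (_ - _)).
    congr G; apply: rv_ext => i; rewrite addr0.
    case: (unliftP ord0 i) => [i' ->|->].
      by rewrite mxE !cons_rvS !mxE /= mulr0 addr0.
    by rewrite mxE !cons_rv0 !mxE !eqxx /= mulr1 addrC.
  by congr G; rewrite scale0r addr0.
have nG s : nice K M (vslice G s).
  by apply: continuous_nice => //; [exact: cS|exact: bounded_supp_vslice].
have ndG s : nice K M' (vslice dG s).
  by apply: continuous_nice => //; [exact: cS|exact: bounded_supp_vslice].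
have HE s : is_derive s (1 : R) (H : R -> R^o) (integral_rV (vslice dG s)).
  apply: is_derive_seq => u u0 ucv.
  have qlip k0 y : `|(u k0)^-1 * (vslice G (u k0 + s) y - vslice G s y)| <= M'.
    rewrite normrM normfV mulrC ler_pdivrMr ?normr_gt0//.
    have := @is_derive_lipschitz (fun s => G (cons_rv s y)) (fun s => dG (cons_rv s y)) M' s (u k0 + s).
    by rewrite addrK; apply => x _; first [exact: shift | exact: (bdG _).1].
  have E k0 : (u k0)^-1 * (H (u k0 + s) - H s) =
     integral_rV (fun y => (u k0)^-1 * (vslice G (u k0 + s) y - vslice G s y)).
    have [n1 e1] := integral_rV_lin (-1) K0 (nG s) (nG (u k0 + s)).
    have [n2 e2] := integral_rV_lin ((u k0)^-1 - 1) K0 n1 n1.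
    rewrite -[LHS]addr0.
    have -> : (fun y => (u k0)^-1 * (vslice G (u k0 + s) y - vslice G s y)) =
      (fun y => ((u k0)^-1 - 1) * (-1 * vslice G s y + vslice G (u k0 + s) y) +
          (-1 * vslice G s y + vslice G (u k0 + s) y)).
      by apply/funext => y; ring.
    by rewrite e2 e1 /H; ring.
  rewrite (_ : (fun k => _) = (fun k0 =>
     integral_rV (fun y => (u k0)^-1 * (vslice G (u k0 + s) y - vslice G s y)))); last exact/funext.
  have [] // := @integral_rV_cvg _ m K M'
     (fun k0 y => (u k0)^-1 * (vslice G (u k0 + s) y - vslice G s y)) (vslice dG s) K0.
    move=> k0; apply: continuous_nice => //.
      move=> y; apply: seq_continuous_at => w wy; apply: cvgMr.
      by apply: cvgB; apply: continuous_seq wy; exact: cS.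
    move=> y; split; first exact: qlip.
    move=> Ky; rewrite /vslice !(bG _).2 ?subrr ?mulr0//;
      exact: lt_le_trans Ky (norm_cons_rv_ge _ _).2.
  move=> y; exact: (is_derive_quotient (shift s y 0) u0 ucv).
apply: (@integral_compact_derive K (M * (2 * K) ^+ m) (M' * (2 * K) ^+ m) H _ K0 HE).
- move=> s; apply: (@seq_continuous_at R^o) => u us.
  have [] // := @integral_rV_cvg _ m K M' (fun k => vslice dG (u k)) (vslice dG s) K0.
  move=> y; apply: (continuous_seq (cdG _)); apply: cons_rv_cvg us _; exact: cvg_cst.
- by apply: bounded_supp_integral => //; exact: continuous_nice.
- by apply: bounded_supp_integral => //; exact: continuous_nice.
Unshelve. all: by end_near. Qed.

(** The functional T stands for the integral over the sphere, of which only
   linearity and bounded convergence are known, so Fubini's theorem is replaced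
   by an argument with primitives: the two sides, integrated up to t only, have
   the same derivative in t and agree for t below the support. *)
Section Exchange.
Variables (V : normedModType R) (W S : set V) (T : (V -> R) -> R).
Hypothesis SW : S `<=` W.

Definition seq_cont_on (phi : V -> R) := forall x (u : nat -> V), W x ->
  (forall k, W (u k)) -> u k @[k --> \oo] --> x -> phi (u k) @[k --> \oo] --> phi x.

Hypothesis T_lin : forall a phi psi, seq_cont_on phi -> seq_cont_on psi ->
  T (fun x => a * phi x + psi x) = a * T phi + T psi.
Hypothesis T_cvg : forall (phi_ : nat -> V -> R) (phi : V -> R) (M : R),
  (forall k, seq_cont_on (phi_ k)) -> seq_cont_on phi ->
  (forall k x, S x -> `|phi_ k x| <= M) ->
  (forall x, S x -> phi_ k x @[k --> \oo] --> phi x) ->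
  T (phi_ k) @[k --> \oo] --> T phi.

Lemma seq_cont_on_lin a phi psi : seq_cont_on phi -> seq_cont_on psi ->
  seq_cont_on (fun x => a * phi x + psi x).
Proof.
move=> h1 h2 x u Wx Wu ux; apply: cvgD; last exact: h2.
by apply: cvgMr; exact: h1.
Qed.

Lemma abs_zero : T (fun=> 0) = 0.
Proof.
have c0 : seq_cont_on (fun=> 0) by move=> *; exact: cvg_cst.
have := T_lin (-1) c0 c0; rewrite (_ : (fun _ => _) = (fun=> 0)).
  by move=> ->; ring.
by apply/funext => x; ring.
Qed.

Notation mu := (@lebesgue_measure R).
Notation prim f t := (\int[mu]_(s in `]-oo, t]%classic) f s).

Section OneDim.
Variables (K M : R) (f : R -> V -> R).
Hypothesis K0 : 0 <= K.
Hypothesis fb : forall x, W x -> bounded_supp K M (fun s => f s x).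
Hypothesis fc : forall s_ s u x, s_ k @[k --> \oo] --> s -> W x -> (forall k, W (u k)) ->
  u k @[k --> \oo] --> x -> f (s_ k) (u k) @[k --> \oo] --> f s x.

Let cls s : seq_cont_on (f s).
Proof. by move=> x u Wx Wu ux; apply: fc => //; exact: cvg_cst. Qed.

Let cs x : W x -> continuous (fun s => f s x).
Proof.
move=> Wx s; apply: (@seq_continuous_at R^o) => u us.
by apply: fc => //; exact: cvg_cst.
Qed.

Let ms x : W x -> measurable_fun setT (fun s => f s x).
Proof. by move=> Wx; apply: continuous_measurable_fun; exact: cs. Qed.

Let cT : continuous (fun s => T (f s)).
Proof.
move=> s; apply: (@seq_continuous_at R^o) => u us.
apply: (T_cvg (M := M)) => [k||k x Sx|x Sx]; [exact: cls|exact: cls| |].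
  exact: (fb (SW Sx) _).1.
by apply: fc => //; [exact: SW|move=> _; exact: SW|exact: cvg_cst].
Qed.

Let MT : exists M', bounded_supp K M' (fun s => T (f s)).
Proof.
have bz s : K < `|s| -> T (f s) = 0.
  move=> Ks; rewrite -abs_zero.
  have h1 : T (f s) @[k --> \oo] --> T (fun=> 0).
    apply: (T_cvg (M := M)) => [k||k x Sx|x Sx]; first exact: cls.
    - by move=> *; exact: cvg_cst.
    - exact: (fb (SW Sx) _).1.
    - rewrite (_ : (fun _ => _) = cst 0); first exact: cvg_cst.
      by apply/funext => k; apply: (fb (SW Sx) _).2.
  have h2 : T (f s) @[k --> \oo] --> T (f s) by exact: cvg_cst.
  by have := cvg_unique _ h2 h1; apply.
have cn : {within `[-K, K], continuous (fun s => `|T (f s)|)}.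
  apply: continuous_subspaceT => s; apply: (@cvg_norm _ R^o); exact: cT.
have KK : - K <= K by have K0' := K0; lra.
have [c _ hc] := EVT_max KK cn.
exists `|T (f c)| => s; split; last exact: bz.
have [/bz ->|h] := ltP K `|s|; first by rewrite normr0.
by apply: hc; rewrite in_itv/= -ler_norml.
Qed.

Let prim_derive (g : R -> R) (t : R) : measurable_fun setT g -> (exists M', bounded_supp K M' g) ->
  continuous g -> is_derive t (1:R) ((fun t => prim g t) : R -> R^o) (g t).
Proof.
move=> mg [M' bg] cg.
have ig : mu.-integrable setT (EFin \o g) by exact: integrable_bounded_supp bg.
have [||||h1 h2] := @continuous_FTC1 R g (BInfty _ true) t (t + 1).
- by rewrite ltrDl.
- exact: integrableS ig.
- by rewrite ltNyr.
- exact: cg.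
by apply: DeriveDef => //; rewrite -derive1E.
Qed.

Let prim_bound (g : R -> R) (M' t t' : R) : measurable_fun setT g -> bounded_supp K M' g ->
  continuous g -> `|prim g t - prim g t'| <= M' * `|t - t'|.
Proof.
move=> mg bg cg; apply: (@is_derive_lipschitz (fun t => prim g t) g) => x _.
  by apply: prim_derive => //; exists M'.
exact: (bg x).1.
Qed.

Let prim_cvg x u t : W x -> (forall k, W (u k)) -> u k @[k --> \oo] --> x ->
  prim (fun s => f s (u k)) t @[k --> \oo] --> prim (fun s => f s x) t.
Proof.
move=> Wx Wu ux; under eq_fun do rewrite Rintegral_mkcond; rewrite Rintegral_mkcond.
apply: (@dominated_bounded_supp _ K M _ _ _ _ _).2.
- move=> k; apply/measurable_restrict => //.
  by apply: measurable_funS (ms (Wu k)).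
- move=> k s; rewrite patchE; case: ifP => _; first exact: (fb (Wu k) s).
  by split=> //; rewrite normr0; apply: le_trans (fb Wx 0).1.
- move=> s; rewrite patchE; case: ifPn => hs; last first.
    rewrite (_ : (fun k => _) = cst 0); first exact: cvg_cst.
    by apply/funext => k; rewrite patchE (negPf hs).
  rewrite (_ : (fun k => _) = (fun k => f s (u k))); first by apply: fc => //; exact: cvg_cst.
  by apply/funext => k; rewrite patchE hs.
Qed.

Let prim_full (g : R -> R) M' : bounded_supp K M' g -> prim g K = \int[mu]_s g s.
Proof.
move=> bg; rewrite Rintegral_mkcond; apply: eq_Rintegral => s _; rewrite patchE; case: ifPn => // hs.
apply/esym/(bg s).2; rewrite ltNge; apply/negP => h; move/negP: hs; apply.
by rewrite inE/= in_itv/=; apply: le_trans (ler_norm _) h.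
Qed.

Let prim_empty (g : R -> R) M' : bounded_supp K M' g -> prim g (- K - 1) = 0.
Proof.
move=> bg; rewrite Rintegral_mkcond (_ : _ \_ _ = cst 0).
  by rewrite Rintegral_cst// mul0r.
apply/funext => s; rewrite patchE; case: ifPn => // hs.
have aux (z : R) : z <= - K - 1 -> K < `|z|.
  by have K0' := K0; move=> hz; rewrite ler0_norm; lra.
by apply: (bg s).2; apply: aux; move: hs; rewrite inE/= in_itv/=.
Qed.

Lemma exchange_1d : \int[mu]_s T (f s) = T (fun x => \int[mu]_s f s x).
Proof.
have [M' bT] := MT.
have mT : measurable_fun setT (fun s => T (f s)) by exact: continuous_measurable_fun.
pose P t x := prim (fun s => f s x) t.
have clsP t : seq_cont_on (P t) by move=> x u Wx Wu ux; exact: prim_cvg.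
pose D t := prim (fun s => T (f s)) t - T (P t).
have hd t : is_derive t (1:R) (D : R -> R^o) 0.
  have -> : 0 = T (f t) - T (f t) by rewrite subrr.
  apply: is_deriveB; first by apply: prim_derive => //; exists M'.
  apply: is_derive_seq => u u0 ucv.
  have E k : (u k)^-1 * (T (P (u k + t)) - T (P t)) =
      T (fun x => (u k)^-1 * P (u k + t) x + (- (u k)^-1 * P t x + 0)).
    have c0 : seq_cont_on (fun=> 0) by move=> *; exact: cvg_cst.
    rewrite T_lin//; last by apply: seq_cont_on_lin.
    rewrite T_lin// abs_zero; ring.
  rewrite (_ : (fun k => _) = (fun k =>
    T (fun x => (u k)^-1 * P (u k + t) x + (- (u k)^-1 * P t x + 0)))); last exact/funext.
  apply: (T_cvg (M := M)).
  - move=> k; do 2! apply: seq_cont_on_lin => //.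
    by move=> *; exact: cvg_cst.
  - exact: cls.
  - move=> k x Sx; have Wx := SW Sx.
    have -> : (u k)^-1 * P (u k + t) x + (- (u k)^-1 * P t x + 0) =
      (u k)^-1 * (P (u k + t) x - P t x) by ring.
    rewrite normrM normfV mulrC ler_pdivrMr ?normr_gt0//.
    have -> : `|u k| = `|u k + t - t| by rewrite addrK.
    by apply: prim_bound; [exact: ms|exact: fb|exact: cs].
  move=> x Sx; have Wx := SW Sx.
  rewrite (_ : (fun k => _) = (fun k => (u k)^-1 * (P (u k + t) x - P t x))); last first.
    by apply/funext => k; ring.
  apply: (is_derive_quotient (f := fun t => P t x)) => //.
  by apply: prim_derive; [exact: ms|exists M; exact: fb|exact: cs].
have := @is_derive_lipschitz D (fun=> 0) 0 (- K - 1) K (fun t _ => hd t).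
rewrite mul0r normr0 => /(_ (fun _ _ => lexx _)); rewrite normr_le0 subr_eq0 => /eqP.
rewrite /D (prim_full bT) (prim_empty bT).
have TE t g : (forall x, S x -> P t x = g x) -> seq_cont_on g -> T (P t) = T g.
  move=> h cg; have h1 : T (P t) @[k --> \oo] --> T g.
    apply: (T_cvg (M := M * `|t - (- K - 1)|)) => // [k x Sx|x Sx].
      have Wx := SW Sx; rewrite -[P t x]subr0 -(prim_empty (fb Wx)).
      by apply: prim_bound; [exact: ms|exact: fb|exact: cs].
    by rewrite (h x Sx); exact: cvg_cst.
  have h2 : T (P t) @[k --> \oo] --> T (P t) by exact: cvg_cst.
  by have := cvg_unique _ h2 h1; apply.
rewrite (TE (- K - 1) (fun=> 0)); last 2 first.
- by move=> x Sx; apply: prim_empty; exact: fb (SW Sx).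
- by move=> *; exact: cvg_cst.
rewrite (TE K (fun x => \int[mu]_s f s x)); last 2 first.
- by move=> x Sx; apply: prim_full; exact: fb (SW Sx).
- move=> x u Wx Wu ux; have := @prim_cvg x u K Wx Wu ux.
  rewrite (prim_full (fb Wx)); apply: cvg_trans; apply: near_eq_cvg.
  by near=> k; rewrite (prim_full (fb (Wu k))).
by rewrite abs_zero subr0 => /eqP; rewrite subr_eq0 => /eqP.
Unshelve. all: by end_near. Qed.

End OneDim.

Lemma exchange_rV m (K M : R) (F : 'rV[R]_m -> V -> R) : 0 <= K ->
  (forall x, W x -> bounded_supp K M (fun y => F y x)) ->
  (forall y_ y u x, y_ k @[k --> \oo] --> y -> W x -> (forall k, W (u k)) ->
    u k @[k --> \oo] --> x -> F (y_ k) (u k) @[k --> \oo] --> F y x) ->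
  integral_rV (fun y => T (F y)) = T (fun x => integral_rV (fun y => F y x)).
Proof.
move=> K0; elim: m F => [|m IH] F bF cF; first by [].
have nF s x : W x -> nice K M (vslice (fun y => F y x) s).
  move=> Wx; apply: continuous_nice => //; last by apply: bounded_supp_vslice; exact: bF.
  move=> y; apply: seq_continuous_at => u uy; apply: cF => //; last exact: cvg_cst.
  by apply: cons_rv_cvg uy; exact: cvg_cst.
rewrite integral_rVE.
have E s : integral_rV (vslice (fun y => T (F y)) s) =
   T (fun x => integral_rV (vslice (fun y => F y x) s)).
  apply: (IH (fun y => F (cons_rv s y))).
    by move=> x Wx; exact: (bounded_supp_vslice s (bF x Wx)).
  move=> y_ y u x hy Wx Wu ux; apply: cF => //.
  by apply: cons_rv_cvg hy; exact: cvg_cst.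
under eq_Rintegral do rewrite E.
apply: (@exchange_1d K (M * (2 * K) ^+ m)) => //.
- move=> x Wx s; split; first by apply: integral_rV_bound => //; exact: nF.
  by move=> Ks; rewrite (bounded_supp_vslice0 (bF x Wx) Ks) integral_rV0.
- move=> s_ s u x hs Wx Wu ux.
  have [] // := @integral_rV_cvg _ m K M
     (fun k => vslice (fun y => F y (u k)) (s_ k)) (vslice (fun y => F y x) s) K0.
    by move=> k; exact: nF.
  move=> y; apply: cF => //; apply: cons_rv_cvg hs _; exact: cvg_cst.
Qed.

End Exchange.

End Sequential.

(** * Functions of class C^k on an open set *)

Section Smoothness.
Context {R : realType}.

(** Reduces directional derivatives to derivatives of functions of one variable. *)
Lemma is_derive_line (V : normedModType R) (F : V -> R^o) (x v : V) (s : R) :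
  differentiable F (x + s *: v) ->
  is_derive s (1 : R) (fun s => F (x + s *: v) : R^o) ('D_v F (x + s *: v)).
Proof.
move=> dF; have /(@derivableP _ _ _ F _ v) [h1 h2] := diff_derivable (v := v) dF.
have E : (fun h : R => h^-1 *: ((fun s => F (x + s *: v) : R^o) (h *: (1 : R) + s) -
            F (x + s *: v))) = (fun h => h^-1 *: (F (h *: v + (x + s *: v)) - F (x + s *: v))).
  apply/funext => h; congr (_ *: (F _ - _)).
  by rewrite [h *: (1:R)]mulr1 scalerDl addrCA.
apply: DeriveDef; first by rewrite /derivable E; exact: h1.
by rewrite /derive E.
Qed.

Lemma dist_half (a b c e : R) : `|a - c| < e / 2 -> `|b - c| < e / 2 -> `|a - b| <= e.
Proof.
rewrite [`|b - c|]distrC => h1 h2; rewrite -[a](subrK c) -addrA.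
by apply: le_trans (ler_normD _ _) _; lra.
Qed.

Section Ck.
Variables (V : normedModType R) (U : set V).
Hypothesis Uo : open U.

Fixpoint Ck (k : nat) (F : V -> R^o) : Prop :=
  (forall x, U x -> differentiable F x) /\
  match k with 0 => True | k'.+1 => forall v, Ck k' ('D_v F) end.

Lemma Ck_diff k F x : Ck k F -> U x -> differentiable F x.
Proof. by case: k => [|k] [h _]; exact: h. Qed.

Lemma Ck_derive k F v : Ck k.+1 F -> Ck k ('D_v F).
Proof. by move=> -[_ h]; exact: h. Qed.

Lemma smooth_onP (F : V -> R^o) : smooth_on U F <-> forall k, Ck k F.
Proof.
split=> [h k|h vs]; last first.
  elim/last_ind: vs F h => [|vs v IH] F h x Ux; first exact: Ck_diff (h 0%N) Ux.
  by rewrite foldr_rcons; apply: IH => // k; exact: Ck_derive (h k.+1).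
elim: k F h => [|k IH] F h; first by split=> // x Ux; exact: (h [::] x Ux).
split=> [x Ux|v]; first exact: (h [::] x Ux).
apply: IH => vs x Ux; have := h (rcons vs v) x Ux.
by rewrite foldr_rcons.
Qed.

Lemma near_on (P : V -> Prop) x : (forall y, U y -> P y) -> U x -> \forall y \near x, P y.
Proof. by move=> h Ux; apply: (filterS h); exact: open_nbhs_nbhs. Qed.

Lemma derive_eq_on (F G : V -> R^o) x v : (forall y, U y -> F y = G y) -> U x ->
  'D_v F x = 'D_v G x.
Proof. by move=> h Ux; apply: near_eq_derive; exact: near_on Ux. Qed.

Lemma differentiable_near0 (H : V -> R^o) x : (\forall y \near x, H y = 0) ->
  differentiable H x.
Proof.
move=> H0.
have cz : continuous (cst 0 : V -> R^o) by move=> y; exact: cvg_cst.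
have e0 : H \o shift x = cst (H x) + (\0 : {linear V -> R^o}) +o_ 0 id.
  apply/eqaddoP => e e0; near=> h.
  have -> : (H \o shift x - (cst (H x) + (\0 : {linear V -> R^o}))) h =
    H (h + x) - (H x + 0) by [].
  rewrite (nbhs_singleton H0) (_ : H (h + x) = 0) ?addr0 ?subr0 ?normr0 ?mulr_ge0// ?ltW//.
  near: h; have := H0; rewrite (near_shift 0 x) /=; apply: filterS => z /=.
  by rewrite subr0.
have E := diff_unique (f := H) (df := \0 : {linear V -> R^o}) cz e0.
by apply/diff_locallyP; rewrite E.
Unshelve. all: by end_near. Qed.

Lemma differentiable_eq_on (F G : V -> R^o) x : (forall y, U y -> F y = G y) -> U x ->
  differentiable F x -> differentiable G x.
Proof.
move=> h Ux dF; have -> : G = F + (G - F) by rewrite addrC subrK.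
apply: differentiableD => //; apply: differentiable_near0.
by apply: near_on Ux => y Uy; rewrite /= !fctE h// subrr.
Qed.

Lemma Ck_eq k (F G : V -> R^o) : (forall y, U y -> F y = G y) -> Ck k F -> Ck k G.
Proof.
elim: k F G => [|k IH] F G h [dF cF].
  by split=> // x Ux; exact: differentiable_eq_on (dF x Ux).
split=> [x Ux|v]; first exact: differentiable_eq_on (dF x Ux).
by apply: IH (cF v) => y Uy; exact: derive_eq_on.
Qed.

Lemma Ck_S k F : Ck k.+1 F -> Ck k F.
Proof.
elim: k F => [|k IH] F [dF cF]; first by split.
by split=> // v; apply: IH; exact: cF.
Qed.

Lemma Ck_cst k (c : R) : Ck k (cst c : V -> R^o).
Proof.
elim: k c => [|k IH] c; split=> // v.
by rewrite (_ : 'D_v _ = cst 0) ?IH//; apply/funext => y; rewrite derive_cst.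
Qed.

Lemma derive_add (F G : V -> R^o) x v : differentiable F x -> differentiable G x ->
  'D_v (fun y => F y + G y : R^o) x = 'D_v F x + 'D_v G x.
Proof. by move=> dF dG; rewrite -deriveD//; exact: diff_derivable. Qed.

Lemma derive_mul (F G : V -> R^o) x v : differentiable F x -> differentiable G x ->
  'D_v (fun y => F y * G y : R^o) x = F x * 'D_v G x + G x * 'D_v F x.
Proof.
move=> dF dG; rewrite -[in RHS]/(F x *: 'D_v G x + G x *: 'D_v F x) -deriveM//;
  exact: diff_derivable.
Qed.

Lemma Ck_add k (F G : V -> R^o) : Ck k F -> Ck k G -> Ck k (fun y => F y + G y).
Proof.
elim: k F G => [|k IH] F G cF cG.
  by split=> // x Ux; apply: differentiableD; [exact: Ck_diff cF Ux|exact: Ck_diff cG Ux].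
split=> [x Ux|v].
  by apply: differentiableD; [exact: Ck_diff cF Ux|exact: Ck_diff cG Ux].
apply: Ck_eq (IH _ _ (Ck_derive v cF) (Ck_derive v cG)) => y Uy.
by rewrite derive_add; [|exact: Ck_diff cF Uy|exact: Ck_diff cG Uy].
Qed.

Lemma Ck_mul k (F G : V -> R^o) : Ck k F -> Ck k G -> Ck k (fun y => F y * G y).
Proof.
elim: k F G => [|k IH] F G cF cG.
  by split=> // x Ux; apply: differentiableM; [exact: Ck_diff cF Ux|exact: Ck_diff cG Ux].
split=> [x Ux|v].
  by apply: differentiableM; [exact: Ck_diff cF Ux|exact: Ck_diff cG Ux].
apply: Ck_eq (Ck_add (IH _ _ (Ck_S cF) (Ck_derive v cG)) (IH _ _ (Ck_S cG) (Ck_derive v cF))) => y Uy.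
by rewrite derive_mul; [|exact: Ck_diff cF Uy|exact: Ck_diff cG Uy].
Qed.

Lemma Ck_scale k (a : R) (F : V -> R^o) : Ck k F -> Ck k (fun y => a * F y).
Proof. by move=> cF; apply: Ck_mul cF; exact: Ck_cst. Qed.

Lemma Ck_sum k (I : Type) (r : seq I) (F : I -> V -> R^o) :
  (forall i, Ck k (F i)) -> Ck k (fun y => \sum_(i <- r) F i y).
Proof.
move=> cF; elim: r => [|i r IH].
  by apply: Ck_eq (Ck_cst k 0) => y _; rewrite big_nil.
by apply: Ck_eq (Ck_add (cF i) IH) => y _; rewrite big_cons.
Qed.

Lemma derive_sum (I : Type) (r : seq I) (F : I -> V -> R^o) x v :
  (forall i, differentiable (F i) x) ->
  'D_v (fun y => \sum_(i <- r) F i y : R^o) x = \sum_(i <- r) 'D_v (F i) x.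
Proof.
move=> dF; elim: r => [|i r IH].
  rewrite big_nil (_ : (fun _ => _) = cst 0) ?derive_cst//.
  by apply/funext => y; rewrite big_nil.
rewrite big_cons -IH -derive_add//.
  by congr ('D_v _ x); apply/funext => y; rewrite big_cons.
elim: r {IH} => [|j r IH].
  rewrite (_ : (fun _ => _) = cst 0); first exact: differentiable_cst.
  by apply/funext => y; rewrite big_nil.
have E : (fun y => \sum_(i <- j :: r) F i y : R^o) = F j + (fun y => \sum_(i <- r) F i y : R^o).
  by apply/funext => y; rewrite big_cons.
by rewrite E; exact: differentiableD.
Qed.

Lemma derive_scale (a : R) (F : V -> R^o) x v : differentiable F x ->
  'D_v (fun y => a * F y : R^o) x = a * 'D_v F x.
Proof.
move=> dF; have dc : differentiable (cst a : V -> R^o) x by exact: differentiable_cst.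
have dz : 'D_v (cst a : V -> R^o) x = 0 by rewrite derive_cst.
by rewrite (derive_mul v dc dF) dz mulr0 addr0.
Qed.

Lemma Ck_continuous k F x : Ck k F -> U x -> {for x, continuous (F : V -> R)}.
Proof. by move=> cF Ux; apply: differentiable_continuous; exact: Ck_diff cF Ux. Qed.

(** The mean value theorem in each of the two variables. The left-hand side is
   symmetric in v and w, which yields the symmetry of second derivatives. *)
Lemma second_difference (F : V -> R^o) x v w e : Ck 1 F -> 0 < e ->
  (forall s t : R, 0 <= s <= e -> 0 <= t <= e -> U (x + s *: v + t *: w)) ->
  exists s t : R, [/\ 0 <= s <= e, 0 <= t <= e &
   F (x + e *: v + e *: w) - F (x + e *: v) - (F (x + e *: w) - F x) =
   e * (e * 'D_w ('D_v F) (x + s *: v + t *: w))].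
Proof.
move=> cF e0 hU.
have e01 : 0 <= e <= e by rewrite ltW//=.
have U0 s : 0 <= s <= e -> U (x + s *: v).
  by move=> hs; have := hU s 0 hs; rewrite scale0r addr0; apply; rewrite lexx ltW.
have dd s : 0 <= s <= e -> is_derive s (1:R)
   (fun s => F (x + e *: w + s *: v) - F (x + s *: v) : R^o)
   ('D_v F (x + e *: w + s *: v) - 'D_v F (x + s *: v)).
  move=> hs; apply: is_deriveB; apply: is_derive_line; apply: Ck_diff cF _.
    by rewrite addrAC; exact: hU.
  exact: U0.
have [||s hs Es] := @MVT R (fun s => F (x + e *: w + s *: v) - F (x + s *: v))
   (fun s => 'D_v F (x + e *: w + s *: v) - 'D_v F (x + s *: v)) 0 e e0.
- by move=> s hs; apply: dd; rewrite !ltW ?(itvP hs).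
- apply: derivable_within_continuous => s hs.
  by have [] // := dd s; rewrite !(itvP hs).
have {}hs : 0 <= s <= e by rewrite !ltW ?(itvP hs).
have dd2 t : 0 <= t <= e -> is_derive t (1:R)
   (fun t => 'D_v F (x + s *: v + t *: w) : R^o) ('D_w ('D_v F) (x + s *: v + t *: w)).
  move=> ht; apply: is_derive_line; apply: Ck_diff (Ck_derive v cF) _; exact: hU.
have [||t ht Et] := @MVT R (fun t => 'D_v F (x + s *: v + t *: w))
   (fun t => 'D_w ('D_v F) (x + s *: v + t *: w)) 0 e e0.
- by move=> t ht; apply: dd2; rewrite !ltW ?(itvP ht).
- apply: derivable_within_continuous => t ht.
  by have [] // := dd2 t; rewrite !(itvP ht).
exists s, t; split=> //; first by rewrite !ltW ?(itvP ht).
move: Es Et; rewrite !scale0r !addr0 !subr0 (addrAC x (e *: w) (s *: v)) => Es Et.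
rewrite -[LHS]/(F (x + e *: v + e *: w) - F (x + e *: v) - (F (x + e *: w) - F x)).
by rewrite (addrAC x (e *: v)) Es Et; ring.
Qed.

Lemma continuous_radius (f g : V -> R) x (e : R) : {for x, continuous f} ->
  {for x, continuous g} -> U x -> 0 < e ->
  exists2 d : R, 0 < d & forall y, `|x - y| < d ->
    [/\ U y, `|f x - f y| < e & `|g x - g y| < e].
Proof.
move=> /cvgrPdist_lt cf /cvgrPdist_lt cg Ux e0.
have nU := open_nbhs_nbhs (conj Uo Ux).
have := filterI nU (filterI (cf _ e0) (cg _ e0)); rewrite nbhs_ballP => -[d d0 hd].
exists d => // y hy; have [|h1 [h2 h3]] := hd y; first by rewrite -ball_normE.
by split.
Qed.

Lemma Schwarz (F : V -> R^o) x v w : Ck 2 F -> U x ->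
  'D_w ('D_v F) x = 'D_v ('D_w F) x.
Proof.
move=> cF Ux; apply/eqP; rewrite -subr_eq0 -normr_eq0 eq_le normr_ge0 andbT.
apply/ler_addgt0Pl => e e0; rewrite addr0.
have c1 := Ck_continuous (Ck_derive w (Ck_derive v cF)) Ux.
have c2 := Ck_continuous (Ck_derive v (Ck_derive w cF)) Ux.
have e2 : 0 < e / 2 by rewrite divr_gt0.
have [d d0 hd] := continuous_radius c1 c2 Ux e2.
pose n := `|v| + `|w| + 1.
have n0 : 0 < n by rewrite /n ltr_wpDl// addr_ge0.
pose h := d / (2 * n).
have h0 : 0 < h by rewrite /h divr_gt0// mulr_gt0.
have close (s t : R) : 0 <= s <= h -> 0 <= t <= h -> `|x - (x + s *: v + t *: w)| < d.
  move=> /andP[s0 sh] /andP[t0 th]; rewrite -addrA opprD addNKr normrN.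
  apply: le_lt_trans (ler_normD _ _) _; rewrite !normrZ !ger0_norm//.
  have : s * `|v| + t * `|w| <= h * `|v| + h * `|w| by rewrite lerD// ler_wpM2r.
  move=> /le_lt_trans; apply.
  have -> : h * `|v| + h * `|w| = h * (n - 1) by rewrite /n; ring.
  have -> : d = h * (2 * n) by rewrite /h divfK// gt_eqF// mulr_gt0.
  by rewrite ltr_pM2l//; lra.
have [|s [t [hs ht E1]]] := @second_difference F x v w h (Ck_S cF) h0.
  by move=> s t hs ht; have [] := hd _ (close s t hs ht).
have close' (a b : R) : 0 <= a <= h -> 0 <= b <= h -> `|x - (x + a *: w + b *: v)| < d.
  by move=> ha hb; rewrite addrAC; exact: close.
have [|s' [t' [hs' ht' E2]]] := @second_difference F x w v h (Ck_S cF) h0.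
  by move=> a b ha hb; have [] := hd _ (close' a b ha hb).
have E : 'D_w ('D_v F) (x + s *: v + t *: w) = 'D_v ('D_w F) (x + s' *: w + t' *: v).
  apply: (mulfI (lt0r_neq0 h0)); apply: (mulfI (lt0r_neq0 h0)).
  move: E1 E2; move: ('D_w ('D_v F) _) ('D_v ('D_w F) _) => A B E1 E2.
  have aux (p q r z : R) : p - q - (r - z) = p - r - (q - z) by ring.
  have E3 : F (x + h *: v + h *: w) - F (x + h *: v) - (F (x + h *: w) - F x) =
    F (x + h *: w + h *: v) - F (x + h *: w) - (F (x + h *: v) - F x).
    by rewrite (addrAC x (h *: w)) aux.
  by have e1 := E1; rewrite E3 E2 in e1; exact: (esym e1).
have [_ b1 _] := hd _ (close s t hs ht).
have [_ _ b2] := hd _ (close' s' t' hs' ht').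
by rewrite E in b1; exact: dist_half b1 b2.
Qed.

End Ck.

Section CkComp.
Variables (V V' : normedModType R) (U : set V) (U' : set V').
Hypothesis (Uo : open U) (U'o : open U').

(** Stated for maps L that are affine only along v, l being their linear part:
   projections, dilations, and linear maps are the applications. *)
Lemma derive_affine (L : V' -> V) (l : V' -> V) (F : V -> R^o) x v :
  differentiable F (L x) -> (forall h : R, L (h *: v + x) = h *: l v + L x) ->
  'D_v (F \o L) x = 'D_(l v) F (L x).
Proof.
move=> dF hl.
have E : (fun h : R => h^-1 *: ((F \o L) (h *: v + x) - (F \o L) x)) =
  (fun h => h^-1 *: (F (h *: l v + L x) - F (L x))).
  by apply/funext => h /=; rewrite hl.
by rewrite /derive E.
Qed.

Lemma Ck_affine (L : V' -> V) (l : V' -> V) k (F : V -> R^o) :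
  (forall x, differentiable L x) ->
  (forall (h : R) v x, L (h *: v + x) = h *: l v + L x) ->
  (forall x, U' x -> U (L x)) -> Ck U k F -> Ck U' k (F \o L).
Proof.
move=> dL hl hU; elim: k F => [|k IH] F cF.
  by split=> // x Ux; apply: differentiable_comp => //; exact: Ck_diff cF (hU _ Ux).
split=> [x Ux|v].
  by apply: differentiable_comp => //; exact: Ck_diff cF (hU _ Ux).
apply: (Ck_eq U'o) (IH _ (Ck_derive (l v) cF)) => y Uy.
by rewrite (derive_affine (l := l))//; exact: Ck_diff cF (hU _ Uy).
Qed.

Lemma derive_comp1 (psi : R^o -> R^o) (F : V -> R^o) x v :
  differentiable F x -> differentiable psi (F x) ->
  'D_v (psi \o F) x = 'D_1 psi (F x) * 'D_v F x.
Proof.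
move=> dF dp; rewrite deriveE; last exact: differentiable_comp.
rewrite diff_comp// /= !deriveE//.
have -> : 'd F x v = ('d F x v : R) *: (1 : R^o) by rewrite [RHS]mulr1.
by rewrite linearZ /= [LHS]mulrC scaler1.
Qed.

Lemma Ck_comp1 (I : set R^o) k (psi : R^o -> R^o) (F : V -> R^o) :
  Ck I k psi -> (forall x, U x -> I (F x)) -> Ck U k F -> Ck U k (psi \o F).
Proof.
move=> + hI; elim: k psi => [|k IH] psi cp cF.
  split=> // x Ux; apply: differentiable_comp; first exact: Ck_diff cF Ux.
  exact: Ck_diff cp (hI _ Ux).
split=> [x Ux|v].
  apply: differentiable_comp; first exact: Ck_diff cF Ux.
  exact: Ck_diff cp (hI _ Ux).
have c1 := IH _ (Ck_derive (1 : R^o) cp) (Ck_S cF).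
have c2 := Ck_mul Uo c1 (Ck_derive v cF).
apply: (Ck_eq Uo) c2 => y Uy.
by rewrite derive_comp1//; [exact: Ck_diff cF Uy|exact: Ck_diff cp (hI _ Uy)].
Qed.

End CkComp.

Lemma open_pos : open [set x : R^o | 0 < x].
Proof. exact: open_gt. Qed.

Lemma Ck_powR k (a : R) : Ck [set x : R^o | 0 < x] k (fun x => x `^ a : R^o).
Proof.
elim: k a => [|k IH] a.
  split=> // x x0; apply/derivable1_diffP.
  by have [] := @is_derive1_powR R a x x0.
split=> [x x0|v].
  by apply/derivable1_diffP; have [] := @is_derive1_powR R a x x0.
apply: (Ck_eq open_pos) (Ck_scale open_pos (v * a) (IH (a - 1))) => y y0.
have dy : differentiable (fun x => x `^ a : R^o) y.
  by apply/derivable1_diffP; have [] := @is_derive1_powR R a y y0.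
rewrite deriveE// -[v]mulr1 [v * 1]/(v *: (1 : R^o)) linearZ -deriveE//=.
have [_ ->] := @is_derive1_powR R a y y0.
by rewrite [RHS]mulrA mulr1.
Qed.

End Smoothness.

(** * A cutoff profile, and the geometry of the sphere *)

Section Cutoff.
Context {R : realType}.

(** Powers of the positive part: elementary functions of any finite
   differentiability, from which cutoffs are built. *)
Definition ppow (m : nat) (s : R) : R := Num.max 0 s ^+ m.

Lemma ppow_le0 m s : (0 < m)%N -> s <= 0 -> ppow m s = 0.
Proof. by move=> m0 s0; rewrite /ppow (max_idPl s0) expr0n gtn_eqF. Qed.

Lemma ppow_ge0 m s : 0 <= ppow m s.
Proof. by rewrite exprn_ge0// le_max lexx. Qed.

Lemma ppow_ge1 m s : 1 <= s -> 1 <= ppow m s.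
Proof.
move=> s1; have s0 : 0 <= s by exact: le_trans ler01 s1.
by rewrite /ppow (max_idPr s0) exprn_ege1.
Qed.

Lemma is_derive_ppow m (s : R) :
  is_derive s (1 : R) (ppow m.+2 : R -> R^o) (m.+2%:R * ppow m.+1 s).
Proof.
have [s0|s0|->] := ltgtP s 0.
- apply: (@near_eq_is_derive _ _ _ (cst 0 : R -> R^o)); last first.
    by rewrite ppow_le0 ?mulr0 ?ltW//; exact: is_derive_cst.
  by near=> t; rewrite /= ppow_le0// ltW//; near: t; exact: lt_nbhsl.
- apply: (@near_eq_is_derive _ _ _ (fun t : R => t ^+ m.+2 : R^o)); last first.
    rewrite /ppow (max_idPr (ltW s0)).
    have := @is_deriveX _ _ (id : R -> R^o) m.+2 s 1 1 (is_derive_id _ _).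
    have -> : (id : R -> R^o) ^+ m.+2 = (fun t => t ^+ m.+2) by apply/funext => t; rewrite exprfctE.
    by move=> [h1 h2]; apply: DeriveDef => //; rewrite h2 [LHS]mulr1.
  near=> t; rewrite /ppow (max_idPr _)// ltW//; near: t; apply: open_nbhs_nbhs; split => //; exact: open_gt.
- rewrite ppow_le0// mulr0; apply: is_derive_seq => u u0 ucv.
  have E k : `|(u k)^-1 * (ppow m.+2 (u k + 0) - ppow m.+2 0)| <= `|u k| ^+ m.+1.
    rewrite (ppow_le0 (s := 0))// addr0 subr0 normrM normfV mulrC ler_pdivrMr ?normr_gt0//.
    rewrite -exprSr /ppow normrX lerXn2r ?nnegrE//.
    by rewrite /Num.max; case: ifP => // _; rewrite normr0.
  have u1 : `|u k| ^+ m.+1 @[k --> \oo] --> (0 : R).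
    have un : `|u k| @[k --> \oo] --> (0 : R) by apply/norm_cvg0P.
    have := continuous_seq (V := R^o) (@exprn_continuous R m.+1 0) un.
    by rewrite expr0n.
  apply/cvgr0Pnorm_le => e e0; move/cvgr0Pnorm_le : u1 => /(_ e e0) [N _ hN].
  exists N => // k Nk; apply: le_trans (E k) _; apply: le_trans (hN k Nk).
  exact: ler_norm.
Unshelve. all: by end_near. Qed.

Lemma Ck_ppow k m : (k.+1 < m)%N -> Ck [set: R^o] k (ppow m : R^o -> R^o).
Proof.
have d m' x : differentiable (ppow m'.+2 : R^o -> R^o) x.
  by apply/derivable1_diffP; have [] := is_derive_ppow m' x.
elim: k m => [|k IH] [|[|m]]// km; split=> // v.
apply: (Ck_eq openT) (Ck_scale openT (v * m.+2%:R) (IH m.+1 km)) => y _.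
rewrite deriveE// -[v in RHS]mulr1 [v * 1]/(v *: (1 : R^o)) linearZ -deriveE//=.
by have [_ ->] := is_derive_ppow m y; rewrite [RHS]mulrA.
Qed.

(** Equal to 0 on the negative half-line and to 1 beyond 1; the exponent 4 makes
   it of class C^2. *)
Definition step (s : R) : R := 1 - ppow 4 (1 - ppow 4 s).

Lemma step_le0 s : s <= 0 -> step s = 0.
Proof.
by move=> s0; rewrite /step (ppow_le0 _ s0)// subr0 /ppow (max_idPr ler01) expr1n subrr.
Qed.

Lemma step_ge1 s : 1 <= s -> step s = 1.
Proof.
by move=> s1; rewrite /step (@ppow_le0 4 (1 - _))// ?subr0// subr_le0 ppow_ge1.
Qed.

Lemma step_itv s : 0 <= step s <= 1.
Proof.
rewrite /step; have := ppow_ge0 4 (1 - ppow 4 s) => h; rewrite subr_ge0 gerBl h andbT.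
rewrite /ppow exprn_ile1 ?le_max ?lexx//.
by rewrite ge_max ler01 gerBl exprn_ge0// le_max lexx.
Qed.

Lemma step_norm s : `|step s| <= 1.
Proof. by have /andP[h1 h2] := step_itv s; rewrite ger0_norm. Qed.

Lemma Ck_step : Ck [set: R^o] 2 (step : R^o -> R^o).
Proof.
have cm (G : R^o -> R^o) : Ck [set: R^o] 2 G -> Ck [set: R^o] 2 (fun s => 1 + -1 * G s).
  move=> cG; apply: (Ck_add openT); first exact: (Ck_cst _ 2 1).
  exact: (Ck_scale openT).
have c4 := @Ck_ppow 2 4 isT.
have c := cm _ (Ck_comp1 (I := [set: R^o]) openT c4 (fun _ _ => I) (cm _ c4)).
by apply: (Ck_eq openT) c => s _; rewrite /step /= !mulN1r.
Qed.

Lemma continuous_step : continuous (step : R -> R).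
Proof. by move=> s; exact: (Ck_continuous Ck_step (x := s) I). Qed.

End Cutoff.

Lemma seq_cvg_sum {R : realType} (I : Type) (r : seq I) (f : I -> nat -> R) (l : I -> R) :
  (forall i, f i k @[k --> \oo] --> l i) ->
  \sum_(i <- r) f i k @[k --> \oo] --> \sum_(i <- r) l i.
Proof.
move=> h; elim: r => [|i r IH].
  rewrite big_nil (_ : (fun k => _) = cst 0); first exact: cvg_cst.
  by apply/funext => k; rewrite big_nil.
rewrite big_cons (_ : (fun k => _) = (fun k => f i k + \sum_(i <- r) f i k)).
  by apply: cvgD.
by apply/funext => k; rewrite big_cons.
Qed.

Section SphereGeometry.
Context {R : realType} {n : nat}.
Notation V := (ambient R n).
Implicit Types (x y z : V) (a : R).

Lemma edotC x y : edot x y = edot y x.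
Proof. by apply: eq_bigr => j _; rewrite mulrC. Qed.

Lemma edotDl x y z : edot (x + y) z = edot x z + edot y z.
Proof. by rewrite -big_split; apply: eq_bigr => j _; rewrite mxE mulrDl. Qed.

Lemma edotZl a x y : edot (a *: x) y = a * edot x y.
Proof. by rewrite /edot mulr_sumr; apply: eq_bigr => j _; rewrite mxE mulrA. Qed.

Lemma edotDr x y z : edot z (x + y) = edot z x + edot z y.
Proof. by rewrite edotC edotDl !(edotC z). Qed.

Lemma edotZr a x y : edot x (a *: y) = a * edot x y.
Proof. by rewrite edotC edotZl (edotC x). Qed.

Lemma edot_ge0 x : 0 <= edot x x.
Proof. by apply: sumr_ge0 => j _; rewrite -expr2 sqr_ge0. Qed.

Lemma coord_sqr_le x j : x 0 j ^+ 2 <= edot x x.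
Proof.
rewrite /edot (bigD1 j)//= -expr2 lerDl.
by apply: sumr_ge0 => i _; rewrite -expr2 sqr_ge0.
Qed.

Lemma edot_eq0 x : (edot x x == 0) = (x == 0).
Proof.
apply/idP/idP => [/eqP h|/eqP ->]; last first.
  by rewrite /edot big1// => j _; rewrite mxE mul0r.
apply/eqP/rv_ext => j; rewrite mxE; apply/eqP; rewrite -sqrf_eq0 eq_le sqr_ge0 andbT.
by rewrite -h coord_sqr_le.
Qed.

Lemma enorm_ge0 x : 0 <= enorm x.
Proof. exact: sqrtr_ge0. Qed.

Lemma enorm_sqr x : enorm x ^+ 2 = edot x x.
Proof. by rewrite sqr_sqrtr// edot_ge0. Qed.

Lemma enorm_eq0 x : (enorm x == 0) = (x == 0).
Proof. by rewrite -sqrf_eq0 enorm_sqr edot_eq0. Qed.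

Lemma enorm_gt0 x : (0 < enorm x) = (x != 0).
Proof. by rewrite lt_def enorm_ge0 andbT enorm_eq0. Qed.

Lemma enormZ a x : enorm (a *: x) = `|a| * enorm x.
Proof. by rewrite /enorm edotZl edotZr mulrA -expr2 sqrtrM ?sqr_ge0// sqrtr_sqr. Qed.

Lemma norm_le_enorm x : `|x| <= enorm x.
Proof.
apply: norm_le_coord => [|i]; first exact: enorm_ge0.
by rewrite -sqrtr_sqr ler_wsqrtr// coord_sqr_le.
Qed.

Lemma enorm_le1 x : (enorm x <= 1) = (edot x x <= 1).
Proof. by rewrite -enorm_sqr expr_le1// enorm_ge0. Qed.

Lemma sphereP x : sphere x <-> edot x x = 1.
Proof.
rewrite /sphere /= -enorm_sqr; split=> [->|h]; first by rewrite expr1n.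
by apply/eqP; rewrite -(@pexpr_eq1 _ _ 2)// ?enorm_ge0// h.
Qed.

Lemma sphere_neq0 x : sphere x -> x != 0.
Proof. by rewrite /sphere/= -enorm_gt0 => ->. Qed.

Definition radial x : V := (enorm x)^-1 *: x.

Lemma radial_sphere x : x != 0 -> sphere (radial x).
Proof.
rewrite -enorm_gt0 => x0; rewrite /sphere/= enormZ ger0_norm ?invr_ge0 ?enorm_ge0//.
by rewrite mulVf// gt_eqF.
Qed.

Lemma radial_id x : sphere x -> radial x = x.
Proof. by rewrite /sphere/= /radial => ->; rewrite invr1 scale1r. Qed.

Lemma hextE (phi : V -> R) x : hext phi x = phi (radial x).
Proof. by []. Qed.

Lemma hext_sphere (phi : V -> R) x : sphere x -> hext phi x = phi x.
Proof. by move=> sx; rewrite hextE radial_id. Qed.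

Lemma radialZ a x : 0 < a -> radial (a *: x) = radial x.
Proof.
move=> a0; rewrite /radial enormZ gtr0_norm// scalerA invfM mulrAC mulVf ?gt_eqF//.
by rewrite mul1r.
Qed.

Lemma continuous_edot : continuous (fun x : V => edot x x).
Proof.
move=> x; apply: seq_continuous_at => u ux; apply: seq_cvg_sum => j.
by apply: cvgM; exact: (continuous_seq (@coord_continuous R _ _ 0 j x) ux).
Qed.

Lemma continuous_enorm : continuous (@enorm R n).
Proof.
move=> x; apply: seq_continuous_at => u ux.
apply: (continuous_seq (V := R^o) (@sqrt_continuous R (edot x x))).
exact: (continuous_seq (continuous_edot (x := x)) ux).
Qed.

Lemma open_neq0 : open [set y : V | y != 0].
Proof.
rewrite (_ : [set _ | _] = (fun x : V => edot x x) @^-1` [set r | 0 < r]).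
  by apply: open_comp; [move=> x _; exact: continuous_edot|exact: open_gt].
by apply/seteqP; split=> x /=; rewrite lt_def edot_ge0 andbT edot_eq0.
Qed.

Lemma continuous_radial x : x != 0 -> {for x, continuous radial}.
Proof.
move=> x0; have c1 : {for x, continuous (fun y : V => (enorm y)^-1)}.
  apply: seq_continuous_at => u ux; apply: cvgV; first by rewrite enorm_eq0.
  exact: (continuous_seq (continuous_enorm (x := x)) ux).
exact: (@cvgZ _ _ _ (nbhs x) _ (fun y : V => (enorm y)^-1) id _ _ c1 cvg_id).
Qed.

Lemma compact_sphere : compact (@sphere R n).
Proof.
apply: bounded_closed_compact.
  exists 1; split; first exact: num_real.
  move=> M M1 x /= sx; apply: le_trans (norm_le_enorm x) _.
  by rewrite (sx : enorm x = 1) ltW.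
rewrite (_ : @sphere R n = (@enorm R n) @^-1` [set 1])//.
apply: closed_comp; first by move=> x _; exact: continuous_enorm.
exact: (@accessible_closed_set1 R^o (@hausdorff_accessible _ (@Rhausdorff R))).
Qed.

(** Continuity is required on the whole punctured space, where the homogeneous
   extensions live and difference quotients are taken. *)
Definition sphere_cont (phi : V -> R) := forall y, y != 0 -> {for y, continuous phi}.

Lemma sphere_contP phi : sphere_cont phi <-> seq_cont_on [set y : V | y != 0] phi.
Proof.
split=> [h x u Wx Wu ux|h y y0]; first exact: continuous_seq (h x Wx) ux.
apply: seq_continuous_at => u uy.
pose u' k := if u k == 0 then y else u k.
have near_eq : \forall k \near \oo, u k != 0.
  have nU : nbhs y [set y : V | y != 0] by apply: open_nbhs_nbhs; split => //; exact: open_neq0.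
  exact: uy _ nU.
have u'y : u' k @[k --> \oo] --> y.
  apply: cvg_trans uy; apply: near_eq_cvg; near=> k.
  by rewrite /u' ifN//; near: k.
have h1 := h y u' y0 _ u'y.
have {}h1 : phi (u' k) @[k --> \oo] --> phi y.
  by apply: h1 => k; rewrite /u' /=; case: ifPn.
apply: cvg_trans h1; apply: near_eq_cvg; near=> k.
by rewrite /u' ifN//; near: k.
Unshelve. all: by end_near. Qed.

Lemma sphere_cont_hext phi : sphere_cont phi -> sphere_cont (hext phi).
Proof.
move=> cp y y0; apply: continuous_comp; first exact: continuous_radial.
exact/cp/sphere_neq0/radial_sphere.
Qed.

Lemma sphere_cont_lin a phi psi : sphere_cont phi -> sphere_cont psi ->
  sphere_cont (fun x => a * phi x + psi x).
Proof.
by move=> /sphere_contP h1 /sphere_contP h2; apply/sphere_contP; exact: seq_cont_on_lin.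
Qed.

Lemma sphere_cont_add phi psi : sphere_cont phi -> sphere_cont psi ->
  sphere_cont (fun x => phi x + psi x).
Proof.
move=> h1 h2 y y0; apply: seq_continuous_at => u uy.
by apply: cvgD; [exact: continuous_seq (h1 y y0) uy|exact: continuous_seq (h2 y y0) uy].
Qed.

Lemma sphere_cont_mul phi psi : sphere_cont phi -> sphere_cont psi ->
  sphere_cont (fun x => phi x * psi x).
Proof.
move=> h1 h2 y y0; apply: seq_continuous_at => u uy.
by apply: cvgM; [exact: continuous_seq (h1 y y0) uy|exact: continuous_seq (h2 y y0) uy].
Qed.

Lemma sphere_cont_cst a : sphere_cont (fun=> a).
Proof. by move=> y _; apply: seq_continuous_at => u _; exact: cvg_cst. Qed.

Lemma sphere_cont_Ck k (F : V -> R^o) : Ck [set y : V | y != 0] k F -> sphere_cont F.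
Proof. by move=> cF y y0; exact: Ck_continuous cF y0. Qed.

Lemma sphere_cont_bounded phi : sphere_cont phi ->
  exists2 M : R, 0 <= M & forall x, sphere x -> `|phi x| <= M.
Proof.
move=> cp.
have cw : {within (@sphere R n), continuous (fun x => `|phi x|)}.
  apply: continuous_in_subspaceT => x; rewrite inE => sx.
  apply: seq_continuous_at => u ux; apply: cvg_norm.
  by apply: continuous_seq ux; exact/cp/sphere_neq0.
have [se|/set0P se] := eqVneq (@sphere R n) set0.
  by exists 0 => // x; rewrite se.
have [c _ hc] := compact_EVT_max se compact_sphere cw.
exists `|phi c| => // x sx; apply: hc; exact: mem_set.
Qed.

End SphereGeometry.

(** * Integration over the sphere *)

Section SphereIntegral.
Context {R : realType} {n : nat}.
Notation V := (ambient R n).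
Implicit Types (x y z : V) (a : R) (phi psi : V -> R).

(** The integrand in polar coordinates; it jumps across the unit sphere and has
   no limit at the origin. *)
Definition ballfun phi y : R := if enorm y <= 1 then hext phi y else 0.

(** Quadratic in k, so that the support of a spike shrinks like 1 / k. *)
Definition sharpness (k : nat) : R := k.+1%:R ^+ 2.

(** As a function of the squared radius: vanishes near 0 and for large radii, and
   tends to the indicator function of the punctured ball. *)
Definition cutoff (k : nat) (q : R) : R :=
  step (sharpness k * q - 1) * step (sharpness k * (1 - q) + 1).

Lemma sharpness_ge1 k : 1 <= sharpness k.
Proof. by rewrite /sharpness exprn_ege1// ler1n. Qed.

Lemma sharpness_gt0 k : 0 < sharpness k.
Proof. exact: lt_le_trans ltr01 (sharpness_ge1 k). Qed.

Lemma cutoff_norm k q : `|cutoff k q| <= 1.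
Proof. by rewrite normrM mulr_ile1// step_norm. Qed.

Lemma cutoff_ge0 k q : 0 <= cutoff k q.
Proof. by apply: mulr_ge0; [have /andP[] := step_itv (sharpness k * q - 1)|
  have /andP[] := step_itv (sharpness k * (1 - q) + 1)]. Qed.

Lemma cutoff_near0 k q : q <= (sharpness k)^-1 -> cutoff k q = 0.
Proof.
move=> h; rewrite /cutoff step_le0 ?mul0r// subr_le0.
by rewrite -(ler_pM2l (sharpness_gt0 k)) mulfV// ?gt_eqF ?sharpness_gt0 in h.
Qed.

Lemma cutoff_far k q : 2 <= q -> cutoff k q = 0.
Proof.
move=> h; rewrite /cutoff [X in _ * X]step_le0 ?mulr0//.
have h1 := sharpness_ge1 k; have : sharpness k * (1 - q) <= 1 * (1 - q).
  by rewrite ler_wnM2r//; lra.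
lra.
Qed.

Lemma cutoff_cvg (q : R) : 0 <= q ->
  cutoff k q @[k --> \oo] --> (((0 < q) && (q <= 1))%:R : R).
Proof.
move=> q0; have [->|qn0] := eqVneq q 0.
  rewrite ltxx /= (_ : (fun k => _) = cst 0); first exact: cvg_cst.
  by apply/funext => k; rewrite cutoff_near0// invr_ge0 ltW// sharpness_gt0.
have qp : 0 < q by rewrite lt_def qn0.
rewrite qp /=.
have big (c : R) : 0 < c -> \forall k \near \oo, 2 <= sharpness k * c.
  move=> c0; have d0 : 0 < c / 2 by rewrite divr_gt0.
  have [N _ hN] := near_infty_natSinv_lt (PosNum d0); exists N => // k Nk.
  have := hN k Nk; rewrite /= => h.
  have k0 : (0:R) < k.+1%:R by [].
  have h2 : 2 <= k.+1%:R * c.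
    have : k.+1%:R * k.+1%:R^-1 < k.+1%:R * (c / 2) by rewrite ltr_pM2l.
    rewrite mulfV ?gt_eqF// => h3; lra.
  apply: le_trans h2 _; rewrite /sharpness expr2 -mulrA ler_peMl ?ler1n// mulr_ge0// ltW//.
apply: cvg_near_cst.
have h1 := big q qp.
have [q1|q1] := leP q 1.
  apply: filterS h1 => k h; rewrite /cutoff (@step_ge1 _ (_ - 1)) ?mul1r ?step_ge1//; last lra.
  by rewrite lerDr mulr_ge0// ?subr_ge0// ltW// sharpness_gt0.
have q10 : 0 < q - 1 by rewrite subr_gt0.
have h2 := big _ q10.
apply: filterS h2 => k h; rewrite /cutoff [X in _ * X]step_le0 ?mulr0//.
have -> : sharpness k * (1 - q) = - (sharpness k * (q - 1)) by ring.
lra.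
Qed.

Definition cutfun (k : nat) psi y : R := cutoff k (edot y y) * hext psi y.

Lemma continuous_cutoff k : continuous (cutoff k : R -> R).
Proof.
move=> q; apply: (@seq_continuous_at R R^o) => u uq.
apply: cvgM; apply: (continuous_seq (V := R^o) (@continuous_step R _)).
  by apply: cvgB; [apply: cvgMr|exact: cvg_cst].
by apply: cvgD; [apply: cvgMr; apply: cvgB; [exact: cvg_cst|]|exact: cvg_cst].
Qed.

Lemma edot_seq (u : nat -> V) y : u k @[k --> \oo] --> y ->
  edot (u k) (u k) @[k --> \oo] --> edot y y.
Proof. exact: (continuous_seq (continuous_edot (x := y))). Qed.

Lemma continuous_cutfun k psi : sphere_cont psi -> continuous (cutfun k psi).
Proof.
move=> cp y; apply: seq_continuous_at => u uy; have eu := edot_seq uy.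
have [y0|y0] := eqVneq y 0.
  rewrite /cutfun y0; have e00 : edot (0 : V) 0 = 0 by apply/eqP; rewrite edot_eq0.
  rewrite e00 cutoff_near0 ?mul0r; last by rewrite invr_ge0 ltW// sharpness_gt0.
  apply: cvg_near_cst; rewrite y0 e00 in eu.
  have s0 : 0 < (sharpness k)^-1 by rewrite invr_gt0 sharpness_gt0.
  move/cvgr0Pnorm_lt : eu => /(_ _ s0); apply: filterS => j h.
  by rewrite cutoff_near0 ?mul0r// ltW// (le_lt_trans (ler_norm _) h).
apply: cvgM.
  exact: (continuous_seq (V := R^o) (continuous_cutoff (k := k) (x := edot y y)) eu).
exact: (continuous_seq (sphere_cont_hext cp y0) uy).
Qed.

Lemma cutfun_supp k psi (M : R) : (forall x, sphere x -> `|psi x| <= M) ->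
  bounded_supp 2 M (cutfun k psi).
Proof.
move=> hM y; split.
  rewrite /cutfun normrM; have [y0|y0] := eqVneq y 0.
    rewrite y0 cutoff_near0; last first.
      have -> : edot (0 : V) 0 = 0 by apply/eqP; rewrite edot_eq0.
      by rewrite invr_ge0 ltW// sharpness_gt0.
    rewrite normr0 mul0r.
    have [s|/set0P[s /hM]] := eqVneq (@sphere R n) set0; last exact: le_trans.
    have d0 : (delta_mx 0 0 : V) != 0.
      by apply/eqP => /matrixP /(_ 0 0); rewrite !mxE eqxx /= => /eqP; rewrite oner_eq0.
    by have := radial_sphere d0; rewrite s.
  rewrite -[leRHS]mul1r ler_pM ?cutoff_norm//; exact/hM/radial_sphere.
move=> y2; rewrite /cutfun cutoff_far ?mul0r//.
have h : 2 < enorm y by exact: lt_le_trans y2 (norm_le_enorm y).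
rewrite -enorm_sqr expr2; have : 2 * 2 <= enorm y * enorm y by rewrite ler_pM// ltW.
lra.
Qed.

Lemma cutfun_nice k psi (M : R) : sphere_cont psi -> (forall x, sphere x -> `|psi x| <= M) ->
  nice 2 M (cutfun k psi).
Proof.
by move=> cp hM; apply: continuous_nice => //; [exact: continuous_cutfun|exact: cutfun_supp].
Qed.

(** Tends to the indicator function of the origin, with integral tending to 0:
   the homogeneous extension takes at the origin the value of the function
   there, which has to be matched in a pointwise limit. *)
Definition spike (k : nat) y : R := 1 - step (sharpness k * edot y y).

Lemma spike_nice k : nice k.+1%:R^-1 1 (spike k).
Proof.
apply: continuous_nice => //.
  move=> y; apply: seq_continuous_at => u uy; apply: cvgB; first exact: cvg_cst.
  apply: (continuous_seq (V := R^o) (@continuous_step R _)); apply: cvgMr.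
  exact: edot_seq.
move=> y; split.
  by rewrite /spike; have /andP[h1 h2] := step_itv (sharpness k * edot y y);
    rewrite ger0_norm ?subr_ge0// gerBl.
move=> hy; rewrite /spike step_ge1 ?subrr//.
have h : k.+1%:R^-1 <= enorm y by apply: le_trans (ltW hy) (norm_le_enorm y).
rewrite -enorm_sqr /sharpness -exprMn exprn_ege1//.
by rewrite -ler_pdivrMl// mulr1.
Qed.

Lemma spike_cvg y : spike k y @[k --> \oo] --> ((y == 0)%:R : R).
Proof.
have [->|y0] := eqVneq y 0.
  rewrite (_ : (fun k => _) = cst 1); first exact: cvg_cst.
  apply/funext => k; rewrite /spike.
  have -> : edot (0 : V) 0 = 0 by apply/eqP; rewrite edot_eq0.
  by rewrite mulr0 step_le0// subr0.
apply: cvg_near_cst.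
have q0 : 0 < edot y y by rewrite lt_def edot_eq0 y0 edot_ge0.
have [N _ hN] := near_infty_natSinv_lt (PosNum q0); exists N => // k Nk.
have h := hN k Nk; rewrite /spike step_ge1 ?subrr//.
have k0 : (0:R) < k.+1%:R by [].
have h2 : 1 <= k.+1%:R * edot y y.
  have : k.+1%:R * k.+1%:R^-1 < k.+1%:R * edot y y by rewrite ltr_pM2l.
  by rewrite mulfV ?gt_eqF// => /ltW.
by apply: le_trans h2 _; rewrite /sharpness expr2 -mulrA ler_peMl ?ler1n// mulr_ge0// ltW.
Qed.

Lemma spike_integral_cvg : integral_rV (spike k) @[k --> \oo] --> (0 : R).
Proof.
have b k : `|integral_rV (spike k)| <= 2 ^+ (n.+1 + n.+1) * k.+1%:R^-1.
  have := integral_rV_bound (ltW _) (spike_nice k); rewrite mul1r exprMn => h.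
  apply: le_trans (h _) _; first by rewrite invr_gt0.
  rewrite ler_wpM2l ?exprn_ge0// -[leRHS]expr1 ler_wiXn2l ?invr_ge0//.
  by rewrite invf_le1// ler1n.
apply/cvgr0Pnorm_le => e e0.
have c0 : (0:R) < 2 ^+ (n.+1 + n.+1) by rewrite exprn_gt0.
have d0 : 0 < e / 2 ^+ (n.+1 + n.+1) by rewrite divr_gt0.
have [N _ hN] := near_infty_natSinv_lt (PosNum d0); exists N => // k Nk.
apply: le_trans (b k) _; have /ltW := hN k Nk; rewrite /= ler_pdivlMr//.
by rewrite mulrC.
Qed.

(** Continuous functions approximate the discontinuous integrand pointwise and
   boundedly. The function phi is only known on the sphere, where it agrees with
   the continuous psi. *)
Lemma ballfun_approx phi psi (M : R) : sphere_cont psi -> (forall x, sphere x -> phi x = psi x) ->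
  (forall x, sphere x -> `|psi x| <= M) ->
  nice 2 (M + `|phi 0|) (ballfun phi) /\
  integral_rV (cutfun k psi) @[k --> \oo] --> integral_rV (ballfun phi).
Proof.
move=> cp E hM.
have M0 : 0 <= M by apply: le_trans (cutfun_supp 0 hM 0).1.
have nspike k : nice 2 1 (spike k).
  have [h1 h2] := spike_nice k; split=> // y; split; first exact: (h2 y).1.
  move=> hy; apply: (h2 y).2; apply: le_lt_trans hy.
  by rewrite (@le_trans _ _ 1)// ?invf_le1// ?ler1n.
pose F k y := phi 0 * spike k y + cutfun k psi y.
have nF k : nice 2 (`|phi 0| * 1 + M) (F k).
  by apply: (integral_rV_lin _ _ (nspike k) (cutfun_nice k cp hM)).1.
have IF k : integral_rV (F k) = phi 0 * integral_rV (spike k) + integral_rV (cutfun k psi).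
  by rewrite (integral_rV_lin _ _ (nspike k) (cutfun_nice k cp hM)).2.
have Fcv y : F k y @[k --> \oo] --> ballfun phi y.
  have h1 := cutoff_cvg (edot_ge0 y).
  have h2 : phi 0 * spike k y @[k --> \oo] --> phi 0 * (y == 0)%:R.
    by apply: cvgMr; exact: spike_cvg.
  have h3 : cutoff k (edot y y) * hext psi y @[k --> \oo] -->
      ((0 < edot y y) && (edot y y <= 1))%:R * hext psi y by exact: cvgMl.
  have -> : ballfun phi y = phi 0 * (y == 0)%:R + ((0 < edot y y) && (edot y y <= 1))%:R * hext psi y.
    rewrite /ballfun enorm_le1; have [->|y0] := eqVneq y 0.
      have -> : edot (0 : V) 0 = 0 by apply/eqP; rewrite edot_eq0.
      by rewrite ltxx ler01 mulr1 mul0r addr0 /hext scaler0.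
    rewrite lt_def edot_eq0 y0 edot_ge0 /= mulr0 add0r; case: ifP => _; last by rewrite mul0r.
    by rewrite mul1r !hextE E//; exact: radial_sphere.
  exact: cvgD.
have [|nB cB] := @integral_rV_cvg _ _ 2 (`|phi 0| * 1 + M) F (ballfun phi) _ nF Fcv => //.
split; first by rewrite addrC -[`|phi 0|]mulr1.
have h0 : phi 0 * integral_rV (spike k) @[k --> \oo] --> phi 0 * 0.
  by apply: cvgMr; exact: spike_integral_cvg.
have h : integral_rV (F k) - phi 0 * integral_rV (spike k) @[k --> \oo] -->
    integral_rV (ballfun phi) - phi 0 * 0 by apply: cvgB.
rewrite mulr0 subr0 in h; apply: cvg_trans h; apply: near_eq_cvg; near=> k.
by apply/eqP; rewrite /= subr_eq addrC; apply/eqP; exact: IF.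
Unshelve. all: by end_near. Qed.

Definition vol_cst : R := (2 * 4 ^+ n * n`!%:R) * (n.+1 + n.+1)%:R.

Lemma vol_cst_gt0 : 0 < vol_cst.
Proof. by rewrite /vol_cst !mulr_gt0// ?exprn_gt0// ltr0n ?fact_gt0. Qed.

Lemma integral_dV0E phi : integral_dV0 phi = vol_cst * integral_rV (ballfun phi).
Proof. by rewrite /integral_dV0 /round_integral mulrA. Qed.

Lemma integral_dV0_cvg phi psi : sphere_cont psi -> (forall x, sphere x -> phi x = psi x) ->
  vol_cst * integral_rV (cutfun k psi) @[k --> \oo] --> integral_dV0 phi.
Proof.
move=> cp E; have [M _ hM] := sphere_cont_bounded cp.
by rewrite integral_dV0E; apply: cvgMr; exact: (ballfun_approx cp E hM).2.
Qed.

Lemma integral_dV0_eq phi psi : sphere_cont psi -> (forall x, sphere x -> phi x = psi x) ->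
  integral_dV0 phi = integral_dV0 psi.
Proof.
move=> cp E; have h1 := integral_dV0_cvg cp E.
have h2 := integral_dV0_cvg cp (fun x _ => erefl (psi x)).
by have := cvg_unique _ h1 h2; apply.
Qed.

Lemma integral_dV0_lin a phi psi : sphere_cont phi -> sphere_cont psi ->
  integral_dV0 (fun x => a * phi x + psi x) = a * integral_dV0 phi + integral_dV0 psi.
Proof.
move=> c1 c2; have [M1 _ h1] := sphere_cont_bounded c1.
have [M2 _ h2] := sphere_cont_bounded c2.
have [n1 _] := ballfun_approx c1 (fun x _ => erefl) h1.
have [n2 _] := ballfun_approx c2 (fun x _ => erefl) h2.
rewrite !integral_dV0E.
have -> : ballfun (fun x => a * phi x + psi x) = (fun y => a * ballfun phi y + ballfun psi y).
  by apply/funext => y; rewrite /ballfun; case: ifP => _ //; rewrite mulr0 addr0.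
by rewrite (integral_rV_lin a _ n1 n2).2//; ring.
Qed.

Lemma integral_dV0_ge0 phi : sphere_cont phi -> (forall x, sphere x -> 0 <= phi x) ->
  0 <= integral_dV0 phi.
Proof.
move=> cp p0; have h := integral_dV0_cvg cp (fun x _ => erefl (phi x)).
rewrite -(cvg_lim _ h)//; apply: limr_ge; first by apply/cvg_ex; eexists; exact: h.
apply: nearW => k; apply: mulr_ge0; first exact: ltW vol_cst_gt0.
apply: integral_rV_ge0 => y; rewrite /cutfun.
have [->|y0] := eqVneq y 0.
  have -> : edot (0 : V) 0 = 0 by apply/eqP; rewrite edot_eq0.
  by rewrite cutoff_near0 ?mul0r// invr_ge0 ltW// sharpness_gt0.
by rewrite mulr_ge0 ?cutoff_ge0//; exact/p0/radial_sphere.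
Qed.

(** A representative whose homogeneous extension vanishes at the origin, so that
   pointwise convergence on the sphere extends to the whole ball. *)
Definition off0 phi y : R := if y == 0 then 0 else phi y.

Lemma off0_eq phi x : sphere x -> off0 phi x = phi x.
Proof. by move=> /sphere_neq0 x0; rewrite /off0 ifN. Qed.

Lemma integral_dV0_dct (phi_ : nat -> V -> R) phi (M : R) :
  (forall k, sphere_cont (phi_ k)) -> sphere_cont phi ->
  (forall k x, sphere x -> `|phi_ k x| <= M) ->
  (forall x, sphere x -> phi_ k x @[k --> \oo] --> phi x) ->
  integral_dV0 (phi_ k) @[k --> \oo] --> integral_dV0 phi.
Proof.
move=> c_ c hM hcv.
rewrite -(integral_dV0_eq c (@off0_eq phi)).
have nk k : nice 2 M (ballfun (off0 (phi_ k))).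
  have [] := @ballfun_approx (off0 (phi_ k)) (phi_ k) M (c_ k) (@off0_eq _) (hM k).
  by rewrite /off0 eqxx normr0 addr0.
have cvk y : ballfun (off0 (phi_ k)) y @[k --> \oo] --> ballfun (off0 phi) y.
  rewrite /ballfun; case: ifP => _; last exact: cvg_cst.
  rewrite !hextE; have [->|y0] := eqVneq y 0.
    rewrite /radial scaler0 (_ : (fun k => _) = cst 0); last first.
      by apply/funext => k; rewrite hextE /radial scaler0 /off0 eqxx.
    by rewrite /off0 eqxx; exact: cvg_cst.
  have sy := radial_sphere y0; rewrite off0_eq//.
  rewrite (_ : (fun k => _) = (fun k => phi_ k (radial y))); first exact: hcv.
  by apply/funext => k; rewrite hextE off0_eq.
have [|_ h] := @integral_rV_cvg _ _ 2 M _ _ _ nk cvk => //.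
rewrite integral_dV0E.
have : vol_cst * integral_rV (ballfun (off0 (phi_ k))) @[k --> \oo] -->
   vol_cst * integral_rV (ballfun (off0 phi)) by apply: cvgMr.
apply: cvg_trans; apply: near_eq_cvg; near=> k.
by rewrite -(integral_dV0_eq (c_ k) (@off0_eq _)) integral_dV0E.
Unshelve. all: by end_near. Qed.

(** A positive value persists on a box inside the cone over a neighbourhood of the
   point, and the integral over that box is positive. *)
Lemma integral_dV0_eq0 phi : sphere_cont phi -> (forall x, sphere x -> 0 <= phi x) ->
  integral_dV0 phi = 0 -> forall x, sphere x -> phi x = 0.
Proof.
move=> cp p0 I0 x0 sx0; apply/eqP; rewrite eq_le p0// andbT leNgt; apply/negP => c0.
pose F := ballfun (off0 phi).
have [M _ hM] := sphere_cont_bounded cp.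
have [nF _] := ballfun_approx cp (@off0_eq phi) hM.
have F0 y : 0 <= F y.
  rewrite /F /ballfun; case: ifP => // _; rewrite hextE.
  have [->|y0] := eqVneq y 0; first by rewrite /radial scaler0 /off0 eqxx.
  by rewrite off0_eq ?p0//; exact: radial_sphere.
pose y0 : V := 2^-1 *: x0.
have h2 : (0 : R) < 2^-1 by rewrite invr_gt0.
have y00 : y0 != 0 by rewrite /y0 scaler_eq0 negb_or gt_eqF//= sphere_neq0.
have hy0 : hext phi y0 = phi x0 by rewrite hextE radialZ// radial_id.
have e0 : enorm y0 = 2^-1 by rewrite enormZ (sx0 : enorm x0 = 1) mulr1 gtr0_norm.
have ch : {for y0, continuous (hext phi)} by exact: sphere_cont_hext.
have c2 : 0 < phi x0 / 2 by rewrite divr_gt0.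
have [d1 d10 hd1] := continuous_radius openT ch ch (x := y0) I c2.
have ce : {for y0, continuous (@enorm R n)} by exact: continuous_enorm.
have [d2 d20 hd2] := continuous_radius openT ce ce (x := y0) I h2.
pose d := Num.min d1 d2 / 2.
have d0 : 0 < d by rewrite divr_gt0// lt_min d10.
have m0 : 0 < Num.min d1 d2 by rewrite lt_min d10.
have dm : d < Num.min d1 d2.
  by rewrite /d; move: m0; move: (Num.min d1 d2) => r r0; rewrite ltr_pdivrMr// ltr_pMr// ltr1n.
have := @integral_rV_box _ _ 2 (M + `|off0 phi 0|) (phi x0 / 2) F
  (fun i => y0 0 i - d) (fun i => y0 0 i + d) _ nF F0 (ltW c2) _ _.
have -> : integral_rV F = 0.
  have := I0; rewrite -(integral_dV0_eq cp (@off0_eq phi)) integral_dV0E.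
  by move/eqP; rewrite mulf_eq0 gt_eqF ?vol_cst_gt0//= => /eqP.
move=> H; have : phi x0 / 2 * \prod_i (y0 0 i + d - (y0 0 i - d)) <= 0.
  apply: H => //; first by move=> i; lra.
  move=> y hy; have ny : `|y0 - y| <= d.
    move: hy; move: (y0) => z hy; apply: norm_le_coord; first exact: ltW.
    by move=> i; rewrite !mxE distrC ler_distl; exact: hy.
  have {}ny := le_lt_trans ny dm; move: ny; rewrite lt_min => /andP[n1 n2].
  have [_ a1 _] := hd1 y n1; have [_ a2 _] := hd2 y n2.
  rewrite hy0 in a1; rewrite e0 in a2.
  have a3 : enorm y <= 1 by move: a2; rewrite ltr_norml => /andP[]; lra.
  rewrite /F /ballfun a3.
  have yn0 : y != 0 by rewrite -enorm_gt0; move: a2; rewrite ltr_norml => /andP[]; lra.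
  rewrite hextE off0_eq; last exact: radial_sphere.
  by rewrite hextE in a1; move: a1; rewrite ltr_norml => /andP[]; lra.
apply/negP; rewrite -ltNge mulr_gt0// prodr_gt0// => i _; lra.
Qed.

End SphereIntegral.

(** * Linear vector fields and integration by parts on the sphere *)

Section Fields.
Context {R : realType} {n : nat}.
Notation V := (ambient R n).
Notation W := [set y : V | y != 0].
Notation d := (n.+1 + n.+1)%N.
Implicit Types (x y z v : V) (a c : R) (A : 'M[R]_d).

Lemma derive_coords (F : V -> R^o) y v : differentiable F y ->
  'D_v F y = \sum_j v 0 j * 'D_(delta_mx 0 j) F y.
Proof.
move=> dF; rewrite deriveE// {1}(row_sum_delta v) linear_sum.
by apply: eq_bigr => j _; rewrite linearZ -deriveE.
Qed.

Lemma differentiable_coord_mul A j y : differentiable (fun y : V => (y *m A) 0 j : R^o) y.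
Proof.
have -> : (fun y : V => (y *m A) 0 j : R^o) =
   \sum_i (fun y : V => y 0 i * A i j : R^o).
  by apply/funext => z; rewrite fct_sumE mxE.
apply: differentiable_sum => i; apply: differentiableM.
  exact: differentiable_coord.
exact: differentiable_cst.
Qed.

Lemma derive_coord_mul A j y v : 'D_v (fun y : V => (y *m A) 0 j : R^o) y = (v *m A) 0 j.
Proof.
rewrite /derive (_ : (fun h : R => _) = (fun h : R => h^-1 * (h * (v *m A) 0 j))); last first.
  apply/funext => h; rewrite /= mulmxDl -scalemxAl; congr (_ * _).
  by rewrite [X in X - _]mxE [X in X + _ - _]mxE addrK.
move: ((v *m A) 0 j) => c; apply: cvg_lim => //.
have cv : (fun h : R => h^-1 * (h * c)) @ (0 : R)^' --> (c : R).
  apply: (@cvg_trans _ ((fun=> c) @ (0 : R)^')); last exact: cvg_cst.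
  by apply: near_eq_cvg; near=> h; rewrite mulKf//; near: h; exact: nbhs_dnbhs_neq.
exact: cv.
Unshelve. all: by end_near. Qed.

Lemma Ck_coord_mul (U : set V) (Uo : open U) k A j : Ck U k (fun y : V => (y *m A) 0 j : R^o).
Proof.
case: k => [|k]; first by split=> // x _; exact: differentiable_coord_mul.
split=> [x _|v]; first exact: differentiable_coord_mul.
apply: (Ck_eq Uo) (Ck_cst _ k ((v *m A) 0 j)) => y _.
by rewrite derive_coord_mul.
Qed.

(** The derivative along the linear vector field y A. It commutes with dilations,
   and for skew A it is tangent to all spheres. *)
Definition Xf A (F : V -> R^o) y : R := 'D_(y *m A) F y.

Lemma Ck_Xf (U : set V) (Uo : open U) k A (F : V -> R^o) : Ck U k.+1 F -> Ck U k (Xf A F).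
Proof.
move=> cF.
have h : Ck U k (fun y => \sum_j (y *m A) 0 j * 'D_(delta_mx 0 j) F y : R^o).
  apply: (Ck_sum Uo) => j; apply: (Ck_mul Uo); first exact: Ck_coord_mul.
  exact: Ck_derive cF.
apply: (Ck_eq Uo) h => y Uy; rewrite /Xf derive_coords//; exact: Ck_diff cF Uy.
Qed.

(** Joins a neighbourhood of the origin, on which a radial cutoff vanishes, to the
   punctured space. *)
Lemma Ck_glue (U U' : set V) k (F : V -> R^o) : Ck U k F -> Ck U' k F -> Ck (U `|` U') k F.
Proof.
elim: k F => [|k IH] F [h1 h2] [h3 h4]; first by split=> // x [/h1|/h3].
split=> [x [/h1|/h3] //|v].
by apply: IH; [exact: h2|exact: h4].
Qed.

Definition hom0 (F : V -> R) := forall c y, 0 < c -> y != 0 -> F (c *: y) = F y.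

Lemma hom0_Xf A (F : V -> R^o) : (forall y, y != 0 -> differentiable F y) ->
  hom0 F -> hom0 (Xf A F).
Proof.
move=> dF hF c y c0 y0; rewrite /Xf -scalemxAl.
have cy0 : c *: y != 0 by rewrite scaler_eq0 negb_or gt_eqF.
rewrite -(derive_affine (L := fun z : V => c *: z) (l := fun z : V => c *: z)).
- by apply: (derive_eq_on (U := W) open_neq0) => // z z0 /=; exact: hF.
- exact: dF.
- by move=> h; rewrite scalerDr !scalerA mulrC.
Qed.

Lemma hom0_hext (phi : V -> R) : hom0 (hext phi).
Proof. by move=> c y c0 y0; rewrite !hextE radialZ. Qed.

Lemma hom0_hextE (F : V -> R) y : hom0 F -> y != 0 -> hext F y = F y.
Proof.
by move=> hF y0; rewrite hextE hF// invr_gt0 enorm_gt0.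
Qed.

Lemma skew_diag A j : A^T = - A -> A j j = 0.
Proof.
move=> hA; have : A^T j j = (- A) j j by rewrite hA.
rewrite !mxE => /eqP; rewrite -addr_eq0 -mulr2n mulrn_eq0 /= => /eqP //.
Qed.

Lemma edot_skew A y : A^T = - A -> edot y (y *m A) = 0.
Proof.
move=> hA; have E z w : edot z w = (z *m w^T) 0 0.
  by rewrite mxE; apply: eq_bigr => j _; rewrite mxE.
have : edot y (y *m A) = - edot y (y *m A).
  by rewrite {1}E trmx_mul hA mulNmx mulmxN mulmxA [LHS]mxE -E edotC.
by move/eqP; rewrite -addr_eq0 -mulr2n mulrn_eq0 /= => /eqP.
Qed.

Lemma bounded_supp_exists (K : R) (F : V -> R) : continuous F ->
  (forall y, K < `|y| -> F y = 0) -> exists M : R, bounded_supp K M F.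
Proof.
move=> cF h.
pose B := [set y : V | `|y| <= K].
have cB : compact B.
  apply: bounded_closed_compact.
    by exists K; split; [exact: num_real|move=> M KM y /= yK; rewrite (le_trans yK)// ltW].
  rewrite (_ : B = (fun y : V => `|y|) @^-1` [set r | r <= K])//.
  by apply: closed_comp; [move=> y _; exact: norm_continuous|exact: closed_le].
have [B0|/set0P B0] := eqVneq B set0.
  exists 0 => y; have Ky : K < `|y|.
    by rewrite ltNge; apply/negP => yK; have : B y by []; rewrite B0.
  by rewrite h// normr0.
have cw : {within B, continuous (fun y => `|F y|)}.
  apply: continuous_subspaceT => y; apply: seq_continuous_at => u uy.
  by apply: cvg_norm; exact: continuous_seq (cF y) uy.
have [c _ hc] := compact_EVT_max B0 cB cw.
exists `|F c| => y; split; last exact: h.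
have [/h ->|yK] := ltP K `|y|; first by rewrite normr0.
by apply: hc; exact: mem_set.
Qed.

Lemma integral_rV_sum0 (I : Type) (r : seq I) (G : I -> V -> R) (K : R) : 0 <= K ->
  (forall i, continuous (G i)) -> (forall i y, K < `|y| -> G i y = 0) ->
  (forall i, integral_rV (G i) = 0) ->
  (exists M : R, nice K M (fun y => \sum_(i <- r) G i y)) /\
  integral_rV (fun y => \sum_(i <- r) G i y) = 0.
Proof.
move=> K0 cG sG iG; elim: r => [|i r [[M nM] IH]].
  have -> : (fun y => \sum_(i <- [::]) G i y) = (fun=> 0).
    by apply/funext => y; rewrite big_nil.
  split; last exact: integral_rV0.
  exists 0; apply: continuous_nice => // [y|y].
    by apply: seq_continuous_at => u _; exact: cvg_cst.
  by rewrite normr0.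
have [M' bG] := bounded_supp_exists (cG i) (sG i).
have nG := continuous_nice K0 (cG i) bG.
have -> : (fun y => \sum_(i <- i :: r) G i y) = (fun y => 1 * G i y + \sum_(i <- r) G i y).
  by apply/funext => y; rewrite big_cons mul1r.
have [n1 e1] := integral_rV_lin 1 K0 nG nM.
by split; [exists (`|1| * M' + M)|rewrite e1 iG IH; ring].
Qed.

Lemma is_derive_coord_line (F : V -> R^o) y j : differentiable F y ->
  is_derive (0 : R) (1 : R) ((fun s => F (y + s *: delta_mx 0 j)) : R -> R^o)
    ('D_(delta_mx 0 j) F y).
Proof.
move=> dF; have := @is_derive_line _ _ F y (delta_mx 0 j) 0.
by rewrite scale0r addr0; exact.
Qed.

(** A skew linear field is divergence free: the j-th coordinate of y A does not
   involve y_j, so each term of the sum is a partial derivative. *)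
Lemma integral_rV_Xf A (H : V -> R^o) (K : R) : 0 <= K -> A^T = - A ->
  Ck setT 1 H -> (forall y, K < `|y| -> H y = 0) -> integral_rV (Xf A H) = 0.
Proof.
move=> K0 hA cH sH.
pose G j y : R^o := (y *m A) 0 j * H y.
have dH y : differentiable H y by exact: Ck_diff cH (I : setT y).
have cG j : Ck setT 1 (G j) by apply: (Ck_mul openT) => //; exact: Ck_coord_mul openT 1%N A j.
have dG j y : differentiable (G j) y by exact: Ck_diff (cG j) (I : setT y).
have dGE j y : 'D_(delta_mx 0 j) (G j) y = (y *m A) 0 j * 'D_(delta_mx 0 j) H y.
  rewrite /G derive_mul//; last exact: differentiable_coord_mul.
  rewrite derive_coord_mul.
  have -> : ((delta_mx 0 j : V) *m A) 0 j = 0 by rewrite -rowE mxE skew_diag.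
  by rewrite mulr0 addr0.
have E : Xf A H = (fun y => \sum_j 'D_(delta_mx 0 j) (G j) y).
  by apply/funext => y; rewrite /Xf derive_coords//; apply: eq_bigr => j _; rewrite dGE.
have sD j y : K < `|y| -> 'D_(delta_mx 0 j) (G j) y = 0.
  move=> Ky; rewrite dGE.
  have -> : 'D_(delta_mx 0 j) H y = 'D_(delta_mx 0 j) (cst 0 : V -> R^o) y.
    have oK : open [set y : V | K < `|y|].
      rewrite (_ : [set _ | _] = (fun y : V => `|y|) @^-1` [set r | K < r])//.
      by apply: open_comp; [move=> ? _; exact: norm_continuous|exact: open_gt].
    by apply: (derive_eq_on oK) => // z /= Kz; exact: sH.
  by rewrite derive_cst mulr0.
rewrite E; apply: (integral_rV_sum0 _ K0 _ sD _).2.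
  by move=> j y; exact: (Ck_continuous (Ck_derive _ (cG j)) (x := y) I).
move=> j.
have sG y : K < `|y| -> G j y = 0 by move=> Ky; rewrite /G sH// mulr0.
have cGj : continuous (G j : V -> R) by move=> y; exact: (Ck_continuous (cG j) (x := y) I).
have cDj : continuous ('D_(delta_mx 0 j) (G j) : V -> R).
  by move=> y; exact: (Ck_continuous (Ck_derive _ (cG j)) (x := y) I).
have [M bM] := bounded_supp_exists cGj sG.
have [M' bM'] := bounded_supp_exists cDj (sD j).
apply: (@integral_rV_derive _ _ K M M' (G j) _ j) => //.
by move=> y; exact: is_derive_coord_line.
Qed.

Lemma derive_edot y v : 'D_v (fun y : V => edot y y : R^o) y = 2 * edot v y.
Proof.
have -> : (fun y : V => edot y y : R^o) = (fun y => \sum_j y 0 j * y 0 j : R^o) by [].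
have dc j : differentiable (fun y : V => y 0 j : R^o) y by exact: differentiable_coord.
have Dc j : 'D_v (fun y : V => y 0 j : R^o) y = v 0 j.
  have := derive_coord_mul 1%:M j y v; rewrite mulmx1 => <-; congr ('D_v _ y).
  by apply/funext => z; rewrite mulmx1.
rewrite derive_sum => [|j]; last by apply: differentiableM.
by rewrite /edot mulr_sumr; apply: eq_bigr => j _; rewrite derive_mul// Dc; ring.
Qed.

Lemma Ck_edot (U : set V) (Uo : open U) k : Ck U k (fun y : V => edot y y : R^o).
Proof.
have cc j : Ck U k (fun y : V => y 0 j : R^o).
  apply: (Ck_eq Uo) (Ck_coord_mul Uo k 1%:M j) => y _; by rewrite mulmx1.
exact: (Ck_sum Uo (F := fun j y => y 0 j * y 0 j) _ (fun j => Ck_mul Uo (cc j) (cc j))).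
Qed.

Lemma Ck_cutoff k : Ck [set: R^o] 2 (cutoff k : R^o -> R^o).
Proof.
have cid : Ck [set: R^o] 2 (fun s : R^o => s).
  split=> // v; apply: (Ck_eq openT) (Ck_cst _ 1 v) => s _.
  by have [_ ->] := is_derive_id s v.
have aff (b c : R) : Ck [set: R^o] 2 (fun s : R^o => step (b * s + c) : R^o).
  have ca := Ck_add openT (Ck_scale openT b cid) (Ck_cst _ 2 c).
  exact: (Ck_comp1 (I := setT) openT Ck_step (fun _ _ => I) ca).
apply: (Ck_eq openT) (Ck_mul openT (aff (sharpness k) (- 1)) (aff (- sharpness k) (sharpness k + 1))) => s _.
by rewrite /cutoff; congr (step _ * step _); ring.
Qed.

(** A radial cutoff is constant along a field tangent to the spheres, so that the
   vanishing of the integral over the whole space descends to the sphere. *)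
Lemma integral_dV0_Xf A (F : V -> R^o) : A^T = - A -> Ck W 1 F -> hom0 F ->
  integral_dV0 (Xf A F) = 0.
Proof.
move=> hA cF hF.
have cX : sphere_cont (Xf A F) by apply: (sphere_cont_Ck (k := 0)); apply: Ck_Xf open_neq0 _ _ _ cF.
have h := integral_dV0_cvg cX (fun x _ => erefl (Xf A F x)).
rewrite -(cvg_lim _ h)// (_ : (fun k => _) = cst 0) ?lim_cst//.
apply/funext => k; apply/eqP; rewrite mulf_eq0; apply/orP; right; apply/eqP.
pose H y : R^o := cutoff k (edot y y) * F y.
have cH1 : Ck W 1 H.
  have c1 := Ck_comp1 (I := setT) open_neq0 (Ck_S (Ck_cutoff k)) (fun _ _ => I)
    (Ck_edot open_neq0 1).
  exact: Ck_mul open_neq0 _ _ _ c1 cF.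
pose O := [set y : V | edot y y < (sharpness k)^-1].
have oO : open O.
  rewrite (_ : O = (fun y : V => edot y y) @^-1` [set r | r < (sharpness k)^-1])//.
  by apply: open_comp; [move=> ? _; exact: continuous_edot|exact: open_lt].
have cH2 : Ck O 1 H.
  apply: (Ck_eq oO) (Ck_cst _ 1 0) => y Oy.
  by rewrite /H cutoff_near0 ?mul0r// ltW.
have WO : W `|` O = setT.
  apply/seteqP; split=> // y _; have [->|y0] := eqVneq y 0; [right|by left].
  rewrite /O /=; have -> : edot (0 : V) 0 = 0 by apply/eqP; rewrite edot_eq0.
  by rewrite invr_gt0 sharpness_gt0.
have cH : Ck setT 1 H by rewrite -WO; exact: Ck_glue.
have sH y : 2 < `|y| -> H y = 0.
  move=> y2; rewrite /H cutoff_far ?mul0r//.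
  have hy : 2 < enorm y by exact: lt_le_trans y2 (norm_le_enorm y).
  rewrite -enorm_sqr expr2; have : 2 * 2 <= enorm y * enorm y by rewrite ler_pM// ltW.
  lra.
rewrite -(integral_rV_Xf _ hA cH sH)//; congr integral_rV; apply/funext => y.
rewrite /cutfun; have [->|y0] := eqVneq y 0.
  rewrite cutoff_near0; last first.
    have -> : edot (0 : V) 0 = 0 by apply/eqP; rewrite edot_eq0.
    by rewrite invr_ge0 ltW// sharpness_gt0.
  by rewrite mul0r /Xf mul0mx derive0.
rewrite hom0_hextE//; last first.
  by apply: hom0_Xf hF => z z0; exact: Ck_diff cF z0.
have dF : differentiable F y by exact: Ck_diff cF y0.
have cc := Ck_comp1 (I := setT) openT (Ck_S (Ck_cutoff k)) (fun _ _ => I) (Ck_edot openT 1).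
have dc : differentiable ((cutoff k : R^o -> R^o) \o (fun y : V => edot y y : R^o)) y.
  exact: Ck_diff cc I.
rewrite /Xf /H (derive_mul _ dc dF) /=.
rewrite (derive_comp1 (F := fun y : V => edot y y : R^o) (psi := cutoff k : R^o -> R^o)); last 2 first.
- exact: Ck_diff (Ck_edot openT 0) I.
- exact: Ck_diff (Ck_cutoff k) I.
by rewrite derive_edot edotC edot_skew// mulr0 mulr0 mulr0 addr0.
Qed.

End Fields.

(** * Fields on space-time *)

Section TimeFields.
Context {R : realType} {n : nat}.
Notation V := (ambient R n).
Notation TV := (R^o * ambient R n)%type.
Notation W := [set y : V | y != 0].
Notation d := (n.+1 + n.+1)%N.
Implicit Types (x y z v : V) (a c t : R) (A : 'M[R]_d) (p : TV) (H K : TV -> R^o).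

(** Only positive times: everything takes place in an open set. *)
Definition spacetime : set TV := [set p | 0 < p.1 /\ p.2 != 0].

Lemma differentiable_snd p : differentiable (snd : TV -> V) p.
Proof.
have sl : linear (snd : TV -> V) by move=> a [x1 x2] [y1 y2].
pose m := GRing.isLinear.Build _ _ _ _ _ sl.
pose f : {linear TV -> V} := HB.pack (snd : TV -> V) m.
have -> : (snd : TV -> V) = f by [].
by apply: linear_differentiable => q; exact: cvg_snd.
Qed.

Lemma open_spacetime : open spacetime.
Proof.
rewrite (_ : spacetime = (fst @^-1` [set s : R | 0 < s]) `&` (snd @^-1` W)); last by [].
apply: openI; apply: open_comp.
- by move=> p _; exact: cvg_fst.
- exact: open_gt.
- by move=> p _; exact: cvg_snd.
- exact: open_neq0.
Qed.

Notation oS := open_spacetime.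

Definition homT H := forall p c, spacetime p -> 0 < c -> H (p.1, c *: p.2) = H p.

(** Smooth fields, homogeneous of degree 0 in the space variable, like the
   extensions that define the calculus on the sphere. *)
Definition sfld H := (forall k, Ck spacetime k H) /\ homT H.

Lemma sfld_diff H p : sfld H -> spacetime p -> differentiable H p.
Proof. by move=> -[h _] sp; exact: Ck_diff (h 0%N) sp. Qed.

Lemma sfld_cst c : sfld (fun=> c).
Proof. by split=> // k; exact: Ck_cst. Qed.

Lemma sfld_add H K : sfld H -> sfld K -> sfld (fun p => H p + K p).
Proof.
move=> [h1 h2] [k1 k2]; split=> [k|p c sp c0]; first exact: (Ck_add oS).
by rewrite h2// k2.
Qed.

Lemma sfld_mul H K : sfld H -> sfld K -> sfld (fun p => H p * K p).
Proof.
move=> [h1 h2] [k1 k2]; split=> [k|p c sp c0]; first exact: (Ck_mul oS).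
by rewrite h2// k2.
Qed.

Lemma sfld_scale c H : sfld H -> sfld (fun p => c * H p).
Proof. by move=> h; apply: sfld_mul h; exact: sfld_cst. Qed.

Lemma sfld_sum (I : Type) (r : seq I) (H : I -> TV -> R^o) :
  (forall i, sfld (H i)) -> sfld (fun p => \sum_(i <- r) H i p).
Proof.
move=> h; split=> [k|p c sp c0].
  by apply: (Ck_sum oS) => i; exact: (h i).1.
by apply: eq_bigr => i _; exact: (h i).2.
Qed.

Lemma sfld_powR a H : sfld H -> (forall p, spacetime p -> 0 < H p) ->
  sfld (fun p => H p `^ a).
Proof.
move=> [h1 h2] hp; split=> [k|p c sp c0]; last by rewrite h2.
exact: (Ck_comp1 (I := [set x : R^o | 0 < x]) oS (Ck_powR k a) hp (h1 k)).
Qed.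

Definition dT H p : R^o := 'D_((1, 0) : TV) H p.
Definition XT A H p : R^o := 'D_((0, p.2 *m A) : TV) H p.

Lemma derive_homT H p (s : R) v c : sfld H -> spacetime p -> 0 < c ->
  'D_((s, c *: v) : TV) H (p.1, c *: p.2) = 'D_((s, v) : TV) H p.
Proof.
move=> sH sp c0.
have scp : spacetime (p.1, c *: p.2).
  by split; [exact: sp.1|rewrite /= scaler_eq0 negb_or gt_eqF//=; exact: sp.2].
pose L (q : TV) : TV := (q.1, c *: q.2).
rewrite -[(p.1, _)]/(L p) -[((s, c *: v) : TV)]/(L (s, v)).
rewrite -(derive_affine (L := L) (l := L)).
- by apply: (derive_eq_on oS) => // q sq; rewrite /= sH.2.
- exact: sfld_diff sH scp.
- by move=> h; apply: injective_projections => //=; rewrite scalerDr !scalerA mulrC.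
Qed.

Lemma sfld_dT H : sfld H -> sfld (dT H).
Proof.
move=> sH; split=> [k|p c sp c0]; first exact: Ck_derive (sH.1 k.+1).
by rewrite /dT -(derive_homT 1 0 sH sp c0) scaler0.
Qed.

Lemma Ck_snd (F : V -> R^o) k : Ck W k F -> Ck spacetime k (fun p => F p.2).
Proof.
apply: (@Ck_affine _ _ _ W spacetime oS snd snd) => // [|p []//].
exact: differentiable_snd.
Qed.

Lemma sfld_snd (F : V -> R^o) : (forall k, Ck W k F) -> hom0 F -> sfld (fun p => F p.2).
Proof. by move=> cF hF; split=> [k|p c [_ p0] c0]; [exact: Ck_snd|exact: hF]. Qed.

Lemma XT_coords A H p : differentiable H p ->
  XT A H p = \sum_j (p.2 *m A) 0 j * 'D_((0, delta_mx 0 j) : TV) H p.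
Proof.
move=> dH; rewrite /XT deriveE// {1}(row_sum_delta (p.2 *m A)).
have -> : ((0, \sum_j (p.2 *m A) 0 j *: delta_mx 0 j) : TV) =
   \sum_j (p.2 *m A) 0 j *: ((0, delta_mx 0 j) : TV).
  have E (r : seq 'I_d) : \sum_(j <- r) (p.2 *m A) 0 j *: ((0, delta_mx 0 j) : TV) =
     (0, \sum_(j <- r) (p.2 *m A) 0 j *: delta_mx 0 j).
    elim: r => [|j r IH]; first by rewrite !big_nil.
    by rewrite !big_cons IH; congr pair; rewrite /= scaler0 addr0.
  by rewrite E.
by rewrite linear_sum; apply: eq_bigr => j _; rewrite linearZ -deriveE.
Qed.

Lemma Ck_coordT k A j : Ck spacetime k (fun p : TV => (p.2 *m A) 0 j : R^o).
Proof. exact: (Ck_snd (Ck_coord_mul open_neq0 k A j)). Qed.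

Lemma sfld_XT A H : sfld H -> sfld (XT A H).
Proof.
move=> sH; split=> [k|p c sp c0]; last first.
  by rewrite /XT /= -scalemxAl; exact: derive_homT.
have h : Ck spacetime k (fun p => \sum_j (p.2 *m A) 0 j * 'D_((0, delta_mx 0 j) : TV) H p : R^o).
  apply: (Ck_sum oS) => j.
  exact: (Ck_mul oS (Ck_coordT k A j) (Ck_derive _ (sH.1 k.+1))).
apply: (Ck_eq oS) h => p sp; rewrite XT_coords//; exact: sfld_diff sH sp.
Qed.

Lemma dT_coord A j p : dT (fun p : TV => (p.2 *m A) 0 j : R^o) p = 0.
Proof.
rewrite /dT (derive_affine (L := snd : TV -> V) (l := snd) (F := fun y : V => (y *m A) 0 j : R^o))//.
  by rewrite derive_coord_mul mul0mx mxE.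
exact: differentiable_coord_mul.
Qed.

(** Mixed partial derivatives commute, and the coefficients of the field do not
   depend on time. *)
Lemma dT_XT A H p : sfld H -> spacetime p -> dT (XT A H) p = XT A (dT H) p.
Proof.
move=> sH sp.
pose G j (q : TV) : R^o := 'D_((0, delta_mx 0 j) : TV) H q.
have dG j : differentiable (G j) p by exact: Ck_diff (Ck_derive _ (sH.1 1%N)) sp.
have dc j : differentiable (fun p : TV => (p.2 *m A) 0 j : R^o) p.
  exact: Ck_diff (Ck_coordT 0 A j) sp.
rewrite XT_coords; last exact: sfld_diff (sfld_dT sH) sp.
have -> : dT (XT A H) p = dT (fun p => \sum_j (p.2 *m A) 0 j * G j p : R^o) p.
  apply: (derive_eq_on oS) sp => q sq; rewrite XT_coords//; exact: sfld_diff sH sq.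
rewrite /dT derive_sum => [|j]; last exact: differentiableM.
apply: eq_bigr => j _; rewrite derive_mul//.
have aux (b c e g f : R) : c = e -> f = 0 -> b * c + g * f = b * e.
  by move=> -> ->; rewrite mulr0 addr0.
apply: aux; last exact: dT_coord.
exact: (Schwarz oS _ _ (sH.1 2%N) sp).
Qed.

Section Rules.
Variables (H K : TV -> R^o).
Hypotheses (sH : sfld H) (sK : sfld K).
Variables (p : TV).
Hypothesis sp : spacetime p.

Lemma dT_add : dT (fun p => H p + K p) p = dT H p + dT K p.
Proof. by rewrite /dT derive_add//; exact: sfld_diff sp. Qed.
Lemma dT_mul : dT (fun p => H p * K p) p = H p * dT K p + K p * dT H p.
Proof. by rewrite /dT derive_mul//; exact: sfld_diff sp. Qed.
Lemma dT_scale c : dT (fun p => c * H p) p = c * dT H p.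
Proof. by rewrite /dT derive_scale//; exact: sfld_diff sp. Qed.
Lemma XT_add A : XT A (fun p => H p + K p) p = XT A H p + XT A K p.
Proof. by rewrite /XT derive_add//; exact: sfld_diff sp. Qed.
Lemma XT_mul A : XT A (fun p => H p * K p) p = H p * XT A K p + K p * XT A H p.
Proof. by rewrite /XT derive_mul//; exact: sfld_diff sp. Qed.
Lemma XT_scale A c : XT A (fun p => c * H p) p = c * XT A H p.
Proof. by rewrite /XT derive_scale//; exact: sfld_diff sp. Qed.

(** Covers time and space derivatives at once. *)
Lemma derive_powR_field a v s : (forall q, spacetime q -> 0 < H q) ->
  'D_((s, v) : TV) (fun p => H p `^ a : R^o) p = a * H p `^ (a - 1) * 'D_((s, v) : TV) H p.
Proof.
move=> hp; have hp0 := hp p sp.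
have [h1 h2] := is_derive1_powR a hp0.
rewrite (derive_comp1 (psi := fun x : R^o => x `^ a : R^o)) ?h2//.
  exact: sfld_diff sH sp.
exact/derivable1_diffP.
Qed.

Lemma dT_powR a : (forall q, spacetime q -> 0 < H q) ->
  dT (fun p => H p `^ a) p = a * H p `^ (a - 1) * dT H p.
Proof. exact: derive_powR_field. Qed.

End Rules.

Lemma XT_eq A H K p : (forall q, spacetime q -> H q = K q) -> spacetime p -> XT A H p = XT A K p.
Proof. exact: (derive_eq_on oS). Qed.
Lemma dT_eq H K p : (forall q, spacetime q -> H q = K q) -> spacetime p -> dT H p = dT K p.
Proof. exact: (derive_eq_on oS). Qed.

Definition slice H t : V -> R^o := fun y => H (t, y).

Lemma Ck_slice k H t : 0 < t -> Ck spacetime k H -> Ck W k (slice H t).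
Proof.
move=> t0; apply: (@Ck_affine _ _ _ spacetime W open_neq0 (fun y : V => (t, y) : TV)
   (fun y : V => (0, y) : TV)) => //.
by move=> h v x; congr pair; rewrite /= scaler0 add0r.
Qed.

Lemma derive_slice H t y v : differentiable H (t, y) ->
  'D_v (slice H t) y = 'D_((0, v) : TV) H (t, y).
Proof.
move=> dH; rewrite -(derive_affine (L := fun y : V => (t, y) : TV) (l := fun y : V => (0, y) : TV))//.
by move=> h; congr pair; rewrite /= scaler0 add0r.
Qed.

Lemma Xf_slice A H t y : sfld H -> 0 < t -> y != 0 -> Xf A (slice H t) y = XT A H (t, y).
Proof. by move=> sH t0 y0; rewrite /Xf derive_slice//; exact: sfld_diff. Qed.

Lemma hom0_slice H t : 0 < t -> homT H -> hom0 (slice H t).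
Proof. by move=> t0 hH c y c0 y0; exact: (hH (t, y) c). Qed.

Lemma sphere_cont_slice H t : 0 < t -> sfld H -> sphere_cont (slice H t).
Proof. by move=> t0 sH; apply: (sphere_cont_Ck (k := 0)); apply: Ck_slice => //; exact: sH.1. Qed.

Lemma integral_XT A H t : A^T = - A -> sfld H -> 0 < t ->
  integral_dV0 (fun x => XT A H (t, x)) = 0.
Proof.
move=> hA sH t0.
rewrite -(integral_dV0_Xf hA (F := slice H t)); first last.
- by apply: hom0_slice => //; exact: sH.2.
- by apply: Ck_slice => //; exact: sH.1.
apply: integral_dV0_eq.
  apply: (sphere_cont_Ck (k := 0)); apply: (Ck_Xf open_neq0).
  by apply: Ck_slice => //; exact: sH.1.
by move=> x sx; rewrite Xf_slice//; exact: sphere_neq0.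
Qed.

Lemma is_derive_time H t x : sfld H -> 0 < t -> x != 0 ->
  is_derive t (1 : R) ((fun s => H (s, x)) : R -> R^o) (dT H (t, x)).
Proof.
move=> sH t0 x0.
have E s : ((0, x) : TV) + s *: ((1, 0) : TV) = (s, x).
  by congr pair; rewrite /= ?add0r ?scaler0 ?addr0 // [s *: _]mulr1.
have := @is_derive_line _ _ H (0, x) (1, 0) t; rewrite E => h.
have -> : (fun s => H (s, x)) = (fun s : R => H (((0, x) : TV) + s *: ((1, 0) : TV))).
  by apply/funext => s; rewrite E.
exact: h (sfld_diff sH _).
Qed.

(** Difference quotients are bounded by the mean value theorem, and bounded
   convergence applies. *)
Lemma is_derive_integral_param (Phi dPhi : R -> V -> R) (t d M : R) : 0 < d ->
  (forall s, `|s - t| <= d -> sphere_cont (Phi s)) -> sphere_cont (dPhi t) ->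
  (forall s x, `|s - t| <= d -> sphere x ->
    is_derive s (1 : R) ((fun s => Phi s x) : R -> R^o) (dPhi s x)) ->
  (forall s x, `|s - t| <= d -> sphere x -> `|dPhi s x| <= M) ->
  is_derive t (1 : R) ((fun s => integral_dV0 (Phi s)) : R -> R^o) (integral_dV0 (dPhi t)).
Proof.
move=> d0 cl cd hd hM.
have tt : `|t - t| <= d by rewrite subrr normr0 ltW.
apply: is_derive_seq => u u0 ucv.
pose u' k := if `|u k| < d then u k else d.
have u'0 k : u' k != 0 by rewrite /u'; case: ifP => // _; rewrite gt_eqF.
have nearu : \forall k \near \oo, u' k = u k.
  move/cvgr0Pnorm_lt : ucv => /(_ _ d0); apply: filterS => k h; by rewrite /u' h.
have u'cv : u' k @[k --> \oo] --> (0 : R).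
  apply: cvg_trans ucv; apply: near_eq_cvg; apply: filterS nearu => k h; by rewrite h.
have u'b k : `|u' k| <= d.
  by rewrite /u'; case: ifP => [/ltW//|_]; rewrite gtr0_norm.
have Iu k s : Num.min t (u' k + t) <= s <= Num.max t (u' k + t) -> `|s - t| <= d.
  have := u'b k; rewrite !ler_norml => /andP[h1 h2].
  by rewrite ge_min le_max => /andP[/orP[] h3 /orP[] h4]; apply/andP; split; lra.
have cu k : sphere_cont (Phi (u' k + t)) by apply: cl; rewrite addrK.
have c0 : sphere_cont (fun _ : V => 0) by exact: sphere_cont_cst.
have E k : (u' k)^-1 * (integral_dV0 (Phi (u' k + t)) - integral_dV0 (Phi t)) =
  integral_dV0 (fun x => (u' k)^-1 * (- 1 * Phi t x + Phi (u' k + t) x) + 0).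
  have z0 : integral_dV0 (fun _ : V => (0 : R)) = 0.
    have := integral_dV0_lin (-1) c0 c0.
    rewrite (_ : (fun x : V => -1 * 0 + 0) = (fun=> 0)); last by apply/funext => x; ring.
    by move=> ->; ring.
  rewrite integral_dV0_lin//; last by apply: sphere_cont_lin => //; exact: cl.
  by rewrite integral_dV0_lin ?z0; [ring|exact: cl|].
have main : integral_dV0 (fun x => (u' k)^-1 * (- 1 * Phi t x + Phi (u' k + t) x) + 0)
   @[k --> \oo] --> integral_dV0 (dPhi t).
  apply: (integral_dV0_dct (M := M)) => //.
  - by move=> k; apply: sphere_cont_lin => //; apply: sphere_cont_lin => //; exact: cl.
  - move=> k x sx; rewrite addr0 mulN1r addrC normrM normfV mulrC ler_pdivrMr ?normr_gt0//.
    have -> : `|u' k| = `|u' k + t - t| by rewrite addrK.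
    apply: (@is_derive_lipschitz _ (fun s => Phi s x) (fun s => dPhi s x)) => s hs.
      exact: hd (Iu k s hs) sx.
    exact: hM (Iu k s hs) sx.
  - move=> x sx.
    have := is_derive_quotient (hd t x tt sx) u'0 u'cv.
    apply: cvg_trans; apply: near_eq_cvg; near=> k.
    by ring.
apply: cvg_trans main; apply: near_eq_cvg; apply: filterS nearu => k h.
by rewrite -E h.
Unshelve. all: by end_near. Qed.

Lemma is_derive_integral H t : sfld H -> 0 < t ->
  is_derive t (1 : R) ((fun s => integral_dV0 (slice H s)) : R -> R^o)
    (integral_dV0 (slice (dT H) t)).
Proof.
move=> sH t0.
have sD := sfld_dT sH.
have t2 : 0 < t / 2 by rewrite divr_gt0.
pose I : set R := `[t / 2, 3 * t / 2]%classic.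
have Ipos s : I s -> 0 < s by rewrite /I /= in_itv /= => /andP[h _]; lra.
have nI s : `|s - t| <= t / 2 -> I s.
  by rewrite ler_norml /I /= in_itv /= => /andP[h1 h2]; apply/andP; split; lra.
have [M hM] : exists M : R, forall s x, I s -> sphere x -> `|dT H (s, x)| <= M.
  have cIS : compact (I `*` (@sphere R n)).
    by apply: compact_setX; [exact: segment_compact|exact: compact_sphere].
  have [e|/set0P ne] := eqVneq (I `*` (@sphere R n)) set0.
    exists 0 => s x Is sx; have : (I `*` (@sphere R n)) (s, x) by split.
    by rewrite e.
  have cw : {within (I `*` (@sphere R n)), continuous (fun p : TV => `|dT H p|)}.
    apply: continuous_in_subspaceT => p; rewrite inE => -[Ip Sp].
    have c : {for p, continuous (dT H : TV -> R)}.
      by apply: Ck_continuous (sD.1 0%N) _; split; [exact: Ipos|exact: sphere_neq0].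
    by apply: seq_continuous_at => u up; apply: cvg_norm; exact: continuous_seq c up.
  have [c _ hc] := compact_EVT_max ne cIS cw.
  by exists `|dT H c| => s x Is sx; apply: (hc (s, x)); exact: mem_set.
apply: (is_derive_integral_param (Phi := slice H) (dPhi := slice (dT H)) (M := M) t2).
- by move=> s /nI /Ipos s0; exact: sphere_cont_slice.
- exact: sphere_cont_slice.
- by move=> s x /nI /Ipos s0 sx; apply: is_derive_time => //; exact: sphere_neq0.
- by move=> s x /nI Is sx; exact: hM.
Qed.

End TimeFields.

(** * The horizontal frame and the sub-Laplacian *)

Section HorizontalFrame.
Context {R : realType} {n : nat}.
Notation V := (ambient R n).
Notation W := [set y : V | y != 0].
Implicit Types (x y z v w : V).

Definition skew_delta (j k : 'I_n.+1) : 'M[R]_n.+1 := delta_mx j k - delta_mx k j.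

Definition frame_index := ('I_n.+1 * 'I_n.+1 * bool)%type.

(** Twice the real part, or minus twice the imaginary part, of the complex fields
   conj z_j d/dz_k - conj z_k d/dz_j. On the sphere they span ker theta_0, with
   redundancies; what is gained is that their coefficients are linear and given
   by skew matrices. *)
Definition frame (i : frame_index) : 'M[R]_(n.+1 + n.+1) :=
  let E := skew_delta i.1.1 i.1.2 in
  if i.2 then block_mx 0 E E 0 else block_mx E 0 0 (- E).

Lemma frame_skew i : (frame i)^T = - frame i.
Proof.
have E : (skew_delta i.1.1 i.1.2)^T = - skew_delta i.1.1 i.1.2.
  by rewrite linearB /= !trmx_delta opprB.
by rewrite /frame; case: ifP => _; rewrite tr_block_mx !linear0 ?linearN /= E opp_block_mx ?oppr0.
Qed.

Definition rdot (a c : 'rV[R]_n.+1) : R := \sum_j a 0 j * c 0 j.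

Lemma rdot_skew_delta (a c : 'rV[R]_n.+1) j k :
  rdot (a *m skew_delta j k) c = a 0 j * c 0 k - a 0 k * c 0 j.
Proof.
have D (i l : 'I_n.+1) : rdot (a *m delta_mx i l) c = a 0 i * c 0 l.
  have -> : a *m delta_mx i l = a 0 i *: delta_mx 0 l.
    apply/rowP => m; rewrite !mxE (bigD1 i)//= big1 ?addr0; first by rewrite mxE eqxx.
    by move=> q /negPf qi; rewrite mxE qi /= mulr0.
  rewrite /rdot (bigD1 l)//= big1 ?addr0; first by rewrite !mxE !eqxx mulr1.
  by move=> q /negPf qi; rewrite !mxE eqxx qi /= mulr0 mul0r.
rewrite -!D /rdot -sumrB; apply: eq_bigr => m _.
by rewrite mulmxBr -mulrBl; congr (_ * _); rewrite [LHS]mxE [X in _ + X]mxE.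
Qed.

Lemma edot_split x v : edot x v = rdot (lsubmx x) (lsubmx v) + rdot (rsubmx x) (rsubmx v).
Proof.
rewrite /edot big_split_ord /=; congr (_ + _); apply: eq_bigr => j _; by rewrite !mxE.
Qed.

Lemma rdotNl (a c : 'rV[R]_n.+1) : rdot (- a) c = - rdot a c.
Proof. by rewrite /rdot -sumrN; apply: eq_bigr => j _; rewrite mxE mulNr. Qed.

Lemma edot_frame x v j k :
  edot (x *m frame (j, k, false)) v =
    lsubmx x 0 j * lsubmx v 0 k - lsubmx x 0 k * lsubmx v 0 j
    - rsubmx x 0 j * rsubmx v 0 k + rsubmx x 0 k * rsubmx v 0 j /\
  edot (x *m frame (j, k, true)) v =
    rsubmx x 0 j * lsubmx v 0 k - rsubmx x 0 k * lsubmx v 0 j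
    + lsubmx x 0 j * rsubmx v 0 k - lsubmx x 0 k * rsubmx v 0 j.
Proof.
rewrite -{1 6}[x]hsubmxK /frame /= !mul_row_block !mulmx0 !addr0 !add0r.
rewrite !edot_split !row_mxKl !row_mxKr mulmxN rdotNl !rdot_skew_delta.
by split; ring.
Qed.

(** Lagrange's identity over the complex numbers, in real coordinates. *)
Lemma frame_identity (a b c d c' d' : 'rV[R]_n.+1) :
  \sum_j \sum_k ((a 0 j * c 0 k - a 0 k * c 0 j - b 0 j * d 0 k + b 0 k * d 0 j) *
     (a 0 j * c' 0 k - a 0 k * c' 0 j - b 0 j * d' 0 k + b 0 k * d' 0 j) +
     (b 0 j * c 0 k - b 0 k * c 0 j + a 0 j * d 0 k - a 0 k * d 0 j) *
     (b 0 j * c' 0 k - b 0 k * c' 0 j + a 0 j * d' 0 k - a 0 k * d' 0 j)) =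
  2 * ((rdot a a + rdot b b) * (rdot c c' + rdot d d')
    - (rdot a c + rdot b d) * (rdot a c' + rdot b d')
    - (rdot a d - rdot b c) * (rdot a d' - rdot b c')).
Proof.
pose L : seq (('I_n.+1 -> R) * ('I_n.+1 -> R)) :=
  [:: (fun j => (a 0 j * a 0 j), fun k => c 0 k * c' 0 k); (fun j => - (a 0 j * c' 0 j), fun k => c 0 k * a 0 k); (fun j => - (a 0 j * b 0 j), fun k => c 0 k * d' 0 k); (fun j => (a 0 j * d' 0 j), fun k => c 0 k * b 0 k); (fun j => - (c 0 j * a 0 j), fun k => a 0 k * c' 0 k); (fun j => (c 0 j * c' 0 j), fun k => a 0 k * a 0 k); (fun j => (c 0 j * b 0 j), fun k => a 0 k * d' 0 k); (fun j => - (c 0 j * d' 0 j), fun k => a 0 k * b 0 k); (fun j => - (b 0 j * a 0 j), fun k => d 0 k * c' 0 k); (fun j => (b 0 j * c' 0 j), fun k => d 0 k * a 0 k); (fun j => (b 0 j * b 0 j), fun k => d 0 k * d' 0 k); (fun j => - (b 0 j * d' 0 j), fun k => d 0 k * b 0 k); (fun j => (d 0 j * a 0 j), fun k => b 0 k * c' 0 k); (fun j => - (d 0 j * c' 0 j), fun k => b 0 k * a 0 k); (fun j => - (d 0 j * b 0 j), fun k => b 0 k * d' 0 k); (fun j => (d 0 j * d' 0 j), fun k => b 0 k * b 0 k); (fun j => (b 0 j * b 0 j), fun k => c 0 k * c' 0 k); (fun j => - (b 0 j * c' 0 j), fun k => c 0 k * b 0 k); (fun j => (b 0 j * a 0 j),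 fun k => c 0 k * d' 0 k); (fun j => - (b 0 j * d' 0 j), fun k => c 0 k * a 0 k); (fun j => - (c 0 j * b 0 j), fun k => b 0 k * c' 0 k); (fun j => (c 0 j * c' 0 j), fun k => b 0 k * b 0 k); (fun j => - (c 0 j * a 0 j), fun k => b 0 k * d' 0 k); (fun j => (c 0 j * d' 0 j), fun k => b 0 k * a 0 k); (fun j => (a 0 j * b 0 j), fun k => d 0 k * c' 0 k); (fun j => - (a 0 j * c' 0 j), fun k => d 0 k * b 0 k); (fun j => (a 0 j * a 0 j), fun k => d 0 k * d' 0 k); (fun j => - (a 0 j * d' 0 j), fun k => d 0 k * a 0 k); (fun j => - (d 0 j * b 0 j), fun k => a 0 k * c' 0 k); (fun j => (d 0 j * c' 0 j), fun k => a 0 k * b 0 k); (fun j => - (d 0 j * a 0 j), fun k => a 0 k * d' 0 k); (fun j => (d 0 j * d' 0 j), fun k => a 0 k * a 0 k)].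
transitivity (\sum_(q <- L) (\sum_j q.1 j) * (\sum_k q.2 k)).
  rewrite [RHS](eq_bigr (fun q => \sum_j \sum_k q.1 j * q.2 k)); last first.
    by move=> q _; rewrite big_distrlr.
  rewrite [RHS]exchange_big; apply: eq_bigr => j _.
  rewrite [RHS]exchange_big; apply: eq_bigr => k _.
  by rewrite /L !big_cons big_nil /=; ring.
rewrite /L !big_cons big_nil /= !sumrN.
have E (f g : 'rV[R]_n.+1) : \sum_j f 0 j * g 0 j = rdot f g by [].
have C f g : rdot f g = rdot g f by apply: eq_bigr => j _; rewrite mulrC.
rewrite !E ?(C c a) ?(C d a) ?(C c b) ?(C d b) ?(C c' a) ?(C d' a) ?(C c' b) ?(C d' b) ?(C b a).
rewrite ?(C c' c) ?(C d' c) ?(C c' d) ?(C d' d) ?(C d c).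
by ring.
Qed.

Lemma Jmul_edot x v : edot (Jmul x) v = rdot (lsubmx x) (rsubmx v) - rdot (rsubmx x) (lsubmx v).
Proof. by rewrite edot_split /Jmul row_mxKl row_mxKr rdotNl addrC. Qed.

Lemma edot_Jmul2 x : edot (Jmul x) (Jmul x) = edot x x.
Proof.
rewrite Jmul_edot /Jmul row_mxKl row_mxKr edot_split.
have -> : rdot (rsubmx x) (- rsubmx x) = - rdot (rsubmx x) (rsubmx x).
  by rewrite -rdotNl; apply: eq_bigr => j _; rewrite !mxE mulrN mulNr.
by rewrite opprK.
Qed.

Lemma theta0E x v : theta0 x v = 2 * edot (Jmul x) v.
Proof. by rewrite Jmul_edot /theta0 /rdot sumrB. Qed.

(** The frame resolves the identity on ker theta_0: what is subtracted are the
   components along the radius and along its image under multiplication by the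
   imaginary unit. *)
Lemma sum_frame x v w :
  \sum_i edot (x *m frame i) v * edot (x *m frame i) w =
  2 * (edot x x * edot v w - edot x v * edot x w - edot (Jmul x) v * edot (Jmul x) w).
Proof.
rewrite !Jmul_edot !(edot_split _ _) -frame_identity.
rewrite pair_big /= -(pair_big xpredT xpredT (fun p (b : bool) =>
  edot (x *m frame (p, b)) v * edot (x *m frame (p, b)) w)) /=.
by apply: eq_bigr => -[j k] _; rewrite big_bool /= !(edot_frame _ _ _ _).1 !(edot_frame _ _ _ _).2 addrC.
Qed.

Lemma edot_round_grad (phi : V -> R) x v : differentiable (hext phi : V -> R^o) x ->
  edot v (round_grad phi x) = 'D_v (hext phi : V -> R^o) x.
Proof.
by move=> dp; rewrite derive_coords//; apply: eq_bigr => j _; rewrite mxE.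
Qed.

Lemma derive_radial (phi : V -> R) x : x != 0 -> differentiable (hext phi : V -> R^o) x ->
  'D_x (hext phi : V -> R^o) x = 0.
Proof.
move=> x0 dp.
have dp0 : differentiable (hext phi : V -> R^o) (x + 0 *: x) by rewrite scale0r addr0.
have [_] := is_derive_line dp0; rewrite scale0r addr0 => <-.
transitivity ('D_(1 : R) (cst (hext phi x) : R -> R^o) (0 : R)); last by rewrite derive_cst.
apply: near_eq_derive; near=> s; rewrite /cst.
rewrite -[X in hext phi (X + _)]scale1r -scalerDl hom0_hext//.
suff : -1 < s by lra.
near: s; apply: open_nbhs_nbhs; split; first exact: open_gt.
by rewrite /= ltrN10.
Unshelve. all: by end_near. Qed.

(** The factor is 1/4 from the normalization of the Levi form, times 1/2 because
   the frame counts every pair (j, k) twice. *)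
Lemma levi_gradE (phi psi : V -> R) x : sphere x ->
  differentiable (hext phi : V -> R^o) x -> differentiable (hext psi : V -> R^o) x ->
  levi_grad phi psi x = 8^-1 * \sum_i Xf (frame i) (hext phi) x * Xf (frame i) (hext psi) x.
Proof.
move=> sx dp dq; have x0 := sphere_neq0 sx.
have x1 : edot x x = 1 by apply/sphereP.
transitivity (8^-1 * \sum_i edot (x *m frame i) (round_grad phi x) * edot (x *m frame i) (round_grad psi x)); last first.
  by congr (_ * _); apply: eq_bigr => i _; rewrite !edot_round_grad.
rewrite sum_frame x1 !(edot_round_grad x)// !derive_radial// /levi_grad /proj_ker_theta0 !theta0E.
move: (round_grad phi x) (round_grad psi x) => v w.
have J1 : edot (Jmul x) (Jmul x) = 1 by rewrite edot_Jmul2.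
rewrite -!(scaleNr _ (Jmul x)) edotDl !edotDr !edotZl !edotZr J1 (edotC v (Jmul x)).
by field.
Qed.

Definition smooth0 (F : V -> R^o) := (forall k, Ck W k F) /\ hom0 F.

Lemma smooth0_hext phi : smooth_sphere phi -> smooth0 (hext phi).
Proof. by move=> /smooth_onP h; split=> //; exact: hom0_hext. Qed.

Lemma smooth_sphere0 (F : V -> R^o) : smooth0 F -> smooth_sphere F.
Proof.
move=> [cF hF]; apply/smooth_onP => k; apply: (Ck_eq open_neq0) (cF k) => y y0.
by rewrite hom0_hextE.
Qed.

Lemma smooth0_diff F x : smooth0 F -> x != 0 -> differentiable F x.
Proof. by move=> [h _] x0; exact: Ck_diff (h 0%N) x0. Qed.

Lemma smooth0_Xf A F : smooth0 F -> smooth0 (Xf A F).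
Proof.
move=> sF; split=> [k|]; first by apply: (Ck_Xf open_neq0); exact: sF.1.
by apply: hom0_Xf; [move=> y y0; exact: smooth0_diff|exact: sF.2].
Qed.

Lemma smooth0_mul (F G : V -> R^o) : smooth0 F -> smooth0 G -> smooth0 (fun y => F y * G y).
Proof.
move=> [h1 h2] [k1 k2]; split=> [k|c y c0 y0]; first exact: (Ck_mul open_neq0).
by rewrite h2// k2.
Qed.

Lemma smooth0_scale a (F : V -> R^o) : smooth0 F -> smooth0 (fun y => a * F y).
Proof.
move=> [h1 h2]; split=> [k|c y c0 y0]; first exact: (Ck_scale open_neq0).
by rewrite h2.
Qed.

Lemma smooth0_sum (I : Type) (r : seq I) (F : I -> V -> R^o) :
  (forall i, smooth0 (F i)) -> smooth0 (fun p => \sum_(i <- r) F i p).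
Proof.
move=> h; split=> [k|c y c0 y0]; last by apply: eq_bigr => i _; exact: (h i).2.
by apply: (Ck_sum open_neq0) => i; exact: (h i).1.
Qed.

Lemma Xf_mul A (F G : V -> R^o) x : smooth0 F -> smooth0 G -> x != 0 ->
  Xf A (fun y => F y * G y) x = F x * Xf A G x + G x * Xf A F x.
Proof. by move=> sF sG x0; apply: derive_mul; exact: smooth0_diff. Qed.

Lemma smooth0_cont F : smooth0 F -> sphere_cont F.
Proof. by move=> sF; exact: (sphere_cont_Ck (sF.1 0%N)). Qed.

Lemma integral_dV0_0 : integral_dV0 (fun _ : V => (0 : R)) = 0.
Proof.
have c0 : sphere_cont (fun _ : V => (0 : R)) by exact: sphere_cont_cst.
have := integral_dV0_lin (-1) c0 c0.
rewrite (_ : (fun x : V => -1 * 0 + 0) = (fun=> 0)); last by apply/funext => x; ring.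
by move=> ->; ring.
Qed.

Lemma integral_dV0_scale a phi : sphere_cont phi ->
  integral_dV0 (fun x : V => a * phi x) = a * integral_dV0 phi.
Proof.
move=> cp; have := integral_dV0_lin a cp (sphere_cont_cst (a := 0 : R)).
rewrite integral_dV0_0 addr0 => <-; congr integral_dV0; apply/funext => x; by rewrite addr0.
Qed.

Lemma integral_dV0_add phi psi : sphere_cont phi -> sphere_cont psi ->
  integral_dV0 (fun x : V => phi x + psi x) = integral_dV0 phi + integral_dV0 psi.
Proof.
move=> cp cq; have := integral_dV0_lin 1 cp cq; rewrite mul1r => <-.
by congr integral_dV0; apply/funext => x; rewrite mul1r.
Qed.

Lemma integral_dV0_sum (I : Type) (r : seq I) (F : I -> V -> R) :
  (forall i, sphere_cont (F i)) ->
  sphere_cont (fun x => \sum_(i <- r) F i x) /\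
  integral_dV0 (fun x => \sum_(i <- r) F i x) = \sum_(i <- r) integral_dV0 (F i).
Proof.
move=> cF; elim: r => [|i r [c e]].
  have -> : (fun x => \sum_(i <- [::]) F i x) = (fun=> 0) by apply/funext => x; rewrite big_nil.
  by rewrite big_nil integral_dV0_0; split=> //; exact: sphere_cont_cst.
have -> : (fun x => \sum_(i <- i :: r) F i x) = (fun x => F i x + \sum_(i <- r) F i x).
  by apply/funext => x; rewrite big_cons.
by rewrite big_cons integral_dV0_add// e; split=> //; exact: sphere_cont_add.
Qed.

(** The sum of squares of the frame: since each of its fields integrates to zero,
   it is the operator dual to the Levi form. *)
Definition lap (F : V -> R^o) y : R^o := 8^-1 * \sum_i Xf (frame i) (Xf (frame i) F) y.

Lemma smooth0_lap F : smooth0 F -> smooth0 (lap F).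
Proof. by move=> sF; apply/smooth0_scale/smooth0_sum => i; do 2 apply: smooth0_Xf. Qed.

Lemma integral_lap (F G : V -> R^o) : smooth0 F -> smooth0 G ->
  integral_dV0 (fun x => lap F x * G x) =
  - integral_dV0 (fun x => 8^-1 * \sum_i Xf (frame i) F x * Xf (frame i) G x).
Proof.
move=> sF sG; apply/eqP; rewrite -addr_eq0; apply/eqP.
have s1 := smooth0_mul (smooth0_lap sF) sG.
have s2 : smooth0 (fun x => 8^-1 * \sum_i Xf (frame i) F x * Xf (frame i) G x).
  by apply/smooth0_scale/smooth0_sum => i; apply: smooth0_mul; exact: smooth0_Xf.
have sX i : smooth0 (fun y => G y * Xf (frame i) F y).
  by apply: smooth0_mul => //; exact: smooth0_Xf.
have cX i : sphere_cont (Xf (frame i) (fun y => G y * Xf (frame i) F y)).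
  by apply/smooth0_cont/smooth0_Xf.
rewrite -integral_dV0_add; [|exact: smooth0_cont|exact: smooth0_cont].
rewrite (integral_dV0_eq (psi := fun x => 8^-1 * \sum_i Xf (frame i) (fun y => G y * Xf (frame i) F y) x)).
- rewrite integral_dV0_scale; last exact: (integral_dV0_sum _ cX).1.
  rewrite (integral_dV0_sum _ cX).2 big1 ?mulr0// => i _.
  by apply: integral_dV0_Xf; [exact: frame_skew|exact: (sX i).1|exact: (sX i).2].
- have := smooth0_cont (smooth0_scale 8^-1 (smooth0_sum _ (fun i => smooth0_Xf (frame i) (sX i)))).
  exact.
- move=> x /sphere_neq0 x0; rewrite /lap -mulrA -mulrDr; congr (_ * _).
  rewrite mulr_suml -big_split; apply: eq_bigr => i _ /=.
  by rewrite (Xf_mul _ sG (smooth0_Xf _ sF) x0) mulrC.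
Qed.

Lemma is_sublaplacian_lap phi : smooth_sphere phi -> is_sublaplacian phi (lap (hext phi)).
Proof.
move=> /smooth0_hext sp; split; first exact/smooth_sphere0/smooth0_lap.
move=> psi /smooth0_hext sq.
have s1 := smooth0_mul (smooth0_lap sp) sq.
rewrite (integral_dV0_eq (smooth0_cont s1)); last by move=> x sx; rewrite (hext_sphere psi).
rewrite integral_lap//; congr (- _); apply/esym/integral_dV0_eq.
  apply: smooth0_cont; apply/smooth0_scale/smooth0_sum => i.
  by apply: smooth0_mul; exact: smooth0_Xf.
by move=> x sx; apply: levi_gradE => //; apply: smooth0_diff => //; exact: sphere_neq0.
Qed.

(** Two candidates differ by a function orthogonal to all smooth functions, in
   particular to itself; strict positivity of the integral makes it vanish. *)
Lemma sublaplacianE phi x : smooth_sphere phi -> sphere x ->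
  sublaplacian phi x = lap (hext phi) x.
Proof.
move=> sp sx.
have h0 := is_sublaplacian_lap sp.
have [h1 h2] : is_sublaplacian phi (sublaplacian phi).
  exact: (xgetPex (fun=> 0) (ex_intro _ _ h0)).
set w := sublaplacian phi in h1 h2 *.
pose D y : R^o := hext w y + -1 * lap (hext phi) y.
have sl := smooth0_lap (smooth0_hext sp).
have sw := smooth0_hext h1.
have sD : smooth0 D.
  split=> [k|c y c0 y0]; last by rewrite /D (sw.2 c y c0 y0) (sl.2 c y c0 y0).
  exact: (Ck_add open_neq0 (sw.1 k) (Ck_scale open_neq0 (-1) (sl.1 k))).
have ssD := smooth_sphere0 sD.
have e1 := h2 _ ssD; have e2 := h0.2 _ ssD.
have cw : sphere_cont (fun x => hext w x * D x) by exact/smooth0_cont/smooth0_mul.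
have cl : sphere_cont (fun x => lap (hext phi) x * D x) by exact/smooth0_cont/smooth0_mul.
have : integral_dV0 (fun x => D x * D x) = 0.
  rewrite (_ : (fun x => D x * D x) = (fun x => -1 * (lap (hext phi) x * D x) + hext w x * D x)).
    rewrite integral_dV0_lin// e2 -(integral_dV0_eq (phi := fun x => w x * D x) cw) ?e1; first by ring.
    by move=> y sy; rewrite hext_sphere.
  by apply/funext => y; rewrite /D; ring.
move=> /(integral_dV0_eq0 (smooth0_cont (smooth0_mul sD sD))) h.
have D2 (r : R) : 0 <= r * r by rewrite -expr2 sqr_ge0.
have aux (r : R) : r * r = 0 -> r = 0 by move/eqP; rewrite mulf_eq0 orbb => /eqP.
have aux2 (r q : R) : r + -1 * q = 0 -> r = q by rewrite mulN1r => /subr0_eq.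
have Dx : D x = 0 := aux _ (h (fun y _ => D2 (D y)) x sx).
by rewrite -(hext_sphere w sx); exact: aux2 Dx.
Qed.

End HorizontalFrame.

(** * Calculus of horizontal fields depending on time *)

Lemma mulr_congr {R : realType} (c a b : R) : a = b -> c * a = c * b.
Proof. by move=> ->. Qed.

(* Abstract the values of the fields at p, which ring solvers would otherwise
   compare up to conversion. *)
Ltac abs_at p := repeat match goal with
  | |- context [?h p] => generalize (h p); intro end.

(** Sealed, as are the next two operations: two derivatives or two integrals are
   to be compared by their arguments, not by unfolding them to limits. *)
HB.lock Definition XX (R : realType) (n : nat) (i : @frame_index n)
  (H : (R^o * ambient R n)%type -> R^o) (p : (R^o * ambient R n)%type) : R^o :=
  XT (frame i) H p.
HB.lock Definition Dt (R : realType) (n : nat)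
  (H : (R^o * ambient R n)%type -> R^o) (p : (R^o * ambient R n)%type) : R^o := dT H p.
HB.lock Definition J (R : realType) (n : nat)
  (H : (R^o * ambient R n)%type -> R^o) (t : R) : R := integral_dV0 (slice H t).

Section Calculus.
Context {R : realType} {n : nat}.
Notation V := (ambient R n).
Notation TV := (R^o * ambient R n)%type.
Notation S := (@spacetime R n).
Implicit Types (H K G : TV -> R^o) (p : TV) (t c : R) (x y : V).

Definition gam H K p : R^o := 8^-1 * \sum_i XX i H p * XX i K p.
Definition lapT H p : R^o := 8^-1 * \sum_i XX i (XX i H) p.

Lemma XXE i H : XX i H = XT (frame i) H.
Proof. by apply/funext => p; rewrite XX.unlock. Qed.
Lemma DtE H : Dt H = dT H.
Proof. by apply/funext => p; rewrite Dt.unlock. Qed.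
Lemma JE H t : J H t = integral_dV0 (slice H t).
Proof. by rewrite J.unlock. Qed.

Lemma sfld_XX i H : sfld H -> sfld (XX i H).
Proof. rewrite XXE; exact: sfld_XT. Qed.

Lemma sfld_Dt H : sfld H -> sfld (Dt H).
Proof. rewrite DtE; exact: sfld_dT. Qed.

Lemma sfld_gam H K : sfld H -> sfld K -> sfld (gam H K).
Proof.
move=> sH sK; apply: sfld_scale; apply: sfld_sum => i.
by apply: sfld_mul; exact: sfld_XX.
Qed.

Lemma sfld_lapT H : sfld H -> sfld (lapT H).
Proof. by move=> sH; apply: sfld_scale; apply: sfld_sum => i; do 2 apply: sfld_XX. Qed.

Lemma XX_mul i H K p : sfld H -> sfld K -> S p ->
  XX i (fun p => H p * K p) p = H p * XX i K p + K p * XX i H p.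
Proof. by move=> sH sK sp; rewrite !XXE; exact: XT_mul. Qed.

Lemma XX_add i H K p : sfld H -> sfld K -> S p ->
  XX i (fun p => H p + K p) p = XX i H p + XX i K p.
Proof. by move=> sH sK sp; rewrite !XXE; exact: XT_add. Qed.

Lemma XX_scale i c H p : sfld H -> S p -> XX i (fun p => c * H p) p = c * XX i H p.
Proof. by move=> sH sp; rewrite !XXE; exact: XT_scale. Qed.

Lemma XX_eq i H K p : (forall q, S q -> H q = K q) -> S p -> XX i H p = XX i K p.
Proof. rewrite !XXE; exact: XT_eq. Qed.

Lemma Dt_XX i H p : sfld H -> S p -> Dt (XX i H) p = XX i (Dt H) p.
Proof. rewrite !XXE !DtE; exact: dT_XT. Qed.

Lemma XX_slice i H t y : sfld H -> 0 < t -> y != 0 -> Xf (frame i) (slice H t) y = XX i H (t, y).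
Proof. rewrite XXE; exact: Xf_slice. Qed.

Lemma Xf_eq A (F K : V -> R^o) y : (forall z, z != 0 -> F z = K z) -> y != 0 -> Xf A F y = Xf A K y.
Proof. exact: (derive_eq_on open_neq0). Qed.

Lemma Dt_add H K p : sfld H -> sfld K -> S p -> Dt (fun p => H p + K p) p = Dt H p + Dt K p.
Proof. by move=> sH sK sp; rewrite !DtE; exact: dT_add. Qed.

Lemma Dt_mul H K p : sfld H -> sfld K -> S p ->
  Dt (fun p => H p * K p) p = H p * Dt K p + K p * Dt H p.
Proof. by move=> sH sK sp; rewrite !DtE; exact: dT_mul. Qed.

Lemma Dt_scale c H p : sfld H -> S p -> Dt (fun p => c * H p) p = c * Dt H p.
Proof. by move=> sH sp; rewrite !DtE; exact: dT_scale. Qed.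

Lemma Dt_powR a H p : sfld H -> S p -> (forall q, S q -> 0 < H q) ->
  Dt (fun p => H p `^ a) p = a * H p `^ (a - 1) * Dt H p.
Proof. by move=> sH sp hp; rewrite !DtE; exact: dT_powR. Qed.

Lemma Dt_eq H K p : (forall q, S q -> H q = K q) -> S p -> Dt H p = Dt K p.
Proof. rewrite !DtE; exact: dT_eq. Qed.

Lemma Dt_sum (I : Type) (r : seq I) (H : I -> TV -> R^o) p : (forall i, sfld (H i)) -> S p ->
  Dt (fun p => \sum_(i <- r) H i p) p = \sum_(i <- r) Dt (H i) p.
Proof.
move=> sH sp; rewrite DtE; under [RHS]eq_bigr do rewrite DtE.
by apply: derive_sum => i; exact: sfld_diff (sH i) sp.
Qed.

Local Opaque Xf.

Lemma lapT_slice H t y : sfld H -> 0 < t -> y != 0 -> lap (slice H t) y = lapT H (t, y).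
Proof.
move=> sH t0 y0; rewrite /lap /lapT; apply: mulr_congr; apply: eq_bigr => i _.
rewrite -(XX_slice i (sfld_XX i sH) t0 y0).
by apply: Xf_eq => // z z0; exact: XX_slice.
Qed.

Lemma gamC H K p : gam H K p = gam K H p.
Proof. by apply: mulr_congr; apply: eq_bigr => i _; rewrite mulrC. Qed.

Lemma gam_ge0 H p : 0 <= gam H H p.
Proof.
by apply: mulr_ge0 => //; apply: sumr_ge0 => i _; rewrite -expr2 sqr_ge0.
Qed.

Section AtPoint.
Variables (H K G : TV -> R^o).
Hypotheses (sH : sfld H) (sK : sfld K) (sG : sfld G).
Variable p : TV.
Hypothesis sp : S p.

Lemma gam_mulr : gam G (fun p => H p * K p) p = H p * gam G K p + K p * gam G H p.
Proof.
rewrite /gam mulrCA [K p * _]mulrCA -mulrDr; apply: mulr_congr.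
rewrite !mulr_sumr -big_split; apply: eq_bigr => i _ /=.
by rewrite XX_mul//; abs_at p; ring.
Qed.

Lemma lapT_mul : lapT (fun p => H p * K p) p = H p * lapT K p + K p * lapT H p + 2 * gam H K p.
Proof.
have sHX i : sfld (XX i H) by exact: sfld_XX.
have sKX i : sfld (XX i K) by exact: sfld_XX.
rewrite /lapT /gam [H p * _]mulrCA [K p * _]mulrCA [2 * _]mulrCA -!mulrDr; apply: mulr_congr.
rewrite !mulr_sumr -!big_split; apply: eq_bigr => i _ /=.
have -> : XX i (XX i (fun p => H p * K p)) p = XX i (fun p => H p * XX i K p + K p * XX i H p) p.
  by apply: XX_eq => // q sq; rewrite XX_mul.
rewrite XX_add//; [|exact: sfld_mul|exact: sfld_mul].
by rewrite !XX_mul//; abs_at p; ring.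
Qed.

Lemma lapT_scale c : lapT (fun p => c * H p) p = c * lapT H p.
Proof.
have sHX i : sfld (XX i H) by exact: sfld_XX.
rewrite /lapT mulrCA; apply: mulr_congr; rewrite mulr_sumr; apply: eq_bigr => i _.
have -> : XX i (XX i (fun p => c * H p)) p = XX i (fun p => c * XX i H p) p.
  by apply: XX_eq => // q sq; rewrite XX_scale.
by rewrite XX_scale.
Qed.

Lemma Dt_lapT : Dt (lapT H) p = lapT (Dt H) p.
Proof.
have sHX i : sfld (XX i H) by exact: sfld_XX.
have sHXX i : sfld (XX i (XX i H)) by exact: sfld_XX.
have ssum (r : seq (@frame_index n)) : sfld (fun p => \sum_(i <- r) XX i (XX i H) p) by exact: sfld_sum.
rewrite /lapT Dt_scale//; apply: mulr_congr.
rewrite Dt_sum//; apply: eq_bigr => i _.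
rewrite (Dt_XX i (sHX i) sp); apply: XX_eq => // q sq; exact: Dt_XX.
Qed.

Lemma Dt_gam : Dt (gam H H) p = 2 * gam H (Dt H) p.
Proof.
have sHX i : sfld (XX i H) by exact: sfld_XX.
have sHXX i : sfld (fun p => XX i H p * XX i H p) by exact: sfld_mul.
have ssum (r : seq (@frame_index n)) : sfld (fun p => \sum_(i <- r) XX i H p * XX i H p) by exact: sfld_sum.
rewrite /gam Dt_scale// mulrCA; apply: mulr_congr.
rewrite Dt_sum// mulr_sumr; apply: eq_bigr => i _.
by rewrite Dt_mul// (Dt_XX i sH sp); abs_at p; ring.
Qed.

End AtPoint.

Lemma J_eq H K t : sfld K -> 0 < t -> (forall x, sphere x -> H (t, x) = K (t, x)) -> J H t = J K t.
Proof. by move=> sK t0 e; rewrite !JE; apply: integral_dV0_eq => //; exact: sphere_cont_slice. Qed.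

Lemma J_add H K t : sfld H -> sfld K -> 0 < t -> J (fun p => H p + K p) t = J H t + J K t.
Proof.
move=> sH sK t0; rewrite !JE.
exact: (integral_dV0_add (sphere_cont_slice t0 sH) (sphere_cont_slice t0 sK)).
Qed.

Lemma J_scale c H t : sfld H -> 0 < t -> J (fun p => c * H p) t = c * J H t.
Proof. by move=> sH t0; rewrite !JE; exact: (integral_dV0_scale c (sphere_cont_slice t0 sH)). Qed.

Lemma J_ge0 H t : sfld H -> 0 < t -> (forall x, sphere x -> 0 <= H (t, x)) -> 0 <= J H t.
Proof. by move=> sH t0 h; rewrite JE; apply: integral_dV0_ge0 => //; exact: sphere_cont_slice. Qed.

Lemma J_le H K t : sfld H -> sfld K -> 0 < t ->
  (forall x, sphere x -> H (t, x) <= K (t, x)) -> J H t <= J K t.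
Proof.
move=> sH sK t0 h; rewrite -subr_ge0.
have -> : J K t - J H t = J (fun p => K p + -1 * H p) t.
  rewrite J_add// ?J_scale//; last exact: sfld_scale.
  by rewrite mulN1r.
apply: J_ge0 => //; first by apply: sfld_add => //; exact: sfld_scale.
by move=> x sx; rewrite mulN1r subr_ge0 h.
Qed.

Lemma J_derive H t : sfld H -> 0 < t -> is_derive t (1 : R) (J H : R -> R^o) (J (Dt H) t).
Proof.
move=> sH t0; rewrite JE DtE (_ : J H = (fun s => integral_dV0 (slice H s))).
  exact: is_derive_integral.
by apply/funext => s; rewrite JE.
Qed.

(** The divergence theorem for w times the horizontal gradient of H; the weights
   that occur are 1 and U ^+ 2, for the standard metric and for the moving one. *)
Lemma J_green w H K t : sfld w -> sfld H -> sfld K -> 0 < t ->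
  J (fun p => (w p * lapT H p + gam w H p) * K p) t = - J (fun p => w p * gam H K p) t.
Proof.
move=> sw sH sK t0.
have sHX i : sfld (XX i H) by exact: sfld_XX.
have sg : sfld (fun p => w p * gam H K p) by apply: sfld_mul => //; exact: sfld_gam.
have s1 : sfld (fun p => (w p * lapT H p + gam w H p) * K p).
  apply: sfld_mul => //; apply: sfld_add; last exact: sfld_gam.
  by apply: sfld_mul => //; exact: sfld_lapT.
pose B i p := K p * (w p * XX i H p).
have sB i : sfld (B i) by apply: sfld_mul => //; exact: sfld_mul.
have sXB i : sfld (XX i (B i)) by exact: sfld_XX.
apply/eqP; rewrite -addr_eq0 -J_add//; apply/eqP.
rewrite (J_eq (K := fun p => 8^-1 * \sum_i XX i (B i) p))//.
- rewrite J_scale//; last exact: sfld_sum.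
  have c i : sphere_cont (slice (XX i (B i)) t) by exact: sphere_cont_slice.
  rewrite JE (integral_dV0_sum _ c).2 big1 ?mulr0// => i _.
  by rewrite XXE; exact: integral_XT (frame_skew i) (sB i) t0.
- by apply: sfld_scale; exact: sfld_sum.
move=> x sx; have sp : S (t, x) by split=> //; exact: sphere_neq0.
rewrite /lapT /gam; move: (t, x) sp => p sp {t t0 x sx}.
have aux (a k c q r : R) : (a * (8^-1 * c) + 8^-1 * q) * k + a * (8^-1 * r) =
  8^-1 * (a * k * c + k * q + a * r) by ring.
rewrite aux; apply: mulr_congr; rewrite !mulr_sumr -!big_split; apply: eq_bigr => i _ /=.
rewrite /B XX_mul//; last exact: sfld_mul.
by rewrite XX_mul//; abs_at p; ring.
Qed.

Lemma J_cauchy w H K t : sfld w -> sfld H -> sfld K -> 0 < t ->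
  (forall x, sphere x -> 0 <= w (t, x)) ->
  J (fun p => H p * K p * w p) t ^+ 2 <=
    J (fun p => H p * H p * w p) t * J (fun p => K p * K p * w p) t.
Proof.
move=> sw sH sK t0 w0.
have s1 : sfld (fun p => H p * H p * w p) by do 2 apply: sfld_mul => //.
have s2 : sfld (fun p => H p * K p * w p) by do 2 apply: sfld_mul => //.
have s3 : sfld (fun p => K p * K p * w p) by do 2 apply: sfld_mul => //.
set a := J _ t; set b := J _ t; set c := J _ t.
have key (r s : R) : 0 <= r ^+ 2 * b + (2 * r * s) * a + s ^+ 2 * c.
  have -> : r ^+ 2 * b + (2 * r * s) * a + s ^+ 2 * c =
     J (fun p => r ^+ 2 * (H p * H p * w p) + ((2 * r * s) * (H p * K p * w p)
       + s ^+ 2 * (K p * K p * w p))) t.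
    rewrite J_add//; [|exact: sfld_scale|by apply: sfld_add; exact: sfld_scale].
    rewrite J_add//; [|exact: sfld_scale|exact: sfld_scale].
    by rewrite !J_scale// /a /b /c; ring.
  apply: J_ge0 => //.
    by apply: sfld_add; [exact: sfld_scale|apply: sfld_add; exact: sfld_scale].
  move=> x sx; have := w0 x sx; move: (w (t, x)) (H (t, x)) (K (t, x)) => w' h k hw.
  have -> : r ^+ 2 * (h * h * w') + (2 * r * s * (h * k * w') + s ^+ 2 * (k * k * w')) =
    (r * h + s * k) ^+ 2 * w' by ring.
  by rewrite mulr_ge0// sqr_ge0.
have b0 : 0 <= b by have := key 1 0; rewrite expr1n mul1r mulr0 mul0r expr0n /= mul0r !addr0.
have c0 : 0 <= c by have := key 0 1; rewrite expr1n mul1r mulr0 !mul0r expr0n /= mul0r !add0r.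
have [bz|bn] := eqVneq b 0.
  have [cz|cn] := eqVneq c 0.
    have h1 := key 1 1; have h2 := key 1 (-1).
    rewrite bz cz in h1 h2 *.
    have -> : a = 0 by lra.
    by rewrite expr0n /= mulr0.
  have h := key (- (c + 1)) a; rewrite bz in h *; rewrite mul0r.
  have : a ^+ 2 * (c + 2) <= 0 by lra.
  by rewrite pmulr_lle0// ltr_wpDl.
have bp : 0 < b by rewrite lt_def bn.
have h := key (- a) b.
have : b * (b * c - a ^+ 2) >= 0 by lra.
by rewrite pmulr_rge0// subr_ge0.
Qed.

End Calculus.

(** * The flow as a system of fields *)

Section FlowFields.
Context {R : realType} {n : nat}.
Notation V := (ambient R n).
Notation TV := (R^o * ambient R n)%type.
Notation S := (@spacetime R n).

(** What the flow provides, in terms of smooth fields: U the conformal factor, F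
   the function f, g = R_theta - alpha f, D = Delta_theta g, rho the density of
   dV_theta. The field Q is alpha, written as a quotient of smooth
   fields, which shows that alpha is smooth. The equation ff_Drho
   says that D is a divergence with respect to the weight U ^+ 2, and ff_mean is
   the choice of alpha. *)
Record flow_fields (alpha : R -> R) (U F g Q D rho : TV -> R^o) : Prop := FlowFields {
  ff_U : sfld U;
  ff_F : sfld F;
  ff_g : sfld g;
  ff_Q : sfld Q;
  ff_D : sfld D;
  ff_rho : sfld rho;
  ff_U0 : forall p, S p -> 0 < U p;
  ff_F0 : forall p, S p -> 0 < F p;
  ff_rho0 : forall p, S p -> 0 < rho p;
  ff_rhoE : forall p, S p -> rho p = U p `^ (2 + 2 / n%:R);
  ff_DtF : forall p, S p -> Dt F p = 0;
  ff_DtU : forall p, S p -> Dt U p = - (n%:R / 2) * (g p * U p);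
  ff_Dtrho : forall p, S p -> Dt rho p = - n.+1%:R * (g p * rho p);
  ff_Dtg : forall p, S p ->
    Dt g p = - (Dt Q p * F p) + g p * (g p + Q p * F p) + n.+1%:R * D p;
  ff_Drho : forall p, S p ->
    D p * rho p = U p * U p * lapT g p + 2 * (U p * gam g U p);
  ff_pde : forall p, S p -> (g p + Q p * F p) * rho p =
    U p * (- (2 + 2 / n%:R) * lapT U p + (n * n.+1)%:R / 2 * U p);
  ff_Q_alpha : forall t x, 0 < t -> x != 0 -> Q (t, x) = alpha t;
  ff_mean : forall t, 0 < t -> J (fun p => g p * rho p) t = 0;
  ff_F_static : forall t s x, F (t, x) = F (s, x)
}.

(** Differentiates in time the equation g + alpha f = R_theta, in the form in
   which the powers of u are cleared, and solves for the derivative of g. *)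
Lemma flow_algebra (nu w g Q F Qt gt lu lg G u D R0 : R) : nu != 0 -> w != 0 ->
  (g + Q * F) * w = - (2 + 2 / nu) * lu + R0 * u ->
  D * w = u * lg + 2 * G ->
  (gt + F * Qt) * w + (g + Q * F) * (- (nu / 2) * (1 + 2 / nu) * (g * w)) =
    - (2 + 2 / nu) * (- (nu / 2) * (g * lu + u * lg + 2 * G)) + R0 * (- (nu / 2) * (g * u)) ->
  gt = - (Qt * F) + g * (g + Q * F) + (nu + 1) * D.
Proof.
move=> nu0 w0 h1 h2 h3; apply: (mulIf w0).
have -> : gt * w = (gt + F * Qt) * w + (g + Q * F) * (- (nu / 2) * (1 + 2 / nu) * (g * w))
   - F * Qt * w + (nu / 2) * (1 + 2 / nu) * g * ((g + Q * F) * w) by ring.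
rewrite h3.
have -> : (- (Qt * F) + g * (g + Q * F) + (nu + 1) * D) * w =
  - (Qt * F) * w + g * ((g + Q * F) * w) + (nu + 1) * (D * w) by ring.
by rewrite h2 h1; field.
Qed.

Lemma lapT_eq (H K : TV -> R^o) p : (forall q, S q -> H q = K q) -> S p -> lapT H p = lapT K p.
Proof.
move=> e sp; apply: mulr_congr; apply: eq_bigr => i _.
by apply: XX_eq => // q sq; apply: XX_eq.
Qed.

Lemma Ck_sub (V' : normedModType R) (A B : set V') k (H : V' -> R^o) : A `<=` B -> Ck B k H -> Ck A k H.
Proof.
move=> AB; elim: k H => [|k IH] H [h1 h2]; first by split=> // x /AB; exact: h1.
by split=> [x /AB|v]; [exact: h1|apply: IH; exact: h2].
Qed.

Variables (f u0 : V -> R) (alpha : R -> R) (u : R -> V -> R).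
Hypothesis hn : (1 <= n)%N.
Hypothesis f_smooth : smooth_sphere f.
Hypothesis f_pos : forall x, sphere x -> 0 < f x.
Hypothesis u_flow : webster_flow f u0 alpha u.

Let e : R := 2 / n%:R.
Let R0 : R := (n * n.+1)%:R / 2.

Let n0 : (n%:R : R) != 0.
Proof. by rewrite pnatr_eq0 -lt0n. Qed.

Let en : n%:R / 2 * e = 1.
Proof. by rewrite /e; field. Qed.

Let U (p : TV) : R^o := hext (u p.1) p.2.
Let F (p : TV) : R^o := hext f p.2.
Let g (p : TV) : R^o := - e * (Dt U p * U p `^ (-1)).
Let rho (p : TV) : R^o := U p `^ (2 + e).
Let Q (p : TV) : R^o :=
  ((- (2 + e) * lapT U p + R0 * U p) * U p `^ (- (1 + e)) + -1 * g p) * F p `^ (-1).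
Let D (p : TV) : R^o := (U p * lapT g p + 2 * gam g U p) * U p `^ (- (1 + e)).

Let sU : sfld U.
Proof.
split=> [k|p c sp c0]; last by rewrite /U /= hom0_hext//; exact: sp.2.
have /smooth_onP h := flow_smooth u_flow.
by apply: Ck_sub (h k) => p [].
Qed.

Let U0 p : S p -> 0 < U p.
Proof.
by move=> [p1 p2]; apply: (flow_pos u_flow); [exact: ltW|exact: radial_sphere].
Qed.

Let sF : sfld F.
Proof. by have [h1 h2] := smooth0_hext f_smooth; exact: sfld_snd. Qed.

Let F0 p : S p -> 0 < F p.
Proof. by move=> [p1 p2]; apply: f_pos; exact: radial_sphere. Qed.

Let sg : sfld g.
Proof. by apply/sfld_scale/sfld_mul; [exact: sfld_Dt|exact: sfld_powR]. Qed.

Let srho : sfld rho.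
Proof. exact: sfld_powR. Qed.

Let sQ : sfld Q.
Proof.
apply: sfld_mul; last exact: sfld_powR.
apply: sfld_add; last exact: sfld_scale.
apply: sfld_mul; last exact: sfld_powR.
by apply: sfld_add; apply: sfld_scale => //; exact: sfld_lapT.
Qed.

Let sD : sfld D.
Proof.
apply: sfld_mul; last exact: sfld_powR.
apply: sfld_add; first by apply: sfld_mul => //; exact: sfld_lapT.
by apply: sfld_scale; exact: sfld_gam.
Qed.

Let pow_sum a b p : S p -> U p `^ (a + b) = U p `^ a * U p `^ b.
Proof. by move=> sp; rewrite powRD//; apply/implyP => _; rewrite gt_eqF ?U0. Qed.

Let U_inv p : S p -> U p `^ (-1) = (U p)^-1.
Proof. by move=> sp; rewrite powR_inv1// ltW ?U0. Qed.

Let U_one p : S p -> U p `^ 1 = U p.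
Proof. by move=> sp; rewrite powRr1// ltW ?U0. Qed.

Let DtU p : S p -> Dt U p = - (n%:R / 2) * (g p * U p).
Proof.
move=> sp; rewrite /g U_inv//; move: (Dt U p) (U p) (U0 sp) => a b b0.
have -> : - (n%:R / 2) * (- e * (a * b^-1) * b) = (n%:R / 2 * e) * (a * (b^-1 * b)) by ring.
by rewrite en mulVf ?gt_eqF// mulr1 mul1r.
Qed.

Let DtF p : S p -> Dt F p = 0.
Proof.
move=> sp; rewrite DtE /dT (derive_affine (L := snd : TV -> V) (l := snd) (F := hext f : V -> R^o))//.
  by rewrite /= derive0.
exact: (smooth0_diff (smooth0_hext f_smooth) sp.2).
Qed.

Let Dtrho p : S p -> Dt rho p = - n.+1%:R * (g p * rho p).
Proof.
move=> sp; rewrite /rho Dt_powR// DtU//.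
have -> : U p `^ (2 + e) = U p `^ (2 + e - 1) * U p by rewrite -[X in _ * X]U_one// -pow_sum// subrK.
move: (U p) (g p) (U p `^ _) => a b c.
have -> : (n.+1%:R : R) = (2 + e) * (n%:R / 2) by rewrite mulrDl [e * _]mulrC en -natr1; field.
ring.
Qed.

Let DtP p : S p -> Dt (fun p => U p `^ (1 + e)) p = - (n%:R / 2) * (1 + e) * (g p * U p `^ (1 + e)).
Proof.
move=> sp; rewrite Dt_powR// DtU//.
have -> : U p `^ (1 + e) = U p `^ (1 + e - 1) * U p by rewrite -[X in _ * X]U_one// -pow_sum// subrK.
by move: (U p) (g p) (U p `^ _) => a b c; ring.
Qed.

Let pow_cancel p : S p -> U p `^ (- (1 + e)) * U p `^ (1 + e) = 1.
Proof. by move=> sp; rewrite -pow_sum// addNr powRr0. Qed.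

Let pde1 p : S p -> (g p + Q p * F p) * U p `^ (1 + e) = - (2 + e) * lapT U p + R0 * U p.
Proof.
move=> sp; rewrite /Q powR_inv1 ?ltW ?F0//.
have := pow_cancel sp; have := F0 sp.
move: (U p) (lapT U p) (F p) (g p) (U p `^ (1 + e)) (U p `^ (- (1 + e))) => v l d c b a d0 ab.
have -> : (c + ((- (2 + e) * l + R0 * v) * a + -1 * c) * d^-1 * d) * b =
  c * b + ((- (2 + e) * l + R0 * v) * (a * b) + -1 * c * b) * (d^-1 * d) by ring.
by rewrite ab mulVf ?gt_eqF//; ring.
Qed.

Let D1 p : S p -> D p * U p `^ (1 + e) = U p * lapT g p + 2 * gam g U p.
Proof. by move=> sp; rewrite /D -mulrA pow_cancel// mulr1. Qed.

Let rho1 p : S p -> rho p = U p `^ (1 + e) * U p.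
Proof.
move=> sp; rewrite -[X in _ * X]U_one// -pow_sum//; congr (_ `^ _); ring.
Qed.

Let Dtg p : S p -> Dt g p = - (Dt Q p * F p) + g p * (g p + Q p * F p) + n.+1%:R * D p.
Proof.
move=> sp; rewrite -natr1.
apply: (@flow_algebra _ (U p `^ (1 + e)) _ _ _ _ _ (lapT U p) (lapT g p) (gam g U p) (U p) _ R0) => //.
- by have h := powR_gt0 (1 + e) (U0 sp); rewrite gt_eqF.
- exact: pde1.
- exact: D1.
have sQF : sfld (fun p => Q p * F p) by exact: sfld_mul.
have sgQF : sfld (fun p => g p + Q p * F p) by exact: sfld_add.
have sP : sfld (fun p => U p `^ (1 + e)) by exact: sfld_powR.
have slU : sfld (lapT U) by exact: sfld_lapT.
have sgU : sfld (fun p => g p * U p) by exact: sfld_mul.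
have L : Dt (fun p => (g p + Q p * F p) * U p `^ (1 + e)) p =
   (Dt g p + F p * Dt Q p) * U p `^ (1 + e) +
   (g p + Q p * F p) * (- (n%:R / 2) * (1 + e) * (g p * U p `^ (1 + e))).
  rewrite Dt_mul// DtP// Dt_add// Dt_mul// DtF//; abs_at p; move=> *; ring.
have Rr : Dt (fun p => - (2 + e) * lapT U p + R0 * U p) p =
   - (2 + e) * (- (n%:R / 2) * (g p * lapT U p + U p * lapT g p + 2 * gam g U p)) +
   R0 * (- (n%:R / 2) * (g p * U p)).
  rewrite Dt_add//; [|exact: sfld_scale|exact: sfld_scale].
  rewrite (Dt_scale (- (2 + e)) slU sp) (Dt_scale R0 sU sp) (DtU sp) (Dt_lapT sU sp).
  by rewrite (lapT_eq (K := fun p => - (n%:R / 2) * (g p * U p)))// lapT_scale// lapT_mul.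
rewrite -L -Rr; apply: Dt_eq => // q sq; exact: pde1.
Qed.

Lemma uT_sphere t x : sphere x -> U (t, x) = u t x.
Proof. by move=> sx; rewrite /U hext_sphere. Qed.

Let smooth_u t : 0 < t -> smooth_sphere (u t).
Proof.
move=> t0; apply/smooth_onP => k; exact: (Ck_slice t0 (sU.1 k)).
Qed.

Let webster_lap t x : 0 < t -> sphere x -> webster (u t) x =
  U (t, x) `^ (- (1 + e)) * (- (2 + e) * lapT U (t, x) + R0 * U (t, x)).
Proof.
move=> t0 sx; rewrite /webster sublaplacianE//; last exact: smooth_u.
rewrite -(uT_sphere t sx); congr (_ * (_ * _ + _)).
exact: (lapT_slice sU t0 (sphere_neq0 sx)).
Qed.

(** The flow equation, solved for R_theta. *)
Lemma webster_g t x : 0 < t -> sphere x -> webster (u t) x = alpha t * f x + g (t, x).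
Proof.
move=> t0 sx; have sp : S (t, x) by split=> //; exact: sphere_neq0.
have h := flow_eq u_flow (ltW t0) sx.
have E : derive1 (fun s => u s x : R^o) t = Dt U (t, x).
  rewrite derive1E DtE.
  have -> : (fun s => u s x : R^o) = (fun s => U (s, x)) by apply/funext => s; rewrite uT_sphere.
  by have [_ ->] := is_derive_time sU t0 (sphere_neq0 sx).
rewrite E (DtU sp) (uT_sphere t sx) in h.
have u1 : u t x != 0 by rewrite -(uT_sphere t sx) gt_eqF ?U0.
have nn : (n%:R / 2 : R) != 0 by rewrite mulf_neq0// invr_neq0.
have h' : n%:R / 2 * (- g (t, x)) * u t x = n%:R / 2 * (alpha t * f x - webster (u t) x) * u t x.
  by rewrite -h; move: (g (t, x)) (u t x) => a b; ring.
have := mulfI nn (mulIf u1 h').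
by move: (g (t, x)) (webster (u t) x) (alpha t * f x) => a b c h2; lra.
Qed.

Let Q_alpha_sphere t x : 0 < t -> sphere x -> Q (t, x) = alpha t.
Proof.
move=> t0 sx; have sp : S (t, x) by split=> //; exact: sphere_neq0.
have f0 := f_pos sx.
rewrite /Q [X in X + _]mulrC -webster_lap// webster_g// /F /= hext_sphere//.
rewrite powR_inv1 ?ltW//; move: (g (t, x)) (f x) f0 => a b b0.
have -> : (alpha t * b + a + -1 * a) / b = alpha t * (b / b) by ring.
by rewrite mulfV ?gt_eqF// mulr1.
Qed.

Lemma flow_fieldsP : flow_fields alpha U F g Q D rho.
Proof.
split=> //.
- by move=> p sp; exact: powR_gt0 (U0 sp).
- move=> p sp; rewrite (rho1 sp); have := D1 sp.
  move: (U p) (gam g U p) (lapT g p) (D p) (U p `^ (1 + e)) => v G l b w h.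
  by rewrite [LHS]mulrA h; ring.
- move=> p sp; rewrite (rho1 sp); have := pde1 sp.
  move: (U p) (g p + Q p * F p) (lapT U p) (U p `^ (1 + e)) => v b l w h.
  by rewrite [LHS]mulrA h mulrC.
- move=> t x t0 x0; rewrite -(Q_alpha_sphere t0 (radial_sphere x0)).
  have := sQ.2 (t, x) (enorm x)^-1; rewrite /= => ->//.
  by rewrite invr_gt0 enorm_gt0.
move=> t t0.
have sFr : sfld (fun p => F p * rho p) by exact: sfld_mul.
have sgr : sfld (fun p => g p * rho p) by exact: sfld_mul.
have h := flow_alpha u_flow (ltW t0).
have E1 : integral_dV (u t) f = J (fun p => F p * rho p) t.
  rewrite JE /integral_dV; apply: integral_dV0_eq; first exact: sphere_cont_slice.
  by move=> x sx; rewrite /slice /rho uT_sphere// /F /= hext_sphere.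
have E2 : integral_dV (u t) (webster (u t)) = J (fun p => alpha t * (F p * rho p) + g p * rho p) t.
  rewrite JE /integral_dV; apply: integral_dV0_eq.
    by apply: sphere_cont_slice => //; apply: sfld_add => //; exact: sfld_scale.
  by move=> x sx; rewrite webster_g// /slice /rho uT_sphere// /F /= hext_sphere// mulrDl mulrA.
move: h; rewrite E1 E2 J_add//; last exact: sfld_scale.
rewrite J_scale// => h; lra.
Qed.

(** The powers of u from the gradient and from the volume form combine to
   u ^+ 2. *)
Lemma G2E t : 0 < t -> G2 f alpha u t = J (fun p => U p * U p * gam g g p) t.
Proof.
move=> t0; rewrite /G2 /integral_dV JE.
have sUg : sfld (fun p => U p * U p * gam g g p).
  by apply: sfld_mul; [exact: sfld_mul|exact: sfld_gam].
apply: integral_dV0_eq; first exact: sphere_cont_slice.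
move=> x sx; have sp : S (t, x) by split=> //; exact: sphere_neq0.
rewrite /grad_sq; set phi := (fun x => _ - _).
have he y : y != 0 -> hext phi y = slice g t y.
  move=> y0; have sy := radial_sphere y0.
  rewrite hextE /phi webster_g// addrAC subrr add0r.
  have := sg.2 (t, y) (enorm y)^-1; rewrite /= => -> //.
  by rewrite invr_gt0 enorm_gt0.
have dh : differentiable (hext phi : V -> R^o) x.
  apply: (differentiable_eq_on open_neq0 (F := slice g t)); [by move=> y y0; rewrite he|exact: sphere_neq0|].
  exact: Ck_diff (Ck_slice t0 (sg.1 0%N)) (sphere_neq0 sx).
rewrite levi_gradE//.
have -> : 8^-1 * (\sum_i Xf (frame i) (hext phi) x * Xf (frame i) (hext phi) x) = gam g g (t, x).
  apply: mulr_congr; apply: eq_bigr => i _.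
  by rewrite -XX_slice//; [rewrite (Xf_eq _ he)//|]; exact: sphere_neq0.
rewrite -(uT_sphere t sx) /slice.
have -> : U (t, x) `^ (- (2 / n%:R)) * gam g g (t, x) * U (t, x) `^ (2 + 2 / n%:R) =
  gam g g (t, x) * (U (t, x) `^ (- (2 / n%:R)) * U (t, x) `^ (2 + 2 / n%:R)) by ring.
rewrite -pow_sum// addrCA addNr addr0.
have -> : (2 : R) = 1 + 1 by [].
by rewrite pow_sum// !U_one// mulrC.
Qed.

End FlowFields.

(** * Evolution of integrals along the flow *)

Ltac sfld_tac := repeat first [assumption | match goal with
  | |- sfld (fun p => gam ?H ?K p) => apply: (@sfld_gam _ _ H K)
  | |- sfld (fun p => lapT ?H p) => apply: (@sfld_lapT _ _ H)
  | |- sfld (fun p => Dt ?H p) => apply: (@sfld_Dt _ _ H)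
  | |- sfld (gam ?H ?K) => apply: (@sfld_gam _ _ H K)
  | |- sfld (lapT ?H) => apply: (@sfld_lapT _ _ H)
  | |- sfld (Dt ?H) => apply: (@sfld_Dt _ _ H)
  | |- sfld (fun p => @?H p * @?K p) => apply: (@sfld_mul _ _ H K)
  | |- sfld (fun p => @?H p + @?K p) => apply: (@sfld_add _ _ H K)
  | |- sfld (fun _ => ?c) => exact: (@sfld_cst _ _ c)
  end].

Section Evolution.
Context {R : realType} {n : nat}.
Notation V := (ambient R n).
Notation TV := (R^o * ambient R n)%type.
Notation S := (@spacetime R n).
Notation nu := (n%:R : R).
Notation nu1 := (n.+1%:R : R).

Implicit Types (t : R) (x : V) (p : TV) (h K : TV -> R^o).
Variables (alpha : R -> R) (U F g Q D rho : TV -> R^o).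
Hypothesis FF : flow_fields alpha U F g Q D rho.

Let sU := ff_U FF.
Let sF := ff_F FF.
Let sg := ff_g FF.
Let sQ := ff_Q FF.
Let sD := ff_D FF.
Let srho := ff_rho FF.
Let sDg : sfld (Dt g). Proof. exact: sfld_Dt. Qed.

Definition pole : V := radial (delta_mx 0 0 : V).

Lemma sphere_pole : sphere pole.
Proof.
apply: radial_sphere; apply/eqP => /matrixP /(_ 0 0); rewrite !mxE eqxx /= => /eqP.
by rewrite oner_eq0.
Qed.

(** The derivative of alpha, read off at an arbitrary point of the sphere from
   the field that represents alpha. *)
Definition alpha' t : R := Dt Q (t, pole).

Lemma spaceP t x : 0 < t -> sphere x -> S (t, x).
Proof. by move=> t0 sx; split=> //; exact: sphere_neq0. Qed.

Lemma is_derive_alpha t x : 0 < t -> sphere x ->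
  is_derive t (1 : R) (alpha : R -> R^o) (Dt Q (t, x)).
Proof.
move=> t0 sx; apply: (@near_eq_is_derive _ _ _ (fun s => Q (s, x) : R^o)).
  near=> s; rewrite (ff_Q_alpha FF)//; last exact: sphere_neq0.
  near: s; apply: open_nbhs_nbhs; split; [exact: open_gt|exact: t0].
by rewrite DtE; apply: is_derive_time => //; exact: sphere_neq0.
Unshelve. all: by end_near. Qed.

Lemma alpha_derive t : 0 < t -> is_derive t (1 : R) (alpha : R -> R^o) (alpha' t).
Proof. by move=> t0; apply: is_derive_alpha => //; exact: sphere_pole. Qed.

Lemma DtQ_alpha' t x : 0 < t -> sphere x -> Dt Q (t, x) = alpha' t.
Proof.
by move=> t0 sx; have [_ <-] := is_derive_alpha t0 sx; have [_ <-] := alpha_derive t0.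
Qed.

Lemma Q_alpha t x : 0 < t -> sphere x -> Q (t, x) = alpha t.
Proof. by move=> t0 sx; apply: (ff_Q_alpha FF) => //; exact: sphere_neq0. Qed.

Lemma Dtg_sphere t x : 0 < t -> sphere x ->
  Dt g (t, x) = - (alpha' t * F (t, x)) + g (t, x) * (g (t, x) + alpha t * F (t, x)) + nu1 * D (t, x).
Proof. by move=> t0 sx; rewrite (ff_Dtg FF (spaceP t0 sx)) DtQ_alpha'// Q_alpha. Qed.

(** Integrals against dV_theta. *)
Notation "'<<' h '>>'" := (J (fun p => h p * rho p)) (at level 0, format "'<<' h '>>'").

Lemma bracket_derive h t : sfld h -> 0 < t ->
  is_derive t (1 : R) (<<h>> : R -> R^o)
    (J (fun p => Dt h p * rho p) t - nu1 * J (fun p => (g p * h p) * rho p) t).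
Proof.
move=> sh t0; have sDh : sfld (Dt h) by exact: sfld_Dt.
have -> : J (fun p => Dt h p * rho p) t - nu1 * J (fun p => (g p * h p) * rho p) t =
   J (Dt (fun p => h p * rho p)) t.
  rewrite [RHS](J_eq (K := fun p => Dt h p * rho p + (- nu1) * (g p * h p * rho p)))//.
  - rewrite J_add//; [|by sfld_tac..].
    by rewrite J_scale// ?mulNr//; sfld_tac.
  - by sfld_tac.
  move=> x sx; have sp := spaceP t0 sx.
  rewrite (Dt_mul sh srho sp) (ff_Dtrho FF sp); abs_at (t, x); move=> *; ring.
by apply: J_derive => //; sfld_tac.
Qed.

Lemma XX_cst i c p : S p -> XX i (fun=> c : R^o) p = 0.
Proof. by move=> sp; rewrite XXE /XT derive_cst. Qed.

Lemma gam_cst c p : S p -> gam g (fun=> c : R^o) p = 0.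
Proof.
by move=> sp; rewrite /gam big1 ?mulr0// => i _; rewrite XX_cst// mulr0.
Qed.

(** The divergence form of Delta_theta g. Applied to powers of g it produces the
   energy G and the cubic quantity H. *)
Lemma J_D K t : sfld K -> 0 < t ->
  J (fun p => (K p * D p) * rho p) t = - J (fun p => U p * U p * gam g K p) t.
Proof.
move=> sK t0; rewrite -(J_green (w := fun p => U p * U p))//; last by sfld_tac.
apply: J_eq => //; first by sfld_tac.
move=> x sx; have sp := spaceP t0 sx.
have h := ff_Drho FF sp.
rewrite (gamC (fun p => U p * U p)) (gam_mulr g sU sU sp).
move: h; abs_at (t, x) => *.
match goal with h : _ * ?r = _ |- ?k * _ * ?r = _ => rewrite -mulrA h end; ring.
Qed.

Notation m := <<F>>.
Notation q := <<(fun p => F p * g p)>>.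
Notation F2 := <<(fun p => g p * g p)>>.
Notation Z := <<(fun p => g p * g p * g p)>>.
Notation F4 := <<(fun p => g p * g p * g p * g p)>>.
Notation Fg2 := <<(fun p => F p * (g p * g p))>>.
Notation Fg3 := <<(fun p => F p * (g p * g p * g p))>>.
Notation G := (J (fun p => U p * U p * gam g g p)).
Notation H := (J (fun p => U p * U p * (g p * gam g g p))).
Notation d1 := <<(fun p => F p * D p)>>.
Notation d2 := <<(fun p => F p * g p * D p)>>.
Notation d3 := <<(fun p => D p * D p)>>.

Lemma J_D1 t : 0 < t -> J (fun p => D p * rho p) t = 0.
Proof.
move=> t0; have s1 : sfld ((fun=> 1) : TV -> R^o) by exact: sfld_cst.
have := J_D s1 t0; rewrite (J_eq (K := fun p => D p * rho p))//; last 2 first.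
- by sfld_tac.
- by move=> x sx; rewrite mul1r.
move=> ->; rewrite (J_eq (K := fun p => 0 * (U p * U p)))//; last 2 first.
- by sfld_tac.
- by move=> x sx; rewrite gam_cst ?mulr0 ?mul0r//; exact: spaceP.
by rewrite J_scale// ?mul0r ?oppr0//; sfld_tac.
Qed.

Lemma J_Dg t : 0 < t -> J (fun p => g p * D p * rho p) t = - G t.
Proof. by move=> t0; exact: J_D. Qed.

Lemma J_Dgg t : 0 < t -> J (fun p => g p * g p * D p * rho p) t = - 2 * H t.
Proof.
move=> t0; have sgg : sfld (fun p => g p * g p) by sfld_tac.
rewrite (J_D sgg t0) (J_eq (K := fun p => 2 * (U p * U p * (g p * gam g g p))))//; last 2 first.
- by sfld_tac.
- move=> x sx; rewrite (gam_mulr g sg sg (spaceP t0 sx)); abs_at (t, x); move=> *; ring.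
by rewrite J_scale// ?mulNr//; sfld_tac.
Qed.

Lemma m_derive t : 0 < t -> is_derive t (1 : R) (m : R -> R^o) (- nu1 * q t).
Proof.
move=> t0; have := bracket_derive sF t0.
rewrite (J_eq (H := fun p => Dt F p * rho p) (K := fun p => 0 * rho p))//; last 2 first.
- by sfld_tac.
- by move=> x sx; rewrite (ff_DtF FF (spaceP t0 sx)).
rewrite J_scale// mul0r sub0r -mulNr.
rewrite (J_eq (H := fun p => g p * F p * rho p) (K := fun p => F p * g p * rho p))//; first by sfld_tac.
by move=> x sx; congr (_ * _); rewrite mulrC.
Qed.

Lemma vol_derive t : 0 < t -> is_derive t (1 : R) (J rho : R -> R^o) 0.
Proof.
move=> t0; have := J_derive srho t0.
rewrite (J_eq (H := Dt rho) (K := fun p => - nu1 * (g p * rho p)))//; last 2 first.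
- by sfld_tac.
- by move=> x sx; rewrite (ff_Dtrho FF (spaceP t0 sx)).
by rewrite J_scale ?(ff_mean FF)// ?mulr0//; sfld_tac.
Qed.

(** The mean of g vanishes at all times; this is its derivative. *)
Lemma alpha'_eq t : 0 < t -> alpha' t * m t = - nu * F2 t + alpha t * q t.
Proof.
move=> t0; have h := bracket_derive sg t0.
have z : is_derive t (1 : R) (<<g>> : R -> R^o) 0.
  apply: (@near_eq_is_derive _ _ _ (cst 0 : R -> R^o)).
  near=> s; rewrite (ff_mean FF)//.
  near: s; apply: open_nbhs_nbhs; split; [exact: open_gt|exact: t0].
have : J (fun p => Dt g p * rho p) t - nu1 * F2 t = 0.
  by have [_ <-] := h; have [_ <-] := z.
rewrite (J_eq (K := fun p => (- alpha' t) * (F p * rho p) + (g p * g p * rho p +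
   (alpha t * (F p * g p * rho p) + nu1 * (D p * rho p)))))//; last 2 first.
- by sfld_tac.
- move=> x sx; rewrite Dtg_sphere//; abs_at (t, x); move=> *; ring.
rewrite J_add//; [|by sfld_tac..].
rewrite J_add//; [|by sfld_tac..].
rewrite J_add//; [|by sfld_tac..].
rewrite !J_scale//; [|by sfld_tac..].
rewrite J_D1// -[nu1]natr1.
move: (F2 t) (m t) (q t) (alpha' t) (alpha t) nu => *; lra.
Unshelve. all: by end_near. Qed.

Lemma F2_derive t : 0 < t -> is_derive t (1 : R) (F2 : R -> R^o)
  (- 2 * nu1 * G t + (1 - nu) * Z t + 2 * alpha t * Fg2 t - 2 * alpha' t * q t).
Proof.
move=> t0; have sgg : sfld (fun p => g p * g p) by sfld_tac.
have := bracket_derive sgg t0.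
rewrite (J_eq (H := fun p => Dt (fun p => g p * g p) p * rho p) (K := fun p =>
   (- 2 * alpha' t) * (F p * g p * rho p) + (2 * (g p * g p * g p * rho p) +
   ((2 * alpha t) * (F p * (g p * g p) * rho p) + (2 * nu1) * (g p * D p * rho p)))))//; last 2 first.
- by sfld_tac.
- move=> x sx; rewrite (Dt_mul sg sg (spaceP t0 sx)) Dtg_sphere//; abs_at (t, x); move=> *; ring.
rewrite J_add//; [|by sfld_tac..].
rewrite J_add//; [|by sfld_tac..].
rewrite J_add//; [|by sfld_tac..].
rewrite !J_scale//; [|by sfld_tac..].
rewrite J_Dg//.
have -> : J (fun p => g p * (g p * g p) * rho p) t = Z t.
  by apply: J_eq => //; [sfld_tac|move=> x sx; abs_at (t, x); move=> *; ring].
rewrite -[nu1]natr1 => h; apply: (is_derive_eq h).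
move: (G t) (Z t) (Fg2 t) (q t) (alpha' t) (alpha t) nu => *; ring.
Qed.

Lemma Z_derive t : 0 < t -> is_derive t (1 : R) (Z : R -> R^o)
  (- 6 * nu1 * H t + (2 - nu) * F4 t + 3 * alpha t * Fg3 t - 3 * alpha' t * Fg2 t).
Proof.
move=> t0; have sgg : sfld (fun p => g p * g p) by sfld_tac.
have sggg : sfld (fun p => g p * g p * g p) by sfld_tac.
have := bracket_derive sggg t0.
rewrite (J_eq (H := fun p => Dt (fun p => g p * g p * g p) p * rho p) (K := fun p =>
   (- 3 * alpha' t) * (F p * (g p * g p) * rho p) + (3 * (g p * g p * g p * g p * rho p) +
   ((3 * alpha t) * (F p * (g p * g p * g p) * rho p) + (3 * nu1) * (g p * g p * D p * rho p)))))//; last 2 first.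
- by sfld_tac.
- move=> x sx; have sp := spaceP t0 sx.
  rewrite (Dt_mul sgg sg sp) (Dt_mul sg sg sp) Dtg_sphere//; abs_at (t, x); move=> *; ring.
rewrite J_add//; [|by sfld_tac..].
rewrite J_add//; [|by sfld_tac..].
rewrite J_add//; [|by sfld_tac..].
rewrite !J_scale//; [|by sfld_tac..].
rewrite J_Dgg//.
have -> : J (fun p => g p * (g p * g p * g p) * rho p) t = F4 t.
  by apply: J_eq => //; [sfld_tac|move=> x sx; abs_at (t, x); move=> *; ring].
rewrite -[nu1]natr1 => h; apply: (is_derive_eq h).
move: (H t) (F4 t) (Fg3 t) (Fg2 t) (alpha' t) (alpha t) nu => *; ring.
Qed.

(** Integrating by parts once more turns the energy of the pair (g, Dt g) into
   the integral of D against Dt g, in which the leading term is the square of D. *)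
Lemma G_derive t : 0 < t -> is_derive t (1 : R) (G : R -> R^o)
  ((4 - nu) * H t + 2 * alpha' t * d1 t - 2 * alpha t * d2 t - 2 * nu1 * d3 t).
Proof.
move=> t0; have sUU : sfld (fun p => U p * U p) by sfld_tac.
have sgam : sfld (gam g g) by exact: sfld_gam.
have sG : sfld (fun p => U p * U p * gam g g p) by sfld_tac.
have := J_derive sG t0.
rewrite (J_eq (H := Dt (fun p => U p * U p * gam g g p)) (K := fun p =>
   (- nu) * (U p * U p * (g p * gam g g p)) + 2 * (U p * U p * gam g (Dt g) p)))//; last 2 first.
- by sfld_tac.
- move=> x sx; have sp := spaceP t0 sx.
  rewrite (Dt_mul sUU sgam sp) (Dt_mul sU sU sp) (ff_DtU FF sp) (Dt_gam sg sp).
  by abs_at (t, x); move=> *; field.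
rewrite J_add//; [|by sfld_tac..].
rewrite !J_scale//; [|by sfld_tac..].
have -> : J (fun p => U p * U p * gam g (Dt g) p) t = - J (fun p => Dt g p * D p * rho p) t.
  by rewrite J_D// opprK.
rewrite (J_eq (H := fun p => Dt g p * D p * rho p) (K := fun p =>
   (- alpha' t) * (F p * D p * rho p) + (g p * g p * D p * rho p +
   (alpha t * (F p * g p * D p * rho p) + nu1 * (D p * D p * rho p)))))//; last 2 first.
- by sfld_tac.
- move=> x sx; rewrite Dtg_sphere//; abs_at (t, x); move=> *; ring.
rewrite J_add//; [|by sfld_tac..].
rewrite J_add//; [|by sfld_tac..].
rewrite J_add//; [|by sfld_tac..].
rewrite !J_scale//; [|by sfld_tac..].
rewrite J_Dgg// => h; apply: (is_derive_eq h).
move: (H t) (d1 t) (d2 t) (d3 t) (alpha' t) (alpha t) nu nu1 => *; ring.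
Qed.

End Evolution.

(** * Quantities controlled by an integrable rate *)

Section Clock.
Context {R : realType}.
Implicit Types (f df x dx P dP : R -> R) (a b t T K e : R).

Lemma mvt_closed f df a b : a < b ->
  (forall t : R, a <= t -> is_derive t (1 : R) (f : R -> R^o) (df t)) ->
  exists2 c, a <= c <= b & f b - f a = df c * (b - a).
Proof.
move=> ab h.
have cf : {within `[a, b], continuous (f : R -> R^o)}.
  apply: derivable_within_continuous => t; rewrite in_itv /= => /andP[ta _].
  by have [] := h t ta.
have h' t : t \in `]a, b[ -> is_derive t (1 : R) f (df t).
  by rewrite in_itv /= => /andP[/ltW ta _]; exact: h.
have [c] := MVT ab h' cf.
by rewrite in_itv /= => /andP[/ltW c1 /ltW c2] e; exists c => //; rewrite c1.
Qed.

Lemma derive_ge0_le f df a b : a <= b ->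
  (forall t : R, a <= t -> is_derive t (1 : R) (f : R -> R^o) (df t)) ->
  (forall t, a <= t -> 0 <= df t) -> f a <= f b.
Proof.
rewrite le_eqVlt => /predU1P[->//|ab] h d0.
have [c /andP[c1 _] e] := mvt_closed ab h.
by rewrite -subr_ge0 e mulr_ge0// ?d0// subr_ge0 ltW.
Qed.

Definition vanishing x := forall e, 0 < e -> exists T, forall t, T <= t -> x t <= e.

(** A nonnegative quantity which is dominated by the rate of decrease of a
   bounded clock, and which grows at most at that rate, tends to 0: over a unit
   of time it is small somewhere and cannot recover afterwards. *)
Lemma clock_vanishing x dx P dP T K : 0 <= K ->
  (forall t, T <= t -> is_derive t (1 : R) (x : R -> R^o) (dx t)) ->
  (forall t, T <= t -> is_derive t (1 : R) (P : R -> R^o) (dP t)) ->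
  (forall t, T <= t -> 0 <= P t) ->
  (forall t, T <= t -> 0 <= x t) ->
  (forall t, T <= t -> x t <= - dP t) ->
  (forall t, T <= t -> dx t <= - (K * dP t)) -> vanishing x.
Proof.
move=> K0 hx hP P0 x0 xP dxP.
have P_le a b : T <= a -> a <= b -> P b <= P a.
  move=> Ta ab; rewrite -lerN2; apply: (@derive_ge0_le (fun t => - P t) (fun t => - dP t) a b ab).
    by move=> t at_; apply: is_deriveN; apply: hP; exact: le_trans at_.
  by move=> t at_; have Tt := le_trans Ta at_; exact: le_trans (x0 _ Tt) (xP _ Tt).
have x_le a b : T <= a -> a <= b -> x b <= x a + K * (P a - P b).
  move=> Ta ab; suff : - (x a + K * P a) <= - (x b + K * P b) by move=> ?; lra.
  apply: (@derive_ge0_le (fun t => - (x t + K * P t)) (fun t => - (dx t + K * dP t)) a b ab).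
    move=> t at_; have Tt := le_trans Ta at_.
    have hxt := hx t Tt; have hPt := hP t Tt.
    by apply: is_deriveN; apply: is_deriveD => //; apply: (is_deriveZ (f := P) K).
  by move=> t at_; have := dxP t (le_trans Ta at_); rewrite oppr_ge0; lra.
pose E := [set P t | t in [set t | T <= t]].
have hE : has_inf E.
  split; first by exists (P T); exists T => //=.
  by exists 0 => _ [t /= Tt <-]; exact: P0.
move=> e e0.
have d0 : 0 < e / (K + 1) by rewrite divr_gt0// ltr_wpDl.
have [_ [T1 /= TT1 <-] hT1] := inf_adherent d0 hE.
exists (T1 + 1) => t T1t.
pose s := t - 1.
have Ts : T1 <= s by rewrite lerBrDr.
have TTs := le_trans TT1 Ts.
have st : s < t by rewrite ltrBlDr ltrDl.
have hP' r : s <= r -> is_derive r (1 : R) (P : R -> R^o) (dP r).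
  by move=> sr; apply: hP; exact: le_trans sr.
have [c /andP[c1 c2] ec] := mvt_closed st hP'.
have Tc := le_trans TTs c1.
have inft : inf E <= P t.
  by apply: ge_inf; [exact: hE.2|exists t => //=; exact: le_trans (ltW st)].
have P1 := P_le _ _ TT1 Ts.
have P2 := P_le _ _ TTs c1.
have P3 := P_le _ _ Tc c2.
have xc := xP _ Tc.
have -> : e = e / (K + 1) + K * (e / (K + 1)) by field; apply/eqP => ?; lra.
have ts : t - s = 1 by rewrite /s; ring.
rewrite ts mulr1 in ec.
apply: (le_trans (x_le _ _ Tc c2)); apply: lerD; first by lra.
by apply: ler_wpM2l => //; lra.
Qed.

(** The same with quadratic growth, which the substitution x / (1 + x) absorbs. *)
Lemma clock_vanishing_quadratic x dx P dP T K : 0 <= K ->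
  (forall t, T <= t -> is_derive t (1 : R) (x : R -> R^o) (dx t)) ->
  (forall t, T <= t -> is_derive t (1 : R) (P : R -> R^o) (dP t)) ->
  (forall t, T <= t -> 0 <= P t) ->
  (forall t, T <= t -> 0 <= x t) ->
  (forall t, T <= t -> x t <= - dP t) ->
  (forall t, T <= t -> dx t <= - (K * dP t) * (1 + x t) ^+ 2) -> vanishing x.
Proof.
move=> K0 hx hP P0 x0 xP dxP.
have x1 t : T <= t -> 0 < 1 + x t by move=> Tt; rewrite ltr_wpDr// x0.
pose y t : R := 1 - (1 + x t)^-1.
have yE t : T <= t -> y t = x t / (1 + x t).
  by move=> Tt; have := x1 t Tt; rewrite /y => h; field; exact: lt0r_neq0.
have vy : vanishing y.
  apply: (@clock_vanishing y (fun t => dx t / (1 + x t) ^+ 2) P dP T K) => //.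
  - move=> t Tt; have h1 := hx t Tt; have n1 := lt0r_neq0 (x1 t Tt).
    have h2 : is_derive t (1 : R) ((fun s => 1 + x s) : R -> R^o) (dx t).
      by apply: (is_derive_eq (is_deriveD (is_derive_cst (1 : R^o) (t : R^o) 1) h1)); rewrite add0r.
    have h3 := @is_deriveV R (fun s => 1 + x s) t (dx t) (1 : R) n1 h2.
    apply: (is_derive_eq (is_deriveB (is_derive_cst (1 : R^o) (t : R^o) 1) h3)).
    by rewrite sub0r scaleNr opprK /GRing.scale /= mulrC.
  - by move=> t Tt; rewrite yE// divr_ge0 ?x0// ltW// x1.
  - move=> t Tt; rewrite yE// ler_pdivrMr ?x1//.
    by apply: (le_trans (xP _ Tt)); rewrite ler_peMr// ?lerDl ?x0//; exact: le_trans (x0 _ Tt) (xP _ Tt).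
  - by move=> t Tt; rewrite ler_pdivrMr ?exprn_gt0 ?x1//; exact: dxP.
move=> e e0; have e1 : 0 < 1 + e by lra.
have [T1 h] := vy _ (divr_gt0 e0 e1).
exists (Num.max T T1) => t; rewrite ge_max => /andP[Tt T1t].
have := h _ T1t; rewrite yE// ler_pdivrMr ?x1// mulrAC ler_pdivlMr// => {}h.
by nra.
Qed.

(** Here P t plays the integral over [t, +oo[ of a function that dominates x;
   only its derivative and its sign matter. *)
Definition integrable_bound x := exists P dP T,
  [/\ forall t, T <= t -> is_derive t (1 : R) (P : R -> R^o) (dP t),
      forall t, T <= t -> 0 <= P t & forall t, T <= t -> x t <= - dP t].

Lemma integrable_bound_le x y T : integrable_bound y -> (forall t, T <= t -> x t <= y t) ->
  integrable_bound x.
Proof.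
move=> [P [dP [T1 [h1 h2 h3]]]] xy; exists P, dP, (Num.max T T1).
split=> t; rewrite ge_max => /andP[Tt T1t]; [exact: h1|exact: h2|].
exact: le_trans (xy _ Tt) (h3 _ T1t).
Qed.

Lemma integrable_bound_add x y : integrable_bound x -> integrable_bound y ->
  integrable_bound (fun t => x t + y t).
Proof.
move=> [P [dP [T1 [h1 h2 h3]]]] [P' [dP' [T2 [k1 k2 k3]]]].
exists (fun t => P t + P' t), (fun t => dP t + dP' t), (Num.max T1 T2).
split=> t; rewrite ge_max => /andP[Tt T1t].
- by have := h1 _ Tt; have := k1 _ T1t => a b; exact: is_deriveD.
- by rewrite addr_ge0 ?h2 ?k2.
- by rewrite opprD lerD ?h3 ?k3.
Qed.

Lemma integrable_bound_scale c x : 0 <= c -> integrable_bound x -> integrable_bound (fun t => c * x t).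
Proof.
move=> c0 [P [dP [T1 [h1 h2 h3]]]].
exists (fun t => c * P t), (fun t => c * dP t), T1; split=> t Tt.
- by have h := h1 _ Tt; exact: (is_deriveZ (f := P) c).
- by rewrite mulr_ge0// h2.
- by rewrite -mulrN ler_wpM2l// h3.
Qed.

Lemma integrable_bound_derive P dP T :
  (forall t, T <= t -> is_derive t (1 : R) (P : R -> R^o) (dP t)) ->
  (forall t, T <= t -> 0 <= P t) -> integrable_bound (fun t => - dP t).
Proof. by move=> h1 h2; exists P, dP, T. Qed.

(** Antiderivatives of both bounds, added up, are the clock. *)
Lemma integrable_vanishing x dx z T :
  (forall t, T <= t -> is_derive t (1 : R) (x : R -> R^o) (dx t)) ->
  (forall t, T <= t -> 0 <= x t) -> (forall t, T <= t -> 0 <= z t) ->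
  integrable_bound x -> integrable_bound z ->
  (forall t, T <= t -> dx t <= z t * (1 + x t) ^+ 2) -> vanishing x.
Proof.
move=> hx x0 z0 [P [dP [T1 [h1 h2 h3]]]] [P' [dP' [T2 [k1 k2 k3]]]] hd.
have mT t : Num.max T (Num.max T1 T2) <= t -> [/\ T <= t, T1 <= t & T2 <= t].
  by rewrite !ge_max => /and3P.
apply: (@clock_vanishing_quadratic x dx (fun t => P t + P' t) (fun t => dP t + dP' t)
  (Num.max T (Num.max T1 T2)) 1) => // t /mT [Tt T1t T2t].
- exact: hx.
- by have := h1 _ T1t; have := k1 _ T2t => a b; exact: is_deriveD.
- by rewrite addr_ge0 ?h2 ?k2.
- exact: x0.
- by have := h3 _ T1t; have := k3 _ T2t; have := z0 _ Tt; lra.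
apply: (le_trans (hd _ Tt)); apply: ler_wpM2r; first exact: sqr_ge0.
by have := h3 _ T1t; have := k3 _ T2t; have := x0 _ Tt; lra.
Qed.

Lemma vanishing_cvg x : (exists T, forall t, T <= t -> 0 <= x t) -> vanishing x ->
  x t @[t --> +oo] --> (0 : R).
Proof.
move=> [T0 x0] v; apply/cvgrPdist_le => e e0; have [T h] := v e e0.
exists (Num.max T T0); split; first exact: num_real.
move=> t; rewrite gt_max => /andP[/ltW Tt /ltW T0t].
by rewrite sub0r normrN ger0_norm ?x0// h.
Qed.

Lemma vanishing_le x y T : vanishing y -> (forall t, T <= t -> x t <= y t) -> vanishing x.
Proof.
move=> v xy e e0; have [T1 h] := v e e0; exists (Num.max T T1) => t.
by rewrite ge_max => /andP[Tt T1t]; exact: le_trans (xy _ Tt) (h _ T1t).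
Qed.

End Clock.

(** * The monotone quantity of the flow *)

Section Bounds.
Context {R : realType} {n : nat}.
Notation V := (ambient R n).
Notation TV := (R^o * ambient R n)%type.
Notation S := (@spacetime R n).
Notation nu := (n%:R : R).
Notation nu1 := (n.+1%:R : R).

Implicit Types (t : R) (x : V) (p : TV) (h K : TV -> R^o).
Variables (alpha : R -> R) (U F g Q D rho : TV -> R^o).
Hypothesis FF : flow_fields alpha U F g Q D rho.
Hypothesis hn : (1 <= n)%N.

Let sU := ff_U FF.
Let sF := ff_F FF.
Let sg := ff_g FF.
Let sQ := ff_Q FF.
Let sD := ff_D FF.
Let srho := ff_rho FF.

Notation "'<<' h '>>'" := (J (fun p => h p * rho p)) (at level 0, format "'<<' h '>>'").
Notation m := <<F>>.
Notation q := <<(fun p => F p * g p)>>.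
Notation F2 := <<(fun p => g p * g p)>>.
Notation alpha' := (alpha' Q).

Lemma rho_ge0 t x : 0 < t -> sphere x -> 0 <= rho (t, x).
Proof. by move=> t0 sx; exact/ltW/(ff_rho0 FF)/spaceP. Qed.

Lemma F_bounds : exists c C : R, 0 < c /\ forall t x, sphere x -> c <= F (t, x) <= C.
Proof.
have F0 : forall p, S p -> 0 < F p := ff_F0 FF.
have [C C0 hC] := sphere_cont_bounded (sphere_cont_slice ltr01 sF).
have sI : sfld (fun p => F p `^ (-1)) by apply: sfld_powR.
have [M M0 hM] := sphere_cont_bounded (sphere_cont_slice ltr01 sI).
have M1 : 0 < M + 1 by lra.
exists (M + 1)^-1, C; split; first by rewrite invr_gt0.
move=> t x sx; rewrite (ff_F_static FF t 1).
have f0 : 0 < F (1, x) by apply: F0; exact: spaceP.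
apply/andP; split; last by have := hC x sx; rewrite /slice ger0_norm// ltW.
have := hM x sx; rewrite /slice (powR_inv1 (ltW f0)) ger0_norm ?invr_ge0 ?(ltW f0)// => h.
rewrite -[leRHS]invrK lef_pV2 ?posrE ?invr_gt0//; lra.
Qed.

Lemma vol_const t : 1 <= t -> J rho t = J rho 1.
Proof.
move=> t1; apply/eqP; rewrite eq_le; apply/andP; split; last first.
  apply: (derive_ge0_le (df := fun=> 0) t1) => // s s1.
  by apply: (vol_derive FF); exact: lt_le_trans s1.
rewrite -lerN2; apply: (derive_ge0_le (f := fun s => - J rho s) (df := fun=> - 0) t1) => [s s1|_ _]; last by rewrite oppr0.
by have h := vol_derive FF (lt_le_trans ltr01 s1); exact: is_deriveN.
Qed.

Lemma vol_gt0 : 0 < J rho 1.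
Proof.
have h : 0 <= J rho 1 by apply: J_ge0 => // x; exact: rho_ge0.
rewrite lt_neqAle h andbT eq_sym; apply/eqP; rewrite JE => e.
have := integral_dV0_eq0 (sphere_cont_slice ltr01 srho) (fun x sx => rho_ge0 ltr01 sx) e (@sphere_pole R n).
by move=> /eqP; rewrite /slice gt_eqF//; apply: (ff_rho0 FF); apply: spaceP => //; exact: sphere_pole.
Qed.

(** The total Webster curvature is the energy of the Yamabe problem, which is a sum
   of squares; hence alpha is nonnegative. *)
Lemma J_pde t : 0 < t -> alpha t * m t =
  (2 + 2 / nu) * J (gam U U) t + (n * n.+1)%:R / 2 * J (fun p => U p * U p) t.
Proof.
move=> t0.
have sQF : sfld (fun p => Q p * F p) by exact: sfld_mul.
have s1 : sfld ((fun=> 1) : TV -> R^o) by exact: sfld_cst.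
have E1 : J (fun p => (g p + Q p * F p) * rho p) t = alpha t * m t.
  rewrite (J_eq (K := fun p => g p * rho p + alpha t * (F p * rho p)))//; last 2 first.
  - by sfld_tac.
  - by move=> x sx; rewrite (Q_alpha FF)//; abs_at (t, x); move=> *; ring.
  rewrite J_add//; [|by sfld_tac..].
  by rewrite J_scale ?(ff_mean FF)// ?add0r//; sfld_tac.
rewrite -E1 (J_eq (K := fun p => (- (2 + 2 / nu)) * (1 * lapT U p * U p) +
   (n * n.+1)%:R / 2 * (U p * U p)))//; last 2 first.
- by sfld_tac.
- by move=> x sx; rewrite (ff_pde FF (spaceP t0 sx)); abs_at (t, x); move: (2 + 2 / nu) (_%:R / 2 : R) => *; ring.
rewrite J_add//; [|by sfld_tac..].
rewrite [X in X + _]J_scale//; last by sfld_tac.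
rewrite [X in _ + X]J_scale//; last by sfld_tac.
congr (_ + _); rewrite mulNr -mulrN; congr (_ * _).
have := J_green s1 sU sU t0.
rewrite (J_eq (H := fun p => 1 * gam U U p) (K := gam U U))//; last 2 first.
- by sfld_tac.
- by move=> x sx; rewrite mul1r.
rewrite (J_eq (K := fun p => 1 * lapT U p * U p))//; last 2 first.
- by sfld_tac.
- move=> x sx; rewrite gamC gam_cst ?addr0//; exact: spaceP.
by move=> ->; rewrite opprK.
Qed.

Section Constants.
Variables cF CF : R.
Hypothesis cF0 : 0 < cF.
Hypothesis hF : forall t x, sphere x -> cF <= F (t, x) <= CF.
Let v0 := J rho 1.
Let m0 := cF * v0.

Let v0_gt0 : 0 < v0. Proof. exact: vol_gt0. Qed.
Let CF0 : 0 < CF.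
Proof. by have /andP[h1 h2] := hF 1 (@sphere_pole R n); exact: lt_le_trans cF0 (le_trans h1 h2). Qed.
Lemma m0_gt0 : 0 < m0. Proof. exact: mulr_gt0. Qed.

Lemma m_bounds t : 1 <= t -> m0 <= m t <= CF * v0.
Proof.
move=> t1; have t0 : 0 < t by exact: lt_le_trans t1.
rewrite /m0 /v0 -(vol_const t1) -!(J_scale _ srho t0); apply/andP; split; apply: J_le => //; try by sfld_tac.
all: move=> x sx; apply: ler_wpM2r; [exact: rho_ge0|by have /andP[] := hF t sx].
Qed.

Lemma alpha_ge0 t : 1 <= t -> 0 <= alpha t.
Proof.
move=> t1; have t0 : 0 < t by exact: lt_le_trans t1.
have /andP[mt _] := m_bounds t1.
have mt0 : 0 < m t := lt_le_trans m0_gt0 mt.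
rewrite -(pmulr_lge0 _ mt0) J_pde//; apply: addr_ge0; apply: mulr_ge0.
- by rewrite addr_ge0// divr_ge0.
- by apply: J_ge0 => //; [sfld_tac|move=> x _; exact: gam_ge0].
- by rewrite divr_ge0.
- by apply: J_ge0 => //; [sfld_tac|move=> x _; rewrite -expr2 sqr_ge0].
Qed.

Lemma F2_ge0 t : 1 <= t -> 0 <= F2 t.
Proof.
move=> t1; have t0 : 0 < t by exact: lt_le_trans t1.
apply: J_ge0 => //; first by sfld_tac.
by move=> x sx; apply: mulr_ge0; [rewrite -expr2 sqr_ge0|exact: rho_ge0].
Qed.

Lemma FF_le t : 1 <= t -> J (fun p => F p * F p * rho p) t <= CF ^+ 2 * v0.
Proof.
move=> t1; have t0 : 0 < t by exact: lt_le_trans t1.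
rewrite /v0 -(vol_const t1) -(J_scale _ srho t0); apply: J_le => //; try by sfld_tac.
move=> x sx; apply: ler_wpM2r; first exact: rho_ge0.
have /andP[h1 h2] := hF t sx; have h0 : 0 <= F (t, x) by apply: le_trans h1; exact: ltW.
by rewrite expr2 ler_pM.
Qed.

Lemma q_sqr t : 1 <= t -> q t ^+ 2 <= CF ^+ 2 * v0 * F2 t.
Proof.
move=> t1; have t0 : 0 < t by exact: lt_le_trans t1.
apply: (le_trans (J_cauchy srho sF sg t0 _)) => [x sx|]; first exact: rho_ge0.
by apply: ler_wpM2r; [exact: F2_ge0|exact: FF_le].
Qed.

(** The clock alpha m^(1/(n+1)), where m is the integral of f: since
   m' = -(n+1) q, the power cancels the term alpha q in the equation for alpha',
   and what remains is a multiple of -F2. *)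
Let a : R := nu1^-1.
Let clock t := alpha t * m t `^ a.
Let w t := m t `^ (a - 1).

Lemma clock_derive t : 1 <= t -> is_derive t (1 : R) (clock : R -> R^o) (- (nu * w t * F2 t)).
Proof.
move=> t1; have t0 : 0 < t by exact: lt_le_trans t1.
have mt : 0 < m t by apply: lt_le_trans m0_gt0 _; have /andP[] := m_bounds t1.
have hw : m t `^ a = w t * m t.
  by rewrite /w -{3}(powRr1 (ltW mt)) -powRD ?subrK// (gt_eqF mt) implybT.
have h1 := alpha_derive FF t0.
have h2 := m_derive FF t0.
have h3 : is_derive t (1 : R) ((fun s => m s `^ a) : R -> R^o) (a * w t * (- nu1 * q t)).
  by have := is_derive1_comp (is_derive1_powR a mt) h2.
have h4 := is_deriveM h1 h3.
apply: (is_derive_eq h4).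
have e := alpha'_eq FF t0; have nu10 : nu1 != 0 by rewrite pnatr_eq0.
rewrite hw /GRing.scale /=; rewrite /a.
move: e; move: (w t) (m t) (q t) (alpha t) (alpha' t) (F2 t) => {h1 h2 h3 h4 hw mt} w' m' q' al al' f2 e.
have -> : w' * m' * al' = w' * (al' * m') by ring.
by rewrite e; field.
Qed.

Let w0 := m0 `^ a / (CF * v0).

Lemma w_ge t : 1 <= t -> w0 <= w t.
Proof.
move=> t1; have /andP[h1 h2] := m_bounds t1; have mt : 0 < m t := lt_le_trans m0_gt0 h1.
have -> : w t = m t `^ a / m t.
  by rewrite /w powRD ?(gt_eqF mt) ?implybT// powRN powRr1// ltW.
apply: ler_pM; [exact: powR_ge0|by rewrite invr_ge0 ltW// mulr_gt0| |].
  by apply: ge0_ler_powR => //; rewrite ?nnegrE ?(ltW m0_gt0) ?(ltW mt)// /a invr_ge0.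
by rewrite lef_pV2 ?posrE// mulr_gt0.
Qed.

Let w0_gt0 : 0 < w0.
Proof. by rewrite divr_gt0 ?powR_gt0 ?m0_gt0// mulr_gt0. Qed.

Lemma clock_ge0 t : 1 <= t -> 0 <= clock t.
Proof. by move=> t1; rewrite mulr_ge0 ?alpha_ge0 ?powR_ge0. Qed.

(** The clock decreases at a rate at least proportional to F2 and is nonnegative. *)
Lemma integrable_F2 : integrable_bound F2.
Proof.
have h := integrable_bound_derive clock_derive clock_ge0.
have i0 : 0 <= w0^-1 by rewrite invr_ge0 ltW.
apply: (integrable_bound_le (T := 1) (integrable_bound_scale i0 h)) => t t1.
rewrite opprK mulrA ler_peMl ?F2_ge0//.
rewrite ler_pdivlMl// mulr1; apply: (le_trans (w_ge t1)).
by rewrite ler_peMl ?ler1n//; exact: le_trans (ltW w0_gt0) (w_ge t1).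
Qed.

Lemma alpha_le : exists A, forall t, 1 <= t -> alpha t <= A.
Proof.
exists (clock 1 / m0 `^ a) => t t1; rewrite ler_pdivlMr ?powR_gt0 ?m0_gt0//.
have /andP[h1 _] := m_bounds t1.
apply: (@le_trans _ _ (clock t)).
  apply: ler_wpM2l; first exact: alpha_ge0.
  by apply: ge0_ler_powR => //; rewrite ?nnegrE ?(ltW m0_gt0)//; [rewrite /a invr_ge0|exact: le_trans (ltW m0_gt0) h1].
rewrite -lerN2; apply: (derive_ge0_le (f := fun s => - clock s) (df := fun s => - - (nu * w s * F2 s)) t1) => s s1.
  by have h := clock_derive s1; exact: is_deriveN.
by rewrite opprK mulr_ge0 ?F2_ge0// mulr_ge0// powR_ge0.
Qed.

End Constants.
End Bounds.

(** * From integrability in time to the vanishing of the Dirichlet energy *)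

Ltac nneg := repeat first [assumption | match goal with
  | |- is_true (0 <= _ ^+ 2)%R => exact: sqr_ge0
  | |- is_true (0 <= _ + _)%R => apply: addr_ge0
  | |- is_true (0 <= _ * _)%R => apply: mulr_ge0
  | |- is_true (0 <= _ / _)%R => apply: divr_ge0
  end | done | apply: ltW; assumption].

Section GrowthAlgebra.
Context {R : realType}.
Implicit Types (m a nu A B q : R).

(** Bounds for the rate alpha' in terms of F2, where q is of the order of the
   square root of F2 by the Cauchy-Schwarz inequality. *)
Lemma rate_sqr m m0 a' nu f2 a q B A : 0 < m0 -> m0 <= m -> 0 <= a -> a <= A -> 0 <= f2 -> 0 <= B ->
  q ^+ 2 <= B * f2 -> a' * m = - nu * f2 + a * q ->
  a' ^+ 2 <= (2 * nu ^+ 2 + 2 * A ^+ 2 * B) / m0 ^+ 2 * (f2 + f2 ^+ 2).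
Proof.
move=> m0_gt0 hm a0 aA f20 B0 hq e.
rewrite mulrAC ler_pdivlMr ?exprn_gt0//.
apply: (@le_trans _ _ (a' ^+ 2 * m ^+ 2)).
  by apply: ler_wpM2l; [exact: sqr_ge0|rewrite ler_sqr ?nnegrE; lra].
rewrite -exprMn e.
have h1 : a ^+ 2 <= A ^+ 2 by rewrite ler_sqr ?nnegrE; lra.
have h2 : a ^+ 2 * q ^+ 2 <= A ^+ 2 * (B * f2) by rewrite ler_pM ?sqr_ge0.
have h3 : (- nu * f2 + a * q) ^+ 2 <= 2 * nu ^+ 2 * f2 ^+ 2 + 2 * (a ^+ 2 * q ^+ 2).
  have := sqr_ge0 (nu * f2 + a * q); rewrite !expr2; lra.
have h4 : 0 <= nu ^+ 2 * f2 by rewrite mulr_ge0 ?sqr_ge0.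
have h5 : 0 <= A ^+ 2 * B * f2 ^+ 2 by nneg.
move: h2 h3 h4 h5; lra.
Qed.

(** The term -n F2 dominates a multiple of the square root of F2 up to a
   constant, whence an upper bound without any smallness of F2. *)
Lemma rate_le m m0 a' nu f2 a q B A : 0 < m0 -> m0 <= m -> 0 <= a -> a <= A -> 0 <= f2 -> 0 <= B ->
  1 <= nu -> q ^+ 2 <= B * f2 -> a' * m = - nu * f2 + a * q ->
  a' <= A ^+ 2 * B / (4 * m0).
Proof.
move=> m0_gt0 hm a0 aA f20 B0 nu1 hq e.
have h1 : a ^+ 2 <= A ^+ 2 by rewrite ler_sqr ?nnegrE; lra.
have h2 : a ^+ 2 * q ^+ 2 <= A ^+ 2 * (B * f2) by rewrite ler_pM ?sqr_ge0.
have h0 : 0 <= A ^+ 2 * B by rewrite mulr_ge0 ?sqr_ge0.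
have h3 : a * q <= f2 + A ^+ 2 * B / 4.
  apply: (le_trans (ler_norm _)); rewrite -ler_sqr ?nnegrE ?addr_ge0 ?divr_ge0//.
  rewrite real_normK ?num_real// exprMn; apply: (le_trans h2).
  have := sqr_ge0 (f2 - A ^+ 2 * B / 4); rewrite !expr2; lra.
have h4 : f2 <= nu * f2 by rewrite ler_peMl.
have h5 : a' * m <= A ^+ 2 * B / 4 by rewrite e; lra.
have [an|ap] := leP a' 0; first by apply: (le_trans an); rewrite divr_ge0//; lra.
rewrite invfM mulrA ler_pdivlMr//; apply: le_trans h5.
by rewrite ler_wpM2l// ltW.
Qed.

(** When F2 is small, the cubic term is at most a small multiple of the quartic one
   and is absorbed. *)
Lemma absorb_sobolev (Cs G Z W f2 f4 : R) : 0 <= Cs -> 0 <= f2 -> 0 <= f4 -> f2 * (6 * Cs + 1) <= 1 ->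
  Z ^+ 2 <= f2 * f4 -> f4 <= Cs * (4 * G + Z + W) ^+ 2 ->
  f4 <= 6 * Cs * (16 * G ^+ 2 + W ^+ 2).
Proof.
move=> C0 f20 f40 h hZ hs.
have h1 : (4 * G + Z + W) ^+ 2 <= 3 * (16 * G ^+ 2 + Z ^+ 2 + W ^+ 2).
  have := sqr_ge0 (4 * G - Z); have := sqr_ge0 (4 * G - W); have := sqr_ge0 (Z - W).
  by rewrite !expr2; lra.
have h2 : f4 <= Cs * (3 * (16 * G ^+ 2 + Z ^+ 2 + W ^+ 2)).
  by apply: (le_trans hs); exact: ler_wpM2l.
have h3 : Cs * Z ^+ 2 <= Cs * (f2 * f4) by exact: ler_wpM2l.
have h4 : f2 * (6 * Cs + 1) * f4 <= 1 * f4 by exact: ler_wpM2r.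
have h5 : 0 <= f2 * f4 by exact: mulr_ge0.
move: h2 h3 h4 h5; lra.
Qed.

Lemma quadratic_growth (x y : R) : 0 <= x -> 0 <= y -> y ^+ 2 + x <= (x + y) * (1 + y) ^+ 2.
Proof.
move=> x0 y0.
have h1 : 0 <= x * y by exact: mulr_ge0.
have h2 : 0 <= y ^+ 3 by exact: exprn_ge0.
have h3 : 0 <= x * y ^+ 2 by rewrite mulr_ge0 ?sqr_ge0.
have h4 : 0 <= y ^+ 2 by exact: sqr_ge0.
have -> : (x + y) * (1 + y) ^+ 2 = x + y + 2 * (x * y) + 2 * y ^+ 2 + x * y ^+ 2 + y ^+ 3 by ring.
lra.
Qed.

End GrowthAlgebra.

Section Growth.
Context {R : realType} {n : nat}.
Notation V := (ambient R n).
Notation TV := (R^o * ambient R n)%type.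
Notation S := (@spacetime R n).
Notation nu := (n%:R : R).
Notation nu1 := (n.+1%:R : R).

Implicit Types (t : R) (x : V) (p : TV) (h k : TV -> R^o).
Variables (alpha : R -> R) (U F g Q D rho : TV -> R^o).
Hypothesis FF : flow_fields alpha U F g Q D rho.
Hypothesis hn : (1 <= n)%N.

Let sU := ff_U FF.
Let sF := ff_F FF.
Let sg := ff_g FF.
Let sQ := ff_Q FF.
Let sD := ff_D FF.
Let srho := ff_rho FF.

Notation "'<<' h '>>'" := (J (fun p => h p * rho p)) (at level 0, format "'<<' h '>>'").
Notation m := <<F>>.
Notation q := <<(fun p => F p * g p)>>.
Notation F2 := <<(fun p => g p * g p)>>.
Notation Z := <<(fun p => g p * g p * g p)>>.
Notation F4 := <<(fun p => g p * g p * g p * g p)>>.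
Notation Fg2 := <<(fun p => F p * (g p * g p))>>.
Notation Fg3 := <<(fun p => F p * (g p * g p * g p))>>.
Notation G := (J (fun p => U p * U p * gam g g p)).
Notation H := (J (fun p => U p * U p * (g p * gam g g p))).
Notation d1 := <<(fun p => F p * D p)>>.
Notation d2 := <<(fun p => F p * g p * D p)>>.
Notation d3 := <<(fun p => D p * D p)>>.
Notation alpha' := (alpha' Q).

Variables cF CF A : R.
Hypothesis cF0 : 0 < cF.
Hypothesis hF : forall t x, sphere x -> cF <= F (t, x) <= CF.
Hypothesis hA : forall t, 1 <= t -> alpha t <= A.

Let v0 := J rho 1.
Let m0 := cF * v0.
Let B := CF ^+ 2 * v0.
Let C1 := (2 * nu ^+ 2 + 2 * A ^+ 2 * B) / m0 ^+ 2.

Let v0_gt0 : 0 < v0. Proof. exact: (vol_gt0 FF). Qed.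
Let m00 : 0 < m0. Proof. exact: mulr_gt0. Qed.
Let B0 : 0 <= B. Proof. by rewrite mulr_ge0 ?sqr_ge0 ?ltW. Qed.
Let nu_ge1 : 1 <= nu. Proof. by rewrite ler1n. Qed.
Let C10 : 0 <= C1.
Proof. by rewrite divr_ge0 ?sqr_ge0// addr_ge0// mulr_ge0 ?sqr_ge0// mulr_ge0 ?sqr_ge0. Qed.
Let CF0 : 0 < CF.
Proof. by have /andP[h1 h2] := hF 1 (@sphere_pole R n); exact: lt_le_trans cF0 (le_trans h1 h2). Qed.
Let A0 : 0 <= A.
Proof. exact: le_trans (alpha_ge0 FF cF0 hF (lexx 1)) (hA (lexx 1)). Qed.
Let pos t : 1 <= t -> 0 < t. Proof. exact: lt_le_trans. Qed.

Let F2_pos t : 1 <= t -> 0 <= F2 t. Proof. exact: (F2_ge0 FF). Qed.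
Let a0 t : 1 <= t -> 0 <= alpha t. Proof. exact: (alpha_ge0 FF cF0 hF). Qed.
Let hm t : 1 <= t -> m0 <= m t. Proof. by move=> t1; have /andP[] := m_bounds FF hF t1. Qed.
Let hq t : 1 <= t -> q t ^+ 2 <= B * F2 t. Proof. exact: (q_sqr FF cF0 hF). Qed.

Lemma alpha'_sqr t : 1 <= t -> alpha' t ^+ 2 <= C1 * (F2 t + F2 t ^+ 2).
Proof.
move=> t1; exact: (rate_sqr m00 (hm t1) (a0 t1) (hA t1) (F2_pos t1) B0 (hq t1) (alpha'_eq FF (pos t1))).
Qed.

Lemma alpha'_le t : 1 <= t -> alpha' t <= A ^+ 2 * B / (4 * m0).
Proof.
move=> t1; exact: (rate_le m00 (hm t1) (a0 t1) (hA t1) (F2_pos t1) B0 nu_ge1 (hq t1) (alpha'_eq FF (pos t1))).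
Qed.

(** The square of h + c k is nonnegative. *)
Lemma J_young h k c t : sfld h -> sfld k -> 0 < t ->
  - 2 * c * J (fun p => k p * h p * rho p) t <=
  J (fun p => h p * h p * rho p) t + c ^+ 2 * J (fun p => k p * k p * rho p) t.
Proof.
move=> sh sk t0; rewrite -subr_ge0.
have -> : J (fun p => h p * h p * rho p) t + c ^+ 2 * J (fun p => k p * k p * rho p) t -
   - 2 * c * J (fun p => k p * h p * rho p) t =
   J (fun p => h p * h p * rho p + (c ^+ 2 * (k p * k p * rho p) + (2 * c) * (k p * h p * rho p))) t.
  rewrite J_add//; [|by sfld_tac..].
  rewrite J_add//; [|by sfld_tac..].
  rewrite [in RHS]J_scale//; last by sfld_tac.
  rewrite [X in _ = _ + (_ + X)]J_scale//; last by sfld_tac.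
  by rewrite addrA !mulNr opprK.
apply: J_ge0 => //; first by sfld_tac.
move=> x sx; rewrite (_ : _ + _ = (h (t, x) + c * k (t, x)) ^+ 2 * rho (t, x)); last by abs_at (t, x); move=> *; ring.
by rewrite mulr_ge0 ?sqr_ge0//; exact: (rho_ge0 FF).
Qed.

Lemma F_weight_le h t : 1 <= t -> sfld h -> (forall x, sphere x -> 0 <= h (t, x)) ->
  0 <= J (fun p => F p * h p * rho p) t <= CF * J (fun p => h p * rho p) t.
Proof.
move=> t1 sh h0; have t0 := pos t1.
rewrite -J_scale//; last by sfld_tac.
apply/andP; split.
  apply: J_ge0 => //; first by sfld_tac.
  move=> x sx; have /andP[f1 f2] := hF t sx; rewrite !mulr_ge0 ?h0 ?(rho_ge0 FF)//.
  exact: le_trans (ltW cF0) f1.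
apply: J_le => //; try by sfld_tac.
move=> x sx; have /andP[f1 f2] := hF t sx; rewrite mulrA; apply: ler_wpM2r; first exact: (rho_ge0 FF).
by apply: ler_wpM2r => //; exact: h0.
Qed.

Lemma Fg2_le t : 1 <= t -> 0 <= Fg2 t <= CF * F2 t.
Proof. by move=> t1; apply: F_weight_le => //; [sfld_tac|move=> x _; rewrite -expr2 sqr_ge0]. Qed.

Let C3 := 2 * A * CF + C1 + B.

Let C30 : 0 <= C3.
Proof. by rewrite /C3; nneg. Qed.

(** The part of the derivative of F2 that does not involve G and Z. *)
Lemma F2_growth t : 1 <= t -> 2 * alpha t * Fg2 t - 2 * alpha' t * q t <= C3 * F2 t * (1 + F2 t).
Proof.
move=> t1.
have h1 := alpha'_sqr t1; have h2 := hq t1; have f0 := F2_pos t1.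
have /andP[h3 h4] := Fg2_le t1.
have h5 : alpha t * Fg2 t <= A * (CF * F2 t) by apply: ler_pM => //; [exact: a0|exact: hA].
have h6 : 0 <= F2 t ^+ 2 by exact: sqr_ge0.
have h7 : 0 <= B * F2 t ^+ 2 by exact: mulr_ge0.
have h8 : 0 <= A * CF * F2 t ^+ 2 by nneg.
have h9 := sqr_ge0 (alpha' t + q t); rewrite [X in 0 <= X]sqrrD in h9.
move: h1 h2 h5 h7 h8 h9; rewrite /C3; move: (F2 t) (q t) (alpha' t) (alpha t) (Fg2 t) B C1 => *; lra.
Qed.

(** Bounds the part of the derivative of G that does not involve H; the square of D
   is spared for the terms with alpha and alpha'. *)
Let C5 := 2 * C1 * B + A ^+ 2 * CF ^+ 2.

Let C50 : 0 <= C5.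
Proof. by rewrite /C5; nneg. Qed.

Lemma d3_ge0 t : 0 < t -> 0 <= d3 t.
Proof.
move=> t0; apply: J_ge0 => //; first by sfld_tac.
by move=> x sx; rewrite mulr_ge0 ?(rho_ge0 FF)// -expr2 sqr_ge0.
Qed.

Lemma alpha'_sqr_small t : 1 <= t -> F2 t <= 1 -> alpha' t ^+ 2 <= 2 * C1 * F2 t.
Proof.
move=> t1 f1; apply: (le_trans (alpha'_sqr t1)); have f0 := F2_pos t1.
rewrite -mulrA [leRHS]mulrCA; apply: ler_wpM2l => //.
by rewrite mulr_natl mulr2n lerD2l expr2 ler_piMl.
Qed.

Lemma G_growth t : 1 <= t -> F2 t <= 1 ->
  2 * alpha' t * d1 t - 2 * alpha t * d2 t <= 2 * d3 t + C5 * F2 t.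
Proof.
move=> t1 f1; have t0 := pos t1; have f0 := F2_pos t1.
have h1 := J_young (- alpha' t) sD sF t0.
have sFg : sfld (fun p => F p * g p) by sfld_tac.
have h2 := J_young (alpha t) sD sFg t0.
have h3 := FF_le FF cF0 hF t1.
have h4 : J (fun p => F p * g p * (F p * g p) * rho p) t <= CF ^+ 2 * F2 t.
  rewrite -J_scale//; last by sfld_tac.
  apply: J_le => //; try by sfld_tac.
  move=> x sx; rewrite [leRHS]mulrA; apply: ler_wpM2r; first exact: (rho_ge0 FF).
  rewrite mulrACA; apply: ler_wpM2r; first by rewrite -expr2 sqr_ge0.
  have /andP[e1 e2] := hF t sx; have e0 : 0 <= F (t, x) by apply: le_trans e1; exact: ltW.
  by rewrite expr2 ler_pM.
have h5 := alpha'_sqr_small t1 f1.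
have h6 : alpha t ^+ 2 <= A ^+ 2 by rewrite ler_sqr ?nnegrE ?a0 ?hA.
have h7 : alpha' t ^+ 2 * J (fun p => F p * F p * rho p) t <= 2 * C1 * F2 t * B.
  apply: (@le_trans _ _ (alpha' t ^+ 2 * B)); first by apply: ler_wpM2l; [exact: sqr_ge0|exact: h3].
  exact: ler_wpM2r.
have h8 : alpha t ^+ 2 * J (fun p => F p * g p * (F p * g p) * rho p) t <= A ^+ 2 * (CF ^+ 2 * F2 t).
  apply: (@le_trans _ _ (alpha t ^+ 2 * (CF ^+ 2 * F2 t))); first by apply: ler_wpM2l; [exact: sqr_ge0|exact: h4].
  by apply: ler_wpM2r => //; nneg.
rewrite sqrrN in h1.
move: h1 h2 h7 h8; rewrite /C5.
move: (J (fun p => F p * F p * rho p) t) (J (fun p => F p * g p * (F p * g p) * rho p) t) (d1 t) (d2 t) (d3 t) (F2 t) (alpha' t) (alpha t).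
move=> *; lra.
Qed.

Lemma G_ge0 t : 0 < t -> 0 <= G t.
Proof.
move=> t0; apply: J_ge0 => //; first by sfld_tac.
by move=> x _; rewrite mulr_ge0 ?gam_ge0// -expr2 sqr_ge0.
Qed.

Lemma F4_ge0 t : 0 < t -> 0 <= F4 t.
Proof.
move=> t0; apply: J_ge0 => //; first by sfld_tac.
move=> x sx; rewrite mulr_ge0 ?(rho_ge0 FF)// -[_ * g _ * g _]mulrA.
by rewrite -expr2 sqr_ge0.
Qed.

Let iF2 : integrable_bound F2 := integrable_F2 FF hn cF0 hF.

Lemma vanishing_le1 (y : R -> R) (e : R) : 0 < e -> vanishing y -> exists T, 1 <= T /\ forall t, T <= t -> y t <= e.
Proof.
move=> e0 v; have [T h] := v e e0; exists (Num.max 1 T); split; first by rewrite le_max lexx.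
by move=> t; rewrite ge_max => /andP[_]; exact: h.
Qed.

Section HighDimension.
Variable gamma : R.
Hypothesis n2 : (2 <= n)%N.
Hypothesis gamma0 : 0 <= gamma.
Hypothesis g_ge : forall t x, 1 <= t -> sphere x -> - gamma <= g (t, x).

(** By the lower bound for g this combination of the indefinite Z with F2 is
   the integral of a nonnegative function. *)
Let Zg t := Z t + gamma * F2 t.

Let ZgE t : 0 < t -> Zg t = J (fun p => (g p + gamma) * (g p * g p) * rho p) t.
Proof.
move=> t0; rewrite /Zg -J_scale//; last by sfld_tac.
rewrite -J_add//; [|by sfld_tac..].
by apply: J_eq => //; [sfld_tac|move=> x sx; abs_at (t, x); move=> *; ring].
Qed.

Let gg_ge0 t x : 1 <= t -> sphere x -> 0 <= (g (t, x) + gamma) * (g (t, x) * g (t, x)).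
Proof.
move=> t1 sx; apply: mulr_ge0; last by rewrite -expr2 sqr_ge0.
by rewrite -lerBlDr sub0r; exact: g_ge.
Qed.

Let Zg_ge0 t : 1 <= t -> 0 <= Zg t.
Proof.
move=> t1; have t0 := pos t1; rewrite ZgE//; apply: J_ge0 => //; first by sfld_tac.
by move=> x sx; rewrite mulr_ge0 ?(rho_ge0 FF)// gg_ge0.
Qed.

Let H_ge t : 1 <= t -> - (gamma * G t) <= H t.
Proof.
move=> t1; have t0 := pos t1; rewrite -mulNr -J_scale//; last by sfld_tac.
apply: J_le => //; try by sfld_tac.
move=> x sx; rewrite mulrCA; apply: ler_wpM2l; first by rewrite -expr2 sqr_ge0.
by apply: ler_wpM2r; [exact: gam_ge0|exact: g_ge].
Qed.

Let Fg3_le t : 1 <= t -> Fg3 t <= CF * Zg t.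
Proof.
move=> t1; have t0 := pos t1; rewrite ZgE//.
have sk : sfld (fun p => (g p + gamma) * (g p * g p)) by sfld_tac.
have /andP[_ h] := F_weight_le t1 sk (fun x sx => gg_ge0 t1 sx).
apply: le_trans h; apply: J_le => //; try by sfld_tac.
move=> x sx; apply: ler_wpM2r; first exact: (rho_ge0 FF).
have /andP[e1 e2] := hF t sx; apply: ler_wpM2l; first exact: le_trans (ltW cF0) e1.
by rewrite mulrDl -mulrA lerDl mulr_ge0// -expr2 sqr_ge0.
Qed.

Let n2' : 2 <= nu. Proof. by rewrite ler_nat. Qed.
Let nuB : 0 <= nu - 1. Proof. by rewrite subr_ge0. Qed.
Let C6 := C3 + (nu - 1) * gamma.
Let C60 : 0 <= C6.
Proof. by rewrite /C6; nneg. Qed.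
Let dF2 t := - 2 * nu1 * G t + (1 - nu) * Z t + 2 * alpha t * Fg2 t - 2 * alpha' t * q t.

Let dF2_le t : 1 <= t -> 2 * nu1 * G t + (nu - 1) * Zg t <= - dF2 t + C6 * F2 t * (1 + F2 t).
Proof.
move=> t1; have h := F2_growth t1; have f0 := F2_pos t1.
have h1 : 0 <= (nu - 1) * gamma * F2 t ^+ 2 by nneg.
move: h h1; rewrite /dF2 /Zg /C6.
move: (G t) (Z t) (F2 t) (q t) (alpha' t) (alpha t) (Fg2 t) C3 nu1 nu => *; lra.
Qed.

Let vF2 : vanishing F2.
Proof.
apply: (@integrable_vanishing R F2 dF2 (fun t => C6 * F2 t) 1).
- by move=> t t1; exact: (F2_derive FF (pos t1)).
- exact: F2_pos.
- by move=> t t1; rewrite mulr_ge0 ?F2_pos.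
- exact: iF2.
- exact: integrable_bound_scale.
move=> t t1; have h := dF2_le t1; have f0 := F2_pos t1.
have g0 : 0 <= 2 * nu1 * G t by rewrite !mulr_ge0 ?G_ge0 ?pos.
have z0 : 0 <= (nu - 1) * Zg t by rewrite !mulr_ge0 ?Zg_ge0 ?subr_ge0.
have : dF2 t <= C6 * F2 t * (1 + F2 t) by lra.
move=> /le_trans; apply; apply: ler_wpM2l; first by rewrite mulr_ge0.
by rewrite expr2 ler_peMl ?lerDl// addr_ge0.
Qed.

(** The decrease of F2 bounds both G and Z + gamma F2 in time mean. It remains to
   see that G, or G with a multiple of Z added, grows at most at such a rate;
   the term to be treated is (4 - n) H. *)
Lemma G_vanishing_high : vanishing G.
Proof.
have [T [T1 hT]] := vanishing_le1 ltr01 vF2.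
have tT t : T <= t -> 1 <= t := le_trans T1.
pose Y t := - dF2 t + 2 * C6 * F2 t.
have iY : integrable_bound Y.
  apply: integrable_bound_add; last by apply: integrable_bound_scale; [rewrite mulr_ge0|exact: iF2].
  by apply: (@integrable_bound_derive _ F2 dF2 1); [move=> t t1; exact: (F2_derive FF (pos t1))|exact: F2_pos].
have Yge t : T <= t -> 2 * nu1 * G t + (nu - 1) * Zg t <= Y t.
  move=> Tt; have t1 := tT _ Tt; apply: (le_trans (dF2_le t1)); rewrite lerD2l.
  rewrite [2 * _]mulrC -mulrA -mulrA; apply: ler_wpM2l => //; rewrite mulrC; apply: ler_wpM2r; first exact: F2_pos.
  by have := hT _ Tt; lra.
have g0 t : T <= t -> 0 <= G t by move=> Tt; rewrite G_ge0 ?pos ?tT.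
have z0 t : T <= t -> 0 <= Zg t by move=> Tt; rewrite Zg_ge0 ?tT.
have nu1_ge1 : 1 <= nu1 by rewrite ler1n.
have iG : integrable_bound G.
  apply: (integrable_bound_le (T := T) iY) => t Tt; apply: le_trans (Yge _ Tt).
  have := g0 _ Tt; have := z0 _ Tt => e1 e2.
  have e3 : 0 <= (nu - 1) * Zg t by rewrite mulr_ge0// subr_ge0.
  have e4 : G t <= nu1 * G t by rewrite ler_peMl.
  by move: e3 e4; rewrite -mulrA; lra.
have iZ : integrable_bound Zg.
  apply: (integrable_bound_le (T := T) iY) => t Tt; apply: le_trans (Yge _ Tt).
  have := g0 _ Tt; have := z0 _ Tt => e1 e2.
  have e3 : 0 <= nu1 * G t by rewrite mulr_ge0.
  have e4 : Zg t <= (nu - 1) * Zg t by rewrite ler_peMl// lerBrDr.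
  by move: e3 e4; rewrite -mulrA; lra.
(* The multiple of Z cancels the indefinite term H in low dimensions. *)
have [k [E [k0 E0 hk]]] : exists k E : R, [/\ 0 <= k, 0 <= E &
    forall t, 1 <= t -> (4 - nu - 6 * nu1 * k) * H t <= E * G t].
  have [n4|n4] := leqP 4 n.
    exists 0, ((nu - 4) * gamma); have n4' : 4 <= nu by rewrite ler_nat.
    split=> //; first by rewrite mulr_ge0// subr_ge0.
    move=> t t1; have h := H_ge t1.
    have : (nu - 4) * - (gamma * G t) <= (nu - 4) * H t by rewrite ler_wpM2l// subr_ge0.
    by rewrite mulr0 subr0; lra.
  have n4' : nu <= 4 by rewrite ler_nat ltnW.
  exists ((4 - nu) / (6 * nu1)), 0; split=> //.
    by rewrite divr_ge0 ?mulr_ge0// subr_ge0.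
  move=> t t1; have c0 : 6 * nu1 != 0 by rewrite lt0r_neq0// mulr_gt0.
  by rewrite mul0r [_ * (_ / _)]mulrC divfK// subrr mul0r.
pose C7 := E + C5 + k * (3 * A * CF + 3 * (1 + 2 * C1) * CF + gamma * (2 * C6)).
have C70 : 0 <= C7.
  by rewrite /C7; nneg.
pose dZ t := - 6 * nu1 * H t + (2 - nu) * F4 t + 3 * alpha t * Fg3 t - 3 * alpha' t * Fg2 t.
pose dG t := (4 - nu) * H t + 2 * alpha' t * d1 t - 2 * alpha t * d2 t - 2 * nu1 * d3 t.
have v : vanishing (fun t => G t + k * Zg t).
  apply: (@integrable_vanishing R (fun t => G t + k * Zg t) (fun t => dG t + k * (dZ t + gamma * dF2 t))
    (fun t => C7 * (G t + Zg t + F2 t)) T).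
  - move=> t Tt; have t0 := pos (tT _ Tt).
    have e1 := G_derive FF t0; have e2 := Z_derive FF t0; have e3 := F2_derive FF t0.
    have e4 : is_derive t (1 : R) ((fun s => gamma * F2 s) : R -> R^o) (gamma * dF2 t).
      exact: (is_deriveZ (f := F2) gamma).
    have e5 : is_derive t (1 : R) (Zg : R -> R^o) (dZ t + gamma * dF2 t) by exact: is_deriveD.
    have e6 : is_derive t (1 : R) ((fun s => k * Zg s) : R -> R^o) (k * (dZ t + gamma * dF2 t)).
      exact: (is_deriveZ (f := Zg) k).
    exact: is_deriveD.
  - by move=> t Tt; rewrite addr_ge0 ?g0// mulr_ge0 ?z0.
  - by move=> t Tt; have e1 := g0 _ Tt; have e2 := z0 _ Tt; have e3 := F2_pos (tT _ Tt); nneg.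
  - by apply: integrable_bound_add => //; exact: integrable_bound_scale.
  - by apply: integrable_bound_scale => //; apply: integrable_bound_add => //; exact: integrable_bound_add.
  move=> t Tt; have t1 := tT _ Tt; have t0 := pos t1.
  have f0 := F2_pos t1; have f1 := hT _ Tt; have g0' := g0 _ Tt; have z0' := z0 _ Tt.
  have b1 := hk _ t1; have b2 := G_growth t1 f1; have b3 := d3_ge0 t0.
  have b4 : d3 t <= nu1 * d3 t by rewrite ler_peMl.
  have b5 : 0 <= (nu - 2) * F4 t by rewrite mulr_ge0 ?F4_ge0// subr_ge0.
  have b6 : alpha t * Fg3 t <= A * CF * Zg t.
    apply: (@le_trans _ _ (alpha t * (CF * Zg t))); first by apply: ler_wpM2l; [exact: a0|exact: Fg3_le].
    by rewrite -mulrA; apply: ler_wpM2r; [nneg|exact: hA].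
  have /andP[c1 c2] := Fg2_le t1.
  have b7 : - alpha' t * Fg2 t <= (1 + 2 * C1) * CF * F2 t.
    have e := alpha'_sqr_small t1 f1.
    have e1 : - alpha' t <= 1 + 2 * C1.
      have := sqr_ge0 (1 + alpha' t).
      have : 2 * C1 * F2 t <= 2 * C1 by rewrite ler_piMr// mulr_ge0.
      by move: e; have := C10; rewrite !expr2; move: (alpha' t) C1 (F2 t) => *; nra.
    apply: (@le_trans _ _ ((1 + 2 * C1) * Fg2 t)); first exact: ler_wpM2r.
    by rewrite -mulrA; apply: ler_wpM2l => //; rewrite addr_ge0// mulr_ge0.
  have b8 : dF2 t <= 2 * C6 * F2 t.
    have := Yge _ Tt; rewrite /Y.
    have e1 : 0 <= nu1 * G t by rewrite mulr_ge0.
    have e2 : 0 <= (nu - 1) * Zg t by rewrite mulr_ge0// subr_ge0.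
    by rewrite -mulrA; lra.
  have b9 : dZ t + gamma * dF2 t <= - 6 * nu1 * H t +
     (3 * A * CF + 3 * (1 + 2 * C1) * CF + gamma * (2 * C6)) * (G t + Zg t + F2 t).
    have c3 : gamma * dF2 t <= gamma * (2 * C6 * F2 t) by exact: ler_wpM2l.
    have c4 : 0 <= A * CF by nneg.
    have c5 : 0 <= (1 + 2 * C1) * CF by nneg.
    have c6 : 0 <= gamma * C6 by rewrite mulr_ge0.
    have c7 : 0 <= A * CF * (G t + F2 t) by nneg.
    have c8 : 0 <= (1 + 2 * C1) * CF * (G t + Zg t) by nneg.
    have c9 : 0 <= gamma * C6 * (G t + Zg t) by nneg.
    move: c3 c7 c8 c9 b5 b6 b7; rewrite /dZ.
    move: (dF2 t) (G t) (Zg t) (F2 t) (H t) (F4 t) (Fg3 t) (Fg2 t) (alpha t) (alpha' t) C1 C6 nu1 nu.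
    move=> *; lra.
  have b10 : k * (dZ t + gamma * dF2 t) <= k * (- 6 * nu1 * H t +
     (3 * A * CF + 3 * (1 + 2 * C1) * CF + gamma * (2 * C6)) * (G t + Zg t + F2 t)) by exact: ler_wpM2l.
  have b11 : dG t + k * (dZ t + gamma * dF2 t) <= C7 * (G t + Zg t + F2 t).
    have c1' : 0 <= E * (Zg t + F2 t) by nneg.
    have c2' : 0 <= C5 * (Zg t + G t) by nneg.
    move: b1 b2 b3 b4 b10 c1' c2'; rewrite /dG /C7.
    move: (dF2 t) (dZ t) (G t) (Zg t) (F2 t) (H t) (alpha t) (alpha' t) (d1 t) (d2 t) (d3 t) C1 C5 C6 nu1 nu.
    move=> *; lra.
  apply: (le_trans b11); rewrite ler_peMr//; first by nneg.
  by rewrite exprn_ege1// lerDl addr_ge0// mulr_ge0.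
by apply: (vanishing_le (T := T) v) => t Tt; rewrite lerDl mulr_ge0// z0.
Qed.

End HighDimension.

Section DimensionOne.
Hypothesis n1 : n = 1%N.
Variable Cs : R.
Hypothesis Cs0 : 0 <= Cs.
Hypothesis sobolev : forall t, 1 <= t -> F4 t <= Cs * (4 * G t + Z t + alpha t * Fg2 t) ^+ 2.

Let nuE : nu = 1. Proof. by rewrite n1. Qed.
Let nu1E : nu1 = 2. Proof. by rewrite n1. Qed.
Let dF2 t := - 2 * nu1 * G t + (1 - nu) * Z t + 2 * alpha t * Fg2 t - 2 * alpha' t * q t.

Let dF2_le t : 1 <= t -> 4 * G t <= - dF2 t + C3 * F2 t * (1 + F2 t).
Proof.
move=> t1; have h := F2_growth t1; move: h; rewrite /dF2 nuE nu1E.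
move: (G t) (Z t) (F2 t) (q t) (alpha' t) (alpha t) (Fg2 t) C3 => *; lra.
Qed.

Let vF2 : vanishing F2.
Proof.
apply: (@integrable_vanishing R F2 dF2 (fun t => C3 * F2 t) 1).
- by move=> t t1; exact: (F2_derive FF (pos t1)).
- exact: F2_pos.
- by move=> t t1; rewrite mulr_ge0 ?F2_pos.
- exact: iF2.
- exact: integrable_bound_scale.
move=> t t1; have h := dF2_le t1; have f0 := F2_pos t1.
have g0 : 0 <= 4 * G t by rewrite !mulr_ge0 ?G_ge0 ?pos.
have : dF2 t <= C3 * F2 t * (1 + F2 t) by lra.
move=> /le_trans; apply; apply: ler_wpM2l; first by rewrite mulr_ge0.
by rewrite expr2 ler_peMl ?lerDl// addr_ge0.
Qed.

Lemma Z_sqr t : 0 < t -> Z t ^+ 2 <= F2 t * F4 t.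
Proof.
move=> t0; have sgg : sfld (fun p => g p * g p) by sfld_tac.
have := J_cauchy srho sg sgg t0 (fun x sx => rho_ge0 FF t0 sx).
rewrite (J_eq (H := fun p => g p * (g p * g p) * rho p) (K := fun p => g p * g p * g p * rho p))//; last 2 first.
- by sfld_tac.
- by move=> x sx; rewrite mulrA.
rewrite (J_eq (H := fun p => g p * g p * (g p * g p) * rho p) (K := fun p => g p * g p * g p * g p * rho p))//.
- by sfld_tac.
- by move=> x sx; rewrite !mulrA.
Qed.

(** The term 3 H is the integral of -(3/2) g^2 D: it is bounded by that of D^2,
   of which the derivative of G has a negative multiple, and that of g^4, to which
   the Sobolev inequality applies. *)
Lemma G_vanishing_one : vanishing G.
Proof.
have e0 : 0 < (6 * Cs + 1)^-1 by rewrite invr_gt0; have := Cs0; lra.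
have [T [T1 hT]] := vanishing_le1 e0 vF2.
have tT t : T <= t -> 1 <= t := le_trans T1.
have g0 t : T <= t -> 0 <= G t by move=> Tt; rewrite G_ge0 ?pos ?tT.
have small t : T <= t -> F2 t * (6 * Cs + 1) <= 1.
  by move=> Tt; rewrite -ler_pdivlMr ?div1r ?hT//; have := Cs0; lra.
have small1 t : T <= t -> F2 t <= 1.
  move=> Tt; apply: le_trans (small _ Tt); have h := Cs0; apply: ler_peMr; [exact: F2_pos (tT _ Tt)|lra].
have iG : integrable_bound G.
  have i1 : integrable_bound (fun t => - dF2 t + 2 * C3 * F2 t).
    apply: integrable_bound_add; last by apply: integrable_bound_scale; [rewrite mulr_ge0|exact: iF2].
    by apply: (@integrable_bound_derive _ F2 dF2 1); [move=> t t1; exact: (F2_derive FF (pos t1))|exact: F2_pos].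
  apply: (integrable_bound_le (T := T) i1) => t Tt.
  have := dF2_le (tT _ Tt) => h; have h0 := g0 _ Tt; have f0 := F2_pos (tT _ Tt).
  have h1 : C3 * F2 t * (1 + F2 t) <= C3 * F2 t * 2.
    by apply: ler_wpM2l; [rewrite mulr_ge0|have := small1 _ Tt; lra].
  by lra.
pose C7 := 54 * Cs + 4 * Cs * (A * CF) ^+ 2 + C5.
have C70 : 0 <= C7 by rewrite /C7; nneg.
pose dG t := (4 - nu) * H t + 2 * alpha' t * d1 t - 2 * alpha t * d2 t - 2 * nu1 * d3 t.
apply: (@integrable_vanishing R G dG (fun t => C7 * (F2 t + G t)) T).
- by move=> t Tt; exact: (G_derive FF (pos (tT _ Tt))).
- exact: g0.
- by move=> t Tt; rewrite mulr_ge0// addr_ge0 ?F2_pos ?g0 ?tT.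
- exact: iG.
- by apply: integrable_bound_scale => //; exact: integrable_bound_add.
move=> t Tt; have t1 := tT _ Tt; have t0 := pos t1.
have f0 := F2_pos t1; have f1 := small1 _ Tt; have g0' := g0 _ Tt.
have f4 := F4_ge0 t0.
have b1 := absorb_sobolev Cs0 f0 f4 (small _ Tt) (Z_sqr t0) (sobolev t1).
have /andP[c1 c2] := Fg2_le t1.
have b2 : (alpha t * Fg2 t) ^+ 2 <= (A * CF) ^+ 2 * F2 t.
  have e1 : alpha t * Fg2 t <= A * CF * F2 t.
    by rewrite -mulrA; apply: ler_pM => //; [exact: a0|exact: hA].
  apply: (@le_trans _ _ ((A * CF * F2 t) ^+ 2)).
    by rewrite ler_sqr ?nnegrE// ?mulr_ge0// ?a0// ltW.
  by rewrite exprMn; apply: ler_wpM2l; [exact: sqr_ge0|rewrite expr2 ler_piMl].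
have sgg : sfld (fun p => g p * g p) by sfld_tac.
have b3 := J_young (3 / 4) sD sgg t0.
have b4 := J_Dgg FF t0.
rewrite b4 in b3.
have b5 : J (fun p => g p * g p * (g p * g p) * rho p) t = F4 t.
  by apply: J_eq => //; [sfld_tac|move=> x sx; rewrite !mulrA].
rewrite b5 in b3.
have b6 := G_growth t1 f1; have b7 := d3_ge0 t0.
have c3 : Cs * (alpha t * Fg2 t) ^+ 2 <= Cs * ((A * CF) ^+ 2 * F2 t) by exact: ler_wpM2l.
have b8 : dG t <= 54 * Cs * G t ^+ 2 + (4 * Cs * (A * CF) ^+ 2 + C5) * F2 t.
  have c4 : 0 <= Cs * ((A * CF) ^+ 2 * F2 t) by nneg.
  move: b1 b3 b6 b7 c3 c4; rewrite /dG nuE nu1E.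
  move: C5 (alpha t) (alpha' t) (H t) (F4 t) (F2 t) (d1 t) (d2 t) (d3 t) (G t ^+ 2) ((alpha t * Fg2 t) ^+ 2) ((A * CF) ^+ 2).
  move=> *; lra.
apply: (le_trans b8).
have c5 : 0 <= Cs * (A * CF) ^+ 2 by rewrite mulr_ge0 ?sqr_ge0.
have c6 : 54 * Cs * G t ^+ 2 <= C7 * G t ^+ 2.
  by apply: ler_wpM2r; [exact: sqr_ge0|rewrite /C7; have := C50; lra].
have c7 : (4 * Cs * (A * CF) ^+ 2 + C5) * F2 t <= C7 * F2 t.
  by apply: ler_wpM2r => //; rewrite /C7; have := Cs0; lra.
apply: (le_trans (lerD c6 c7)); rewrite -mulrDr -mulrA; apply: ler_wpM2l => //.
exact: quadratic_growth.
Qed.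

End DimensionOne.
End Growth.

(** * The maximum principle at a spatial minimum *)

Section Minimum.
Context {R : realType} {V : normedModType R}.
Variable U : set V.
Hypothesis Uo : open U.
Implicit Types (x v : V) (F : V -> R^o) (s e : R).

Lemma line_in x v : U x -> exists2 e : R, 0 < e & forall s, `|s| <= e -> U (x + s *: v).
Proof.
move=> Ux; have /nbhs_normP [d /= d0 hd] := open_nbhs_nbhs (conj Uo Ux).
have v1 : 0 < `|v| + 1 by rewrite ltr_wpDl.
exists (d / (`|v| + 1)) => [|s hs]; first by rewrite divr_gt0.
apply: hd; rewrite /= opprD addrA subrr add0r normrN normrZ.
apply: (@le_lt_trans _ _ (d / (`|v| + 1) * `|v|)); first exact: ler_wpM2r.
by rewrite mulrAC ltr_pdivrMr// ltr_pM2l// ltrDl.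
Qed.

Lemma cvg_shrink e : e * k.+1%:R^-1 @[k --> \oo] --> (0 : R).
Proof. by rewrite -(mulr0 e); apply: cvgMr; exact: cvg_harmonic. Qed.

Lemma min_derive_ge0 F x v : U x -> differentiable F x -> (forall y, U y -> F x <= F y) ->
  0 <= 'D_v F x.
Proof.
move=> Ux dF h; have [e e0 he] := line_in v Ux.
have hd : is_derive (0 : R) (1 : R) (fun s => F (x + s *: v) : R^o) ('D_v F x).
  by have := @is_derive_line _ _ F x v 0; rewrite scale0r addr0; exact.
pose u k : R := e * k.+1%:R^-1.
have u0 k : 0 < u k by rewrite mulr_gt0.
have := is_derive_quotient hd (fun k => lt0r_neq0 (u0 k)) (cvg_shrink e).
move=> /cvgr_to_ge; apply; near=> k.
rewrite addr0 scale0r addr0 mulr_ge0 ?invr_ge0 ?(ltW (u0 k))// subr_ge0; apply: h; apply: he.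
by rewrite gtr0_norm ?u0// /u ler_piMr// ?(ltW e0)// invf_le1 ?ler1n.
Unshelve. all: by end_near. Qed.

Lemma min_derive_eq0 F x v : U x -> differentiable F x -> (forall y, U y -> F x <= F y) ->
  'D_v F x = 0.
Proof.
move=> Ux dF h; apply/eqP; rewrite eq_le min_derive_ge0// andbT -oppr_ge0.
have -> : - 'D_v F x = 'D_(- v) F x by rewrite !deriveE// linearN.
exact: min_derive_ge0.
Qed.

(** By the mean value theorem there are points near x at which the first
   derivative is nonnegative; as it vanishes at x, its derivative is nonnegative. *)
Lemma min_derive2_ge0 F x v : Ck U 1 F -> U x -> (forall y, U y -> F x <= F y) ->
  0 <= 'D_v ('D_v F) x.
Proof.
move=> cF Ux h; have [e e0 he] := line_in v Ux.
have dF y : U y -> differentiable F y by exact: Ck_diff cF.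
have hd (s : R) : `|s| <= e -> is_derive s (1 : R) (fun s => F (x + s *: v) : R^o) ('D_v F (x + s *: v)).
  by move=> hs; apply: is_derive_line; apply: dF; exact: he.
pose u k : R := e * k.+1%:R^-1.
have u0 k : 0 < u k by rewrite mulr_gt0.
have ue k : u k <= e by rewrite /u ler_piMr// ?(ltW e0)// invf_le1 ?ler1n.
have hc k : exists c : R, 0 < c < u k /\ 0 <= 'D_v F (x + c *: v).
  have cf : {within `[0, u k], continuous ((fun s => F (x + s *: v)) : R -> R^o)}.
    apply: derivable_within_continuous => t; rewrite in_itv /= => /andP[t0 tu].
    by have [] := hd t _; rewrite ?ger0_norm//; exact: le_trans tu (ue k).
  have hd' t : t \in `]0, u k[ -> is_derive t (1 : R) (fun s => F (x + s *: v)) ('D_v F (x + t *: v)).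
    rewrite in_itv /= => /andP[/ltW t0 /ltW tu]; apply: hd.
    by rewrite ger0_norm//; exact: le_trans tu (ue k).
  have [c cI ec] := MVT (u0 k) hd' cf; exists c; split; first by rewrite in_itv /= in cI.
  rewrite -(pmulr_lge0 _ (u0 k)); move: ec; rewrite subr0 => <-.
  rewrite scale0r addr0 subr_ge0; apply: h; apply: he.
  by rewrite gtr0_norm.
have [c c_prop] := choice hc.
have c0 k : 0 < c k by have [/andP[]] := c_prop k.
have ccv : c k @[k --> \oo] --> (0 : R).
  apply: (@squeeze_cvgr _ _ _ _ (fun=> 0) u) => //; [|exact: cvg_cst|exact: cvg_shrink].
  by near=> k; have [/andP[/ltW -> /ltW ->]] := c_prop k.
have hD : is_derive (0 : R) (1 : R) (fun s => 'D_v F (x + s *: v) : R^o) ('D_v ('D_v F) x).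
  have := @is_derive_line _ _ ('D_v F) x v 0; rewrite scale0r addr0; apply.
  exact: Ck_diff (Ck_derive v cF) Ux.
have := is_derive_quotient hD (fun k => lt0r_neq0 (c0 k)) ccv.
move=> /cvgr_to_ge; apply; near=> k.
rewrite addr0 scale0r addr0 (min_derive_eq0 v Ux (dF _ Ux) h) subr0.
by rewrite mulr_ge0 ?invr_ge0 ?(ltW (c0 k))//; have [] := c_prop k.
Unshelve. all: by end_near. Qed.

End Minimum.

Section SphereMinimum.
Context {R : realType} {n : nat}.
Notation V := (ambient R n).
Notation W := [set y : V | y != 0].
Implicit Types (x v : V) (F : V -> R^o).

Lemma Xf_min_eq0 A F x : Ck W 1 F -> x != 0 -> (forall y, y != 0 -> F x <= F y) -> Xf A F x = 0.
Proof. by move=> cF x0 h; apply: (min_derive_eq0 (U := W) open_neq0) => //; exact: Ck_diff cF x0. Qed.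

(** At a critical point the derivative of the coefficients of the field does not
   contribute. *)
Lemma Xf_Xf_min_ge0 A F x : Ck W 2 F -> x != 0 -> (forall y, y != 0 -> F x <= F y) ->
  0 <= Xf A (Xf A F) x.
Proof.
move=> cF x0 h; set v := x *m A.
have dF y : y != 0 -> differentiable F y by exact: Ck_diff cF.
have dDF w y : y != 0 -> differentiable ('D_w F) y by exact: (Ck_diff (Ck_derive w cF)).
have dc j y : differentiable (fun y : V => (y *m A) 0 j : R^o) y.
  exact: differentiable_coord_mul.
suff -> : Xf A (Xf A F) x = 'D_v ('D_v F) x.
  by apply: (min_derive2_ge0 (U := W) open_neq0) => //; exact: Ck_S cF.
rewrite {1}/Xf -/v.
rewrite (derive_eq_on (U := W) open_neq0 (G := fun y => \sum_j (y *m A) 0 j * 'D_(delta_mx 0 j) F y)) //; last first.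
  by move=> y y0; rewrite /Xf derive_coords// ; exact: dF.
rewrite derive_sum; last by move=> j; apply: differentiableM => //; exact: dDF.
rewrite (derive_coords _ (dDF v _ x0)); apply: eq_bigr => j _.
rewrite derive_mul//; last exact: dDF.
rewrite (min_derive_eq0 (U := W) open_neq0 _ x0 (dF _ x0) h) mul0r addr0.
by apply: mulr_congr; apply: (Schwarz (U := W) open_neq0 _ _ cF x0).
Qed.

End SphereMinimum.

Section LowerBound.
Context {R : realType} {n : nat}.
Notation V := (ambient R n).
Notation TV := (R^o * ambient R n)%type.
Notation S := (@spacetime R n).
Implicit Types (t : R) (x : V) (p : TV).
Variables (alpha : R -> R) (U F g Q D rho : TV -> R^o).
Hypothesis FF : flow_fields alpha U F g Q D rho.
Hypothesis hn : (1 <= n)%N.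

Let sg := ff_g FF.

Variables cF CF A : R.
Hypothesis cF0 : 0 < cF.
Hypothesis hF : forall t x, sphere x -> cF <= F (t, x) <= CF.
Hypothesis hA : forall t, 1 <= t -> alpha t <= A.

Let C2 := A ^+ 2 * (CF ^+ 2 * J rho 1) / (4 * (cF * J rho 1)).

(** In terms of u, Delta_theta g is a second order term plus a multiple of the
   gradient of g, which vanishes at a minimum. *)
Lemma D_ge0_at_min t x : 0 < t -> sphere x -> (forall y, sphere y -> g (t, x) <= g (t, y)) ->
  0 <= D (t, x).
Proof.
move=> t0 sx h; have sp := spaceP t0 sx; have x0 := sphere_neq0 sx.
have hg y : y != 0 -> slice g t x <= slice g t y.
  move=> y0; have := sg.2 (t, y) (enorm y)^-1; rewrite /slice /= => <-//.
    exact: h (radial_sphere y0).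
  by rewrite invr_gt0 enorm_gt0.
have X0 i : XX i g (t, x) = 0.
  rewrite -XX_slice//; apply: Xf_min_eq0 => //; exact: Ck_slice (sg.1 1%N).
have l0 : 0 <= lapT g (t, x).
  rewrite -lapT_slice// mulr_ge0//; apply: sumr_ge0 => i _.
  by apply: Xf_Xf_min_ge0 => //; exact: Ck_slice (sg.1 2%N).
have G0 : gam g U (t, x) = 0 by rewrite /gam big1 ?mulr0// => i _; rewrite X0 mul0r.
have r0 := ff_rho0 FF sp.
rewrite -(pmulr_lge0 _ r0) (ff_Drho FF sp) G0 mulr0 mulr0 addr0 mulr_ge0//.
by rewrite -expr2 sqr_ge0.
Qed.

(** For very negative g the term g^2 dominates in the equation for the
   derivative of g. *)
Lemma lower_bound_algebra (a F' g' a' D' nu1 A' C C' : R) : 0 <= a -> a <= A' -> 0 <= F' -> F' <= C ->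
  a' <= C' -> 0 <= C' -> 0 <= nu1 -> 0 <= D' -> g' < - (A' * C + C' * C + 1) ->
  0 < - (a' * F') + g' * (g' + a * F') + nu1 * D'.
Proof.
move=> a0 aA F0 FC a'C C'0 n0 D0 hg.
have h1 : a * F' <= A' * C by exact: ler_pM.
have h2 : a' * F' <= C' * C.
  by apply: (@le_trans _ _ (C' * F')); [exact: ler_wpM2r|exact: ler_wpM2l].
have h3 : 0 <= nu1 * D' by exact: mulr_ge0.
have C0 : 0 <= C by exact: le_trans FC.
have h0 : 0 <= A' * C by rewrite mulr_ge0//; exact: le_trans aA.
have h4 : 0 <= C' * C by exact: mulr_ge0.
have h5 : g' + a * F' <= - (C' * C + 1) by lra.
have h6 : (C' * C + 1) * 1 <= (- (g' + a * F')) * (- g') by apply: ler_pM; lra.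
by move: h6; rewrite mulrNN [(g' + _) * _]mulrC; lra.
Qed.

(** At a minimum over [1, T] and the sphere, reached after time 1, the time
   derivative is at most 0, while the equation for g makes it positive if the
   minimal value is too negative. *)
Lemma g_lower_bound : exists2 gamma : R, 0 <= gamma &
  forall t x, 1 <= t -> sphere x -> - gamma <= g (t, x).
Proof.
have [M M0 hM] := sphere_cont_bounded (sphere_cont_slice ltr01 sg).
have a0 := alpha_ge0 FF cF0 hF (lexx 1).
have A0 : 0 <= A := le_trans a0 (hA (lexx 1)).
have CF0 : 0 <= CF.
  by have /andP[h1 h2] := hF 1 (@sphere_pole R n); exact: le_trans (ltW cF0) (le_trans h1 h2).
have v0 := vol_gt0 FF.
have C20 : 0 <= C2.
  by rewrite divr_ge0// !mulr_ge0 ?sqr_ge0 ?(ltW v0) ?(ltW cF0).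
pose g0 := A * CF + C2 * CF + 1.
have g00 : 0 <= g0 by rewrite !addr_ge0// mulr_ge0.
exists (Num.max g0 M); first by rewrite le_max g00.
move=> T x T1 sx; rewrite leNgt; apply/negP => hlt.
pose K : set TV := `[1, T]%classic `*` @sphere R n.
have K0 : K !=set0 by exists (T, x); split=> //=; rewrite in_itv /= T1 lexx.
have cK : compact K by apply: compact_setX; [exact: segment_compact|exact: compact_sphere].
have pK p : K p -> 1 <= p.1 /\ sphere p.2.
  by move=> [/=]; rewrite in_itv /= => /andP[-> _].
have cg : {within K, continuous (g : TV -> R)}.
  apply: continuous_in_subspaceT => p; rewrite inE => /pK [p1 p2].
  apply: differentiable_continuous; apply: sfld_diff sg _.
  by case: p p1 p2 => s y p1 p2; apply: spaceP => //; exact: lt_le_trans p1.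
have [[t y] /set_mem Kty hmin] := compact_EVT_min K0 cK cg.
have [/= t1 sy] := pK _ Kty.
have t0 : 0 < t by exact: lt_le_trans t1.
have tT : t <= T by move: Kty => [/=]; rewrite in_itv /= => /andP[].
have hg : g (t, y) < - Num.max g0 M.
  apply: le_lt_trans hlt; apply: hmin; apply: mem_set; split=> //=.
  by rewrite in_itv /= T1 lexx.
have t_gt1 : 1 < t.
  rewrite lt_neqAle t1 andbT eq_sym; apply/eqP => e; move: hg; rewrite e ltNge => /negP; apply.
  have := hM y sy; rewrite /slice ler_norml => /andP[+ _].
  by apply: le_trans; rewrite lerN2 le_max lexx orbT.
have hs z : sphere z -> g (t, y) <= g (t, z).
  by move=> sz; apply: hmin; apply: mem_set; split=> //=; rewrite in_itv /= t1.
have D0 := D_ge0_at_min t0 sy hs.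
have Dt_le0 : Dt g (t, y) <= 0.
  have hd := is_derive_time sg t0 (sphere_neq0 sy); rewrite -DtE in hd.
  have e0 : 0 < t - 1 by rewrite subr_gt0.
  pose u k : R := - (t - 1) * k.+1%:R^-1.
  have u0 k : u k < 0 by rewrite /u mulNr oppr_lt0 mulr_gt0.
  have := is_derive_quotient hd (fun k => ltr0_neq0 (u0 k)) (cvg_shrink _).
  move=> /cvgr_to_le; apply; near=> k.
  rewrite mulr_le0_ge0 ?invr_le0 ?(ltW (u0 k))// subr_ge0; apply: hmin; apply: mem_set; split=> //=.
  rewrite in_itv /=; apply/andP; split; last by have := u0 k; lra.
  have : (t - 1) * k.+1%:R^-1 <= t - 1 by rewrite ler_piMr ?(ltW e0)// invf_le1 ?ler1n.
  by rewrite /u mulNr; move: (_ / _) => z; lra.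
have : 0 < Dt g (t, y).
  have /andP[f1 f2] := hF t sy.
  rewrite (Dtg_sphere FF t0 sy).
  apply: (lower_bound_algebra (A' := A) (C := CF) (C' := C2)) => //.
  - exact: (alpha_ge0 FF cF0 hF t1).
  - exact: hA.
  - exact: le_trans (ltW cF0) f1.
  - exact: (alpha'_le FF hn cF0 hF hA t1).
  - by apply: (lt_le_trans hg); rewrite lerN2 le_max lexx.
by rewrite ltNge Dt_le0.
Unshelve. all: by end_near. Qed.

End LowerBound.

(** * Rotations generated by skew matrices *)

Section Rotation.
Context {R : realType} {n : nat}.
Notation V := (ambient R n).
Notation W := [set y : V | y != 0].
Notation d := (n.+1 + n.+1)%N.
Notation Lam := (@integral_dV0 R n).
Implicit Types (x y z : V) (s t c : R) (phi psi : V -> R) (v : V -> R^o).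

Lemma integral_dV0_le phi psi : sphere_cont phi -> sphere_cont psi ->
  (forall x, sphere x -> phi x <= psi x) -> Lam phi <= Lam psi.
Proof.
move=> c1 c2 h; rewrite -subr_ge0.
have -> : Lam psi - Lam phi = Lam (fun x => -1 * phi x + psi x).
  by rewrite integral_dV0_lin// mulN1r addrC.
apply: integral_dV0_ge0; first exact: sphere_cont_lin.
by move=> x sx; rewrite mulN1r addrC subr_ge0; exact: h.
Qed.

Lemma integral_dV0_norm_le phi psi : sphere_cont phi -> sphere_cont psi ->
  (forall x, sphere x -> `|phi x| <= psi x) -> `|Lam phi| <= Lam psi.
Proof.
move=> c1 c2 h; rewrite ler_norml; apply/andP; split.
  rewrite lerNl -mulN1r -integral_dV0_scale//; apply: integral_dV0_le => //.
    by apply: sphere_cont_mul => //; exact: sphere_cont_cst.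
  by move=> x sx; have := h x sx; rewrite ler_norml mulN1r lerNl => /andP[].
by apply: integral_dV0_le => // x sx; have := h x sx; rewrite ler_norml => /andP[].
Qed.

Lemma hom0_bounded phi : sphere_cont phi -> hom0 phi ->
  exists2 M : R, 0 <= M & forall y, y != 0 -> `|phi y| <= M.
Proof.
move=> c h; have [M M0 hM] := sphere_cont_bounded c; exists M => // y y0.
have e0 : 0 < (enorm y)^-1 by rewrite invr_gt0 enorm_gt0.
by rewrite -(h _ _ e0 y0); apply: hM; exact: radial_sphere.
Qed.

(** A homogeneous function of degree 0 is constant along rays. *)
Lemma hom0_euler v y : hom0 v -> y != 0 -> differentiable v y -> 'D_y v y = 0.
Proof.
move=> hv y0 dv; have := @is_derive_line _ _ v y y 0; rewrite scale0r addr0 => /(_ dv) [_ <-].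
rewrite -[RHS](@derive_cst _ R^o R^o (v y) (0 : R) (1 : R)).
apply: near_eq_derive.
near=> s; have s1 : 0 < 1 + s.
  have : `|s| < 1 by near: s; apply: (@nbhs0_lt _ R^o); exact: ltr01.
  by rewrite ltr_norml => /andP[h _]; lra.
by rewrite -{1}[y]scale1r -scalerDl hv.
Unshelve. all: by end_near. Qed.

Variables (Q : 'M[R]_d) (c : R).
Hypothesis Q_skew : Q^T = - Q.
Hypothesis Q_sqr : Q *m Q = (- c)%:M.
Hypothesis c0 : 0 <= c.

(** Up to a positive factor, the rotation generated by Q; on functions
   homogeneous of degree 0 the factor is invisible. *)
Definition rot s y : V := y + s *: (y *m Q).

Lemma rotZ s a y : rot s (a *: y) = a *: rot s y.
Proof. by rewrite /rot -scalemxAl scalerDr scalerA mulrC -scalerA. Qed.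

Lemma rot_mulQ s y : rot s y *m Q = rot s (y *m Q).
Proof. by rewrite /rot mulmxDl -scalemxAl. Qed.

Lemma rotK s y : rot (- s) (rot s y) = (1 + s ^+ 2 * c) *: y.
Proof.
rewrite {1}/rot rot_mulQ /rot -mulmxA Q_sqr mul_mx_scalar scalerDr !scalerA scaleNr addrA addrK.
by rewrite -{1}[y]scale1r -scalerDl; congr (_ *: _); ring.
Qed.

Let den_gt0 s : 0 < 1 + s ^+ 2 * c.
Proof. by rewrite ltr_pwDl// mulr_ge0 ?sqr_ge0. Qed.

Lemma rot_neq0 s y : y != 0 -> rot s y != 0.
Proof.
apply: contraNneq => e; have := rotK s y; rewrite e /rot mul0mx scaler0 addr0 => /esym/eqP.
by rewrite scaler_eq0 gt_eqF//= => /eqP ->.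
Qed.

Lemma rot_affine (h : R) y z s : rot s (h *: y + z) = h *: rot s y + rot s z.
Proof.
rewrite /rot mulmxDl -scalemxAl !scalerDr addrACA; congr (_ + _ + _).
by rewrite !scalerA mulrC.
Qed.

Lemma differentiable_rot s y : differentiable (rot s) y.
Proof.
rewrite (_ : rot s = \sum_j (fun y : V => (y *m (1%:M + s *: Q)) 0 j *: (delta_mx 0 j : V))).
  apply: differentiable_sum => j.
  apply: differentiableZl; exact: differentiable_coord_mul.
by apply/funext => z; rewrite fct_sumE -row_sum_delta /rot mulmxDr mulmx1 -scalemxAr.
Qed.

Lemma continuous_rot s : continuous (rot s).
Proof. by move=> y; apply: differentiable_continuous; exact: differentiable_rot. Qed.

Lemma Ck_rot k v s : Ck W k v -> Ck W k (v \o rot s).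
Proof.
apply: (@Ck_affine _ _ _ W W open_neq0 (rot s) (rot s)) => [y|h y z|y]; [exact: differentiable_rot|exact: rot_affine|exact: rot_neq0].
Qed.

Lemma hom0_rot phi s : hom0 phi -> hom0 (phi \o rot s).
Proof. by move=> h a y a0 y0; rewrite /= rotZ h// rot_neq0. Qed.

Lemma sphere_cont_rot phi s : sphere_cont phi -> sphere_cont (phi \o rot s).
Proof.
by move=> h y y0; apply: continuous_comp; [exact: continuous_rot|exact/h/rot_neq0].
Qed.

Lemma Xf_rot v s y : differentiable v (rot s y) -> Xf Q (v \o rot s) y = Xf Q v (rot s y).
Proof.
move=> dv; rewrite /Xf (derive_affine (l := rot s)) ?rot_mulQ// => h.
exact: rot_affine.
Qed.

Lemma derive_dir v (a b z : V) (h k : R) : differentiable v z ->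
  'D_(h *: (a + k *: b)) v z = h * ('D_a v z + k * 'D_b v z).
Proof. by move=> dv; rewrite !deriveE// linearZ linearD linearZ. Qed.

(** The derivative of rot s in s is the field y Q at the rotated point, up to a
   radial component, which does not matter by Euler's identity, and up to the
   factor accounting for the growth of rot s. *)
Lemma is_derive_rot v y s : hom0 v -> y != 0 -> differentiable v (rot s y) ->
  is_derive s (1 : R) ((fun s => v (rot s y)) : R -> R^o) ((1 + s ^+ 2 * c)^-1 * Xf Q v (rot s y)).
Proof.
move=> hv y0 dv; have h := is_derive_line dv.
apply: (is_derive_eq h).
have e : y *m Q = (1 + s ^+ 2 * c)^-1 *: (rot s y *m Q + (s * c) *: rot s y).
  apply: (scalerI (lt0r_neq0 (den_gt0 s))); rewrite scalerA mulfV ?lt0r_neq0// scale1r.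
  rewrite rot_mulQ /rot -mulmxA Q_sqr mul_mx_scalar scalerDr !scalerA mulrN scaleNr addrA subrK.
  by rewrite scalerDl scale1r; congr (_ + _ *: _); ring.
have ev := hom0_euler hv (rot_neq0 s y0) dv.
rewrite -/(rot s y) [in LHS]e derive_dir// ev mulr0 addr0.
by [].
Qed.

Lemma den_le1 s : (1 + s ^+ 2 * c)^-1 <= 1.
Proof. by rewrite invf_le1// lerDl mulr_ge0 ?sqr_ge0. Qed.

Lemma is_derive_integral_rot eta v s : sphere_cont eta -> Ck W 1 v -> hom0 v ->
  is_derive s (1 : R) ((fun s => Lam (fun x => eta x * v (rot s x))) : R -> R^o)
    (Lam (fun x => eta x * ((1 + s ^+ 2 * c)^-1 * Xf Q v (rot s x)))).
Proof.
move=> ce cv hv.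
have dv y : y != 0 -> differentiable v y by exact: Ck_diff cv.
have cX : Ck W 0 (Xf Q v) by apply: Ck_Xf cv; exact: open_neq0.
have hX : hom0 (Xf Q v) by exact: hom0_Xf.
have [M M0 hM] := hom0_bounded (sphere_cont_Ck cX) hX.
have [M' M'0 hM'] := sphere_cont_bounded ce.
apply: (is_derive_integral_param (Phi := fun s x => eta x * v (rot s x))
  (dPhi := fun s x => eta x * ((1 + s ^+ 2 * c)^-1 * Xf Q v (rot s x))) (d := 1) (M := M' * M)) => //.
- move=> r _; apply: sphere_cont_mul => //; exact: (sphere_cont_rot (sphere_cont_Ck cv)).
- apply: sphere_cont_mul => //; apply: sphere_cont_mul; first exact: sphere_cont_cst.
  exact: (sphere_cont_rot (sphere_cont_Ck cX)).
- move=> r x _ sx; have x0 := sphere_neq0 sx.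
  have h := is_derive_rot hv x0 (dv _ (rot_neq0 r x0)).
  exact: (is_deriveZ (f := fun s => v (rot s x)) (eta x)).
move=> r x _ sx; rewrite normrM ler_pM ?hM'// normrM -[M]mul1r ler_pM//.
  by rewrite ger0_norm ?den_le1// invr_ge0 ltW.
exact: hM (rot_neq0 r (sphere_neq0 sx)).
Qed.

(** The derivative in s is the integral of a derivative along the skew field Q. *)
Lemma integral_rot v s : Ck W 1 v -> hom0 v -> Lam (v \o rot s) = Lam v.
Proof.
move=> cv hv.
have dv y : y != 0 -> differentiable v y by exact: Ck_diff cv.
have h r : is_derive r (1 : R) ((fun s => Lam (v \o rot s)) : R -> R^o) 0.
  have h1 := is_derive_integral_rot r (@sphere_cont_cst _ _ 1) cv hv.
  have e : Lam (fun x => 1 * ((1 + r ^+ 2 * c)^-1 * Xf Q v (rot r x))) = 0.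
    have cX : Ck W 0 (Xf Q (v \o rot r)) by apply: (Ck_Xf open_neq0); exact: Ck_rot.
    rewrite (integral_dV0_eq (psi := fun x => (1 + r ^+ 2 * c)^-1 * Xf Q (v \o rot r) x)).
    - rewrite integral_dV0_scale; last exact: sphere_cont_Ck cX.
      by rewrite (integral_dV0_Xf Q_skew (Ck_rot r cv) (hom0_rot r hv)) mulr0.
    - by apply: sphere_cont_mul; [exact: sphere_cont_cst|exact: sphere_cont_Ck cX].
    move=> x sx; rewrite mul1r Xf_rot//; apply: dv; apply: rot_neq0; exact: sphere_neq0.
  rewrite e in h1; rewrite (_ : (fun s => Lam (v \o rot s)) = (fun s => Lam (fun x => 1 * v (rot s x))))//.
  by apply/funext => t; congr Lam; apply/funext => x; rewrite mul1r.
have := @is_derive_lipschitz R (fun s => Lam (v \o rot s)) (fun=> 0) 0 0 s (fun t _ => h t).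
rewrite mul0r normr0 => /(_ (fun _ _ => lexx _)); rewrite normr_le0 subr_eq0 => /eqP ->.
by congr Lam; apply/funext => x; rewrite /= /rot scale0r addr0.
Qed.

(** Writing eta = v o rot s - v, the function s |-> Lam (eta * (v o rot s)) changes
   by the left-hand side, and its derivative is bounded in terms of the norms of eta
   and of Xf Q v, by the invariance of the measure. *)
Lemma rot_modulus v s : Ck W 2 v -> hom0 v ->
  Lam (fun x => (v (rot s x) - v x) ^+ 2) <= s ^+ 2 * Lam (fun x => Xf Q v x ^+ 2).
Proof.
move=> cv2 hv; have cv : Ck W 1 v by exact: Ck_S.
have cX : Ck W 1 (Xf Q v) by apply: (Ck_Xf open_neq0).
have dv y : y != 0 -> differentiable v y by exact: Ck_diff cv.
have hX : hom0 (Xf Q v) by exact: hom0_Xf.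
have scv := sphere_cont_Ck cv; have scX := sphere_cont_Ck cX.
pose eta x := v (rot s x) - v x.
have ce : sphere_cont eta.
  rewrite (_ : eta = fun x => -1 * v x + (v \o rot s) x); last by apply/funext => x; rewrite mulN1r addrC.
  by apply: sphere_cont_lin => //; exact: (sphere_cont_rot scv).
have ce2 : sphere_cont (fun x => eta x ^+ 2).
  by under eq_fun do rewrite expr2; exact: sphere_cont_mul.
have cX2 : Ck W 1 (fun x => Xf Q v x ^+ 2 : R^o).
  have -> : (fun x => Xf Q v x ^+ 2) = (fun x => Xf Q v x * Xf Q v x) by apply/funext => x; rewrite expr2.
  exact: (Ck_mul open_neq0).
have scX2 := sphere_cont_Ck cX2.
have hX2 : hom0 (fun x => Xf Q v x ^+ 2) by move=> a y a0 y0; rewrite hX.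
have [->|s0] := eqVneq s 0.
  rewrite expr0n mul0r (integral_dV0_eq (psi := fun=> 0)) ?integral_dV0_0//.
    exact: sphere_cont_cst.
  by move=> x _; rewrite /rot scale0r addr0 subrr expr0n.
set N := Lam _; set E := Lam _.
have as0 : 0 < `|s| by rewrite normr_gt0.
(* The weights of Young's inequality, balanced for an interval of length |s|. *)
pose k := (2 * `|s|)^-1; pose l := `|s| / 2.
have bound r : `|Lam (fun x => eta x * ((1 + r ^+ 2 * c)^-1 * Xf Q v (rot r x)))| <= k * N + l * E.
  have cXr : sphere_cont (fun x => Xf Q v (rot r x)) by exact: (sphere_cont_rot scX).
  have cX2r : sphere_cont (fun x => Xf Q v (rot r x) ^+ 2) by exact: (sphere_cont_rot scX2).
  have -> : k * N + l * E = Lam (fun x => k * eta x ^+ 2 + l * Xf Q v (rot r x) ^+ 2).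
    rewrite integral_dV0_lin//; last by apply: sphere_cont_mul => //; exact: sphere_cont_cst.
    have -> : E = Lam (fun x => Xf Q v (rot r x) ^+ 2) by exact: esym (integral_rot r cX2 hX2).
    by rewrite (integral_dV0_scale l cX2r).
  apply: integral_dV0_norm_le.
  - apply: sphere_cont_mul => //; apply: sphere_cont_mul => //; exact: sphere_cont_cst.
  - apply: sphere_cont_lin => //; apply: sphere_cont_mul => //; exact: sphere_cont_cst.
  move=> x sx; rewrite !normrM [`|_^-1|]ger0_norm ?invr_ge0 ?(ltW (den_gt0 r))//.
  apply: (@le_trans _ _ (`|eta x| * `|Xf Q v (rot r x)|)).
    by rewrite ler_wpM2l// ler_piMl// den_le1.
  rewrite -(real_normK (num_real (eta x))) -(real_normK (num_real (Xf Q v _))).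
  move: (`|eta x|) (`|Xf Q v (rot r x)|) => a b.
  rewrite -subr_ge0 (_ : _ - _ = (2 * `|s|)^-1 * (a - `|s| * b) ^+ 2).
    by rewrite mulr_ge0 ?sqr_ge0// invr_ge0 mulr_ge0.
  by rewrite /k /l; field; rewrite normr_eq0.
have hd r : is_derive r (1 : R) ((fun s => Lam (fun x => eta x * v (rot s x))) : R -> R^o)
    (Lam (fun x => eta x * ((1 + r ^+ 2 * c)^-1 * Xf Q v (rot r x)))).
  exact: is_derive_integral_rot.
have := @is_derive_lipschitz R (fun s => Lam (fun x => eta x * v (rot s x))) _ _ 0 s (fun t _ => hd t)
  (fun t _ => bound t).
rewrite subr0 => h.
have eN : Lam (fun x => eta x * v (rot s x)) - Lam (fun x => eta x * v (rot 0 x)) = N.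
  have cr r : sphere_cont (fun x => eta x * v (rot r x)).
    by apply: sphere_cont_mul => //; exact: (sphere_cont_rot scv).
  rewrite -mulN1r addrC -integral_dV0_lin//; apply: integral_dV0_eq => // x sx.
  have -> : rot 0 x = x by rewrite /rot scale0r addr0.
  by rewrite /eta; move: (v (rot s x)) (v x) => a b; ring.
rewrite eN in h.
have {}h := le_trans (ler_norm N) h.
have : (k * N + l * E) * `|s| = N / 2 + s ^+ 2 * E / 2.
  by rewrite -(real_normK (num_real s)) /k /l; field; rewrite normr_eq0.
by move=> e; rewrite e in h; lra.
Qed.

End Rotation.

(** * The three-sphere as the unit quaternions *)

Section Quaternions.
Context {R : realType}.
Notation V := (ambient R 1).
Notation W := [set y : V | y != 0].
Notation Lam := (@integral_dV0 R 1).
Implicit Types (x y z : V) (s t : R) (phi psi : V -> R) (v : V -> R^o).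

Let l0 : 'I_2 := ord0.
Let l1 : 'I_2 := ord_max.

Definition q0 x : R := x 0 (lshift 2 l0).
Definition q1 x : R := x 0 (lshift 2 l1).
Definition q2 x : R := x 0 (rshift 2 l0).
Definition q3 x : R := x 0 (rshift 2 l1).

Lemma ord2P (i : 'I_2) : i = l0 \/ i = l1.
Proof. by case: i => -[|[|//]] h; [left|right]; apply/val_inj. Qed.

Lemma quat_ext x y : q0 x = q0 y -> q1 x = q1 y -> q2 x = q2 y -> q3 x = q3 y -> x = y.
Proof.
move=> h0 h1 h2 h3; apply: rv_ext => i; case: (split_ordP i) => j ->.
  by have [->|->] := ord2P j.
by have [->|->] := ord2P j.
Qed.

Lemma quat_sum (F : 'I_(2 + 2) -> R) :
  \sum_i F i = F (lshift 2 l0) + F (lshift 2 l1) + F (rshift 2 l0) + F (rshift 2 l1).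
Proof.
rewrite big_split_ord /= !big_ord_recl !big_ord0 !addr0.
have -> : lift ord0 ord0 = l1 by apply/val_inj.
by rewrite addrA.
Qed.

Lemma edot_quat x y : edot x y = q0 x * q0 y + q1 x * q1 y + q2 x * q2 y + q3 x * q3 y.
Proof. exact: quat_sum. Qed.

Definition mx2 (a b c e : R) : 'M[R]_2 :=
  \matrix_(i, j) if i == l0 then (if j == l0 then a else b) else (if j == l0 then c else e).

(** Two horizontal fields that generate a copy of the quaternions under
   multiplication of matrices; their bracket is the missing direction. *)
Definition quatX : 'M[R]_(2 + 2) := frame (n := 1) ((l0, l1), false).
Definition quatY : 'M[R]_(2 + 2) := frame (n := 1) ((l0, l1), true).

Lemma quatX_block : quatX = block_mx (mx2 0 1 (-1) 0) 0 0 (mx2 0 (-1) 1 0).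
Proof.
rewrite /quatX /frame /= /skew_delta; congr block_mx; apply/matrixP => i j; rewrite !mxE;
  by have [->|->] := ord2P i; have [->|->] := ord2P j; rewrite /= ?subr0 ?sub0r ?opprK ?oppr0.
Qed.

Lemma quatY_block : quatY = block_mx 0 (mx2 0 1 (-1) 0) (mx2 0 1 (-1) 0) 0.
Proof.
rewrite /quatY /frame /= /skew_delta; congr block_mx; apply/matrixP => i j; rewrite !mxE;
  by have [->|->] := ord2P i; have [->|->] := ord2P j; rewrite /= ?subr0 ?sub0r ?opprK ?oppr0.
Qed.

Let mulE x (A : 'M[R]_(2 + 2)) j : (x *m A) 0 j =
  q0 x * A (lshift 2 l0) j + q1 x * A (lshift 2 l1) j + q2 x * A (rshift 2 l0) j + q3 x * A (rshift 2 l1) j.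
Proof. by rewrite mxE; exact: quat_sum. Qed.

Let blockE := (@block_mxEul R 2 2 2 2, @block_mxEur R 2 2 2 2, @block_mxEdl R 2 2 2 2, @block_mxEdr R 2 2 2 2).

Ltac qmul := rewrite /q0 /q1 /q2 /q3 mulE ?blockE ?mxE /= ?mulr0 ?mulr1 ?mulrN1 ?addr0 ?add0r.

Lemma q0X x : q0 (x *m quatX) = - q1 x. Proof. by rewrite quatX_block; qmul. Qed.
Lemma q1X x : q1 (x *m quatX) = q0 x. Proof. by rewrite quatX_block; qmul. Qed.
Lemma q2X x : q2 (x *m quatX) = q3 x. Proof. by rewrite quatX_block; qmul. Qed.
Lemma q3X x : q3 (x *m quatX) = - q2 x. Proof. by rewrite quatX_block; qmul. Qed.
Lemma q0Y x : q0 (x *m quatY) = - q3 x. Proof. by rewrite quatY_block; qmul. Qed.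
Lemma q1Y x : q1 (x *m quatY) = q2 x. Proof. by rewrite quatY_block; qmul. Qed.
Lemma q2Y x : q2 (x *m quatY) = - q1 x. Proof. by rewrite quatY_block; qmul. Qed.
Lemma q3Y x : q3 (x *m quatY) = q0 x. Proof. by rewrite quatY_block; qmul. Qed.

Lemma q0D x y : q0 (x + y) = q0 x + q0 y. Proof. exact: mxE. Qed.
Lemma q1D x y : q1 (x + y) = q1 x + q1 y. Proof. exact: mxE. Qed.
Lemma q2D x y : q2 (x + y) = q2 x + q2 y. Proof. exact: mxE. Qed.
Lemma q3D x y : q3 (x + y) = q3 x + q3 y. Proof. exact: mxE. Qed.
Lemma q0Z s x : q0 (s *: x) = s * q0 x. Proof. exact: mxE. Qed.
Lemma q1Z s x : q1 (s *: x) = s * q1 x. Proof. exact: mxE. Qed.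
Lemma q2Z s x : q2 (s *: x) = s * q2 x. Proof. exact: mxE. Qed.
Lemma q3Z s x : q3 (s *: x) = s * q3 x. Proof. exact: mxE. Qed.

Definition qE := (q0X, q1X, q2X, q3X, q0Y, q1Y, q2Y, q3Y, q0D, q1D, q2D, q3D, q0Z, q1Z, q2Z, q3Z).

Lemma mx_ext (A B : 'M[R]_(2 + 2)) : (forall x, x *m A = x *m B) -> A = B.
Proof. by move=> h; apply/row_matrixP => i; rewrite !rowE; exact: h. Qed.

Lemma quatX_sqr : quatX *m quatX = (- 1)%:M.
Proof.
apply: mx_ext => x; rewrite mulmxA mul_mx_scalar.
by apply: quat_ext; rewrite !qE; ring.
Qed.

Lemma quatY_sqr : quatY *m quatY = (- 1)%:M.
Proof.
apply: mx_ext => x; rewrite mulmxA mul_mx_scalar.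
by apply: quat_ext; rewrite !qE; ring.
Qed.

Lemma quatX_skew : quatX^T = - quatX. Proof. exact: frame_skew. Qed.
Lemma quatY_skew : quatY^T = - quatY. Proof. exact: frame_skew. Qed.

(** The quaternion product, as a combination of the right translations
   generated by quatX and quatY. *)
Definition quat x y : V := q0 y *: x + q1 y *: (x *m quatX) + q2 y *: (x *m quatY *m quatX) +
  q3 y *: (x *m quatY).

(** The imaginary part of the left multiplication by x. *)
Definition quatL x : 'M[R]_(2 + 2) :=
  block_mx (mx2 0 (q1 x) (- q1 x) 0) (mx2 (q2 x) (q3 x) (q3 x) (- q2 x))
    (mx2 (- q2 x) (- q3 x) (- q3 x) (q2 x)) (mx2 0 (q1 x) (- q1 x) 0).

Lemma q0L x y : q0 (y *m quatL x) = - (q1 y * q1 x) - q2 y * q2 x - q3 y * q3 x.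
Proof. by qmul; rewrite !mulrN. Qed.
Lemma q1L x y : q1 (y *m quatL x) = q0 y * q1 x - q2 y * q3 x + q3 y * q2 x.
Proof. by qmul; rewrite !mulrN. Qed.
Lemma q2L x y : q2 (y *m quatL x) = q0 y * q2 x + q1 y * q3 x - q3 y * q1 x.
Proof. by qmul; rewrite !mulrN. Qed.
Lemma q3L x y : q3 (y *m quatL x) = q0 y * q3 x - q1 y * q2 x + q2 y * q1 x.
Proof. by qmul; rewrite !mulrN. Qed.

(** The product is also the action of a matrix depending on x, whose part other
   than the multiples of the identity is skew. *)
Lemma quat_left x y : quat x y = q0 x *: y + y *m quatL x.
Proof.
by rewrite /quat; apply: quat_ext; rewrite ?(q0L, q1L, q2L, q3L, qE); ring.
Qed.

Lemma quatL_skew x : (quatL x)^T = - quatL x.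
Proof.
rewrite /quatL tr_block_mx opp_block_mx; congr block_mx; apply/matrixP => i j; rewrite !mxE;
  by have [->|->] := ord2P i; have [->|->] := ord2P j; rewrite /= ?opprK ?oppr0.
Qed.

Definition imag_sqr x : R := q1 x ^+ 2 + q2 x ^+ 2 + q3 x ^+ 2.

Lemma imag_sqr_ge0 x : 0 <= imag_sqr x.
Proof. by rewrite !addr_ge0 ?sqr_ge0. Qed.

Lemma quatL_sqr x : quatL x *m quatL x = (- imag_sqr x)%:M.
Proof.
apply: mx_ext => y; rewrite mulmxA mul_mx_scalar /imag_sqr.
by apply: quat_ext; rewrite ?(q0L, q1L, q2L, q3L, qE); ring.
Qed.

(** Euler's four-square identity. *)
Lemma edot_quat_mul x y : edot (quat x y) (quat x y) = edot x x * edot y y.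
Proof. by rewrite !edot_quat /quat !qE; ring. Qed.

Lemma quat_neq0 x y : x != 0 -> y != 0 -> quat x y != 0.
Proof.
by move=> x0 y0; rewrite -edot_eq0 edot_quat_mul mulf_neq0// edot_eq0.
Qed.

Lemma sphere_quat x : sphere x -> q0 x ^+ 2 + imag_sqr x = 1.
Proof.
move=> /sphereP; rewrite edot_quat /imag_sqr => <-; ring.
Qed.

Lemma mulmx_cvg (A : 'M[R]_(2 + 2)) (u : nat -> V) x : u k @[k --> \oo] --> x ->
  (u k *m A : V) @[k --> \oo] --> (x *m A : V).
Proof.
move=> ux; have e z : z *m A = rot A 1 z - z by rewrite /rot scale1r addrC addKr.
rewrite e (_ : (fun k => _) = (fun k => rot A 1 (u k) - u k)); last by apply/funext => k; exact: e.
by apply: cvgB => //; exact: (cvg_comp _ _ ux (@continuous_rot R 1 A 1 x)).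
Qed.

Lemma coord_cvg (u : nat -> V) x i : u k @[k --> \oo] --> x -> (u k 0 i : R) @[k --> \oo] --> (x 0 i : R).
Proof.
move=> /cvgrPdist_lt h; apply/cvgrPdist_lt => e /h; apply: filterS => k; apply: le_lt_trans.
by have := coord_le_norm (x - u k) i; rewrite !mxE.
Qed.

Lemma quat_cvg (u w : nat -> V) x y : u k @[k --> \oo] --> x -> w k @[k --> \oo] --> y ->
  quat (u k) (w k) @[k --> \oo] --> quat x y.
Proof.
by move=> ux wy; apply: cvgD; [apply: cvgD; [apply: cvgD|]|];
  apply: cvgZ; rewrite ?/(q0 _); try exact: coord_cvg; do ?apply: mulmx_cvg.
Qed.

Lemma sphere_cont_quat phi x : x != 0 -> sphere_cont phi -> sphere_cont (fun y => phi (quat x y)).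
Proof.
move=> x0 h y y0; apply: seq_continuous_at => u uy.
by apply: continuous_seq (h _ (quat_neq0 x0 y0)) _; apply: quat_cvg => //; exact: cvg_cst.
Qed.

(** Left multiplication by a unit quaternion x preserves the measure: apart
   from x = -1 it is, up to a factor, the square of a rotation with positive
   real part. *)
Lemma integral_quat v x : Ck W 1 v -> hom0 v -> sphere x -> Lam (fun y => v (quat x y)) = Lam v.
Proof.
move=> cv hv sx; have Sq := sphere_quat sx.
have rotation Q c s (w : V -> R^o) : Q^T = - Q -> Q *m Q = (- c)%:M -> 0 <= c -> Ck W 1 w -> hom0 w ->
    [/\ Lam (w \o rot Q s) = Lam w, Ck W 1 (w \o rot Q s) & hom0 (w \o rot Q s)].
  by move=> h1 h2 h3 cw hw; split; [exact: (integral_rot h1 h2)|exact: (Ck_rot h2)|exact: (hom0_rot h2)].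
have [e|e] := eqVneq (q0 x) (-1).
  have [i1 i2 i3] : [/\ q1 x = 0, q2 x = 0 & q3 x = 0].
    move: Sq; rewrite e /imag_sqr; have := sqr_ge0 (q1 x); have := sqr_ge0 (q2 x); have := sqr_ge0 (q3 x).
    by move=> a b c' d; split; apply/eqP; rewrite -sqrf_eq0; apply/eqP; lra.
  have X4 y : rot quatX 1 (rot quatX 1 (rot quatX 1 (rot quatX 1 y))) = 4 *: quat x y.
    by rewrite quat_left /rot; apply: quat_ext; rewrite ?(q0L, q1L, q2L, q3L, qE) e i1 i2 i3; ring.
  have [E1 c1 h1] := rotation _ _ 1 v quatX_skew quatX_sqr ler01 cv hv.
  have [E2 c2 h2] := rotation _ _ 1 _ quatX_skew quatX_sqr ler01 c1 h1.
  have [E3 c3 h3] := rotation _ _ 1 _ quatX_skew quatX_sqr ler01 c2 h2.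
  have [E4 c4 h4] := rotation _ _ 1 _ quatX_skew quatX_sqr ler01 c3 h3.
  rewrite -E1 -E2 -E3 -E4; apply: integral_dV0_eq; first exact: sphere_cont_Ck c4.
  move=> y sy; have n0 : quat x y != 0 by apply: quat_neq0; exact: sphere_neq0.
  by have := hv 4 _ (ltr0Sn R 3) n0; rewrite -X4 => <-.
have x1 : 0 < 1 + q0 x.
  have : -1 <= q0 x by have := imag_sqr_ge0 x; have := sqr_ge0 (1 + q0 x); nra.
  by rewrite le_eqVlt eq_sym (negPf e) /=; lra.
pose t := (1 + q0 x)^-1.
have R2 y : rot (quatL x) t (rot (quatL x) t y) = (2 * t) *: quat x y.
  rewrite quat_left {1}/rot rot_mulQ /rot -mulmxA quatL_sqr mul_mx_scalar.
  have -> : imag_sqr x = (1 - q0 x) * (1 + q0 x) by move: Sq; rewrite expr2; lra.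
  apply: quat_ext; rewrite ?(q0D, q1D, q2D, q3D, q0Z, q1Z, q2Z, q3Z) /t; field; exact: lt0r_neq0.
have [E1 c1 h1] := rotation _ _ t v (quatL_skew x) (quatL_sqr x) (imag_sqr_ge0 x) cv hv.
have [E2 c2 h2] := rotation _ _ t _ (quatL_skew x) (quatL_sqr x) (imag_sqr_ge0 x) c1 h1.
rewrite -E1 -E2; apply: integral_dV0_eq; first exact: sphere_cont_Ck c2.
move=> y sy; have n0 : quat x y != 0 by apply: quat_neq0; exact: sphere_neq0.
have t2 : 0 < 2 * t by apply: mulr_gt0; [exact: ltr0Sn|rewrite /t invr_gt0; exact: x1].
by have := hv _ _ t2 n0; rewrite -R2 => <-.
Qed.

End Quaternions.

(** * Decomposition of a quaternion into horizontal rotations *)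

Section Decomposition.
Context {R : realType}.
Implicit Types (r : R).

(** Solves (1 + a X)(1 + b Y)(1 + c X) = h up to a factor, X and Y being
   anticommuting imaginary units: with h = z + Y w and z, w complex numbers
   over X, the angles of the outer factors are half the sum and half the
   difference of the arguments of z and w, and 1 + e / |e| has half the argument
   of e. *)
Lemma euler_decomposition r (h0 h1 h2 h3 : R) : 0 < r -> r <= 1 ->
  4^-1 <= h0 <= 2^-1 -> `|h1| <= r / 8 -> `|h2| <= r ^+ 2 / 8 -> r / 8 <= h3 <= r / 4 ->
  exists a b c l : R, [/\ 0 < l, h0 = l * (1 - a * c), h1 = l * (a + c), h2 = l * (b * (c - a)) &
    h3 = l * (b * (1 + a * c))] /\ [/\ `|a| <= 2 * r, `|b| <= 2 * r & `|c| <= 2 * r].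
Proof.
move=> r0 r1 /andP[h01 h02] h1r h2r /andP[h31 h32].
have rr : r ^+ 2 <= r by rewrite expr2 ler_piMl// ltW.
have rr0 : 0 < r ^+ 2 by rewrite exprn_gt0.
have h0p : 0 < h0 by lra.
have h3p : 0 < h3 by lra.
pose z2 := h0 ^+ 2 + h1 ^+ 2; pose w2 := h3 ^+ 2 + h2 ^+ 2.
have z20 : 0 < z2 by rewrite ltr_pwDl ?exprn_gt0 ?sqr_ge0.
have w20 : 0 < w2 by rewrite ltr_pwDl ?exprn_gt0 ?sqr_ge0.
pose N := Num.sqrt (z2 * w2).
have NE : N ^+ 2 = z2 * w2 by rewrite sqr_sqrtr// ltW// mulr_gt0.
have N0 : 0 <= N by exact: sqrtr_ge0.
have NE' : N * N = (h0 ^+ 2 + h1 ^+ 2) * (h3 ^+ 2 + h2 ^+ 2) by rewrite -NE expr2.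
have h03 : 0 < h0 * h3 by exact: mulr_gt0.
have N03 : h0 * h3 <= N.
  rewrite -ler_sqr ?nnegrE// ?(ltW h03)// NE exprMn.
  by apply: ler_pM; rewrite ?sqr_ge0// lerDl sqr_ge0.
have h03r : r / 32 <= h0 * h3.
  have -> : r / 32 = 4^-1 * (r / 8) by field.
  by apply: ler_pM => //; rewrite ?invr_ge0// divr_ge0// ltW.
have h12 : `|h1 * h2| <= r ^+ 2 / 64.
  have -> : r ^+ 2 / 64 = 8^-1 * (r ^+ 2 / 8) by field.
  rewrite normrM; apply: ler_pM => //; apply: (le_trans h1r); lra.
have num : `|h0 * h2| + `|h1 * h3| <= 3 * r ^+ 2 / 32.
  have e1 : `|h0 * h2| <= 2^-1 * (r ^+ 2 / 8).
    by rewrite normrM; apply: ler_pM => //; rewrite gtr0_norm.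
  have e2 : `|h1 * h3| <= (r / 8) * (r / 4).
    by rewrite normrM; apply: ler_pM => //; rewrite gtr0_norm.
  apply: (le_trans (lerD e1 e2)); rewrite expr2; lra.
pose P := N + h0 * h3 - h1 * h2; pose M := N + h0 * h3 + h1 * h2.
move: h12; rewrite ler_norml => /andP[h12a h12b].
have P0 : 3 * r / 64 <= P by rewrite /P; lra.
have M0 : 3 * r / 64 <= M by rewrite /M; lra.
have P1 : 0 < P by lra.
have M1 : 0 < M by lra.
pose k := 2 * (h0 * w2 + N * h3).
have k0 : 0 < k by rewrite /k mulr_gt0// ltr_pwDl ?mulr_gt0// mulr_ge0// ltW.
have quot (x y : R) : 3 * r / 64 <= y -> `|x| <= 3 * r ^+ 2 / 32 -> `|x / y| <= 2 * r.
  move=> hy hx; have y0 : 0 < y by lra.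
  rewrite normrM normfV (gtr0_norm y0) ler_pdivrMr//; apply: (le_trans hx).
  have -> : 3 * r ^+ 2 / 32 = 2 * r * (3 * r / 64) by field.
  by apply: ler_wpM2l => //; lra.
exists ((h1 * h3 - h0 * h2) / M), (N / z2), ((h0 * h2 + h1 * h3) / P), (P * M / k).
have Pn := lt0r_neq0 P1; have Mn := lt0r_neq0 M1; have kn := lt0r_neq0 k0; have zn := lt0r_neq0 z20.
split; [split|split].
- by rewrite divr_gt0// mulr_gt0.
- have e : P * M - (h1 * h3 - h0 * h2) * (h0 * h2 + h1 * h3) = k * h0.
    have -> : P * M - (h1 * h3 - h0 * h2) * (h0 * h2 + h1 * h3) =
      N * N + 2 * N * h0 * h3 + h0 ^+ 2 * h3 ^+ 2 - h1 ^+ 2 * h2 ^+ 2 - (h1 * h3 - h0 * h2) * (h0 * h2 + h1 * h3).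
      by rewrite /P /M; ring.
    by rewrite NE' /k /w2; ring.
  have -> : P * M / k * (1 - (h1 * h3 - h0 * h2) / M * ((h0 * h2 + h1 * h3) / P)) =
    (P * M - (h1 * h3 - h0 * h2) * (h0 * h2 + h1 * h3)) / k by field; rewrite Mn Pn kn.
  by rewrite e mulrAC mulfV// mul1r.
- have e : (h1 * h3 - h0 * h2) * P + (h0 * h2 + h1 * h3) * M = k * h1.
    by rewrite /P /M /k /w2; ring.
  have -> : P * M / k * ((h1 * h3 - h0 * h2) / M + (h0 * h2 + h1 * h3) / P) =
    ((h1 * h3 - h0 * h2) * P + (h0 * h2 + h1 * h3) * M) / k by field; rewrite Mn Pn kn.
  by rewrite e mulrAC mulfV// mul1r.
- have e : N * ((h0 * h2 + h1 * h3) * M - (h1 * h3 - h0 * h2) * P) = k * z2 * h2.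
    have -> : N * ((h0 * h2 + h1 * h3) * M - (h1 * h3 - h0 * h2) * P) =
       2 * h2 * h0 * (N * N) + N * (2 * h0 * h2 * h0 * h3 + 2 * h1 * h3 * h1 * h2) by rewrite /P /M; ring.
    by rewrite NE' /k /w2 /z2; ring.
  have -> : P * M / k * (N / z2 * ((h0 * h2 + h1 * h3) / P - (h1 * h3 - h0 * h2) / M)) =
    (N * ((h0 * h2 + h1 * h3) * M - (h1 * h3 - h0 * h2) * P)) / (k * z2) by field; rewrite Mn Pn kn zn.
  by rewrite e mulrAC mulfV ?mul1r// mulf_neq0.
- have e : N * (P * M + (h1 * h3 - h0 * h2) * (h0 * h2 + h1 * h3)) = k * z2 * h3.
    have -> : N * (P * M + (h1 * h3 - h0 * h2) * (h0 * h2 + h1 * h3)) =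
      N * (N * N + h0 ^+ 2 * h3 ^+ 2 - h1 ^+ 2 * h2 ^+ 2 + (h1 * h3 - h0 * h2) * (h0 * h2 + h1 * h3))
      + 2 * h0 * h3 * (N * N) by rewrite /P /M; ring.
    by rewrite NE' /k /w2 /z2; ring.
  have -> : P * M / k * (N / z2 * (1 + (h1 * h3 - h0 * h2) / M * ((h0 * h2 + h1 * h3) / P))) =
    (N * (P * M + (h1 * h3 - h0 * h2) * (h0 * h2 + h1 * h3))) / (k * z2) by field; rewrite Mn Pn kn zn.
  by rewrite e mulrAC mulfV ?mul1r// mulf_neq0.
- apply: quot => //; apply: le_trans num; apply: (le_trans (ler_normB _ _)); by rewrite addrC.
- rewrite ger0_norm ?divr_ge0 ?(ltW z20)// ler_pdivrMr// -ler_sqr ?nnegrE//; last first.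
    by rewrite mulr_ge0 ?(ltW z20)// mulr_ge0// ltW.
  have e1 : 16^-1 <= z2.
    have : 4^-1 * 4^-1 <= h0 * h0 by apply: ler_pM => //; rewrite invr_ge0.
    by rewrite /z2 !expr2; have := sqr_ge0 h1; rewrite expr2; lra.
  have e2 : h3 ^+ 2 <= r ^+ 2 / 16.
    by have : h3 * h3 <= (r / 4) * (r / 4) by [apply: ler_pM => //; exact: ltW]; rewrite !expr2; lra.
  have e3 : h2 ^+ 2 <= r ^+ 2 / 64.
    rewrite -(real_normK (num_real h2)).
    have : `|h2| * `|h2| <= (r / 8) * (r / 8).
      by apply: ler_pM => //; apply: (le_trans h2r); lra.
    by rewrite !expr2; lra.
  have e4 : 16^-1 * (4 * r ^+ 2) <= z2 * (4 * r ^+ 2) by apply: ler_wpM2r => //; rewrite mulr_ge0// ltW.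
  have e5 : w2 <= z2 * (4 * r ^+ 2) by apply: le_trans e4; rewrite /w2; lra.
  have -> : (2 * r * z2) ^+ 2 = z2 * (z2 * (4 * r ^+ 2)) by ring.
  by rewrite NE; apply: ler_wpM2l => //; exact: ltW.
- by apply: quot => //; apply: le_trans num; exact: ler_normD.
Qed.

End Decomposition.

(** * An anisotropic bump *)

Section Kernel.
Context {R : realType}.
Notation V := (ambient R 1).
Notation W := [set y : V | y != 0].
Notation Lam := (@integral_dV0 R 1).
Implicit Types (x y z : V) (s t r : R) (phi psi : V -> R) (v : V -> R^o).

(** Written with absolute values only, which makes its continuity immediate. *)
Definition tent (s : R) : R := (1 - `|s| + `|1 - `|s| |) / 2.

Lemma tentE s : tent s = Num.max 0 (1 - `|s|).
Proof.
rewrite /tent; move: (1 - `|s|) => a.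
by have [h|h] := leP 0 a; [rewrite ger0_norm//|rewrite ltr0_norm//]; field.
Qed.

Lemma tent_ge0 s : 0 <= tent s.
Proof. by rewrite tentE le_max lexx. Qed.

Lemma tent_le1 s : tent s <= 1.
Proof. by rewrite tentE ge_max ler01 gerBl normr_ge0. Qed.

Lemma tent_neq0 s : tent s != 0 -> `|s| < 1.
Proof.
by rewrite ltNge; apply: contraNN => h; rewrite tentE; apply/eqP/max_idPl; rewrite subr_le0.
Qed.

Lemma tent_half s : `|s| <= 2^-1 -> 2^-1 <= tent s.
Proof. by move=> h; rewrite tentE le_max; apply/orP; right; move: (`|s|) h => a h; lra. Qed.

Lemma tent_cvg (u : nat -> R) s : u k @[k --> \oo] --> s -> tent (u k) @[k --> \oo] --> tent s.
Proof.
move=> us; have h : 1 - `|u k| @[k --> \oo] --> 1 - `|s|.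
  by apply: cvgB; [exact: cvg_cst|exact: (@cvg_norm _ R^o)].
by apply: cvgMl; apply: cvgD => //; exact: (@cvg_norm _ R^o).
Qed.

(** A bump of height 1 on a box which, in Heisenberg coordinates at the unit
   quaternion, has the anisotropic size r, r, r^2; its mass is of order r^4. The
   last coordinate stays away from 0, as the decomposition into rotations
   requires. *)
Definition kernel r y : R :=
  tent ((q0 y - 3 / 8) * 8) * tent (q1 y * (8 / r)) * tent (q2 y * (8 / r ^+ 2)) *
  tent ((q3 y - 3 * r / 16) * (16 / r)).

Lemma kernel_ge0 r y : 0 <= kernel r y.
Proof. by rewrite /kernel; do 3 (apply: mulr_ge0; last exact: tent_ge0); exact: tent_ge0. Qed.

Lemma kernel_le1 r y : kernel r y <= 1.
Proof.
have h (a b : R) : 0 <= a <= 1 -> 0 <= b <= 1 -> 0 <= a * b <= 1.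
  by move=> /andP[a0 a1] /andP[b0 b1]; rewrite mulr_ge0// mulr_ile1.
have t u : 0 <= tent u <= 1 by rewrite tent_ge0 tent_le1.
suff /andP[] : 0 <= kernel r y <= 1 by [].
exact: (h _ _ (h _ _ (h _ _ (t _) (t _)) (t _)) (t _)).
Qed.

Lemma kernel_supp r y : 0 < r -> kernel r y != 0 ->
  [/\ 4^-1 <= q0 y <= 2^-1, `|q1 y| <= r / 8, `|q2 y| <= r ^+ 2 / 8 & r / 8 <= q3 y <= r / 4].
Proof.
move=> r0; have rr0 : 0 < r ^+ 2 by rewrite exprn_gt0.
rewrite /kernel 3!mulf_eq0 !negb_or -!andbA => /and4P[n0 n1 n2 n3].
have h0 := tent_neq0 n0; have h1 := tent_neq0 n1; have h2 := tent_neq0 n2; have h3 := tent_neq0 n3.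
split.
- by move: h0; rewrite ltr_norml => /andP[a b]; apply/andP; split; lra.
- move: h1; rewrite normrM [`|8 / r|]gtr0_norm ?divr_gt0// mulrA ltr_pdivrMr// mul1r => h1; lra.
- move: h2; rewrite normrM [`|8 / _|]gtr0_norm ?divr_gt0// mulrA ltr_pdivrMr// mul1r => h2; lra.
- move: h3; rewrite normrM [`|16 / _|]gtr0_norm ?divr_gt0// mulrA ltr_pdivrMr// mul1r => h3.
  have : `|q3 y - 3 * r / 16| < r / 16 by lra.
  by rewrite ltr_norml => /andP[a b]; apply/andP; split; lra.
Qed.

Lemma kernel_coord r y : 0 < r -> r <= 1 -> kernel r y != 0 -> forall i, `|y 0 i| <= 2^-1.
Proof.
move=> r0 r1 /(kernel_supp r0) [h0 h1 h2 h3] i.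
have rr : r ^+ 2 <= 1 by rewrite expr2; have : r * r <= 1 * 1 by [apply: ler_pM => //; exact: ltW]; rewrite mul1r.
have H0 : `|q0 y| <= 2^-1 by rewrite ger0_norm; lra.
have H1 : `|q1 y| <= 2^-1 by lra.
have H2 : `|q2 y| <= 2^-1 by lra.
have H3 : `|q3 y| <= 2^-1 by rewrite ger0_norm; lra.
by case: (split_ordP i) => j ->; have [->|->] := ord2P j.
Qed.

Lemma kernel_bounded_supp r : 0 < r -> r <= 1 -> bounded_supp 2 1 (kernel r).
Proof.
move=> r0 r1 y; split; first by rewrite ger0_norm ?kernel_ge0// kernel_le1.
move=> hy; apply/eqP; apply: contraTT hy => /(kernel_coord r0 r1) h; rewrite -leNgt.
by apply: norm_le_coord => // i; apply: (le_trans (h i)); lra.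
Qed.

Lemma kernel_enorm r y : 0 < r -> r <= 1 -> kernel r y != 0 -> enorm y <= 1.
Proof.
move=> r0 r1 /(kernel_coord r0 r1) h; rewrite enorm_le1 edot_quat -!expr2.
have sq (a : R) : `|a| <= 2^-1 -> a ^+ 2 <= 4^-1.
  move=> ha; rewrite -(real_normK (num_real a)).
  have : `|a| * `|a| <= 2^-1 * 2^-1 by apply: ler_pM.
  by rewrite -expr2 => ?; lra.
by have := sq _ (h (lshift 2 ord0)); have := sq _ (h (lshift 2 ord_max)); have := sq _ (h (rshift 2 ord0));
  have := sq _ (h (rshift 2 ord_max)); rewrite -/(q0 y) -/(q1 y) -/(q2 y) -/(q3 y); lra.
Qed.

Lemma kernel_cvg r (u : nat -> V) y : u k @[k --> \oo] --> y -> kernel r (u k) @[k --> \oo] --> kernel r y.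
Proof.
move=> uy; rewrite /kernel /q0 /q1 /q2 /q3.
by apply: cvgM; [apply: cvgM; [apply: cvgM|]|]; apply: tent_cvg; apply: cvgMl;
  try apply: cvgB; try exact: coord_cvg; exact: cvg_cst.
Qed.

Lemma kernel_near0 r (u : nat -> V) : u k @[k --> \oo] --> (0 : V) -> \forall k \near \oo, kernel r (u k) = 0.
Proof.
move=> u0; have h := coord_cvg (i := lshift 2 ord0) u0; rewrite mxE in h.
have e0 : (0 : R) < 4^-1 by rewrite invr_gt0.
move/cvgr0Pnorm_lt : h => /(_ _ e0); apply: filterS => k hk.
have : tent ((q0 (u k) - 3 / 8) * 8) = 0.
  apply/eqP; apply: contraTT hk => /tent_neq0; rewrite -leNgt ltr_norml => /andP[a b].
  by apply: le_trans (ler_norm _); rewrite -/(q0 (u k)); lra.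
by rewrite /kernel => ->; rewrite !mul0r.
Qed.

Lemma kernel0 r : kernel r 0 = 0.
Proof.
have h : (0 : V) @[k --> \oo] --> (0 : V) by exact: cvg_cst.
by have [N _ /(_ N (leqnn N))] := kernel_near0 r h.
Qed.

Definition vec4 (a b c e : R) : V :=
  row_mx (\row_j if j == ord0 then a else b) (\row_j if j == ord0 then c else e).

(** On the concentric box of half the size each factor is at least 1/2. *)
Lemma kernel_mass r : 0 < r -> r <= 1 -> r ^+ 4 / 2 ^+ 17 <= integral_rV (kernel r).
Proof.
move=> r0 r1.
pose c := vec4 (3 / 8) 0 0 (3 * r / 16); pose w := vec4 (1 / 8) (r / 8) (r ^+ 2 / 8) (r / 16).
have nk : nice 2 1 (kernel r).
  apply: continuous_nice => //; last exact: kernel_bounded_supp.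
  by move=> y; apply: seq_continuous_at => u; exact: kernel_cvg.
have vE a b e f : [/\ q0 (vec4 a b e f) = a, q1 (vec4 a b e f) = b, q2 (vec4 a b e f) = e & q3 (vec4 a b e f) = f].
  by rewrite /q0 /q1 /q2 /q3 /vec4 !row_mxEl !row_mxEr !mxE.
have [c0 c1 c2 c3] := vE (3 / 8) 0 0 (3 * r / 16).
have [w0 w1 w2 w3] := vE (1 / 8) (r / 8) (r ^+ 2 / 8) (r / 16).
have rr0 : 0 < r ^+ 2 by rewrite exprn_gt0.
have wp i : 0 <= w 0 i.
  by case: (split_ordP i) => j ->; have [->|->] := ord2P j;
    rewrite ?[w 0 _]w0 ?[w 0 _]w1 ?[w 0 _]w2 ?[w 0 _]w3 divr_ge0// ltW.
have := @integral_rV_box R _ 2 1 16^-1 (kernel r) (fun i => c 0 i - w 0 i / 2) (fun i => c 0 i + w 0 i / 2).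
have -> : \prod_i (c 0 i + w 0 i / 2 - (c 0 i - w 0 i / 2)) = (1 / 8) * (r / 8) * (r ^+ 2 / 8) * (r / 16).
  under eq_bigr do rewrite opprB addrC addrA subrK -splitr.
  rewrite big_split_ord /= !big_ord_recl !big_ord0 !mulr1.
  have -> : lift ord0 ord0 = ord_max :> 'I_2 by apply/val_inj.
  by rewrite ?[w 0 _]w0 ?[w 0 _]w1 ?[w 0 _]w2 ?[w 0 _]w3 !mulrA.
have -> : 16^-1 * (1 / 8 * (r / 8) * (r ^+ 2 / 8) * (r / 16)) = r ^+ 4 / 2 ^+ 17 by field.
apply=> //; [exact: kernel_ge0|by move=> i; have := wp i; lra|].
move=> y hy.
have hy0 := hy (lshift 2 ord0); have hy1 := hy (lshift 2 ord_max).
have hy2 := hy (rshift 2 ord0); have hy3 := hy (rshift 2 ord_max).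
rewrite ?[w 0 _]w0 ?[w 0 _]w1 ?[w 0 _]w2 ?[w 0 _]w3 ?[c 0 _]c0 ?[c 0 _]c1 ?[c 0 _]c2 ?[c 0 _]c3 in hy0 hy1 hy2 hy3.
rewrite -/(q0 y) in hy0; rewrite -/(q1 y) in hy1; rewrite -/(q2 y) in hy2; rewrite -/(q3 y) in hy3.
have rn := lt0r_neq0 r0.
have scale (a b k : R) : 0 < k -> - (b / 2) <= a <= b / 2 -> b * k = 1 -> 2^-1 <= tent (a * k).
  move=> k0 /andP[h1 h2] e; apply: tent_half; rewrite normrM (gtr0_norm k0).
  have h : `|a| <= b / 2 by rewrite ler_norml h1 h2.
  by apply: (le_trans (ler_wpM2r (ltW k0) h)); rewrite mulrAC e mul1r.
have t0 : 2^-1 <= tent ((q0 y - 3 / 8) * 8).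
  by apply: (scale _ (1 / 8)) => //; [apply/andP; split; lra|field].
have t1 : 2^-1 <= tent (q1 y * (8 / r)).
  by apply: (scale _ (r / 8)); [rewrite divr_gt0|apply/andP; split; lra|field].
have t2 : 2^-1 <= tent (q2 y * (8 / r ^+ 2)).
  by apply: (scale _ (r ^+ 2 / 8)); [rewrite divr_gt0|apply/andP; split; lra|field].
have t3 : 2^-1 <= tent ((q3 y - 3 * r / 16) * (16 / r)).
  by apply: (scale _ (r / 16)); [rewrite divr_gt0|apply/andP; split; lra|field].
have -> : 16^-1 = 2^-1 * 2^-1 * 2^-1 * 2^-1 :> R by field.
rewrite /kernel.
have h2 : 0 <= 2^-1 :> R by rewrite invr_ge0.
by do 3 (apply: ler_pM => //; rewrite ?mulr_ge0//).
Qed.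

End Kernel.

(** * Translations in the horizontal Sobolev space *)

Section WeakType.
Context {R : realType}.
Notation V := (ambient R 1).
Notation W := [set y : V | y != 0].
Notation Lam := (@integral_dV0 R 1).
Implicit Types (x y z : V) (s t r : R) (phi psi : V -> R) (v : V -> R^o).

Definition dirichlet v : R :=
  Lam (fun x => Xf quatX v x ^+ 2) + Lam (fun x => Xf quatY v x ^+ 2).

Lemma Ck_sqr k v : Ck W k v -> Ck W k (fun x => v x ^+ 2 : R^o).
Proof.
move=> cv; have -> : (fun x => v x ^+ 2 : R^o) = (fun x => v x * v x) by apply/funext => x; rewrite expr2.
exact: (Ck_mul open_neq0).
Qed.

Lemma sphere_cont_sqr phi : sphere_cont phi -> sphere_cont (fun x => phi x ^+ 2).
Proof. by move=> h; under eq_fun do rewrite expr2; exact: sphere_cont_mul. Qed.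

Lemma sphere_cont_scale s phi : sphere_cont phi -> sphere_cont (fun x => s * phi x).
Proof. by move=> h; apply: sphere_cont_mul => //; exact: sphere_cont_cst. Qed.

Lemma sphere_cont_sub phi psi : sphere_cont phi -> sphere_cont psi -> sphere_cont (fun x => phi x - psi x).
Proof.
move=> h1 h2; rewrite (_ : (fun x => _) = (fun x => -1 * psi x + phi x)); first exact: sphere_cont_lin.
by apply/funext => x; rewrite mulN1r addrC.
Qed.

Lemma sqr_add3 (a b c e : R) : (a - e) ^+ 2 <= 3 * ((a - b) ^+ 2 + (b - c) ^+ 2 + (c - e) ^+ 2).
Proof.
have := sqr_ge0 ((a - b) - (b - c)); have := sqr_ge0 ((a - b) - (c - e)).
by have := sqr_ge0 ((b - c) - (c - e)); rewrite !expr2; lra.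
Qed.

Lemma modulus_sum (a b c x y s : R) : a <= 4 * s * x -> b <= 4 * s * y -> c <= 4 * s * x -> 0 <= s * y ->
  3 * (a + b + c) <= 24 * s * (x + y).
Proof. by move=> *; lra. Qed.

Lemma sqr_le4 (s r : R) : `|s| <= 2 * r -> s ^+ 2 <= 4 * r ^+ 2.
Proof.
move=> hs; rewrite -(real_normK (num_real s)).
by have : `|s| * `|s| <= (2 * r) * (2 * r) by [apply: ler_pM]; rewrite !expr2; lra.
Qed.

Section Modulus.
Variable v : V -> R^o.
Hypothesis cv2 : Ck W 2 v.
Hypothesis hv : hom0 v.

Let cv : Ck W 1 v. Proof. exact: Ck_S. Qed.

Definition sqdiff (Q : 'M[R]_(2 + 2)) s x : R^o := (v (rot Q s x) - v x) ^+ 2.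

Lemma sqdiff_Ck (Q : 'M[R]_(2 + 2)) (c : R) s : Q *m Q = (- c)%:M -> 0 <= c -> Ck W 1 (sqdiff Q s) /\ hom0 (sqdiff Q s).
Proof.
move=> Q2 c0; split; last first.
  move=> a x a0 x0; rewrite /sqdiff rotZ hv// ?[v (a *: x)]hv//; exact: (rot_neq0 Q2 c0).
have e : sqdiff Q s = (fun x => ((v \o rot Q s) x + -1 * v x) ^+ 2) by apply/funext => x; rewrite /sqdiff mulN1r.
rewrite e; apply: Ck_sqr; apply: (Ck_add open_neq0); first exact: (Ck_rot Q2 c0).
exact: (Ck_scale open_neq0).
Qed.

(** Three rotations in horizontal directions by angles of order r reach the
   translation by y, whose component along the bracket of quatX and quatY is of
   order r^2. *)
Lemma quat_modulus r y : 0 < r -> r <= 1 -> kernel r y != 0 ->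
  Lam (fun x => (v (quat x y) - v x) ^+ 2) <= 24 * r ^+ 2 * dirichlet v.
Proof.
move=> r0 r1 /(kernel_supp r0) [h0 h1 h2 h3].
have [a [b [c [l [[l0 e0 e1 e2 e3] [ha hb hc]]]]]] := euler_decomposition r0 r1 h0 h1 h2 h3.
have E x : quat x y = l *: rot quatX c (rot quatY b (rot quatX a x)).
  by rewrite /quat /rot e0 e1 e2 e3; apply: quat_ext; rewrite !qE; ring.
have [cX hX] := sqdiff_Ck c quatX_sqr ler01; have [cY hY] := sqdiff_Ck b quatY_sqr ler01.
have [cX' hX'] := sqdiff_Ck a quatX_sqr ler01.
have cYX := Ck_rot quatX_sqr ler01 a cY; have hYX := hom0_rot quatX_sqr ler01 a hY.
have cXY := Ck_rot quatY_sqr ler01 b cX; have hXY := hom0_rot quatY_sqr ler01 b hX.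
have cXYX := Ck_rot quatX_sqr ler01 a cXY.
have IA : Lam ((sqdiff quatX c \o rot quatY b) \o rot quatX a) = Lam (sqdiff quatX c).
  by rewrite (integral_rot quatX_skew quatX_sqr ler01 a cXY hXY) (integral_rot quatY_skew quatY_sqr ler01 b cX hX).
have IB : Lam (sqdiff quatY b \o rot quatX a) = Lam (sqdiff quatY b).
  exact: (integral_rot quatX_skew quatX_sqr ler01 a cY hY).
have sA := sphere_cont_Ck cXYX; have sB := sphere_cont_Ck cYX; have sC := sphere_cont_Ck cX'.
have sAB : sphere_cont (fun x => ((sqdiff quatX c \o rot quatY b) \o rot quatX a) x + (sqdiff quatY b \o rot quatX a) x).
  exact: sphere_cont_add.
have sABC := sphere_cont_scale (s := 3) (sphere_cont_add sAB sC).
pose w := ((v \o rot quatX c) \o rot quatY b) \o rot quatX a.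
have scw : sphere_cont w.
  exact: (sphere_cont_Ck (Ck_rot quatX_sqr ler01 a (Ck_rot quatY_sqr ler01 b (Ck_rot quatX_sqr ler01 c cv)))).
have wE x : x != 0 -> v (quat x y) = w x.
  move=> x0; have n1 := rot_neq0 quatX_sqr ler01 a x0; have n2 := rot_neq0 quatY_sqr ler01 b n1.
  by rewrite E (hv l0 (rot_neq0 quatX_sqr ler01 c n2)).
have sw2 : sphere_cont (fun x => (w x - v x) ^+ 2) := sphere_cont_sqr (sphere_cont_sub scw (sphere_cont_Ck cv)).
have bound : Lam (fun x => (v (quat x y) - v x) ^+ 2) <=
    3 * (Lam (sqdiff quatX c) + Lam (sqdiff quatY b) + Lam (sqdiff quatX a)).
  have EQ := etrans (integral_dV0_scale 3 (sphere_cont_add sAB sC)) (congr1 (fun t : R => 3 * t)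
    (etrans (integral_dV0_add sAB sC) (congr1 (fun t : R => t + Lam (sqdiff quatX a))
      (etrans (integral_dV0_add sA sB) (f_equal2 +%R IA IB))))).
  rewrite -EQ.
  rewrite (integral_dV0_eq (psi := fun x => (w x - v x) ^+ 2)); first last.
  - by move=> x sx; exact: (congr1 (fun t : R => (t - v x) ^+ 2) (wE x (sphere_neq0 sx))).
  - exact: sw2.
  apply: (integral_dV0_le sw2 sABC).
  by move=> x sx; exact: sqr_add3.
have eX0 : 0 <= Lam (fun x => Xf quatX v x ^+ 2).
  apply: integral_dV0_ge0; last by move=> x _; exact: sqr_ge0.
  by apply: sphere_cont_sqr; apply: (sphere_cont_Ck (k := 0)); exact: (Ck_Xf open_neq0).
have eY0 : 0 <= Lam (fun x => Xf quatY v x ^+ 2).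
  apply: integral_dV0_ge0; last by move=> x _; exact: sqr_ge0.
  by apply: sphere_cont_sqr; apply: (sphere_cont_Ck (k := 0)); exact: (Ck_Xf open_neq0).
have mA := rot_modulus quatX_skew quatX_sqr ler01 c cv2 hv.
have mB := rot_modulus quatY_skew quatY_sqr ler01 b cv2 hv.
have mC := rot_modulus quatX_skew quatX_sqr ler01 a cv2 hv.
have nA := ler_wpM2r eX0 (sqr_le4 hc); have nB := ler_wpM2r eY0 (sqr_le4 hb); have nC := ler_wpM2r eX0 (sqr_le4 ha).
apply: (le_trans bound); rewrite /dirichlet.
have rY := mulr_ge0 (sqr_ge0 r) eY0.
exact: (modulus_sum (le_trans mA nA) (le_trans mB nB) (le_trans mC nC) rY).
Qed.

End Modulus.
End WeakType.

(** * Averages over anisotropic boxes and a weak-type inequality *)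

Section IntegralRules.
Context {R : realType} {d : nat}.
Notation I := (@integral_rV R d).
Notation niced := (@nice R d 2).
Implicit Types (F K : 'rV[R]_d -> R).

Let two_ge0 : 0 <= 2 :> R. Proof. by []. Qed.

Lemma nice_zero : niced 0 (fun=> 0).
Proof.
apply: continuous_nice => //; first by move=> y; apply: seq_continuous_at => u _; exact: cvg_cst.
by move=> y; rewrite normr0.
Qed.

Lemma nice_scale (a M : R) F : niced M F ->
  niced (`|a| * M + 0) (fun y => a * F y) /\ I (fun y => a * F y) = a * I F.
Proof.
move=> nF; have [h1 h2] := integral_rV_lin a two_ge0 nF nice_zero.
have e : (fun y => a * F y + 0) = (fun y => a * F y) by apply/funext => y; rewrite addr0.
by rewrite e in h1 h2; split=> //; rewrite h2 integral_rV0 addr0.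
Qed.

Lemma integral_rV_le (M M' : R) F K : niced M F -> niced M' K ->
  (forall y, F y <= K y) -> I F <= I K.
Proof.
move=> nF nK h; rewrite -subr_ge0.
have [_ e] := integral_rV_lin (-1) two_ge0 nF nK.
have -> : I K - I F = I (fun y => -1 * F y + K y) by rewrite e mulN1r addrC.
by apply: integral_rV_ge0 => y; rewrite mulN1r addrC subr_ge0.
Qed.

End IntegralRules.

Section Averages.
Context {R : realType}.
Notation V := (ambient R 1).
Notation W := [set y : V | y != 0].
Notation Lam := (@integral_dV0 R 1).
Notation I4 := (@integral_rV R (2 + 2)).
Notation nice4 := (@nice R (2 + 2) 2).
Implicit Types (x y z : V) (s t : R) (phi psi : V -> R).
Local Opaque integral_rV integral_dV0.

Lemma norm_mul_le1 (a b : R) : `|a| <= 1 -> `|b| <= 1 -> `|a * b| <= 1.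
Proof. by move=> h1 h2; rewrite normrM mulr_ile1. Qed.

Lemma average_algebra (c z k : R) : c * z <= c * (k / 2) -> k / 2 * c <= - c * z + c * k.
Proof. by move=> h; lra. Qed.

Lemma absorb_average (c k e : R) : 0 < k -> k / 2 * c <= (c / 4 + e) * k -> c <= 4 * e.
Proof. by move=> k0; rewrite [leRHS]mulrC -mulrA ler_pM2l// => h; lra. Qed.

Lemma two_ge0 : 0 <= 2 :> R. Proof. by []. Qed.

Variable r : R.
Hypothesis r0 : 0 < r.
Hypothesis r1 : r <= 1.

Let m : R := I4 (kernel r).

Lemma kernel_mass_gt0 : 0 < m.
Proof. by apply: lt_le_trans (kernel_mass r0 r1); rewrite divr_gt0 ?exprn_gt0. Qed.

Lemma kernel_mul_continuous psi : sphere_cont psi -> continuous (fun y => kernel r y * psi y).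
Proof.
move=> h y; apply: seq_continuous_at => u uy.
have [y0|y0] := eqVneq y 0.
  rewrite y0 kernel0 mul0r; rewrite y0 in uy.
  by apply: cvg_near_cst; apply: filterS (kernel_near0 r uy) => k ->; rewrite mul0r.
by apply: cvgM; [exact: kernel_cvg|exact: continuous_seq (h y y0) uy].
Qed.

Lemma kernel_mul_nice psi : sphere_cont psi -> (forall y, y != 0 -> `|psi y| <= 1) ->
  nice4 1 (fun y => kernel r y * psi y).
Proof.
move=> c h; apply: continuous_nice => //; first exact: kernel_mul_continuous.
move=> y; split; last by move=> /(kernel_bounded_supp r0 r1 y).2 ->; rewrite mul0r.
have [->|y0] := eqVneq y 0; first by rewrite kernel0 mul0r normr0.
by rewrite normrM mulr_ile1// ?h// ger0_norm ?kernel_ge0// kernel_le1.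
Qed.

Lemma kernel_nice : nice4 1 (kernel r).
Proof.
have n1 y : y != 0 -> `|(fun _ : V => 1 : R) y| <= 1 by rewrite normr1.
have := kernel_mul_nice (@sphere_cont_cst R 1 1) n1.
by rewrite (_ : (fun y => kernel r y * 1) = kernel r)//; apply/funext => y; rewrite mulr1.
Qed.

Variable v : V -> R^o.
Hypothesis cv2 : Ck W 2 v.
Hypothesis hv : hom0 v.
Hypothesis v01 : forall x, x != 0 -> 0 <= v x <= 1.

Let cv : Ck W 1 v. Proof. exact: Ck_S. Qed.
Let scv : sphere_cont v. Proof. exact: sphere_cont_Ck cv. Qed.
Let v_norm x : x != 0 -> `|v x| <= 1.
Proof. by move=> /v01 /andP[h1 h2]; rewrite ger0_norm. Qed.

(** By invariance the average at x of v against the bump is at most the integral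
   of v over all translates. *)
Lemma average_sup x : sphere x -> I4 (fun y => kernel r y * v (quat x y)) <= Lam v / @vol_cst R 1.
Proof.
move=> sx; have x0 := sphere_neq0 sx.
pose psi y := v (quat x y).
have cpsi : sphere_cont psi by exact: sphere_cont_quat.
have bpsi y : y != 0 -> `|psi y| <= 1 by move=> y0; apply: v_norm; exact: quat_neq0.
have nk := kernel_mul_nice cpsi bpsi.
have bs y : sphere y -> `|psi y| <= 1 by move=> /sphere_neq0; exact: bpsi.
have [nb _] := ballfun_approx cpsi (@off0_eq R 1 psi) bs.
rewrite -(integral_quat cv hv sx) -[X in Lam X]/psi -(integral_dV0_eq cpsi (@off0_eq R 1 psi)).
rewrite integral_dV0E [leRHS]mulrC (mulKf (lt0r_neq0 (@vol_cst_gt0 R 1))).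
apply: (integral_rV_le nk nb) => y.
have [->|y0] := eqVneq y 0.
  rewrite kernel0 mul0r /ballfun; case: ifP => // _.
  by rewrite hextE /radial scaler0 /off0 eqxx.
have E : hext (off0 psi) y = psi y.
  rewrite hextE off0_eq; last exact: radial_sphere.
  have e0 : 0 < (enorm y)^-1 by rewrite invr_gt0 enorm_gt0.
  have q0' := quat_neq0 x0 y0.
  rewrite /psi /radial -(hv e0 q0'); congr v.
  by rewrite !quat_left scalerDr !scalerA mulrC -scalemxAl.
have /andP[p0 p1] := v01 (quat_neq0 x0 y0).
have [k0|k0] := eqVneq (kernel r y) 0.
  by rewrite k0 mul0r /ballfun; case: ifP => // _; rewrite E.
rewrite /ballfun (kernel_enorm r0 r1 k0) E -[leRHS]mul1r; apply: ler_wpM2r => //; exact: kernel_le1.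
Qed.

(** A function supported where v = 1, playing the indicator function of that set. *)
Variable chi : V -> R.
Hypothesis cchi : sphere_cont chi.
Hypothesis chi01 : forall x, x != 0 -> 0 <= chi x <= 1.
Hypothesis chi_v : forall x, x != 0 -> chi x != 0 -> v x = 1.

(** Its integral in y compares v, at points where it is 1, with its average; its
   integral in x is controlled by the modulus of continuity of v. *)
Let Phi y x := kernel r y * (chi x * (v x - v (quat x y))).

Let Phi_bound x : x != 0 -> bounded_supp 2 1 (fun y => Phi y x).
Proof.
move=> x0 y; split; last by move=> /(kernel_bounded_supp r0 r1 y).2; rewrite /Phi => ->; rewrite mul0r.
have [->|y0] := eqVneq y 0; first by rewrite /Phi kernel0 mul0r normr0.
have k1 : `|kernel r y| <= 1 by rewrite ger0_norm ?kernel_ge0// kernel_le1.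
have c1 : `|chi x| <= 1 by have /andP[a0 a1] := chi01 x0; rewrite ger0_norm.
apply: norm_mul_le1 => //; apply: norm_mul_le1 => //.
have /andP[a0 a1] := v01 x0; have /andP[b0 b1] := v01 (quat_neq0 x0 y0).
by rewrite ler_norml; move: (v x) (v _) a0 a1 b0 b1 => *; apply/andP; split; lra.
Qed.

Let Phi_cvg (w : nat -> V) y (u : nat -> V) x : w k @[k --> \oo] --> y -> x != 0 ->
  (forall k, u k != 0) -> u k @[k --> \oo] --> x -> Phi (w k) (u k) @[k --> \oo] --> Phi y x.
Proof.
move=> wy x0 u0 ux; rewrite /Phi.
have [y0|y0] := eqVneq y 0.
  rewrite y0 kernel0 mul0r; rewrite y0 in wy.
  by apply: cvg_near_cst; apply: filterS (kernel_near0 r wy) => k ->; rewrite mul0r.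
apply: cvgM; first exact: kernel_cvg.
apply: cvgM; first exact: continuous_seq (cchi x0) ux.
apply: cvgB; first exact: continuous_seq (scv x0) ux.
exact: continuous_seq (scv (quat_neq0 x0 y0)) (quat_cvg ux wy).
Qed.

Let Phi_sphere_cont y : sphere_cont (Phi y).
Proof. by apply/sphere_contP => x u x0 u0 ux; apply: Phi_cvg => //; exact: cvg_cst. Qed.

Let one_cont : sphere_cont (fun _ : V => 1 : R). Proof. exact: sphere_cont_cst. Qed.

Let LPhi_nice : nice4 (Lam (fun=> 1)) (fun y => Lam (Phi y)).
Proof.
apply: continuous_nice => //.
  move=> y; apply: seq_continuous_at => u uy.
  apply: (@integral_dV0_dct R 1 (fun k => Phi (u k)) (Phi y) 1).
  - by move=> k; exact: Phi_sphere_cont.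
  - exact: Phi_sphere_cont.
  - by move=> k x /sphere_neq0 x0; exact: (Phi_bound x0 _).1.
  - by move=> x /sphere_neq0 x0; apply: Phi_cvg => //; exact: cvg_cst.
move=> y; split.
  apply: integral_dV0_norm_le => //.
  by move=> x /sphere_neq0 x0; exact: (Phi_bound x0 _).1.
move=> hy; rewrite (_ : Phi y = fun=> 0) ?integral_dV0_0//.
by apply/funext => x; rewrite /Phi (kernel_bounded_supp r0 r1 y).2// mul0r.
Qed.

Lemma exchange_average : I4 (fun y => Lam (Phi y)) = Lam (fun x => I4 (fun y => Phi y x)).
Proof.
apply: (@exchange_rV R V W (@sphere R 1) Lam _ _ _ (2 + 2) 2 1 Phi).
- by move=> x /sphere_neq0.
- by move=> a phi psi /sphere_contP h1 /sphere_contP h2; exact: integral_dV0_lin.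
- move=> phi_ phi M h1 /sphere_contP h2 h3 h4; apply: (integral_dV0_dct (M := M)) => //.
  by move=> k; apply/sphere_contP; exact: h1.
- exact: two_ge0.
- exact: Phi_bound.
- exact: Phi_cvg.
Qed.

Let C : R := Lam chi / 4 + 24 * r ^+ 2 * dirichlet v.

Let LPhi_le y : Lam (Phi y) <= C * kernel r y.
Proof.
have [k0|k0] := eqVneq (kernel r y) 0.
  rewrite k0 mulr0 (_ : Phi y = fun=> 0) ?integral_dV0_0//.
  by apply/funext => x; rewrite /Phi k0 mul0r.
have y0 : y != 0 by apply: contraNneq k0 => ->; rewrite kernel0.
have cq : sphere_cont (fun x => v (quat x y)).
  by apply/sphere_contP => x u x0 u0 ux; apply: continuous_seq (scv (quat_neq0 x0 y0)) _;
    apply: quat_cvg => //; exact: cvg_cst.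
have cd : sphere_cont (fun x => chi x * (v x - v (quat x y))).
  by apply: sphere_cont_mul => //; exact: sphere_cont_sub.
have cd2 : sphere_cont (fun x => (v (quat x y) - v x) ^+ 2).
  by apply: sphere_cont_sqr; exact: sphere_cont_sub.
rewrite (integral_dV0_scale _ cd) mulrC; apply: ler_wpM2r; first exact: kernel_ge0.
apply: (@le_trans _ _ (Lam (fun x => 4^-1 * chi x + (v (quat x y) - v x) ^+ 2))).
  apply: integral_dV0_le => //; first exact: sphere_cont_lin.
  move=> x /sphere_neq0 /chi01 /andP[]; move: (chi x) (v x) (v (quat x y)) => c a b c0 c1.
  have h1 : c * c <= c by rewrite ler_piMl.
  by have := sqr_ge0 (c / 2 - (a - b)); rewrite !expr2; lra.
rewrite integral_dV0_lin// /C [X in X + _]mulrC lerD2l; exact: quat_modulus.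
Qed.

Let average_ge x : sphere x -> Lam v / @vol_cst R 1 <= m / 2 -> (m / 2) * chi x <= I4 (fun y => Phi y x).
Proof.
move=> sx hm; have x0 := sphere_neq0 sx.
have cpsi : sphere_cont (fun y => v (quat x y)) by exact: sphere_cont_quat.
have bpsi y : y != 0 -> `|v (quat x y)| <= 1 by move=> y0; apply: v_norm; exact: quat_neq0.
have nk := kernel_mul_nice cpsi bpsi.
have [n1 e1] := nice_scale (chi x * v x) kernel_nice.
have [_ e2] := integral_rV_lin (- chi x) two_ge0 nk n1.
have -> : (fun y => Phi y x) = (fun y => - chi x * (kernel r y * v (quat x y)) + chi x * v x * kernel r y).
  by apply/funext => y; rewrite /Phi; ring.
rewrite e2 e1; have /andP[c0 c1] := chi01 x0.
have a := le_trans (average_sup sx) hm.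
have [->|cn] := eqVneq (chi x) 0; first by rewrite mulr0 oppr0 !mul0r addr0.
by rewrite (chi_v x0 cn) mulr1; exact: average_algebra (ler_wpM2l c0 a).
Qed.

(** If averages of v at scale r are at most 1/2, then on the set where v = 1 the
   function differs from its average by at least 1/2. *)
Lemma weak_type_scale : Lam v / @vol_cst R 1 <= m / 2 -> Lam chi <= 96 * r ^+ 2 * dirichlet v.
Proof.
move=> hm; have m0 := kernel_mass_gt0.
have h1 : I4 (fun y => Lam (Phi y)) <= C * m.
  have [n1 e1] := nice_scale C kernel_nice; rewrite -e1.
  exact: (integral_rV_le LPhi_nice n1).
have h2 : m / 2 * Lam chi <= Lam (fun x => I4 (fun y => Phi y x)).
  rewrite -(integral_dV0_scale (m / 2) cchi); apply: integral_dV0_le.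
  - exact: sphere_cont_scale.
  - apply/sphere_contP => x u x0 u0 ux.
    have nP z : z != 0 -> nice4 1 (fun y => Phi y z).
      move=> z0; apply: continuous_nice => //; last exact: Phi_bound.
      by move=> y; apply: seq_continuous_at => w wy; apply: Phi_cvg => //; exact: cvg_cst.
    apply: (@integral_rV_cvg R (2 + 2) 2 1 (fun k y => Phi y (u k)) (fun y => Phi y x) two_ge0 _ _).2.
      by move=> k; exact: nP (u0 k).
    by move=> y; apply: Phi_cvg => //; exact: cvg_cst.
  - by move=> x sx; exact: average_ge.
rewrite -exchange_average in h2; have {h1 h2} := le_trans h2 h1.
by move=> /(absorb_average m0); rewrite !mulrA (_ : 4 * 24 = 96)//; ring.
Qed.

End Averages.

Section Weak.
Context {R : realType}.
Notation V := (ambient R 1).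
Notation W := [set y : V | y != 0].
Notation Lam := (@integral_dV0 R 1).

(** The mass of the bump at scale r is at least r^4 / 2^17 and the average is to
   be at most half of it, whence the exponent 18. *)
Definition mass_cst : R := @vol_cst R 1 / (2 ^+ 18).

Lemma mass_cst_gt0 : 0 < mass_cst.
Proof. by rewrite divr_gt0 ?exprn_gt0 ?vol_cst_gt0. Qed.

(** The previous estimate at the scale r with r^4 proportional to Lam v. *)
Lemma weak_type (v : V -> R^o) (chi : V -> R) : Ck W 2 v -> hom0 v ->
  (forall x, x != 0 -> 0 <= v x <= 1) -> sphere_cont chi ->
  (forall x, x != 0 -> 0 <= chi x <= 1) -> (forall x, x != 0 -> chi x != 0 -> v x = 1) ->
  Lam v <= mass_cst -> Lam chi ^+ 2 <= 96 ^+ 2 / mass_cst * Lam v * dirichlet v ^+ 2.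
Proof.
move=> cv hv v01 cc c01 cv1 hc; have m0 := mass_cst_gt0.
have scv : sphere_cont v by exact: sphere_cont_Ck cv.
have chi0 : 0 <= Lam chi.
  by apply: integral_dV0_ge0 => // x /sphere_neq0 /c01 /andP[].
have chi_le : Lam chi <= Lam v.
  apply: integral_dV0_le => // x /sphere_neq0 x0.
  have [->|cn] := eqVneq (chi x) 0; first by have /andP[] := v01 x x0.
  by rewrite (cv1 x x0 cn); have /andP[] := c01 x x0.
have [v0|v0] := eqVneq (Lam v) 0.
  by have -> : Lam chi = 0 by [apply/eqP; rewrite eq_le chi0 andbT -v0]; rewrite v0 mulr0 mul0r expr0n.
have vp : 0 < Lam v by rewrite lt_neqAle eq_sym v0 (le_trans chi0 chi_le).
pose q := Lam v / mass_cst.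
have q0 : 0 < q by exact: divr_gt0.
have q1 : q <= 1 by rewrite ler_pdivrMr// mul1r.
pose r := Num.sqrt (Num.sqrt q).
have r2 : r ^+ 2 = Num.sqrt q by rewrite sqr_sqrtr// sqrtr_ge0.
have r4 : r ^+ 4 = q by rewrite (exprM r 2 2) r2 sqr_sqrtr// ltW.
have r0 : 0 < r by rewrite !sqrtr_gt0.
have r1 : r <= 1 by rewrite -(expr_le1 (n := 4))// ?r4// ltW.
have h := @weak_type_scale R r r0 r1 v cv hv v01 chi cc c01 cv1.
have hm : Lam v / @vol_cst R 1 <= integral_rV (kernel r) / 2.
  apply: (@le_trans _ _ (r ^+ 4 / 2 ^+ 17 / 2)); last by rewrite ler_pM2r ?invr_gt0//; exact: kernel_mass.
  have vn := lt0r_neq0 (@vol_cst_gt0 R 1).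
  rewrite r4 /q /mass_cst le_eqVlt; apply/orP; left; apply/eqP.
  by rewrite (exprSr _ 17); move: (2 ^+ 17 : R) (lt0r_neq0 (exprn_gt0 17 (ltr0Sn R 1))) => k kn; field; rewrite vn kn.
have {}h := h hm.
have := ler_pM chi0 chi0 h h; rewrite -!expr2 => /le_trans; apply.
have -> : (96 * r ^+ 2 * dirichlet v) ^+ 2 = 96 ^+ 2 * r ^+ 4 * dirichlet v ^+ 2 by ring.
rewrite r4 /q le_eqVlt; apply/orP; left; apply/eqP.
by move: (Lam v) (dirichlet v) mass_cst => a b c; ring.
Qed.

End Weak.

(** * Dyadic truncation and the Folland-Stein inequality *)

Section StepDerivative.
Context {R : realType}.
Implicit Types (s z : R).

Definition dstep s : R := 16 * (ppow 3 (1 - ppow 4 s) * ppow 3 s).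

Lemma is_derive_step s : is_derive s (1 : R) (step : R -> R^o) (dstep s).
Proof.
have h1 := is_derive_ppow 2 s.
have h2 : is_derive s (1 : R) ((fun t => 1 - ppow 4 t) : R -> R^o) (- (4 * ppow 3 s)).
  by apply: (is_derive_eq (is_deriveB (is_derive_cst (1 : R^o) (s : R^o) 1) h1)); rewrite sub0r.
have h3 := @is_derive1_comp R (ppow 4) (fun t => 1 - ppow 4 t) s _ _ (is_derive_ppow 2 (1 - ppow 4 s)) h2.
apply: (is_derive_eq (is_deriveB (is_derive_cst (1 : R^o) (s : R^o) 1) h3)).
by rewrite /dstep sub0r /GRing.scale /=; ring.
Qed.

(** The factor by which squared derivatives of a dyadic truncation, weighted with
   its level, exceed those of the function; it is supported in [1, 2]. *)
Definition theta z : R := 4 * z * dstep (z - 1) ^+ 2.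

Lemma theta_out z : z <= 1 \/ 2 <= z -> theta z = 0.
Proof.
rewrite /theta /dstep => -[h|h].
  by rewrite (@ppow_le0 _ 3 (z - 1)) ?subr_le0// !mulr0 expr0n mulr0.
have h1 : 1 <= z - 1 by rewrite lerBrDr.
by rewrite (@ppow_le0 _ 3 (1 - _)) ?subr_le0 ?ppow_ge1// mul0r mulr0 expr0n mulr0.
Qed.

Let M : R := 8 * 16 ^+ 2.

Let M0 : 0 <= M.
Proof. by rewrite /M; apply: mulr_ge0; [exact: ler0n|exact: sqr_ge0]. Qed.

Lemma theta_le z : 0 <= z -> theta z <= M.
Proof.
move=> z0; have [h|h] := leP z 1; first by rewrite (theta_out (or_introl h)); exact: M0.
have [h2|h2] := leP 2 z; first by rewrite (theta_out (or_intror h2)); exact: M0.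
have p1 m (s : R) : s <= 1 -> 0 <= ppow m s <= 1.
  move=> s1; rewrite ppow_ge0 /ppow exprn_ile1 ?le_max ?lexx//.
  by rewrite ge_max ler01.
have z1 : z - 1 <= 1 by lra.
have /andP[a0 a1] := p1 3%N (z - 1) z1.
have b0' : 1 - ppow 4 (z - 1) <= 1 by rewrite gerBl ppow_ge0.
have /andP[b0 b1] := p1 3%N _ b0'.
have ab0 : 0 <= ppow 3 (1 - ppow 4 (z - 1)) * ppow 3 (z - 1) by exact: mulr_ge0.
have ab1 : ppow 3 (1 - ppow 4 (z - 1)) * ppow 3 (z - 1) <= 1 by exact: mulr_ile1.
rewrite /theta /dstep /M; move: (_ * ppow 3 _) ab0 ab1 => c c0 c1.
have c2 : (16 * c) ^+ 2 <= 16 ^+ 2.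
  by rewrite exprMn ler_piMr ?sqr_ge0// expr2 mulr_ile1.
apply: ler_pM; [lra|exact: sqr_ge0|lra|exact: c2].
Qed.

(** At each point only one dyadic truncation varies. *)
Lemma theta_sum_le z K : 0 <= z -> \sum_(k < K) theta (z / 2 ^+ k) <= M.
Proof.
move=> z0; elim: K => [|K IH]; first by rewrite big_ord0; exact: M0.
rewrite big_ord_recr /=.
have zK : 0 <= z / 2 ^+ K by rewrite divr_ge0// exprn_ge0.
have [h|h] := leP (z / 2 ^+ K) 1; first by rewrite (theta_out (or_introl h)) addr0; exact: IH.
rewrite big1 ?add0r; first by apply: theta_le; exact: zK.
move=> k _; apply: theta_out; right.
have -> : z / 2 ^+ k = z / 2 ^+ K * 2 ^+ (K - k).
  have e : 2 ^+ K = 2 ^+ (K - k) * 2 ^+ k :> R by rewrite -exprD subnK// ltnW// ltn_ord.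
  have A0 : 2 ^+ (K - k) != 0 :> R by rewrite expf_neq0// pnatr_eq0.
  have B0 : 2 ^+ k != 0 :> R by rewrite expf_neq0// pnatr_eq0.
  by rewrite e; move: (2 ^+ (K - k)) (2 ^+ k) A0 B0 => A B A0 B0; field; rewrite A0 B0.
have h2 : 2 <= 2 ^+ (K - k) :> R.
  rewrite -{1}(expr1 2); apply: ler_weXn2l; first by rewrite ler1n.
  by rewrite subn_gt0.
apply: (@le_trans _ _ (1 * 2)); first by rewrite mul1r.
by apply: ler_pM => //; exact: ltW.
Qed.

Lemma theta_sum : exists2 C : R, 0 <= C & forall z K, 0 <= z -> \sum_(k < K) theta (z / 2 ^+ k) <= C.
Proof. by exists M; [exact: M0|exact: theta_sum_le]. Qed.

Lemma trunc_algebra (a b c l : R) : l != 0 ->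
  l * (a * (l^-1 * (2 * (b * c)))) ^+ 2 = 4 * (b ^+ 2 / l) * a ^+ 2 * c ^+ 2.
Proof. by move=> ln; field. Qed.

(** The recursion first bounds every b k by B = b 0 + C e^2; after that
   b k.+1 is at most sqrt (C B) E k, which sums to sqrt (C B) e. *)
Lemma sqr_recursion (b E : nat -> R) (C e : R) K : 0 <= C -> 0 <= e -> (forall k, 0 <= b k) ->
  (forall k, 0 <= E k) -> (forall k, b k.+1 ^+ 2 <= C * b k * E k ^+ 2) ->
  (forall k, \sum_(j < k) E j <= e) -> \sum_(k < K) b k <= 2 * (b 0%N + C * e ^+ 2).
Proof.
move=> C0 e0 b0 E0 hb hE; set B := b 0%N + C * e ^+ 2.
have c0 : 0 <= C * e ^+ 2 by rewrite mulr_ge0 ?sqr_ge0.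
have B0 : 0 <= B by rewrite addr_ge0.
have Ek k : E k <= e.
  by apply: le_trans (hE k.+1); rewrite big_ord_recr /= lerDr sumr_ge0.
have Ek2 k : E k ^+ 2 <= e ^+ 2 by rewrite ler_sqr ?nnegrE.
have bB k : b k <= B.
  elim: k => [|k IH]; first by rewrite lerDl.
  rewrite -ler_sqr ?nnegrE//; apply: (le_trans (hb k)).
  apply: (@le_trans _ _ (C * B * e ^+ 2)).
    by apply: ler_pM; rewrite ?mulr_ge0 ?sqr_ge0// ler_wpM2l.
  rewrite [B ^+ 2]expr2; have -> : C * B * e ^+ 2 = B * (C * e ^+ 2) by ring.
  by rewrite ler_wpM2l// lerDr.
pose S := Num.sqrt (C * B).
have S2 : S ^+ 2 = C * B by rewrite sqr_sqrtr// mulr_ge0.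
have S0 : 0 <= S by exact: sqrtr_ge0.
have bS k : b k.+1 <= S * E k.
  rewrite -ler_sqr ?nnegrE ?mulr_ge0// exprMn S2; apply: (le_trans (hb k)).
  by apply: ler_wpM2r; [exact: sqr_ge0|exact: ler_wpM2l].
have hsum : \sum_(k < K) b k <= b 0%N + S * e.
  case: K => [|K]; first by rewrite big_ord0 addr_ge0// mulr_ge0.
  rewrite big_ord_recl /= lerD2l; apply: (@le_trans _ _ (S * \sum_(k < K) E k)).
    by rewrite mulr_sumr; apply: ler_sum => k _; exact: bS.
  exact: ler_wpM2l.
apply: (le_trans hsum).
have h : S * e <= B.
  rewrite -ler_sqr ?nnegrE ?mulr_ge0// exprMn S2.
  rewrite [B ^+ 2]expr2; have -> : C * B * e ^+ 2 = B * (C * e ^+ 2) by ring.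
  by rewrite ler_wpM2l// lerDr.
have : b 0%N <= B by rewrite lerDl.
lra.
Qed.

End StepDerivative.

Section Truncation.
Context {R : realType}.
Notation V := (ambient R 1).
Notation W := [set y : V | y != 0].
Notation Lam := (@integral_dV0 R 1).
Local Opaque integral_rV integral_dV0.
Implicit Types (x y : V) (k K : nat).

Variable w : V -> R^o.
Hypothesis cw2 : Ck W 2 w.
Hypothesis hw : hom0 w.
Variable l0 : R.
Hypothesis l0_gt0 : 0 < l0.

Let cw1 : Ck W 1 w. Proof. exact: Ck_S. Qed.
Let scw : sphere_cont w. Proof. exact: sphere_cont_Ck cw1. Qed.

(** The truncations refer to the values of the square of w, which is smooth. *)
Definition level k : R := 2 ^+ k * l0.

Lemma level_gt0 k : 0 < level k.
Proof. by rewrite mulr_gt0// exprn_gt0. Qed.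

Lemma levelS k : level k.+1 = 2 * level k.
Proof. by rewrite /level exprS mulrA. Qed.

Lemma level_ge k : l0 <= level k.
Proof. by rewrite ler_peMl ?(ltW l0_gt0)// exprn_ege1// ler1n. Qed.

Definition trunc k x : R^o := step (w x ^+ 2 / level k - 1).

Let argfun k x : R^o := (level k)^-1 * (w x * w x) + -1.

Let truncE k : trunc k = (step : R^o -> R^o) \o argfun k.
Proof. by apply/funext => x; rewrite /trunc /argfun /= expr2 mulrC. Qed.

Let argfun_Ck k : Ck W 2 (argfun k).
Proof.
apply: (Ck_add open_neq0); last exact: (Ck_cst _ 2 (-1)).
by apply: (Ck_scale open_neq0); exact: (Ck_mul open_neq0).
Qed.

Lemma trunc_Ck k : Ck W 2 (trunc k).
Proof.
rewrite truncE; exact: (Ck_comp1 (I := [set: R^o]) open_neq0 Ck_step (fun _ _ => I) (argfun_Ck k)).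
Qed.

Lemma trunc_hom0 k : hom0 (trunc k).
Proof. by move=> a x a0 x0; rewrite /trunc hw. Qed.

Lemma trunc01 k x : x != 0 -> 0 <= trunc k x <= 1.
Proof. by move=> _; exact: step_itv. Qed.

Lemma trunc_eq1 k x : 2 * level k <= w x ^+ 2 -> trunc k x = 1.
Proof.
move=> h; apply: step_ge1; rewrite lerBrDr ler_pdivlMr ?level_gt0//.
Qed.

Lemma trunc_neq0 k x : trunc k x != 0 -> level k < w x ^+ 2.
Proof.
rewrite ltNge; apply: contraNN => h; apply/eqP; apply: step_le0.
by rewrite subr_le0 ler_pdivrMr ?level_gt0// mul1r.
Qed.

Lemma trunc_le k x : trunc k x <= w x ^+ 2 / l0.
Proof.
have /andP[_ h1] := step_itv (w x ^+ 2 / level k - 1).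
have [->|h] := eqVneq (trunc k x) 0; first by rewrite divr_ge0 ?sqr_ge0// ltW.
apply: (le_trans h1); rewrite ler_pdivlMr// mul1r.
by apply: (le_trans (level_ge k)); exact/ltW/trunc_neq0.
Qed.

Lemma Xf_trunc A k x : x != 0 ->
  level k * Xf A (trunc k) x ^+ 2 = theta (w x ^+ 2 / l0 / 2 ^+ k) * Xf A w x ^+ 2.
Proof.
move=> x0.
have dw : differentiable w x by exact: Ck_diff cw1 x0.
have da : differentiable (argfun k) x by exact: Ck_diff (argfun_Ck k) x0.
have ds : differentiable (step : R^o -> R^o) (argfun k x) by exact: (Ck_diff (Ck_step (R := R)) (I : setT (argfun k x))).
have dww : differentiable (fun y => w y * w y : R^o) x by exact: differentiableM.
have D1 : Xf A (argfun k) x = (level k)^-1 * (2 * (w x * Xf A w x)).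
  rewrite /Xf derive_add//; last by apply: differentiableM.
  rewrite derive_scale// derive_mul// derive_cst addr0.
  by apply: mulr_congr; move: (w x) ('D_ _ w x) => a b; ring.
have [_ D2] := is_derive_step (argfun k x).
have D3 : Xf A (trunc k) x = dstep (argfun k x) * Xf A (argfun k) x.
  by rewrite truncE /Xf derive_comp1// D2.
rewrite D3 D1 /theta.
have e : argfun k x = w x ^+ 2 / l0 / 2 ^+ k - 1.
  by rewrite /argfun /level invfM expr2; ring.
have ln := lt0r_neq0 (level_gt0 k).
have e2 : w x ^+ 2 / l0 / 2 ^+ k = w x ^+ 2 / level k by rewrite /level invfM; ring.
rewrite e e2; exact: trunc_algebra.
Qed.

Let scX A : sphere_cont (fun x => Xf A w x ^+ 2).
Proof. by apply: sphere_cont_sqr; apply: (sphere_cont_Ck (k := 0)); exact: (Ck_Xf open_neq0). Qed.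

Let scXt A k : sphere_cont (fun x => Xf A (trunc k) x ^+ 2).
Proof.
by apply: sphere_cont_sqr; apply: (sphere_cont_Ck (k := 1)); apply: (Ck_Xf open_neq0); exact: trunc_Ck.
Qed.

(** The energies of the truncations, weighted by their levels, add up to at most a
   multiple of the energy of w. *)
Let energy_sum A (C : R) K : (forall z K, 0 <= z -> \sum_(k < K) theta (z / 2 ^+ k) <= C) ->
  \sum_(k < K) level k * Lam (fun x => Xf A (trunc k) x ^+ 2) <= C * Lam (fun x => Xf A w x ^+ 2).
Proof.
move=> hC.
have cF (k : 'I_K) : sphere_cont (fun x => level k * Xf A (trunc k) x ^+ 2).
  by apply: sphere_cont_scale; exact: scXt.
have [cS eS] := integral_dV0_sum (index_enum _) cF.
have -> : \sum_(k < K) level k * Lam (fun x => Xf A (trunc k) x ^+ 2) =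
   \sum_(k < K) Lam (fun x => level k * Xf A (trunc k) x ^+ 2).
  by apply: eq_bigr => k _; rewrite (integral_dV0_scale (level k) (@scXt A k)).
rewrite -eS -(integral_dV0_scale C (@scX A)); apply: (integral_dV0_le cS).
  by apply: sphere_cont_scale; exact: scX.
move=> x /sphere_neq0 x0; under eq_bigr do rewrite (Xf_trunc A _ x0).
rewrite -mulr_suml; apply: ler_wpM2r; first exact: sqr_ge0.
by apply: hC; rewrite divr_ge0 ?sqr_ge0// ltW.
Qed.

Lemma dirichlet_ge0 (v : V -> R^o) : Ck W 2 v -> 0 <= dirichlet v.
Proof.
move=> cv; apply: addr_ge0; apply: integral_dV0_ge0; try by move=> x _; exact: sqr_ge0.
all: by apply: sphere_cont_sqr; apply: (sphere_cont_Ck (k := 1)); exact: (Ck_Xf open_neq0).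
Qed.

(** Makes the truncations so small in mean that the weak-type inequality applies. *)
Hypothesis small : Lam (fun x => w x ^+ 2) <= mass_cst * l0.

Let scw2 : sphere_cont (fun x => w x ^+ 2). Proof. exact: sphere_cont_sqr. Qed.
Let sct k : sphere_cont (trunc k). Proof. exact: sphere_cont_Ck (trunc_Ck k). Qed.

Let trunc_mass k : l0 * Lam (trunc k) <= Lam (fun x => w x ^+ 2).
Proof.
rewrite -(integral_dV0_scale l0 (@sct k)); apply: integral_dV0_le => //.
  exact: sphere_cont_scale.
by move=> x _; have := trunc_le k x; rewrite ler_pdivlMr// mulrC.
Qed.

Let trunc_int_ge0 k : 0 <= Lam (trunc k).
Proof. by apply: integral_dV0_ge0 => // x _; have /andP[] := step_itv (w x ^+ 2 / level k - 1). Qed.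

Let bk k := level k ^+ 2 * Lam (trunc k).
Let Ek k := level k * dirichlet (trunc k).
Let Cw : R := 96 ^+ 2 / mass_cst.

(** The weak-type inequality for v = trunc k and chi = trunc k.+1: where the
   latter is not 0, the former is 1. *)
Let bk_rec k : bk k.+1 ^+ 2 <= 16 * Cw * bk k * Ek k ^+ 2.
Proof.
have hk : Lam (trunc k) <= mass_cst.
  by rewrite -(ler_pM2l l0_gt0) [leRHS]mulrC; exact: le_trans (trunc_mass k) small.
have h := weak_type (trunc_Ck k) (@trunc_hom0 k) (@trunc01 k) (@sct k.+1) (@trunc01 k.+1) _ hk.
have {}h : Lam (trunc k.+1) ^+ 2 <= Cw * Lam (trunc k) * dirichlet (trunc k) ^+ 2.
  by apply: h => x _ /trunc_neq0 /ltW; rewrite levelS; exact: trunc_eq1.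
rewrite /bk /Ek levelS; have l4 : 0 <= 16 * level k ^+ 4.
  by apply: mulr_ge0; [exact: ler0n|exact/exprn_ge0/ltW/level_gt0].
have hh := ler_wpM2l l4 h.
move: hh; move: (Lam (trunc k.+1)) (Lam (trunc k)) (dirichlet _) Cw (level k) => a b c C l hh.
have -> : ((2 * l) ^+ 2 * a) ^+ 2 = 16 * l ^+ 4 * a ^+ 2 by ring.
have -> : 16 * C * (l ^+ 2 * b) * (l * c) ^+ 2 = 16 * l ^+ 4 * (C * b * c ^+ 2) by ring.
exact: hh.
Qed.

Lemma layer_cake K x : w x ^+ 2 <= level K.+1 ->
  w x ^+ 4 <= 2 * l0 * w x ^+ 2 + 16 * \sum_(k < K) level k ^+ 2 * trunc k x.
Proof.
have w4 : w x ^+ 4 = w x ^+ 2 * w x ^+ 2 by rewrite -exprD.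
have w0 : 0 <= w x ^+ 2 by exact: sqr_ge0.
elim: K => [|K IH].
  rewrite big_ord0 mulr0 addr0 /level expr1 w4 => h; exact: ler_wpM2r.
move=> h; rewrite big_ord_recr /= mulrDr addrA.
have t0 : 0 <= 16 * (level K ^+ 2 * trunc K x).
  apply: mulr_ge0; first exact: ler0n.
  by apply: mulr_ge0; [exact: sqr_ge0|have /andP[] := step_itv (w x ^+ 2 / level K - 1)].
have [h1|h1] := leP (w x ^+ 2) (level K.+1); first by apply: (le_trans (IH h1)); rewrite lerDl.
have e : trunc K x = 1 by apply: trunc_eq1; rewrite -levelS ltW.
have s0 : 0 <= 2 * l0 * w x ^+ 2 + 16 * \sum_(k < K) level k ^+ 2 * trunc k x.
  apply: addr_ge0; first by apply: mulr_ge0 => //; apply: mulr_ge0; [exact: ler0n|exact: ltW].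
  apply: mulr_ge0; first exact: ler0n.
  apply: sumr_ge0 => k _; apply: mulr_ge0; first exact: sqr_ge0.
  by have /andP[] := step_itv (w x ^+ 2 / level k - 1).
apply: (@le_trans _ _ (16 * (level K ^+ 2 * trunc K x))); last by rewrite lerDr.
have -> : 16 * (level K ^+ 2 * trunc K x) = level K.+2 * level K.+2 by rewrite e !levelS; ring.
by rewrite w4; exact: ler_pM.
Qed.

Lemma sobolev_level (C : R) : 0 <= C -> (forall z K, 0 <= z -> \sum_(k < K) theta (z / 2 ^+ k) <= C) ->
  Lam (fun x => w x ^+ 4) <= 2 * l0 * Lam (fun x => w x ^+ 2) +
    16 * (2 * (l0 * Lam (fun x => w x ^+ 2) + 16 * Cw * (C * dirichlet w) ^+ 2)).
Proof.
move=> C0 hC.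
have [M M0 hM] := sphere_cont_bounded scw2.
have [K hK] : exists K, M <= level K.+1.
  exists (Num.truncn (M / l0)).+1; rewrite -ler_pdivrMr//.
  have := truncnS_gt (M / l0) => /ltW /le_trans; apply.
  rewrite -natrX ler_nat; exact: (ltnW (ltnW (ltn_expl _.+2 (isT : (1 < 2)%N)))).
have E0 k : 0 <= Ek k by apply: mulr_ge0; [exact/ltW/level_gt0|exact/dirichlet_ge0/trunc_Ck].
have b0 k : 0 <= bk k by apply: mulr_ge0; [exact: sqr_ge0|exact: trunc_int_ge0].
have e0 : 0 <= C * dirichlet w by apply: mulr_ge0 => //; exact: dirichlet_ge0.
have Cw0 : 0 <= 16 * Cw.
  by apply: mulr_ge0; [exact: ler0n|apply: divr_ge0; [exact: sqr_ge0|exact/ltW/mass_cst_gt0]].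
have hE k : \sum_(j < k) Ek j <= C * dirichlet w.
  rewrite /Ek /dirichlet mulrDr; under eq_bigr do rewrite mulrDr.
  by rewrite big_split /=; apply: lerD; exact: energy_sum.
have hb := sqr_recursion K Cw0 e0 b0 E0 bk_rec hE.
have cF (k : 'I_K) : sphere_cont (fun x => level k ^+ 2 * trunc k x).
  by apply: sphere_cont_scale; exact: sct.
have [cS eS] := integral_dV0_sum (index_enum _) cF.
have sw4 : sphere_cont (fun x => w x ^+ 4).
  have -> : (fun x => w x ^+ 4) = (fun x => (w x ^+ 2) ^+ 2) by apply/funext => x; rewrite -exprM.
  exact: sphere_cont_sqr.
have s2 := sphere_cont_scale (s := 2 * l0) scw2.
have sS := sphere_cont_scale (s := 16) cS.
have h1 : Lam (fun x => w x ^+ 4) <=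
    Lam (fun x => 2 * l0 * w x ^+ 2 + 16 * \sum_(k < K) level k ^+ 2 * trunc k x).
  apply: (integral_dV0_le sw4 (sphere_cont_add s2 sS)) => x sx.
  by apply: layer_cake; apply: le_trans hK; exact: le_trans (ler_norm _) (hM x sx).
rewrite (integral_dV0_add s2 sS) (integral_dV0_scale _ scw2) (integral_dV0_scale _ cS) eS in h1.
have e1 : \sum_(k < K) Lam (fun x => level k ^+ 2 * trunc k x) = \sum_(k < K) bk k.
  by apply: eq_bigr => k _; rewrite (integral_dV0_scale _ (@sct k)).
rewrite e1 in h1; apply: (le_trans h1).
have h2 : bk 0%N <= l0 * Lam (fun x => w x ^+ 2).
  have -> : bk 0%N = l0 * (l0 * Lam (trunc 0%N)) by rewrite /bk /level expr0 mul1r expr2 mulrA.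
  by apply: ler_wpM2l; [exact: ltW|exact: trunc_mass].
rewrite lerD2l; apply: ler_wpM2l; first exact: ler0n.
apply: (le_trans hb); apply: ler_wpM2l; first exact: ler0n.
by rewrite lerD2r.
Qed.

End Truncation.

Section Sobolev.
Context {R : realType}.
Notation V := (ambient R 1).
Notation W := [set y : V | y != 0].
Notation Lam := (@integral_dV0 R 1).
Local Opaque integral_rV integral_dV0.

Lemma sobolev_algebra (l a d c C e : R) : 0 <= a -> 0 <= d -> 0 < c -> 0 <= C -> 0 <= e ->
  l <= 2 * ((a + d) / c) * a + 16 * (2 * ((a + d) / c * a + 16 * C * (e * d) ^+ 2)) ->
  l <= (2 / c + 16 * (2 * (c^-1 + 16 * C * e ^+ 2))) * (a + d) ^+ 2.
Proof.
move=> a0 d0 c0 C0 e0 /le_trans; apply.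
have y0 : 0 <= a + d by exact: addr_ge0.
have c0' : 0 <= c^-1 by rewrite invr_ge0 ltW.
have u : (a + d) / c * a <= c^-1 * (a + d) ^+ 2.
  by rewrite [_ / c]mulrC -mulrA expr2; apply: ler_wpM2l => //; apply: ler_wpM2l => //; rewrite lerDl.
have v : C * (e * d) ^+ 2 <= C * e ^+ 2 * (a + d) ^+ 2.
  rewrite exprMn mulrA; apply: ler_wpM2l; first by apply: mulr_ge0 => //; exact: sqr_ge0.
  by rewrite ler_sqr ?nnegrE// lerDr.
have -> : 2 * ((a + d) / c) * a + 16 * (2 * ((a + d) / c * a + 16 * C * (e * d) ^+ 2)) =
  2 * ((a + d) / c * a) + 16 * (2 * ((a + d) / c * a + 16 * (C * (e * d) ^+ 2))) by ring.
have -> : (2 / c + 16 * (2 * (c^-1 + 16 * C * e ^+ 2))) * (a + d) ^+ 2 =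
  2 * (c^-1 * (a + d) ^+ 2) + 16 * (2 * (c^-1 * (a + d) ^+ 2 + 16 * (C * e ^+ 2 * (a + d) ^+ 2))) by ring.
apply: lerD; first by apply: ler_wpM2l.
apply: ler_wpM2l; first exact: ler0n.
apply: ler_wpM2l; first exact: ler0n.
by apply: lerD => //; apply: ler_wpM2l => //; exact: ler0n.
Qed.

(** Weak-type inequalities for the dyadic truncations sum up to a strong one. The
   lowest level is the square of the Sobolev norm, up to a constant, which makes
   both the remainder below that level and the first term of the recursion of the
   right size. *)
Lemma folland_stein : exists2 C : R, 0 <= C & forall w : V -> R^o, Ck W 2 w -> hom0 w ->
  Lam (fun x => w x ^+ 4) <= C * (Lam (fun x => w x ^+ 2) + dirichlet w) ^+ 2.
Proof.
have [C C0 hC] := @theta_sum R.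
have c0 := @mass_cst_gt0 R.
have Cw0 : 0 <= 96 ^+ 2 / @mass_cst R by apply: divr_ge0; [exact: sqr_ge0|exact: ltW].
exists (2 / mass_cst + 16 * (2 * (mass_cst^-1 + 16 * (96 ^+ 2 / mass_cst) * C ^+ 2))).
  apply: addr_ge0; first by apply: divr_ge0; [exact: ler0n|exact: ltW].
  apply: mulr_ge0; first exact: ler0n.
  apply: mulr_ge0; first exact: ler0n.
  apply: addr_ge0; first by rewrite invr_ge0 ltW.
  apply: mulr_ge0; last exact: sqr_ge0.
  by apply: mulr_ge0; first exact: ler0n.
move=> w cw hw.
have scw : sphere_cont w by exact: sphere_cont_Ck cw.
have scw2 := sphere_cont_sqr scw.
have a0 : 0 <= Lam (fun x => w x ^+ 2) by apply: integral_dV0_ge0 => // x _; exact: sqr_ge0.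
have d0 := dirichlet_ge0 cw.
have [y0|y0] := eqVneq (Lam (fun x => w x ^+ 2) + dirichlet w) 0.
  have z : Lam (fun x => w x ^+ 2) = 0.
    by apply/eqP; rewrite eq_le a0 andbT -y0 lerDl.
  have wz := integral_dV0_eq0 scw2 (fun x _ => sqr_ge0 (w x)) z.
  rewrite y0 expr0n mulr0 (integral_dV0_eq (psi := fun=> 0)) ?integral_dV0_0//.
    exact: sphere_cont_cst.
  by move=> x sx; rewrite (exprM _ 2 2) (wz x sx) expr0n.
have yp : 0 < Lam (fun x => w x ^+ 2) + dirichlet w by rewrite lt_neqAle eq_sym y0 addr_ge0.
have l0 : 0 < (Lam (fun x => w x ^+ 2) + dirichlet w) / mass_cst by exact: divr_gt0.
have small : Lam (fun x => w x ^+ 2) <= mass_cst * ((Lam (fun x => w x ^+ 2) + dirichlet w) / mass_cst).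
  by rewrite mulrC divfK ?lt0r_neq0// lerDl.
exact: (sobolev_algebra a0 d0 c0 Cw0 C0 (sobolev_level cw hw l0 small C0 hC)).
Qed.

End Sobolev.

(** * Convergence *)

Lemma energy_le (R : realFieldType) (s a b c : R) : a + b <= s ->
  c ^+ 2 + (a + b) <= 2 * (4 * (8^-1 * s) + c * c).
Proof. by move=> h; have := sqr_ge0 c; rewrite expr2 => c2; lra. Qed.

Section SobolevFlow.
Context {R : realType}.
Notation V := (ambient R 1).
Notation TV := (R^o * ambient R 1)%type.
Notation S := (@spacetime R 1).
Notation Lam := (@integral_dV0 R 1).
Local Opaque integral_rV integral_dV0.
Implicit Types (t : R) (x : V) (p : TV).
Variables (alpha : R -> R) (U F g Q D rho : TV -> R^o).
Hypothesis FF : flow_fields alpha U F g Q D rho.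

Let sU := ff_U FF.
Let sF := ff_F FF.
Let sg := ff_g FF.
Let sQ := ff_Q FF.
Let srho := ff_rho FF.

Notation "'<<' h '>>'" := (J (fun p => h p * rho p)) (at level 0, format "'<<' h '>>'").
Notation Z := <<(fun p => g p * g p * g p)>>.
Notation F4 := <<(fun p => g p * g p * g p * g p)>>.
Notation Fg2 := <<(fun p => F p * (g p * g p))>>.
Notation G := (J (fun p => U p * U p * gam g g p)).

Let w p : R^o := U p * g p.
Let sw : sfld w. Proof. exact: sfld_mul. Qed.

(** Conformal invariance of the quadratic form of the Yamabe problem: in the
   metric of the flow it is evaluated at g, in the standard one at U g. *)
Lemma conformal_energy t : 0 < t ->
  4 * G t + Z t + alpha t * Fg2 t = J (fun p => 4 * gam w w p + w p * w p) t.
Proof.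
move=> t0.
have s1 : sfld ((fun=> 1) : TV -> R^o) by exact: sfld_cst.
have sgg : sfld (fun p => g p * g p) by exact: sfld_mul.
have sK : sfld (fun p => U p * (g p * g p)) by exact: sfld_mul.
have sQF : sfld (fun p => Q p * F p) by exact: sfld_mul.
have E1 : Z t + alpha t * Fg2 t = J (fun p => (g p + Q p * F p) * rho p * (g p * g p)) t.
  rewrite [RHS](J_eq (K := fun p => g p * g p * g p * rho p + alpha t * (F p * (g p * g p) * rho p)))//.
  - rewrite J_add//; [|by sfld_tac..].
    by rewrite [X in _ = _ + X]J_scale//; sfld_tac.
  - by sfld_tac.
  by move=> x sx; rewrite (Q_alpha FF)//; abs_at (t, x); move=> *; ring.
have E2 : J (fun p => (g p + Q p * F p) * rho p * (g p * g p)) t =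
    -4 * J (fun p => (1 * lapT U p + gam (fun=> 1) U p) * (U p * (g p * g p))) t + J (fun p => w p * w p) t.
  rewrite (J_eq (K := fun p => -4 * ((1 * lapT U p + gam (fun=> 1) U p) * (U p * (g p * g p))) + w p * w p))//.
  - rewrite J_add//; [|by sfld_tac..].
    by rewrite [X in X + _ = _]J_scale//; sfld_tac.
  - by sfld_tac.
  move=> x sx; have sp := spaceP t0 sx.
  rewrite (ff_pde FF sp) (gamC (fun=> 1)) (gam_cst U 1 sp) /w; abs_at (t, x); move=> *; field.
  by [].
rewrite -addrA E1 E2 (J_green s1 sU sK t0).
have E3 : 4 * G t = J (fun p => 4 * (U p * U p * gam g g p)) t by rewrite J_scale//; sfld_tac.
have E4 : -4 * - J (fun p => 1 * gam U (fun p0 => U p0 * (g p0 * g p0)) p) t =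
   J (fun p => 4 * (2 * (U p * g p * gam U g p) + g p * g p * gam U U p)) t.
  rewrite [RHS]J_scale//; last by sfld_tac.
  rewrite mulrNN; apply: mulr_congr; apply: J_eq => //; first by sfld_tac.
  move=> x sx; have sp := spaceP t0 sx.
  by rewrite (gam_mulr U sU sgg sp) (gam_mulr U sg sg sp); abs_at (t, x); move=> *; ring.
rewrite E3 E4 -J_add//; [|by sfld_tac..].
rewrite -J_add//; [|by sfld_tac..].
apply: J_eq => //; first by sfld_tac.
move=> x sx; have sp := spaceP t0 sx.
rewrite (gam_mulr w sU sg sp) (gamC w U) (gamC w g) (gam_mulr g sU sg sp) (gam_mulr U sU sg sp) (gamC g U) /w.
by abs_at (t, x); move=> *; ring.
Qed.

Lemma integral_dV0_add3 (a b c : V -> R) : sphere_cont a -> sphere_cont b -> sphere_cont c ->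
  Lam (fun x => a x + (b x + c x)) = Lam a + (Lam b + Lam c).
Proof. by move=> sa sb sc; rewrite (integral_dV0_add sa (sphere_cont_add sb sc)) (integral_dV0_add sb sc). Qed.

(** The Folland-Stein inequality for U g: by conformal invariance its energy is
   expressed in the moving metric, and the integral of (U g)^4 is that of g^4
   against dV_theta, since n = 1. *)
Lemma flow_sobolev : exists2 C : R, 0 <= C &
  forall t, 1 <= t -> F4 t <= C * (4 * G t + Z t + alpha t * Fg2 t) ^+ 2.
Proof.
have [C C0 hC] := @folland_stein R.
exists (C * 4); first by apply: mulr_ge0 => //; exact: ler0n.
move=> t t1; have t0 : 0 < t by exact: lt_le_trans t1.
rewrite (conformal_energy t0).
have cw k : Ck [set y : V | y != 0] k (slice w t) by exact: Ck_slice (sw.1 k).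
have hw : hom0 (slice w t) by exact: (hom0_slice t0 sw.2).
have h := hC _ (cw 2%N) hw.
have scw : sphere_cont (slice w t) by exact: sphere_cont_slice.
have scX A : sphere_cont (fun x => Xf A (slice w t) x ^+ 2).
  by apply: sphere_cont_sqr; apply: (sphere_cont_Ck (k := 1)); exact: (Ck_Xf open_neq0).
have e4 : F4 t = Lam (fun x => slice w t x ^+ 4).
  rewrite JE; apply: integral_dV0_eq.
    have -> : (fun x => slice w t x ^+ 4) = (fun x => (slice w t x ^+ 2) ^+ 2) by apply/funext => x; rewrite -exprM.
    by do 2 apply: sphere_cont_sqr.
  move=> x sx; have sp := spaceP t0 sx.
  have u0 : 0 <= U (t, x) by exact/ltW/(ff_U0 FF).
  have -> : slice (fun p => g p * g p * g p * g p * rho p) t x = g (t, x) ^+ 4 * rho (t, x).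
    by rewrite /slice; ring.
  rewrite (ff_rhoE FF sp) (_ : 2 + 2 / 1%:R = 4%:R); last by field.
  by rewrite powR_mulrn// /slice /w exprMn mulrC.
have le : Lam (fun x => slice w t x ^+ 2) + dirichlet (slice w t) <=
    2 * J (fun p => 4 * gam w w p + w p * w p) t.
  have sY : sfld (fun p => 4 * gam w w p + w p * w p) by sfld_tac.
  rewrite JE -(integral_dV0_scale 2 (sphere_cont_slice t0 sY)) /dirichlet.
  rewrite -(integral_dV0_add3 (sphere_cont_sqr scw) (scX quatX) (scX quatY)).
  apply: integral_dV0_le.
  - by apply: sphere_cont_add; [exact: sphere_cont_sqr|exact: sphere_cont_add].
  - by apply: sphere_cont_scale; exact: sphere_cont_slice.
  move=> x sx; have x0 := sphere_neq0 sx.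
  have gE : gam w w (t, x) = 8^-1 * \sum_i Xf (frame i) (slice w t) x ^+ 2.
    by rewrite /gam; apply: mulr_congr; apply: eq_bigr => i _; rewrite (XX_slice i sw t0 x0) expr2.
  have -> : slice (fun p => 4 * gam w w p + w p * w p) t x = 4 * gam w w (t, x) + slice w t x * slice w t x by [].
  rewrite gE.
  pose i1 : frame_index := ((ord0 : 'I_2, ord_max : 'I_2), false).
  pose i2 : frame_index := ((ord0 : 'I_2, ord_max : 'I_2), true).
  have S2 : Xf quatX (slice w t) x ^+ 2 + Xf quatY (slice w t) x ^+ 2 <=
     \sum_i Xf (frame i) (slice w t) x ^+ 2.
    rewrite (bigD1 i1)//= (bigD1 i2)//= addrA lerDl.
    by apply: sumr_ge0 => i _; exact: sqr_ge0.
  exact: energy_le S2.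
rewrite e4; apply: (le_trans h); rewrite -mulrA; apply: ler_wpM2l => //.
have l0 : 0 <= Lam (fun x => slice w t x ^+ 2) + dirichlet (slice w t).
  apply: addr_ge0; last exact: dirichlet_ge0.
  by apply: integral_dV0_ge0; [exact: sphere_cont_sqr|move=> x _; exact: sqr_ge0].
move: le l0; move: (Lam _ + _) (J _ t) => a b hab a0.
have -> : 4 * b ^+ 2 = (2 * b) ^+ 2 by ring.
by rewrite ler_sqr ?nnegrE//; exact: le_trans hab.
Qed.

End SobolevFlow.

Lemma flow_G_vanishing (R : realType) (n : nat) (hn : (1 <= n)%N) (alpha : R -> R)
    (U F g Q D rho : (R^o * ambient R n)%type -> R^o) :
  flow_fields alpha U F g Q D rho -> vanishing (J (fun p => U p * U p * gam g g p)).
Proof.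
move=> FF; have [cF [CF [cF0 hF]]] := F_bounds FF.
have [A hA] := alpha_le FF cF0 hF.
have [n2|n1] := leqP 2 n.
  have [gamma gamma0 hg] := g_lower_bound FF hn cF0 hF hA.
  exact: (G_vanishing_high FF hn cF0 hF hA n2 gamma0 hg).
have n1' : n = 1%N by apply/eqP; rewrite eqn_leq hn -ltnS n1.
subst n; have [C C0 hS] := flow_sobolev FF.
exact: (G_vanishing_one FF hn cF0 hF hA (erefl 1%N) C0 hS).
Qed.

Lemma flow_G_cvg (R : realType) (n : nat) (hn : (1 <= n)%N) (alpha : R -> R)
    (U F g Q D rho : (R^o * ambient R n)%type -> R^o) :
  flow_fields alpha U F g Q D rho ->
  J (fun p => U p * U p * gam g g p) t @[t --> +oo] --> (0 : R).
Proof.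
move=> FF; apply: (vanishing_cvg _ (flow_G_vanishing hn FF)).
by exists 1 => t t1; exact: (G_ge0 FF (lt_le_trans ltr01 t1)).
Qed.

Theorem lemma3p3 (R : realType) (n : nat) (hn : (1 <= n)%N)
    (f u0 : ambient R n -> R)
    (f_smooth : smooth_sphere f)
    (f_pos : forall x, sphere x -> 0 < f x)
    (u0_smooth : smooth_sphere u0)
    (u0_pos : forall x, sphere x -> 0 < u0 x)
    (u0_volume : integral_dV0 (fun x => u0 x `^ (2 + 2 / n%:R))
                 = integral_dV0 (fun _ : ambient R n => 1))
    (alpha : R -> R) (u : R -> ambient R n -> R)
    (u_flow : webster_flow f u0 alpha u) :
  G2 f alpha u t @[t --> +oo] --> (0 : R).
Proof.
have FF := flow_fieldsP hn f_smooth f_pos u_flow.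
have := flow_G_cvg hn FF; apply: cvg_trans; apply: near_eq_cvg.
near=> t; rewrite (G2E hn u_flow)//.
Unshelve. all: by end_near. Qed.
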